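(* Let $\varphi\colon R\to S$ be a homomorphism of commutative Noetherian rings and let $C,X$ be homologically finite $R$-complexes with $C$ semidualizing. If $\varphi$ is module-finite with $\operatorname{fd}_R(S)<\infty$ and $\mathrm{m\text{-}Spec}(R)\subseteq\operatorname{Im}(\varphi^* )$, then \begin{align*} \mathrm{G}_{C}\text{-}\dim_R(X)-\operatorname{pd}_R(S) &\leq\mathrm{G}_{\mathbf R\mathrm{Hom}_R(S,C)}\text{-}\dim_S(X\otimes^{\mathbf L}_R S)\\ &\leq\mathrm{G}_{C}\text{-}\dim_R(X)+\operatorname{pd}_R(S). \end{align*} Thus, $X\otimes^{\mathbf L}_R S$ is $\mathbf R\mathrm{Hom}_R(S,C)$-reflexive if and only if $X$ is $C$-reflexive. If $R$ is local or $\operatorname{amp}(C)=0=\operatorname{amp}(\mathbf R\mathrm{Hom}_R(S,R))$, then $$\mathrm{G}_{\mathbf R\mathrm{Hom}_R(S,C)}\text{-}\dim_S(X\otimes^{\mathbf L}_R S)=\mathrm{G}_{C}\text{-}\dim_R(X).$$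
   Context: Complexes are indexed homologically; $\mathsf D(R)$ is the derived category. $\inf(X)$ and $\sup(X)$ are the infimum and supremum of $\{i\mid\operatorname{H}_i(X)\neq0\}$, and $\operatorname{amp}(X)=\sup(X)-\inf(X)$. A complex is homologically finite if its total homology is finitely generated, and homologically bounded if $\operatorname{H}_i=0$ for all but finitely many $i$. $\varphi$ is module-finite if $S$ is a finitely generated $R$-module. $\varphi^*\colon\operatorname{Spec}(S)\to\operatorname{Spec}(R)$ is the induced map, $\mathrm{m\text{-}Spec}(R)$ the set of maximal ideals. $\operatorname{fd}_R$, $\operatorname{pd}_R$ denote flat and projective dimension. An $R$-complex $C$ is semidualizing if it is homologically finite and the homothety morphism $R\to\mathbf R\mathrm{Hom}_R(C,C)$ is an isomorphism in $\mathsf D(R)$. For $C$ semidualizing, a homologically finite $R$-complex $X$ is $C$-reflexive if $\mathbf R\mathrm{Hom}_R(X,C)$ is homologically bounded and the biduality morphism $X\to\mathbf R\mathrm{Hom}_R(\mathbf R\mathrm{Hom}_R(X,C),C)$ is an isomorphism in $\mathsf D(R)$. Set $\mathrm{G}_{C}\text{-}\dim_R(X)=\inf(C)-\inf(\mathbf R\mathrm{Hom}_R(X,C))$ if $X$ is $C$-reflexive, and $\infty$ otherwise. Under the hypotheses $\mathbf R\mathrm{Hom}_R(S,C)$, viewed as an $S$-complex, is semidualizing over $S$, so the dimension over $S$ is defined. *)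

(* Defs.v *)
From HB Require Import structures.
From mathcomp Require Import all_boot all_order all_algebra generic_quotient.
From mathcomp Require Import boolp classical_sets cardinality constructive_ereal.

Set Implicit Arguments.
Unset Strict Implicit.
Unset Printing Implicit Defensive.

Import Order.TTheory GRing.Theory Num.Theory.
Local Open Scope ring_scope.
Local Open Scope quotient_scope.


Section Ideals.
Variable R : comPzRingType.
Implicit Types I J p m : set R.

Definition ideal I : Prop :=
  I 0 /\ forall a x y, I x -> I y -> I (a * x + y).

Definition noetherian : Prop :=
  forall I, ideal I -> exists s : seq R,
    (forall x, x \in s -> I x) /\
    forall x, I x -> exists c : nat -> R, x = \sum_(k < size s) c k * s`_k.

Definition prime_ideal p : Prop :=
  [/\ ideal p, ~ p 1 & forall x y, p (x * y) -> p x \/ p y].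

Definition maximal_ideal m : Prop :=
  [/\ ideal m, ~ m 1 &
      forall J, ideal J -> ~ J 1 -> (m `<=` J)%classic -> J = m].

Definition local_ring : Prop :=
  exists m, maximal_ideal m /\ forall m', maximal_ideal m' -> m' = m.

End Ideals.


(** Restriction of scalars along [phi]. *)
Definition restr (R S : comPzRingType) (phi : {rmorphism R -> S})
  (M : lmodType S) : Type := M.

Section Restr.
Variables (R S : comPzRingType) (phi : {rmorphism R -> S}) (M : lmodType S).

HB.instance Definition _ := GRing.Zmodule.on (restr phi M).

Definition restr_scale (a : R) (x : restr phi M) : restr phi M :=
  phi a *: (x : M).

Fact restr_scaleA a b x :
  restr_scale a (restr_scale b x) = restr_scale (a * b) x.
Proof. by rewrite /restr_scale rmorphM scalerA. Qed.
Fact restr_scale1 : left_id 1 restr_scale.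
Proof. by move=> x; rewrite /restr_scale rmorph1 scale1r. Qed.
Fact restr_scaleDr : right_distributive restr_scale +%R.
Proof. by move=> a x y; rewrite /restr_scale scalerDr. Qed.
Fact restr_scaleDl x : {morph restr_scale^~ x : a b / a + b}.
Proof. by move=> a b; rewrite /restr_scale rmorphD scalerDl. Qed.

HB.instance Definition _ := GRing.Zmodule_isLmodule.Build R (restr phi M)
  restr_scaleA restr_scale1 restr_scaleDr restr_scaleDl.

End Restr.

Section RestrMap.
Variables (R S : comPzRingType) (phi : {rmorphism R -> S}).
Variables (M M' : lmodType S) (f : {linear M -> M'}).

Definition restr_map (x : restr phi M) : restr phi M' := f x.
Fact restr_map_linear : linear restr_map.
Proof. by move=> a x y; rewrite /restr_map; exact: linearP. Qed.
HB.instance Definition _ :=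
  GRing.isLinear.Build R _ _ _ restr_map restr_map_linear.

End RestrMap.
Arguments restr_map {R S} phi {M M'} f x.

(** [shom phi M N] is Hom_R(M, N) for an S-module M and an R-module N, with the
    S-module structure coming from M. With [phi] the identity it is the usual
    Hom of R-modules. *)
Definition shom (R S : comPzRingType) (phi : {rmorphism R -> S})
  (M : lmodType S) (N : lmodType R) : Type := {linear restr phi M -> N}.

Section Shom.
Variables (R S : comPzRingType) (phi : {rmorphism R -> S}).
Variables (M : lmodType S) (N : lmodType R).
Local Notation H := (shom phi M N).

Definition shom_fun (f : H) : M -> N := (f : {linear restr phi M -> N}).

Lemma shomP (f g : H) : (forall x, shom_fun f x = shom_fun g x) -> f = g.
Proof.
case: f g => f [[f1] [f2]] [g [[g1] [g2]]] fg.
have e : f = g by apply: funext => x; exact: fg.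
by case: _ / e g1 g2 {fg} => g1 g2;
  rewrite (Prop_irrelevance f1 g1) (Prop_irrelevance f2 g2).
Qed.

HB.instance Definition _ := gen_eqMixin H.
HB.instance Definition _ := gen_choiceMixin H.

Definition shom_zero : H := \0.
Definition shom_opp (f : H) : H := \- (f : {linear restr phi M -> N}).
Definition shom_add (f g : H) : H :=
  (f : {linear restr phi M -> N}) \+ (g : {linear restr phi M -> N}).

Fact shom_addA : associative shom_add.
Proof. by move=> f g h; apply: shomP => x; exact: addrA. Qed.
Fact shom_addC : commutative shom_add.
Proof. by move=> f g; apply: shomP => x; exact: addrC. Qed.
Fact shom_add0 : left_id shom_zero shom_add.
Proof. by move=> f; apply: shomP => x; exact: add0r. Qed.
Fact shom_addN : left_inverse shom_zero shom_opp shom_add.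
Proof. by move=> f; apply: shomP => x; exact: addNr. Qed.

HB.instance Definition _ := GRing.isZmodule.Build H
  shom_addA shom_addC shom_add0 shom_addN.

Section Scale.
Variables (t : S) (f : H).
Definition shom_scale_fun (x : restr phi M) : N := shom_fun f (t *: (x : M)).
Fact shom_scale_linear : linear shom_scale_fun.
Proof.
move=> a x y; rewrite /shom_scale_fun scalerDr.
have -> : t *: (a *: x : M) = a *: (t *: (x : M) : restr phi M).
  by rewrite [in RHS]/GRing.scale [in LHS]/(_ *: x) /= /restr_scale !scalerA mulrC.
exact: (linearP (f : {linear restr phi M -> N})).
Qed.
HB.instance Definition _ :=
  GRing.isLinear.Build R _ _ _ shom_scale_fun shom_scale_linear.
Definition shom_scale : H := (shom_scale_fun : {linear restr phi M -> N}).
End Scale.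

Fact shom_scaleA a b f : shom_scale a (shom_scale b f) = shom_scale (a * b) f.
Proof.
apply: shomP => x; rewrite /= /shom_scale_fun /shom_fun /= /shom_scale_fun.
by rewrite scalerA mulrC.
Qed.
Fact shom_scale1 : left_id 1 shom_scale.
Proof.
by move=> f; apply: shomP => x; rewrite {1}/shom_fun /= /shom_scale_fun scale1r.
Qed.
Fact shom_scaleDr : right_distributive shom_scale +%R.
Proof. by move=> a f g; apply: shomP => x. Qed.
Fact shom_scaleDl f : {morph shom_scale^~ f : a b / a + b}.
Proof.
move=> a b; apply: shomP => x; rewrite {1}/shom_fun /= /shom_scale_fun scalerDl.
exact: (linearD (f : {linear restr phi M -> N})).
Qed.

HB.instance Definition _ := GRing.Zmodule_isLmodule.Build S H
  shom_scaleA shom_scale1 shom_scaleDr shom_scaleDl.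

End Shom.

Section ShomComp.
Variables (R S : comPzRingType) (phi : {rmorphism R -> S}).

Definition shom_post (M : lmodType S) (N N' : lmodType R)
    (g : {linear N -> N'}) (f : shom phi M N) : shom phi M N' :=
  g \o (f : {linear restr phi M -> N}).

Definition shom_pre (M M' : lmodType S) (N : lmodType R)
    (f : shom phi M' N) (h : {linear M -> M'}) : shom phi M N :=
  (f : {linear restr phi M' -> N}) \o restr_map phi h.

End ShomComp.

(** [tens phi M N] is the tensor product of M and N over R, for an R-module M
    and an S-module N, with the S-module structure coming from N. It is
    presented by generators and relations: a sequence of pairs stands for the
    sum of the corresponding elementary tensors. *)
Section Tensor.
Variables (R S : comPzRingType) (phi : {rmorphism R -> S}).
Variables (M : lmodType R) (N : lmodType S).

Inductive tens_rel : seq (M * N) -> seq (M * N) -> Prop :=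
| TensRefl s : tens_rel s s
| TensSym s t : tens_rel s t -> tens_rel t s
| TensTrans s t u : tens_rel s t -> tens_rel t u -> tens_rel s u
| TensCat s s' t t' :
    tens_rel s s' -> tens_rel t t' -> tens_rel (s ++ t) (s' ++ t')
| TensComm s t : tens_rel (s ++ t) (t ++ s)
| TensZero y : tens_rel [:: (0, y)] [::]
| TensAddl x x' y : tens_rel [:: (x + x', y)] [:: (x, y); (x', y)]
| TensAddr x y y' : tens_rel [:: (x, y + y')] [:: (x, y); (x, y')]
| TensScale a x y : tens_rel [:: (a *: x, y)] [:: (x, phi a *: y)].

Definition tens_relb (s t : seq (M * N)) : bool := `[< tens_rel s t >].

Fact tens_relb_refl : reflexive tens_relb.
Proof. by move=> s; apply/asboolP; constructor. Qed.
Fact tens_relb_sym : symmetric tens_relb.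
Proof. by move=> s t; apply/asboolP/asboolP; exact: TensSym. Qed.
Fact tens_relb_trans : transitive tens_relb.
Proof.
by move=> t s u /asboolP st /asboolP tu; apply/asboolP; exact: TensTrans tu.
Qed.

Canonical tens_equiv :=
  EquivRel tens_relb tens_relb_refl tens_relb_sym tens_relb_trans.

Definition tens : Type := {eq_quot tens_equiv}.
HB.instance Definition _ := Choice.on tens.
HB.instance Definition _ := EqQuotient.on tens.

Definition tens_class (s : seq (M * N)) : tens := \pi_{eq_quot tens_equiv} s.
Definition tens_repr (u : tens) : seq (M * N) :=
  repr (u : {eq_quot tens_equiv}).

Lemma tens_classK u : tens_class (tens_repr u) = u.
Proof. exact: reprK. Qed.
Lemma tens_classP s t : tens_rel s t <-> tens_class s = tens_class t.
Proof.
split=> [st|/eqP]; first by apply/eqP; rewrite eqmodE; exact/asboolP.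
by rewrite eqmodE => /asboolP.
Qed.
Lemma tens_reprP s : tens_rel (tens_repr (tens_class s)) s.
Proof. by apply/tens_classP; rewrite tens_classK. Qed.

Definition tens_zero : tens := tens_class [::].
Definition tens_add (u v : tens) : tens :=
  tens_class (tens_repr u ++ tens_repr v).
Definition tens_opp (u : tens) : tens :=
  tens_class [seq (- p.1, p.2) | p <- tens_repr u].
Definition tens_scale (t : S) (u : tens) : tens :=
  tens_class [seq (p.1, t *: p.2) | p <- tens_repr u].

Lemma tens_ind (P : tens -> Prop) : (forall s, P (tens_class s)) -> forall u, P u.
Proof. by move=> Ps u; rewrite -(tens_classK u). Qed.

Lemma tens_addE s t :
  tens_add (tens_class s) (tens_class t) = tens_class (s ++ t).
Proof. by apply/tens_classP; apply: TensCat; exact: tens_reprP. Qed.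

Lemma tens_rel_opp s t : tens_rel s t ->
  tens_rel [seq (- p.1, p.2) | p <- s] [seq (- p.1, p.2) | p <- t].
Proof.
elim=> {s t} /=.
- by move=> *; constructor.
- by move=> s t _ h; exact: TensSym.
- by move=> s t u _ h1 _ h2; exact: TensTrans h2.
- by move=> s s' t t' _ h1 _ h2; rewrite !map_cat; exact: TensCat.
- by move=> s t; rewrite !map_cat; exact: TensComm.
- by move=> y; rewrite oppr0; exact: TensZero.
- by move=> x x' y; rewrite opprD; exact: TensAddl.
- by move=> x y y'; exact: TensAddr.
- by move=> a x y; rewrite -scalerN; exact: TensScale.
Qed.

Lemma tens_oppE s :
  tens_opp (tens_class s) = tens_class [seq (- p.1, p.2) | p <- s].
Proof. by apply/tens_classP/tens_rel_opp; exact: tens_reprP. Qed.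

Lemma tens_rel_scale r s t : tens_rel s t ->
  tens_rel [seq (p.1, r *: p.2) | p <- s] [seq (p.1, r *: p.2) | p <- t].
Proof.
elim=> {s t} /=.
- by move=> *; constructor.
- by move=> s t _ h; exact: TensSym.
- by move=> s t u _ h1 _ h2; exact: TensTrans h2.
- by move=> s s' t t' _ h1 _ h2; rewrite !map_cat; exact: TensCat.
- by move=> s t; rewrite !map_cat; exact: TensComm.
- by move=> y; exact: TensZero.
- by move=> x x' y; exact: TensAddl.
- by move=> x y y'; rewrite scalerDr; exact: TensAddr.
- by move=> a x y; rewrite scalerA mulrC -scalerA; exact: TensScale.
Qed.

Lemma tens_scaleE r s :
  tens_scale r (tens_class s) = tens_class [seq (p.1, r *: p.2) | p <- s].
Proof. by apply/tens_classP/tens_rel_scale; exact: tens_reprP. Qed.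

Fact tens_addA : associative tens_add.
Proof.
by elim/tens_ind=> s; elim/tens_ind=> t; elim/tens_ind=> u; rewrite !tens_addE catA.
Qed.
Fact tens_addC : commutative tens_add.
Proof.
elim/tens_ind=> s; elim/tens_ind=> t; rewrite !tens_addE.
by apply/tens_classP; exact: TensComm.
Qed.
Fact tens_add0 : left_id tens_zero tens_add.
Proof. by elim/tens_ind=> s; rewrite tens_addE. Qed.
Fact tens_addN : left_inverse tens_zero tens_opp tens_add.
Proof.
elim/tens_ind=> s; rewrite tens_oppE tens_addE; apply/tens_classP.
elim: s => [|[x y] s IHs] /=; first by constructor.
rewrite -cat1s -[(x, y) :: s]cat1s.
apply: (@TensTrans _ ([:: (- x, y)] ++ ([:: (x, y)] ++
   ([seq (- p.1, p.2) | p <- s] ++ s)))).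
  apply: TensCat; first exact: TensRefl.
  by rewrite !catA; apply: TensCat; [exact: TensComm|exact: TensRefl].
rewrite catA -[[::]]cats0; apply: TensCat => //=.
apply: TensTrans (TensZero y); rewrite -(addNr x).
by apply: TensSym; exact: TensAddl.
Qed.

HB.instance Definition _ := GRing.isZmodule.Build tens
  tens_addA tens_addC tens_add0 tens_addN.

Fact tens_scaleA a b u : tens_scale a (tens_scale b u) = tens_scale (a * b) u.
Proof.
elim/tens_ind: u => s; rewrite !tens_scaleE -map_comp; congr tens_class.
by apply: eq_map => p /=; rewrite scalerA.
Qed.
Fact tens_scale1 : left_id 1 tens_scale.
Proof.
elim/tens_ind=> s; rewrite tens_scaleE -[in RHS](map_id s); congr tens_class.
by apply: eq_map => -[x y] /=; rewrite scale1r.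
Qed.
Fact tens_scaleDr : right_distributive tens_scale +%R.
Proof.
move=> a; elim/tens_ind=> s; elim/tens_ind=> t.
rewrite /GRing.add /= tens_addE !tens_scaleE tens_addE.
by rewrite map_cat.
Qed.
Fact tens_scaleDl u : {morph tens_scale^~ u : a b / a + b}.
Proof.
move=> a b; elim/tens_ind: u => s; rewrite [RHS]/GRing.add /=.
rewrite !tens_scaleE tens_addE; apply/tens_classP.
elim: s => [|[x y] s IHs] /=; first by constructor.
set A := map _ s in IHs *; set B := map _ s in IHs *; set C := map _ s in IHs *.
apply: (@TensTrans _ ([:: (x, a *: y); (x, b *: y)] ++ (B ++ C))).
  rewrite scalerDl.
  exact: (@TensCat [:: _] [:: _; _] _ _ (TensAddr _ _ _) IHs).
apply: (@TensCat [:: (x, a *: y)] [:: (x, a *: y)]); first exact: TensRefl.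
rewrite -[_ :: (B ++ C)]/(([:: (x, b *: y)] ++ B) ++ C).
rewrite -[_ :: C]/([:: (x, b *: y)] ++ C) [X in tens_rel _ X]catA.
by apply: TensCat; [exact: TensComm|exact: TensRefl].
Qed.

HB.instance Definition _ := GRing.Zmodule_isLmodule.Build S tens
  tens_scaleA tens_scale1 tens_scaleDr tens_scaleDl.

End Tensor.

(** The map of tensor products induced by a map in the first variable. *)
Section TensMap.
Variables (R S : comPzRingType) (phi : {rmorphism R -> S}).
Variables (M M' : lmodType R) (f : {linear M -> M'}) (N : lmodType S).

Definition tens_map (u : tens phi M N) : tens phi M' N :=
  tens_class phi [seq (f p.1, p.2) | p <- tens_repr u].

Lemma tens_rel_map s t : tens_rel phi s t ->
  tens_rel phi [seq (f p.1, p.2) | p : M * N <- s]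
               [seq (f p.1, p.2) | p : M * N <- t].
Proof.
elim=> {s t} /=.
- by move=> *; constructor.
- by move=> s t _ h; exact: TensSym.
- by move=> s t u _ h1 _ h2; exact: TensTrans h2.
- by move=> s s' t t' _ h1 _ h2; rewrite !map_cat; exact: TensCat.
- by move=> s t; rewrite !map_cat; exact: TensComm.
- by move=> y; rewrite linear0; exact: TensZero.
- by move=> x x' y; rewrite linearD; exact: TensAddl.
- by move=> x y y'; exact: TensAddr.
- by move=> a x y; rewrite linearZ; exact: TensScale.
Qed.

Lemma tens_mapE s :
  tens_map (tens_class phi s) = tens_class phi [seq (f p.1, p.2) | p <- s].
Proof. by apply/tens_classP/tens_rel_map; exact: tens_reprP. Qed.

Fact tens_map_linear : linear tens_map.
Proof.
move=> a; elim/tens_ind=> s; elim/tens_ind=> t.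
rewrite /GRing.add /GRing.scale /= tens_scaleE tens_addE !tens_mapE.
by rewrite tens_scaleE tens_addE map_cat -!map_comp.
Qed.
HB.instance Definition _ :=
  GRing.isLinear.Build S _ _ _ tens_map tens_map_linear.

End TensMap.
Arguments tens_map {R S} phi {M M'} f N u.

Section ModuleClasses.
Variable R : comPzRingType.
Local Notation id_R := (idfun : {rmorphism R -> R}).

Definition fin_gen (M : lmodType R) : Prop :=
  exists s : seq M, forall x, exists c : nat -> R,
    x = \sum_(k < size s) c k *: s`_k.

Definition projective (P : lmodType R) : Prop :=
  forall (M N : lmodType R) (g : {linear M -> N}) (f : {linear P -> N}),
    (forall y, exists x, g x = y) ->
    exists h : {linear P -> M}, forall x, g (h x) = f x.

Definition flat (F : lmodType R) : Prop :=
  forall (M N : lmodType R) (f : {linear M -> N}),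
    injective f -> injective (tens_map id_R f F).

End ModuleClasses.


(** Homological indexing. The differential is given for all pairs of degrees
    and vanishes off degree -1, which avoids transports along equalities of
    degrees. *)
Record complex (R : comPzRingType) := Complex {
  cobj :> int -> lmodType R;
  cd : forall i j, {linear cobj i -> cobj j};
  cd_shape : forall i j x, i != j + 1 -> cd i j x = 0;
  cd_cd : forall i j k x, cd j k (cd i j x) = 0
}.
Arguments cd {R} c i j.

Record chmap (R : comPzRingType) (X Y : complex R) := Chmap {
  chmap_comp :> forall i, {linear X i -> Y i};
  chmapP : forall i j x, cd Y i j (chmap_comp i x) = chmap_comp j (cd X i j x)
}.

Section Homology.
Variable R : comPzRingType.
Implicit Types X Y : complex R.

Definition is_cycle X i (z : X i) : Prop := forall j, cd X i j z = 0.
Definition is_boundary X i (z : X i) : Prop := exists j (w : X j), z = cd X j i w.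

(** H_i(X) = 0 *)
Definition hzero X (i : int) : Prop := forall z : X i, is_cycle z -> is_boundary z.

Definition acyclic X : Prop := forall i, hzero X i.

(** H_i(X) is finitely generated *)
Definition hfin_gen X (i : int) : Prop :=
  exists s : seq (X i), (forall z, z \in s -> is_cycle z) /\
    forall z : X i, is_cycle z -> exists c : nat -> R,
      is_boundary (z - \sum_(k < size s) c k *: s`_k).

Definition hbounded X : Prop := finite_set [set i | ~ hzero X i].

(** The direct sum of the H_i(X) is finitely generated iff all but finitely many
    summands vanish and each of them is finitely generated. *)
Definition hfinite X : Prop := hbounded X /\ forall i, hfin_gen X i.

(** A morphism of complexes becomes an isomorphism in the derived category iff
    it is bijective on homology. *)
Definition qiso X Y (f : chmap X Y) : Prop :=
  forall i,
    (forall z : X i, is_cycle z -> is_boundary (f i z) -> is_boundary z) /\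
    (forall w : Y i, is_cycle w -> exists2 z : X i, is_cycle z & is_boundary (w - f i z)).

Definition hinf X : \bar int :=
  infimum +oo%E [set i%:E | i in [set i | ~ hzero X i]].
Definition hsup X : \bar int :=
  supremum -oo%E [set i%:E | i in [set i | ~ hzero X i]].
Definition amp X : \bar int := (hsup X - hinf X)%E.

Definition chmap_id_comp X i : {linear X i -> X i} := idfun.
Definition chmap_id X : chmap X X :=
  @Chmap R X X (@chmap_id_comp X) (fun _ _ _ => erefl).

End Homology.

Section InDegree0.
Variables (R : comPzRingType) (M : lmodType R).

Definition in_deg0_obj (i : int) : lmodType R :=
  match i with Posz 0 => M | _ => 'rV[R]_0 end.
Definition in_deg0_d i j : {linear in_deg0_obj i -> in_deg0_obj j} := \0.

(** The module M as a complex concentrated in degree 0. *)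
Definition in_deg0 : complex R :=
  @Complex R in_deg0_obj in_deg0_d (fun _ _ _ _ => erefl) (fun _ _ _ _ => erefl).

Section FromDegree0.
Variables (Y : complex R) (g : {linear M -> Y 0}).
Hypothesis gP : forall x, is_cycle (g x).

Definition from_deg0_comp (i : int) : {linear in_deg0 i -> Y i} :=
  match i return {linear in_deg0_obj i -> Y i} with
  | Posz 0 => g
  | Posz _.+1 => \0
  | Negz _ => \0
  end.

Fact from_deg0P i j x :
  cd Y i j (from_deg0_comp i x) = from_deg0_comp j (cd in_deg0 i j x).
Proof.
by rewrite [RHS]linear0; case: i x => [[|n]|n] x; rewrite ?gP // linear0.
Qed.
Definition from_deg0 : chmap in_deg0 Y := Chmap from_deg0P.

End FromDegree0.
End InDegree0.

Lemma odd_absz_addr1 (n : int) : odd (absz (n + 1)) = ~~ odd (absz n).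
Proof.
case: n => [n|[|n]] //; first by rewrite -PoszD absz_nat addn1.
have -> : Negz n.+1 + 1 = Negz n.
  by rewrite !NegzE -[n.+2]addn1 PoszD opprD addrNK.
by rewrite /= negbK.
Qed.

Lemma signr_absz_addr1 (R : pzRingType) (n : int) :
  (-1) ^+ absz (n + 1) = - (-1) ^+ absz n :> R.
Proof.
rewrite -signr_odd -[in RHS]signr_odd odd_absz_addr1.
by case: (odd _); rewrite /= ?expr0 ?expr1 ?opprK.
Qed.

(** [homC phi X Y] is the complex Hom_R(X, Y) of S-modules, for an S-complex X
    and an R-complex Y. An element of degree n is a family of maps X_i -> Y_j
    vanishing unless j = i + n. *)
Section HomComplex.
Variables (R S : comPzRingType) (phi : {rmorphism R -> S}).
Variables (X : complex S) (Y : complex R).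

Record homdeg (n : int) : Type := Homdeg {
  hcomp :> forall i j, shom phi (X i) (Y j);
  hcompP : forall i j, j != i + n -> hcomp i j = 0
}.

Section Degree.
Variable n : int.
Local Notation H := (homdeg n).

Lemma homdegP (f g : H) : (forall i j, f i j = g i j) -> f = g.
Proof.
case: f g => f fP [g gP] /= fg.
have e : f = g by apply: functional_extensionality_dep => i;
  apply: functional_extensionality_dep => j; exact: fg.
by case: _ / e gP {fg} => gP; rewrite (Prop_irrelevance fP gP).
Qed.

HB.instance Definition _ := gen_eqMixin H.
HB.instance Definition _ := gen_choiceMixin H.

Fact homdeg_oppP (f : H) i j : j != i + n -> - f i j = 0.
Proof. by move=> ij; rewrite hcompP // oppr0. Qed.
Fact homdeg_addP (f g : H) i j : j != i + n -> f i j + g i j = 0.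
Proof. by move=> ij; rewrite !hcompP // addr0. Qed.
Fact homdeg_scaleP (a : S) (f : H) i j : j != i + n -> a *: f i j = 0.
Proof. by move=> ij; rewrite hcompP // scaler0. Qed.

Definition homdeg_zero : H := @Homdeg n (fun _ _ => 0) (fun _ _ _ => erefl).
Definition homdeg_opp (f : H) : H := Homdeg (homdeg_oppP f).
Definition homdeg_add (f g : H) : H := Homdeg (homdeg_addP f g).
Definition homdeg_scale (a : S) (f : H) : H := Homdeg (homdeg_scaleP a f).

Fact homdeg_addA : associative homdeg_add.
Proof. by move=> f g h; apply: homdegP => i j; exact: addrA. Qed.
Fact homdeg_addC : commutative homdeg_add.
Proof. by move=> f g; apply: homdegP => i j; exact: addrC. Qed.
Fact homdeg_add0 : left_id homdeg_zero homdeg_add.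
Proof. by move=> f; apply: homdegP => i j; exact: add0r. Qed.
Fact homdeg_addN : left_inverse homdeg_zero homdeg_opp homdeg_add.
Proof. by move=> f; apply: homdegP => i j; exact: addNr. Qed.

HB.instance Definition _ := GRing.isZmodule.Build H
  homdeg_addA homdeg_addC homdeg_add0 homdeg_addN.

Fact homdeg_scaleA a b f :
  homdeg_scale a (homdeg_scale b f) = homdeg_scale (a * b) f.
Proof. by apply: homdegP => i j; exact: scalerA. Qed.
Fact homdeg_scale1 : left_id 1 homdeg_scale.
Proof. by move=> f; apply: homdegP => i j; exact: scale1r. Qed.
Fact homdeg_scaleDr : right_distributive homdeg_scale +%R.
Proof. by move=> a f g; apply: homdegP => i j; exact: scalerDr. Qed.
Fact homdeg_scaleDl f : {morph homdeg_scale^~ f : a b / a + b}.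
Proof. by move=> a b; apply: homdegP => i j; exact: scalerDl. Qed.

HB.instance Definition _ := GRing.Zmodule_isLmodule.Build S H
  homdeg_scaleA homdeg_scale1 homdeg_scaleDr homdeg_scaleDl.

End Degree.

(** d(f) = d o f - (-1)^n f o d for f of degree n = m + 1 *)
Definition homd_comp (n m : int) (f : homdeg n) i j : shom phi (X i) (Y j) :=
  if n == m + 1 then
    shom_post (cd Y (j + 1) j) (f i (j + 1))
      - (-1) ^+ absz n *: shom_pre (f (i - 1) j) (cd X i (i - 1))
  else 0.

Lemma shom_fun0 (M : lmodType S) (N : lmodType R) x :
  shom_fun (0 : shom phi M N) x = 0.
Proof. by []. Qed.
Lemma shom_funD (M : lmodType S) (N : lmodType R) (f g : shom phi M N) x :
  shom_fun (f + g) x = shom_fun f x + shom_fun g x.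
Proof. by []. Qed.
Lemma shom_funN (M : lmodType S) (N : lmodType R) (f : shom phi M N) x :
  shom_fun (- f) x = - shom_fun f x.
Proof. by []. Qed.
Lemma shom_funZ (M : lmodType S) (N : lmodType R) (f : shom phi M N) a x :
  shom_fun (a *: f) x = shom_fun f (a *: x).
Proof. by []. Qed.
Lemma shom_fun_sign (M : lmodType S) (N : lmodType R) (f : shom phi M N) k x :
  shom_fun ((-1) ^+ k *: f) x = (-1) ^+ k *: shom_fun f x.
Proof.
rewrite -signr_odd -[in RHS]signr_odd; case: (odd k).
  by rewrite expr1 !scaleN1r.
by rewrite expr0 !scale1r.
Qed.
Lemma shom_fun_at0 (M : lmodType S) (N : lmodType R) (f : shom phi M N) :
  shom_fun f 0 = 0.
Proof. exact: (linear0 (f : {linear restr phi M -> N})). Qed.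
Lemma shom_fun_atN (M : lmodType S) (N : lmodType R) (f : shom phi M N) x :
  shom_fun f (- x) = - shom_fun f x.
Proof. exact: (linearN (f : {linear restr phi M -> N})). Qed.
Lemma shom_fun_atD (M : lmodType S) (N : lmodType R) (f : shom phi M N) x y :
  shom_fun f (x + y) = shom_fun f x + shom_fun f y.
Proof. exact: (linearD (f : {linear restr phi M -> N})). Qed.

Lemma homd_compE (n m : int) (f : homdeg n) i j x : n = m + 1 ->
  shom_fun (homd_comp m f i j) x =
  cd Y (j + 1) j (shom_fun (f i (j + 1)) x)
    - (-1) ^+ absz n *: shom_fun (f (i - 1) j) (cd X i (i - 1) x).
Proof.
by move/eqP=> nm; rewrite /homd_comp nm shom_funD shom_funN shom_fun_sign.
Qed.

Fact homd_compP (n m : int) (f : homdeg n) i j : j != i + m -> homd_comp m f i j = 0.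
Proof.
move=> ij; apply: shomP => x.
have [nm|nm] := eqVneq n (m + 1); last by rewrite /homd_comp (negPf nm).
have h1 : j + 1 != i + n.
  by apply: contraNneq ij; rewrite nm addrA => /addIr ->.
have h2 : j != i - 1 + n.
  by apply: contraNneq ij => ->; rewrite nm addrACA addNr addr0.
by rewrite homd_compE // (hcompP _ h1) (hcompP _ h2) linear0 scaler0 subr0.
Qed.

Definition homd_fun (n m : int) (f : homdeg n) : homdeg m :=
  Homdeg (@homd_compP n m f).

Lemma homdegPE n (f g : homdeg n) (a : S) i j :
  (a *: f + g) i j = a *: f i j + g i j.
Proof. by []. Qed.
Lemma homd_funE n m (f : homdeg n) i j : homd_fun m f i j = homd_comp m f i j.
Proof. by []. Qed.

Fact homd_linear n m : linear (@homd_fun n m).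
Proof.
move=> a f g; apply: homdegP => i j; apply: shomP => x.
rewrite homdegPE !homd_funE shom_funD shom_funZ.
have [nm|nm] := eqVneq n (m + 1); last first.
  by rewrite /homd_comp (negPf nm) !shom_fun0 addr0.
rewrite !homd_compE // !homdegPE !shom_funD !shom_funZ.
rewrite linearD scalerDr opprD addrACA.
by rewrite (linearZ_LR (cd X i (i - 1))).
Qed.
HB.instance Definition _ n m :=
  GRing.isLinear.Build S _ _ _ (@homd_fun n m) (@homd_linear n m).
Definition homd n m : {linear homdeg n -> homdeg m} := @homd_fun n m.

Fact homd_shape n m f : n != m + 1 -> homd n m f = 0.
Proof. by move=> nm; apply: homdegP => i j; rewrite /= /homd_comp (negPf nm). Qed.

Fact homd_homd n m k f : homd m k (homd n m f) = 0.
Proof.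
have [nm|nm] := eqVneq n (m + 1); last by rewrite (homd_shape f nm) linear0.
have [mk|mk] := eqVneq m (k + 1); last by rewrite homd_shape.
apply: homdegP => i j; apply: shomP => x.
rewrite homd_funE homd_compE // !homd_funE !homd_compE //.
rewrite linearB !cd_cd sub0r linearZ_LR shom_fun_at0 scaler0 subr0.
have -> : (-1) ^+ absz n = - (-1) ^+ absz m :> R.
  by rewrite -signr_absz_addr1; congr (_ ^+ absz _).
by rewrite scaleNr opprK subrr.
Qed.

Definition homC : complex S := Complex homd_shape homd_homd.

End HomComplex.

(** The complex obtained from X by applying the tensor product with N over R in
    each degree. *)
Section TensComplex.
Variables (R S : comPzRingType) (phi : {rmorphism R -> S}).
Variables (X : complex R) (N : lmodType S).

Definition tensd i j : {linear tens phi (X i) N -> tens phi (X j) N} :=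
  tens_map phi (cd X i j) N.

Lemma tens_map_eq0 (M M' : lmodType R) (f : {linear M -> M'}) u :
  (forall x, f x = 0) -> tens_map phi f N u = 0.
Proof.
move=> f0; elim/tens_ind: u => s; rewrite tens_mapE.
elim: s => [//|p s IHs] /=; rewrite f0 -cat1s -tens_addE IHs.
have -> : tens_class phi [:: (0 : M', p.2)] = 0.
  by apply/tens_classP; exact: TensZero.
exact: addr0.
Qed.

Fact tensd_shape i j u : i != j + 1 -> tensd i j u = 0.
Proof. by move=> ij; apply: tens_map_eq0 => x; exact: cd_shape. Qed.

Fact tensd_tensd i j k u : tensd j k (tensd i j u) = 0.
Proof.
rewrite -(@tens_map_eq0 _ _ (cd X j k \o cd X i j) u) => [|x]; last exact: cd_cd.
by elim/tens_ind: u => s; rewrite /tensd /= !tens_mapE -map_comp.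
Qed.

Definition tensC : complex S := Complex tensd_shape tensd_tensd.

End TensComplex.


Section Resolutions.
Variable R : comPzRingType.
Local Notation id_R := (idfun : {rmorphism R -> R}).

Definition Kprojective (P : complex R) : Prop :=
  forall A : complex R, acyclic A -> acyclic (homC id_R P A).

Definition Kinjective (I : complex R) : Prop :=
  forall A : complex R, acyclic A -> acyclic (homC id_R A I).

(** Every complex has K-projective and K-injective resolutions (Spaltenstein);
    one of each is chosen. The value when there is none is irrelevant. *)
Definition is_proj_res (X : complex R) (p : {P : complex R & chmap P X}) : Prop :=
  Kprojective (projT1 p) /\ qiso (projT2 p).

Definition proj_res (X : complex R) : {P : complex R & chmap P X} :=
  if pselect (exists p, is_proj_res p) is left h then projT1 (cid h)
  else existT _ X (chmap_id X).

Definition is_inj_res (Y : complex R) (p : {I : complex R & chmap Y I}) : Prop :=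
  Kinjective (projT1 p) /\ qiso (projT2 p).

Definition inj_res (Y : complex R) : {I : complex R & chmap Y I} :=
  if pselect (exists p, is_inj_res p) is left h then projT1 (cid h)
  else existT _ Y (chmap_id Y).

End Resolutions.

(** RHom_R(X, Y) as an S-complex, for an S-complex X and an R-complex Y; this is
    the usual derived Hom when [phi] is the identity of R. *)
Definition RHom (R S : comPzRingType) (phi : {rmorphism R -> S})
  (X : complex S) (Y : complex R) : complex S := homC phi X (projT1 (inj_res Y)).

(** The derived tensor product of X and S over R, as an S-complex: base change
    of a K-projective resolution of X. *)
Definition Ltens (R S : comPzRingType) (phi : {rmorphism R -> S})
  (X : complex R) : complex S := tensC phi (projT1 (proj_res X)) S^o.


Section Dimensions.
Variable R : comPzRingType.

(** M has a resolution of length at most n by modules in the class C. For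
    negative n this forces M = 0, so that the zero module has dimension -oo. *)
Definition has_res (C : lmodType R -> Prop) (M : lmodType R) (n : int) : Prop :=
  exists (P : complex R) (f : chmap P (in_deg0 M)),
    [/\ forall i, C (P i),
        forall i, ~~ (0 <= i <= n) -> forall x : P i, x = 0 & qiso f].

Definition pd (M : lmodType R) : \bar int :=
  infimum +oo%E [set n%:E | n in [set n | has_res (@projective R) M n]].

Definition fd (M : lmodType R) : \bar int :=
  infimum +oo%E [set n%:E | n in [set n | has_res (@flat R) M n]].

End Dimensions.


Section GDim.
Variable R : comPzRingType.
Local Notation id_R := (idfun : {rmorphism R -> R}).

Lemma shom_fun_atZ (M N : lmodType R) (f : shom id_R M N) a (x : M) :
  shom_fun f (a *: x) = a *: shom_fun f x.
Proof. exact: (linearZ_LR (f : {linear restr id_R M -> N}) a x). Qed.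

Section OfLinear.
Variables (M N : lmodType R) (f : {linear M -> N}).
Definition of_linear_fun (x : restr id_R M) : N := f x.
Fact of_linear_linear : linear of_linear_fun.
Proof. by move=> a x y; exact: linearP. Qed.
HB.instance Definition _ :=
  GRing.isLinear.Build R _ _ _ of_linear_fun of_linear_linear.
Definition of_linear : shom id_R M N := of_linear_fun.
End OfLinear.

(** A morphism of complexes as an element of degree 0 of the Hom complex. *)
Section OfChmap.
Variables (X Y : complex R) (f : chmap X Y).

Definition of_chmap_comp (i j : int) : shom id_R (X i) (Y j) :=
  if @eqP _ i j is ReflectT e then
    ecast j (shom id_R (X i) (Y j)) e (of_linear (f i))
  else 0.

Fact of_chmapP i j : j != i + 0 -> of_chmap_comp i j = 0.
Proof.
rewrite addr0 /of_chmap_comp => ij.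
by case: eqP => // e; rewrite e eqxx in ij.
Qed.

Definition of_chmap : homC id_R X Y 0 := Homdeg of_chmapP.

Lemma of_chmapC i i' j j' x : (i == j') = (i' == j) ->
  cd Y j' j (shom_fun (of_chmap_comp i j') x) =
  shom_fun (of_chmap_comp i' j) (cd X i i' x).
Proof.
rewrite /of_chmap_comp; case: eqP => [e|_]; case: eqP => // e' _.
  by case: _ / e; case: _ / e'; exact: chmapP.
by rewrite !shom_fun0 linear0.
Qed.

Lemma of_chmap_cycle : is_cycle of_chmap.
Proof.
move=> m; have [m0|m0] := eqVneq 0 (m + 1); last exact: cd_shape.
apply: homdegP => i j; apply: shomP => x.
rewrite homd_funE homd_compE // scale1r shom_fun0; apply/eqP.
rewrite subr_eq0; apply/eqP/of_chmapC.
by rewrite subr_eq.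
Qed.
End OfChmap.

Lemma cycleZ (X : complex R) i a (z : X i) : is_cycle z -> is_cycle (a *: z).
Proof. by move=> zP j; rewrite linearZ_LR zP scaler0. Qed.

Section Homothety.
Variable C : complex R.
Let elt : RHom id_R C C 0 := of_chmap (projT2 (inj_res C)).

Definition homothety_fun (a : R^o) : RHom id_R C C 0 := (a : R) *: elt.
Fact homothety_linear : linear homothety_fun.
Proof. by move=> a x y; rewrite /homothety_fun scalerDl scalerA. Qed.
HB.instance Definition _ :=
  GRing.isLinear.Build R _ _ _ homothety_fun homothety_linear.
Fact homothety_cycle a : is_cycle (homothety_fun a).
Proof. by apply: cycleZ; exact: of_chmap_cycle. Qed.

(** R -> RHom_R(C, C), sending 1 to the identity of C, represented by the chosen
    resolution of C. *)
Definition homothety : chmap (in_deg0 R^o) (RHom id_R C C) :=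
  @from_deg0 R R^o _ homothety_fun homothety_cycle.
End Homothety.

Definition semidualizing (C : complex R) : Prop :=
  hfinite C /\ qiso (homothety C).

(** The map X -> Hom(Hom(X, I), I) sending x to f |-> (-1)^(|x||f|) f(x). *)
Section Biduality.
Variables X I : complex R.
Local Notation H := (homC id_R X I).

Definition bidual_fun (p : int) (x : X p) (n j : int) (f : restr id_R (H n)) :
    I j :=
  (-1) ^+ (absz n * absz p) *: shom_fun (hcomp (f : homdeg id_R X I n) p j) x.

Fact bidual_fun_linear (p : int) (x : X p) (n j : int) : linear (@bidual_fun p x n j).
Proof.
move=> a f g; rewrite /bidual_fun [hcomp _ _ _]/(a *: hcomp f p j + hcomp g p j).
rewrite shom_funD shom_funZ scalerDr; congr (_ + _).
rewrite shom_fun_atZ.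
by rewrite !scalerA mulrC.
Qed.
HB.instance Definition _ p x n j :=
  GRing.isLinear.Build R _ _ _ (@bidual_fun p x n j) (@bidual_fun_linear p x n j).
Definition bidual_shom (p : int) (x : X p) (n j : int) : shom id_R (H n) (I j) := @bidual_fun p x n j.

Fact bidual_shomP (p : int) (x : X p) (n j : int) : 
  j != n + p -> bidual_shom x n j = 0.
Proof.
move=> nj; apply: shomP => f; rewrite /= /bidual_fun.
by rewrite hcompP ?scaler0 // addrC.
Qed.

Definition bidual_elt p (x : X p) : homC id_R H I p := Homdeg (@bidual_shomP p x).

Lemma bidual_eltE p (x : X p) n j (f : H n) :
  shom_fun (hcomp (bidual_elt x : homdeg id_R H I p) n j) f =
  (-1) ^+ (absz n * absz p) *: shom_fun (hcomp (f : homdeg id_R X I n) p j) x.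
Proof. by []. Qed.

Fact bidual_elt_linear (p : int) : linear (@bidual_elt p).
Proof.
move=> a x y; apply: homdegP => n j; apply: shomP => f.
rewrite homdegPE shom_funD shom_funZ !bidual_eltE.
rewrite [hcomp (a *: f) _ _]/(a *: hcomp f p j) shom_funZ.
by rewrite shom_fun_atD scalerDr.
Qed.
HB.instance Definition _ p :=
  GRing.isLinear.Build R _ _ _ (@bidual_elt p) (@bidual_elt_linear p).

Definition biduality_comp (p : int) : {linear X p -> homC id_R H I p} := @bidual_elt p.

Fact biduality_map_subproof p q x :
  cd (homC id_R H I) p q (biduality_comp p x) = biduality_comp q (cd X p q x).
Proof.
have [pq|pq] := eqVneq p (q + 1); last by rewrite !cd_shape ?linear0.
subst p; apply: homdegP => n j; apply: shomP => f.
rewrite homd_funE homd_compE // !bidual_eltE.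
rewrite homd_funE homd_compE ?subrK // linearZ_LR addrK.
have on : odd (absz (n - 1)) = ~~ odd (absz n).
  by rewrite -[in RHS](subrK 1 n) odd_absz_addr1 negbK.
have sgE k : (-1) ^+ k = (if odd k then -1 else 1) :> R.
  by rewrite -signr_odd; case: (odd k).
rewrite !sgE !oddM on odd_absz_addr1.
case: (odd (absz n)); case: (odd (absz q)) => /=;
  rewrite ?(scaleN1r, scale1r, opprK) ?opprD ?opprK.
all: by rewrite ?addNKr ?addKr ?addrA ?subrr ?addNr ?add0r.
Qed.

Definition biduality_map : chmap X (homC id_R H I) :=
  Chmap biduality_map_subproof.
End Biduality.

(** X -> RHom_R(RHom_R(X, C), C) *)
Definition biduality (C X : complex R) :
  chmap X (RHom id_R (RHom id_R X C) C) := biduality_map X (projT1 (inj_res C)).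

Definition reflexive_cplx (C X : complex R) : Prop :=
  [/\ hfinite X, hbounded (RHom id_R X C) & qiso (biduality C X)].

(** For X = 0 and C non-zero this is -oo, since then hinf (RHom _ X C) = +oo. *)
Definition Gdim (C X : complex R) : \bar int :=
  if `[< reflexive_cplx C X >] then (hinf C - hinf (RHom id_R X C))%E
  else +oo%E.

End GDim.

(* Main.v *)
From HB Require Import structures.
From mathcomp Require Import all_boot all_order all_algebra generic_quotient.
From mathcomp Require Import boolp classical_sets cardinality constructive_ereal.
From mathcomp Require Import ring zify.
Require Import Defs.

Set Implicit Arguments.
Unset Strict Implicit.
Unset Printing Implicit Defensive.

Import Order.TTheory GRing.Theory Num.Theory.
Local Open Scope ring_scope.

(** Let F -> S be a perfect resolution of S over R, let L -> X be a resolution by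
    finite free modules and C -> I an injective one, and put Y = Hom(L, I).
    Adjunction identifies the S-level objects with R-level ones:
    RHom_R(S, C) ~ Hom(F, I), RHom_S(X (x) S, RHom_R(S, C)) ~ Hom(F, Y), and the
    biduality map of X (x) S over S with that of L (x) S with respect to I.
    Everything then reduces to how W |-> Hom(F, W) changes the infimum, and to the
    descent of reflexivity from L (x) S to L.

    The hypothesis on maximal ideals provides, for every maximal m, a map
    S -> R/m with 1 |-> 1, hence a functional F_0 -> R/m killing boundaries. With
    Nakayama it shows that H_l(T(R)) localized at m vanishes for all l as soon as
    T(S) is acyclic, for an exact functor T with finitely generated, bounded
    H(T(R)): lift a bottom class of T(R) to T of a free cover of S and push it back
    along the functional. Applied to the cone of the biduality map of the Koszul
    complex on generators of m, tensored with L (x) -, this is the descent of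
    reflexivity. The Koszul complex supplies the boundedness which T needs: its
    dual is an iterated extension of complexes killed by m, and on those the
    evaluation Hom(F, -) -> id splits by means of the functional.

    Since inf W - pd S <= inf Hom(F, W) <= inf W, both inequalities follow. In the
    two special cases Hom(F, -) shifts the infimum by a constant, namely the least
    degree in which Hom(F, k), respectively Hom(F, R), has homology. *)

(** The hard direction is from X (x) S back to X. Hom(L, I) is bounded above by construction, but
    reflexivity of X (x) S alone does not bound it below, so an induction on degrees that starts at
    the infimum cannot begin; the bidual of L has the same defect. Splitting of the evaluation is
    not stable under extensions, but nilpotence of the map from V to the cone of its evaluation is:
    the exponents add, and nilpotence still carries bounds from Hom(F, V) back to V. The Koszul
    complex is removed again one element at a time by Nakayama.

    Neither localizations nor homology modules are formed. H_l(V)_m = 0 means that one scalar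
    outside m sends every l-cycle to a boundary, and a functional to R/m is a function to R that is
    linear modulo m. Vanishing, local vanishing and finite generation of homology obey the same
    rules in exact sequences and are treated together as [zero_like].

    Flat dimension enters only to make S perfect: flat modules have injective character duals, and
    these force a high syzygy of a free resolution of S to be projective. The case S = 0, in which
    both dimensions are -oo, is separate. *)

(** * Submodules, maximal ideals, injective modules *)

(** [zm] decides equalities in abelian groups by reflection; [ring] does not
    apply to the carrier of a module. *)
Inductive zexp := ZVar of nat | ZZero | ZAdd of zexp & zexp | ZOpp of zexp.

Section ZExp.
Variables (V : zmodType) (env : seq V).
Fixpoint zeval e : V := match e with
  | ZVar k => env`_k | ZZero => 0
  | ZAdd a b => zeval a + zeval b | ZOpp a => - zeval a end.
(** A coefficient is kept as two natural numbers, the occurrences with sign + and those with sign -,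
    so that [zcheck] computes in [nat] without subtraction. *)
Fixpoint zcoef (neg : bool) (e : zexp) (k : nat) : nat := match e with
  | ZVar i => if eqn i k then (if neg then 0 else 1) else 0
  | ZZero => 0
  | ZAdd a b => Nat.add (zcoef neg a k) (zcoef neg b k)
  | ZOpp a => zcoef (negb neg) a k end.
Lemma zevalE e : zeval e =
  \sum_(k < size env) (env`_k *+ zcoef false e k - env`_k *+ zcoef true e k).
Proof.
elim: e => [i||a IHa b IHb|a IHa] /=.
- have [lt|ge] := ltnP i (size env); last first.
    rewrite nth_default // big1 // => k _; case: eqnP => [e|_]; last by rewrite subrr.
    by move: (ltn_ord k); rewrite -e ltnNge ge.
  rewrite (bigD1 (Ordinal lt)) //= big1 ?addr0.
    by case: eqnP => //= _; rewrite subr0.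
  move=> k /negPf nk; case: eqnP => [e|_]; last by rewrite subrr.
  by move: nk; rewrite -val_eqE /= e eqxx.
- by rewrite big1 // => k _; rewrite subrr.
- rewrite IHa IHb -big_split; apply: eq_bigr => k _ /=.
  by rewrite !plusE !mulrnDr opprD addrACA.
- by rewrite IHa -sumrN; apply: eq_bigr => k _; rewrite opprB.
Qed.
Fixpoint zcheck (e f : zexp) (n : nat) : bool := match n with
  | 0 => true
  | S n => eqn (Nat.add (zcoef false e n) (zcoef true f n))
               (Nat.add (zcoef false f n) (zcoef true e n)) && zcheck e f n end.
Lemma zcheckP e f : zcheck e f (size env) -> zeval e = zeval f.
Proof.
move=> h; rewrite !zevalE; apply: eq_bigr => k _; case: k => k /=.
elim: (size env) h => // n IHn /= /andP[/eqnP h1 h2].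
rewrite ltnS leq_eqVlt => /orP[/eqP -> |]; last exact: IHn.
move: h1; rewrite !plusE => h1; apply/eqP.
by rewrite subr_eq addrAC eq_sym subr_eq -!mulrnDr h1.
Qed.
End ZExp.

Ltac zm_posc x l := lazymatch l with
  | cons ?y ?l' => match constr:(O) with
     | _ => let _ := match constr:(O) with _ => constr_eq x y end in constr:(O)
     | _ => let n := zm_posc x l' in constr:(S n) end end.
Ltac zm_posu x l := lazymatch l with
  | cons ?y ?l' => match constr:(O) with
     | _ => let _ := match constr:(O) with _ => unify x y end in constr:(O)
     | _ => let n := zm_posu x l' in constr:(S n) end end.
Ltac zm_pos x l := match constr:(O) with
  | _ => zm_posc x l | _ => zm_posu x l end.
Ltac zm_atoms add V t l := lazymatch t with
  | (?a + ?b)%R => let l' := zm_atoms add V a l in zm_atoms add V b l'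
  | (- ?a)%R => zm_atoms add V a l
  | 0%R => l
  | _ => add V t l end.
Ltac zm_addc V t l := match constr:(O) with
  | _ => let _ := zm_posc t l in l | _ => constr:(@cons V t l) end.
Ltac zm_addu V t l := match constr:(O) with
  | _ => let _ := zm_pos t l in l | _ => constr:(@cons V t l) end.
Ltac zm_reify t l := lazymatch t with
  | (?a + ?b)%R => let a' := zm_reify a l in let b' := zm_reify b l in
     constr:(ZAdd a' b')
  | (- ?a)%R => let a' := zm_reify a l in constr:(ZOpp a')
  | 0%R => constr:(ZZero)
  | _ => let n := zm_pos t l in constr:(ZVar n) end.
Ltac zm_run add := lazymatch goal with |- @eq ?T ?x ?y =>
  let l := zm_atoms add T x (@nil T) in
  let l := zm_atoms add T y l in
  let e := zm_reify x l in let f := zm_reify y l in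
  exact (@zcheckP _ l e f erefl) end.
(** The first run separates atoms syntactically; the second also merges atoms that are merely
    convertible. *)
Ltac zm := first [zm_run zm_addc | zm_run zm_addu].

Definition mklin (R : comPzRingType) (M N : lmodType R) (f : M -> N)
    (fP : linear f) : {linear M -> N} :=
  HB.pack_for {linear M -> N} f (GRing.isLinear.Build R M N _ f fP).

Section Submodules.
Variable R : comPzRingType.

Record submod (V : lmodType R) := Submod {
  in_sub :> V -> Prop;
  sub_0 : in_sub 0;
  sub_lin : forall a x y, in_sub x -> in_sub y -> in_sub (a *: x + y) }.

Section SubmodTheory.
Variables (V : lmodType R) (U : submod V).

Lemma subD x y : U x -> U y -> U (x + y).
Proof. by move=> Ux Uy; rewrite -[x]scale1r; exact: sub_lin. Qed.
Lemma subZ a x : U x -> U (a *: x).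
Proof. by move=> Ux; rewrite -[_ *: _]addr0; apply: sub_lin => //; exact: sub_0. Qed.
Lemma subN x : U x -> U (- x).
Proof. by rewrite -scaleN1r; exact: subZ. Qed.
Lemma subB x y : U x -> U y -> U (x - y).
Proof. by move=> Ux Uy; apply: subD => //; exact: subN. Qed.
Lemma sub_sum (I : Type) (r : seq I) (P : pred I) (F : I -> V) :
  (forall i, P i -> U (F i)) -> U (\sum_(i <- r | P i) F i).
Proof. by move=> h; apply: big_ind => //; [exact: sub_0 | exact: subD]. Qed.
Lemma subBC x y : U (x - y) -> U (y - x).
Proof. by move/subN; rewrite opprB. Qed.
Lemma subBT x y z : U (x - y) -> U (y - z) -> U (x - z).
Proof. by move=> h1 h2; rewrite -(subrKA y); exact: subD. Qed.

Definition subm : Type := {x : V | U x}.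
Definition sval_ (x : subm) : V := proj1_sig x.
Lemma sval_inj : injective sval_.
Proof.
move=> [x Ux] [y Uy]; rewrite /sval_ /= => e; case: _ / e Uy => Uy.
by rewrite (Prop_irrelevance Ux Uy).
Qed.
Definition mksub x (Ux : U x) : subm := exist _ x Ux.

HB.instance Definition _ := gen_eqMixin subm.
HB.instance Definition _ := gen_choiceMixin subm.

Definition subm0 : subm := mksub (sub_0 U).
Definition subm_add (x y : subm) : subm := mksub (subD (proj2_sig x) (proj2_sig y)).
Definition subm_opp (x : subm) : subm := mksub (subN (proj2_sig x)).
Definition subm_scale a (x : subm) : subm := mksub (subZ a (proj2_sig x)).
Fact subm_addA : associative subm_add.
Proof. by move=> x y z; apply: sval_inj; exact: addrA. Qed.
Fact subm_addC : commutative subm_add.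
Proof. by move=> x y; apply: sval_inj; exact: addrC. Qed.
Fact subm_add0 : left_id subm0 subm_add.
Proof. by move=> x; apply: sval_inj; exact: add0r. Qed.
Fact subm_addN : left_inverse subm0 subm_opp subm_add.
Proof. by move=> x; apply: sval_inj; exact: addNr. Qed.
HB.instance Definition _ := GRing.isZmodule.Build subm
  subm_addA subm_addC subm_add0 subm_addN.
Fact subm_scaleA a b x : subm_scale a (subm_scale b x) = subm_scale (a * b) x.
Proof. by apply: sval_inj; exact: scalerA. Qed.
Fact subm_scale1 : left_id 1 subm_scale.
Proof. by move=> x; apply: sval_inj; exact: scale1r. Qed.
Fact subm_scaleDr : right_distributive subm_scale +%R.
Proof. by move=> a x y; apply: sval_inj; exact: scalerDr. Qed.
Fact subm_scaleDl x : {morph subm_scale^~ x : a b / a + b}.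
Proof. by move=> a b; apply: sval_inj; exact: scalerDl. Qed.
HB.instance Definition _ := GRing.Zmodule_isLmodule.Build R subm
  subm_scaleA subm_scale1 subm_scaleDr subm_scaleDl.
Fact sval_linear : linear sval_. Proof. by []. Qed.
Definition sinc : {linear subm -> V} := mklin sval_linear.
Lemma sincP x : U (sinc x). Proof. exact: (proj2_sig x). Qed.
Lemma sinc_inj : injective sinc. Proof. exact: sval_inj. Qed.
Lemma sincK x (Ux : U x) : sinc (mksub Ux) = x. Proof. by []. Qed.

(** V/U is the subtype of the chosen coset representatives. *)
Definition rep (x : V) : V := xget 0 [set y | U (x - y)]%classic.
Lemma repP x : U (x - rep x).
Proof.
rewrite /rep; case: xgetP => [y -> //|/(_ x) []]; rewrite /= subrr; exact: sub_0.
Qed.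
Lemma rep_eq x y : U (x - y) -> rep x = rep y.
Proof.
move=> h; rewrite /rep; congr xget; apply/predeqP => z /=; split => h'.
  by apply: subBT h'; exact: subBC.
exact: subBT h'.
Qed.
Lemma rep_rep x : rep (rep x) = rep x.
Proof. by apply: rep_eq; apply: subBC; exact: repP. Qed.

Definition quom : Type := {x : V | rep x = x}.
Definition qcl (x : V) : quom := exist _ (rep x) (rep_rep x).
Definition qrep (q : quom) : V := proj1_sig q.
Lemma qrep_inj : injective qrep.
Proof.
move=> [x xP] [y yP]; rewrite /qrep /= => e; case: _ / e yP => yP.
by rewrite (Prop_irrelevance xP yP).
Qed.
Lemma qrepK q : qcl (qrep q) = q.
Proof. by apply: qrep_inj; exact: (proj2_sig q). Qed.
Lemma qclP x y : qcl x = qcl y <-> U (x - y).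
Proof.
split=> [e|h]; last first.
  rewrite /qcl; move: (rep_rep x) (rep_rep y); rewrite (rep_eq h) => p q.
  by rewrite (Prop_irrelevance p q).
have {}e : rep x = rep y by exact: (congr1 qrep e).
have -> : x - y = (x - rep x) - (y - rep y) by rewrite e opprB addrA subrK.
by apply: subB; exact: repP.
Qed.
HB.instance Definition _ := gen_eqMixin quom.
HB.instance Definition _ := gen_choiceMixin quom.
Definition quom_add (p q : quom) := qcl (qrep p + qrep q).
Definition quom_opp (p : quom) := qcl (- qrep p).
Definition quom_scale a (p : quom) := qcl (a *: qrep p).
Lemma quom_addE x y : quom_add (qcl x) (qcl y) = qcl (x + y).
Proof.
apply/qclP; rewrite opprD addrACA; apply: subD; apply: subBC; exact: repP.
Qed.
Lemma quom_oppE x : quom_opp (qcl x) = qcl (- x).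
Proof. by apply/qclP; rewrite opprK addrC; exact: repP. Qed.
Lemma quom_scaleE a x : quom_scale a (qcl x) = qcl (a *: x).
Proof. by apply/qclP; rewrite -scalerBr; apply/subZ/subBC; exact: repP. Qed.
Lemma quom_ind (P : quom -> Prop) : (forall x, P (qcl x)) -> forall q, P q.
Proof. by move=> h q; rewrite -(qrepK q). Qed.
Fact quom_addA : associative quom_add.
Proof.
by elim/quom_ind=> x; elim/quom_ind=> y; elim/quom_ind=> z; rewrite !quom_addE addrA.
Qed.
Fact quom_addC : commutative quom_add.
Proof. by elim/quom_ind=> x; elim/quom_ind=> y; rewrite !quom_addE addrC. Qed.
Fact quom_add0 : left_id (qcl 0) quom_add.
Proof. by elim/quom_ind=> x; rewrite !quom_addE add0r. Qed.
Fact quom_addN : left_inverse (qcl 0) quom_opp quom_add.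
Proof. by elim/quom_ind=> x; rewrite quom_oppE quom_addE addNr. Qed.
HB.instance Definition _ := GRing.isZmodule.Build quom
  quom_addA quom_addC quom_add0 quom_addN.
Fact quom_scaleA a b x : quom_scale a (quom_scale b x) = quom_scale (a * b) x.
Proof. by elim/quom_ind: x => x; rewrite !quom_scaleE scalerA. Qed.
Fact quom_scale1 : left_id 1 quom_scale.
Proof. by elim/quom_ind => x; rewrite !quom_scaleE scale1r. Qed.
Fact quom_scaleDr : right_distributive quom_scale +%R.
Proof.
move=> a; elim/quom_ind=> x; elim/quom_ind=> y.
by rewrite [X in quom_scale a X]quom_addE !quom_scaleE scalerDr [RHS]quom_addE.
Qed.
Fact quom_scaleDl x : {morph quom_scale^~ x : a b / a + b}.
Proof.
move=> a b; elim/quom_ind: x => x.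
by rewrite !quom_scaleE scalerDl [RHS]quom_addE.
Qed.
HB.instance Definition _ := GRing.Zmodule_isLmodule.Build R quom
  quom_scaleA quom_scale1 quom_scaleDr quom_scaleDl.
Fact qcl_linear : linear qcl.
Proof.
move=> a x y; rewrite -[a *: qcl x]/(quom_scale a (qcl x)) quom_scaleE.
exact: (esym (quom_addE _ _)).
Qed.
Definition qpi : {linear V -> quom} := mklin qcl_linear.
Lemma qpiP x y : qpi x = qpi y <-> U (x - y). Proof. exact: qclP. Qed.
Lemma qpi0 x : qpi x = 0 <-> U x.
Proof. by rewrite -(linear0 qpi) qpiP subr0. Qed.
Lemma qpi_surj q : exists x, qpi x = q. Proof. by exists (qrep q); exact: qrepK. Qed.

End SubmodTheory.

Definition factors (V N : lmodType R) (U : submod V) (f : {linear V -> N}) :=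
  forall x, U x -> f x = 0.
Lemma qrep_factor (V N : lmodType R) (U : submod V) (f : {linear V -> N})
  (fU : factors U f) x : f (qrep (qpi U x)) = f x.
Proof.
apply/eqP; rewrite -subr_eq0 -linearB; apply/eqP/fU.
by apply: subBC; exact: repP.
Qed.
Lemma qlift_linear (V N : lmodType R) (U : submod V) (f : {linear V -> N})
  (fU : factors U f) : linear (fun q : quom U => f (qrep q)).
Proof.
move=> a; elim/quom_ind => x; elim/quom_ind => y.
by rewrite -[qcl U x]/(qpi U x) -[qcl U y]/(qpi U y) -linearP !qrep_factor // linearP.
Qed.
Definition qlift (V N : lmodType R) (U : submod V) (f : {linear V -> N})
  (fU : factors U f) : {linear quom U -> N} := mklin (qlift_linear fU).
Lemma qliftE (V N : lmodType R) (U : submod V) (f : {linear V -> N})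
  (fU : factors U f) x : qlift fU (qpi U x) = f x.
Proof. exact: (qrep_factor fU). Qed.

Section KerImg.
Variables (V N : lmodType R) (f : {linear V -> N}).
Fact ker_lin a x y : f x = 0 -> f y = 0 -> f (a *: x + y) = 0.
Proof. by move=> fx fy; rewrite linearP fx fy scaler0 addr0. Qed.
Definition ker : submod V := @Submod V (fun x => f x = 0) (linear0 f) ker_lin.
Fact img_0 : exists x, 0 = f x. Proof. by exists 0; rewrite linear0. Qed.
Fact img_lin a y y' : (exists x, y = f x) -> (exists x, y' = f x) ->
  exists x, a *: y + y' = f x.
Proof. by move=> [x ->] [x' ->]; exists (a *: x + x'); rewrite linearP. Qed.
Definition img : submod N := @Submod N (fun y => exists x, y = f x) img_0 img_lin.
End KerImg.

End Submodules.

(** * Finitely generated modules over a Noetherian ring *)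

Section Noetherian.
Variable R : comPzRingType.
Implicit Types V : lmodType R.

Definition comb V (s : seq V) (c : nat -> R) : V := \sum_(k < size s) c k *: s`_k.

Lemma comb_cons V (x : V) s c : comb (x :: s) c = c 0%N *: x + comb s (c \o S).
Proof. by rewrite /comb /= big_ord_recl. Qed.
Lemma comb_nil V c : comb [::] c = 0 :> V.
Proof. by rewrite /comb big_ord0. Qed.
Lemma combL V (s : seq V) a c c' :
  comb s (fun k => a * c k + c' k) = a *: comb s c + comb s c'.
Proof.
rewrite /comb scaler_sumr -big_split; apply: eq_bigr => k _ /=.
by rewrite scalerDl scalerA.
Qed.
Lemma comb_sub V (U : submod V) s c : (forall x, x \in s -> U x) -> U (comb s c).
Proof. by move=> h; apply: sub_sum => k _; apply/subZ/h/mem_nth. Qed.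

Fact span_0 V (B : submod V) (s : seq V) : exists c, B (0 - comb s c).
Proof.
exists (fun=> 0).
by rewrite /comb big1 ?subrr; [exact: sub_0 | move=> k _; rewrite scale0r].
Qed.
Fact span_lin V (B : submod V) (s : seq V) a x y : (exists c, B (x - comb s c)) ->
  (exists c, B (y - comb s c)) -> exists c, B (a *: x + y - comb s c).
Proof.
move=> [c cP] [c' c'P]; exists (fun k => a * c k + c' k).
by rewrite combL opprD addrACA -scalerN -scalerDr; exact: sub_lin.
Qed.
Definition spanm V (B : submod V) (s : seq V) : submod V :=
  @Submod R V (fun z => exists c, B (z - comb s c)) (span_0 B s) (@span_lin V B s).
Lemma span_base V (B : submod V) s x : B x -> spanm B s x.
Proof.
move=> Bx; exists (fun=> 0).
by rewrite /comb big1 ?subr0 // => k _; rewrite scale0r.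
Qed.
Lemma span_mem V (B : submod V) s x : x \in s -> spanm B s x.
Proof.
move=> xs; exists (fun k => (k == index x s)%:R).
have lt : (index x s < size s)%N by rewrite index_mem.
rewrite /comb (bigD1 (Ordinal lt)) //= eqxx scale1r nth_index // big1 ?addr0 ?subrr.
  exact: sub_0.
by move=> k /negPf; rewrite -val_eqE /= => ->; rewrite scale0r.
Qed.
Lemma span_min V (B U : submod V) s x : (forall x, B x -> U x) ->
  (forall x, x \in s -> U x) -> spanm B s x -> U x.
Proof.
move=> BU sU [c /BU h]; rewrite -(subrK (comb s c) x); apply: subD => //.
exact: comb_sub.
Qed.
Lemma span_cons V (B : submod V) x s z : spanm B (x :: s) z ->
  exists r, spanm B s (z - r *: x).
Proof. by case=> c; rewrite comb_cons opprD addrA => h; exists (c 0%N), (c \o S). Qed.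

Hypothesis noethR : noetherian R.

(** Relative to B, so that it also applies to the homology of a complex. *)
Lemma fg_sub V (B U : submod V) (s : seq V) : (forall z, U z -> spanm B s z) ->
  exists t, (forall z, z \in t -> U z) /\ forall z, U z -> spanm B t z.
Proof.
elim: s U => [|x s IHs] U Us; first by exists [::].
(* I is the ideal of coefficients that elements of U can have at the new generator x. Lifts of
   generators of I reduce the claim to U', the elements of U that do without x. *)
pose I : set R := [set r | exists2 z, U z & spanm B s (z - r *: x)]%classic.
have idI : ideal I.
  split=> [|a r r' [z Uz zP] [z' Uz' z'P]].
    by exists 0; [exact: sub_0 | rewrite scale0r subrr; exact: sub_0].
  exists (a *: z + z'); first exact: sub_lin.
  rewrite scalerDl -scalerA opprD addrACA -scalerBr; exact: sub_lin.
have [rs [rsI Irs]] := noethR idI.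
have /choice [g gP] : forall r, exists z, I r -> U z /\ spanm B s (z - r *: x).
  move=> r; have [[z Uz zP]|nI] := pselect (I r); first by exists z.
  by exists 0.
pose U' : submod V := @Submod R V (fun z => U z /\ spanm B s z)
  (conj (sub_0 _) (sub_0 _)) (fun a z z' h h' =>
     conj (sub_lin a h.1 h'.1) (sub_lin a h.2 h'.2)).
have [t [tU' tP]] := IHs U' (fun z h => h.2).
exists ([seq g r | r <- rs] ++ t); split=> [z|z Uz].
  rewrite mem_cat => /orP[/mapP[r rrs ->]|/tU'[] //].
  by case: (gP _ (rsI _ rrs)).
have [r rP] := span_cons (Us z Uz).
have [c cr] := Irs r (ex_intro2 _ _ z Uz rP).
pose w := \sum_(k < size rs) c k *: g (rs`_k).
have Uw : U w.
  by apply: sub_sum => k _; apply: subZ; case: (gP _ (rsI _ (mem_nth 0 (ltn_ord k)))).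
have sw : spanm B s (z - w).
  have -> : z - w = (z - r *: x) - \sum_(k < size rs) c k *: (g (rs`_k) - rs`_k *: x).
    under eq_bigr do rewrite scalerBr scalerA.
    rewrite sumrB -scaler_suml -cr opprB addrA subrK //.
  apply: subB => //; apply: sub_sum => k _; apply: subZ.
  by case: (gP _ (rsI _ (mem_nth 0 (ltn_ord k)))).
rewrite -(subrK w z); apply: subD.
  apply: (span_min (s := t)) (tP _ (conj (subB Uz Uw) sw)); first exact: span_base.
  by move=> y yt; apply: span_mem; rewrite mem_cat yt orbT.
apply: sub_sum => k _; apply/subZ/span_mem; rewrite mem_cat map_f //.
exact: mem_nth.
Qed.

End Noetherian.

(** * Maximal ideals and Nakayama's lemma *)

Section MaximalIdeals.
Variables (R : comPzRingType) (m : set R).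
Hypothesis maxm : maximal_ideal m.

Lemma max_submod : exists M : submod (R^o : lmodType R), forall x, M x <-> m x.
Proof.
case: maxm => -[m0 mL] _ _.
by exists (@Submod R (R^o : lmodType R) (m : R^o -> Prop) m0 mL).
Qed.
Lemma max0 : m 0. Proof. by case: maxm => -[]. Qed.
Lemma maxL a x y : m x -> m y -> m (a * x + y). Proof. by case: maxm => -[_ h] _ _; exact: h. Qed.
Lemma maxD x y : m x -> m y -> m (x + y).
Proof. by move=> mx my; rewrite -[x]mul1r; exact: maxL. Qed.
Lemma maxM a x : m x -> m (a * x).
Proof. by move=> mx; rewrite -[_ * _]addr0; apply: maxL => //; exact: max0. Qed.
Lemma maxN x : m x -> m (- x). Proof. by rewrite -mulN1r; exact: maxM. Qed.
Lemma maxB x y : m x -> m y -> m (x - y).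
Proof. by move=> mx my; apply: maxD => //; exact: maxN. Qed.
Lemma max1 : ~ m 1. Proof. by case: maxm. Qed.

Lemma max_inv a : ~ m a -> exists b, m (1 - b * a).
Proof.
move=> na; case: (maxm) => _ _ mmax.
pose J : set R := [set x | exists b, m (x - b * a)]%classic.
have [J1|nJ1] := pselect (J 1); first by [].
exfalso; apply: na; rewrite -(mmax J) //; last first.
- by move=> x mx; exists 0; rewrite mul0r subr0.
- split=> [|c x y [b bP] [b' b'P]]; first by exists 0; rewrite mul0r subr0; exact: max0.
  exists (c * b + b'); rewrite mulrDl -mulrA opprD addrACA -mulrBr; exact: maxL.
by exists 1; rewrite mul1r subrr; exact: max0.
Qed.
Lemma max_prime a b : ~ m a -> ~ m b -> ~ m (a * b).
Proof.
move=> /max_inv [c cP] nb mab; apply: nb.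
have -> : b = (1 - c * a) * b + c * (a * b) by rewrite mulrBl mul1r mulrA subrK.
by apply: maxD; [rewrite mulrC|]; exact: maxM.
Qed.
Lemma max_sub_unit a x : ~ m a -> m x -> ~ m (a - x).
Proof. by move=> na mx h; apply: na; rewrite -(subrK x a); exact: maxD. Qed.

(** Nakayama over the localization at m, with scalars outside m as denominators. No determinant is
    used: [tau = t - c 0] lies outside m, so [tau *: x] is a combination of the remaining generators
    modulo B, and the other relations, multiplied by tau, lose their x. *)
Lemma nakayama (V : lmodType R) (B : submod V) (s : seq V) :
  (forall y, y \in s -> exists2 t, ~ m t &
     exists2 c, (forall j, m (c j)) & B (t *: y - comb s c)) ->
  exists2 t, ~ m t & forall y, y \in s -> B (t *: y).
Proof.
elim: s => [|x s IHs] h; first by exists 1 => //; exact: max1.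
have [t nt [c mc cP]] := h x (mem_head _ _).
set tau := t - c 0%N; have ntau : ~ m tau by exact: max_sub_unit.
have taux : B (tau *: x - comb s (c \o S)).
  by move: cP; rewrite comb_cons opprD addrA -scalerBl.
have [y ys|u nu uP] := IHs.
  have yxs : y \in x :: s by rewrite inE ys orbT.
  have [t' nt' [c' mc' c'P]] := h y yxs.
  exists (tau * t'); first exact: max_prime.
  exists (fun k => c' 0%N * c k.+1 + tau * c' k.+1).
    by move=> j; apply: maxL => //; exact: maxM.
  rewrite combL; move: c'P; rewrite comb_cons opprD addrA => c'P.
  have -> : comb s (fun k => tau * c' k.+1) = tau *: comb s (c' \o S).
    rewrite /comb scaler_sumr; apply: eq_bigr => k _; by rewrite scalerA.
  have -> : (tau * t') *: y - (c' 0%N *: comb s (c \o S) + tau *: comb s (c' \o S)) =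
    tau *: (t' *: y - c' 0%N *: x - comb s (c' \o S))
      + c' 0%N *: (tau *: x - comb s (c \o S)).
    rewrite !scalerBr !scalerA [c' 0%N * tau]mulrC opprD !addrA.
    by rewrite [_ - _ - _ + _]addrAC subrK addrAC.
  by apply: sub_lin => //; exact: subZ.
exists (u * tau) => [|y]; first exact: max_prime.
rewrite inE => /orP[/eqP->|/uP h']; last by rewrite mulrC -scalerA; exact: subZ.
rewrite -scalerA -(subrK (comb s (c \o S)) (tau *: x)) scalerDr; apply: subD.
  exact: subZ.
rewrite /comb scaler_sumr; apply: sub_sum => k _.
by rewrite scalerA mulrC -scalerA; apply/subZ/uP; exact: mem_nth.
Qed.

End MaximalIdeals.

(** * Maximal submodules and functionals modulo a maximal ideal *)

Section Zorn.
Variables (R : comPzRingType) (V : lmodType R).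

Lemma zorn_avoid (U : submod V) (Q : V -> Prop) : (forall x, U x -> ~ Q x) ->
  exists N : submod V, [/\ forall x, U x -> N x, forall x, N x -> ~ Q x &
    forall N' : submod V, (forall x, N x -> N' x) -> (forall x, N' x -> ~ Q x) ->
      forall x, N' x -> N x].
Proof.
move=> UQ.
(* The chain handed to Zorn's lemma may be empty, and the empty set is no submodule; so the closure
   condition is imposed on the union of U and X instead of on X. *)
pose P : set (set V) := [set X | (forall a x y, U x \/ X x -> U y \/ X y ->
   U (a *: x + y) \/ X (a *: x + y)) /\ (forall x, X x -> ~ Q x)]%classic.
have [|X [[XL XQ] Xmax]] := @Zorn_bigcup V P.
  move=> F FP Ftot; split=> [a x y|x [X FX Xx]]; last by have [_] := FP _ FX; exact.
  have one Z z (FZ : F Z) : U z \/ Z z -> U z \/ (\bigcup_(X in F) X)%classic z.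
    by move=> [|Zz]; [left | right; exists Z].
  move=> [Ux|[X FX Xx]] [Uy|[Y FY Yy]].
  - by left; exact: sub_lin.
  - by apply: (one Y) => //; apply: (FP _ FY).1; [left | right].
  - by apply: (one X) => //; apply: (FP _ FX).1; [right | left].
  - case: (Ftot _ _ FX FY) => [XY|YX].
      by apply: (one Y) => //; apply: (FP _ FY).1; right => //; exact: XY.
    by apply: (one X) => //; apply: (FP _ FX).1; right => //; exact: YX.
exists (@Submod R V (fun x => U x \/ X x) (or_introl (sub_0 U)) XL); split=> /=.
- by move=> x; left.
- by move=> x [/UQ|/XQ].
move=> N' NN' N'Q x N'x; right; apply: contrapT => nXx.
apply: (Xmax (fun z => N' z)); last first.
  split=> [a u v h1 h2|]; last exact: N'Q.
  right; apply: sub_lin; [case: h1 | case: h2] => //.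
    by move=> ?; apply: NN'; left.
  by move=> ?; apply: NN'; left.
split; first by move=> z Xz; apply: NN'; right.
by move=> h; apply: nXx; exact: h.
Qed.

(** A functional V/U -> R/m with value 1 at v, given by representatives. Let N be maximal among the
    submodules that contain U but not v. Since m V lies in U, maximality gives V = N + R v, and c
    reads off the coefficient of v, which is unique modulo m. *)
Lemma functional_mod (m : set R) (U : submod V) v : maximal_ideal m ->
  (forall a x, m a -> U (a *: x)) -> ~ U v ->
  exists c : V -> R, [/\ forall a x y, m (c (a *: x + y) - (a * c x + c y)),
    forall x, U x -> m (c x) & m (c v - 1)].
Proof.
move=> maxm mU nUv.
have [|N [UN Nv Nmax]] := @zorn_avoid U (fun x => x = v).
  by move=> x Ux e; apply: nUv; rewrite -e.
have nNv : ~ N v by move=> /Nv.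
have mN b : N (b *: v) -> m b.
  move=> h; apply: contrapT => /(max_inv maxm)[b' b'P]; apply: nNv.
  have -> : v = (1 - b' * b) *: v + b' *: (b *: v).
    by rewrite scalerBl scale1r scalerA subrK.
  by apply: subD; [exact/UN/mU | exact: subZ].
have tot w : exists b, N (w - b *: v).
  have [Nw|nNw] := pselect (N w); first by exists 0; rewrite scale0r subr0.
  pose N' := spanm N [:: w].
  have [[x N'x xv]|h] := pselect (exists2 x, N' x & x = v); last first.
    exfalso; apply: nNw; apply: (Nmax N'); last by apply: span_mem; rewrite mem_head.
      by move=> x; exact: span_base.
    by move=> x N'x xv; apply: h; exists x.
  move: N'x; rewrite {x}xv => -[c]; rewrite comb_cons comb_nil addr0.
  set a := c 0%N => cP.
  have na : ~ m a.
    move=> ma; apply: nNv; rewrite -(subrK (a *: w) v); apply: subD => //.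
    exact/UN/mU.
  have [b bP] := max_inv maxm na.
  exists b; have -> : w - b *: v = (1 - b * a) *: w - b *: (v - a *: w).
    by rewrite scalerBl scale1r scalerBr !scalerA opprB addrA subrK.
  by apply: subB; [exact/UN/mU | exact: subZ].
have [c cP] := choice tot.
exists c; split=> [a x y|x Ux|]; apply: mN.
- have -> : (c (a *: x + y) - (a * c x + c y)) *: v =
     a *: (x - c x *: v) + (y - c y *: v) - (a *: x + y - c (a *: x + y) *: v).
    by rewrite !scalerBl scalerDl scalerBr scalerA; zm.
  by apply: subB => //; exact: sub_lin.
- have -> : c x *: v = x - (x - c x *: v) by rewrite opprB addrC subrK.
  by apply: subB => //; exact: UN.
- by rewrite scalerBl scale1r; apply: subBC.
Qed.

End Zorn.

Lemma ideal_in_maximal (R : comPzRingType) (U : submod (R^o : lmodType R)) :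
  ~ U 1 -> exists m : set R, maximal_ideal m /\ forall x, U x -> m x.
Proof.
move=> nU; have [|N [UN Nv Nmax]] := @zorn_avoid R _ U (fun x => x = 1).
  by move=> x Ux e; apply: nU; rewrite -e.
exists (fun x : R => N (x : R^o)); split; last exact: UN.
split; first by split; [exact: (sub_0 N) | move=> a x y; exact: (@sub_lin R R^o N a x y)].
  by move=> /Nv.
move=> J [J0 JL] nJ1 mJ; apply/seteqP; split=> // x Jx.
apply: (Nmax (@Submod R (R^o : lmodType R) (J : R^o -> Prop) J0 JL)) => //= y Jy ey.
by apply: nJ1; rewrite -ey.
Qed.

Section ShomBuild.
Variables (R S : comPzRingType) (phi : {rmorphism R -> S}).

Definition mkshom (M : lmodType S) (N : lmodType R) (f : M -> N)
    (fP : forall a x y, f (phi a *: x + y) = a *: f x + f y) : shom phi M N :=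
  @mklin R (restr phi M) N f fP.
Lemma mkshomE M N f fP x : shom_fun (@mkshom M N f fP) x = f x.
Proof. by []. Qed.
Lemma shom_linP (M : lmodType S) (N : lmodType R) (f : shom phi M N) a x y :
  shom_fun f (phi a *: x + y) = a *: shom_fun f x + shom_fun f y.
Proof. exact: (linearP (f : {linear restr phi M -> N}) a x y). Qed.

Section Swap.
Variables (A M : lmodType S) (N : lmodType R) (g : {linear A -> shom phi M N}).
Fact swap_shomP x a (y z : A) : shom_fun (g (phi a *: y + z)) x =
  a *: shom_fun (g y) x + shom_fun (g z) x.
Proof.
rewrite linearP shom_funD shom_funZ -[phi a *: x]addr0 shom_linP shom_fun_at0.
by rewrite addr0.
Qed.
Definition swap_fun (x : M) : shom phi A N := mkshom (swap_shomP x).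
Fact swap_linear : linear swap_fun.
Proof.
move=> a x y; apply: shomP => z; rewrite shom_funD shom_funZ !mkshomE.
by rewrite shom_fun_atD linearZ_LR shom_funZ.
Qed.
Definition shom_swap : {linear M -> shom phi A N} := mklin swap_linear.
Lemma shom_swapE x y : shom_fun (shom_swap x) y = shom_fun (g y) x. Proof. by []. Qed.
End Swap.

Section PreLin.
Variables (A B : lmodType S) (N : lmodType R) (f : {linear A -> B}).
Fact pre_linear : linear (fun h : shom phi B N => shom_pre h f).
Proof.
move=> a h k; apply: shomP => x; rewrite shom_funD shom_funZ.
rewrite /shom_fun /= -[restr_map _ _ _]/(f x) -[restr_map _ _ _]/(f (a *: x)).
by rewrite linearZ_LR.
Qed.
Definition pre_lin : {linear shom phi B N -> shom phi A N} := mklin pre_linear.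
Lemma pre_linE h x : shom_fun (pre_lin h) x = shom_fun h (f x). Proof. by []. Qed.
End PreLin.
End ShomBuild.

(** * Injective modules and the character module of R *)

Section Injective.
Variable R : comPzRingType.

Definition inj_mod (J : lmodType R) : Prop :=
  forall (A B : lmodType R) (f : {linear A -> B}) (g : {linear A -> J}),
    injective f -> exists h : {linear B -> J}, forall x, h (f x) = g x.

End Injective.

(** A map A -> Hom(M, J) is the same as a map M -> Hom(A, J). It lifts through Hom(B, J) -> Hom(A,
    J), which is onto because J is injective, because M is projective. *)
Lemma inj_shom (R S : comPzRingType) (phi : {rmorphism R -> S}) (M : lmodType S)
  (J : lmodType R) : projective M -> inj_mod J -> inj_mod (shom phi M J).
Proof.
move=> Mproj Jinj A B f g finj.
have [y|G GP] := Mproj _ _ (pre_lin phi J f) (shom_swap g).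
  have [|h hP] := Jinj (restr phi A) (restr phi B) (restr_map phi f) (y : {linear _ -> _}).
    exact: finj.
  by exists h; apply: shomP => x; exact: hP.
exists (shom_swap G) => x; apply: shomP => z.
by rewrite shom_swapE -pre_linE GP shom_swapE.
Qed.

Lemma projective_free1 (R : comPzRingType) : projective (R^o : lmodType R).
Proof.
move=> M N g f gsurj; have [x xP] := gsurj (f 1).
have lin : linear (fun a : R^o => (a : R) *: x).
  by move=> a b c; rewrite scalerDl scalerA.
exists (mklin lin) => a; rewrite /= linearZ_LR xP -linearZ_LR; congr (f _).
exact: mulr1.
Qed.

Section QZ.

Definition ratZ : Type := rat.
HB.instance Definition _ := GRing.Zmodule.on ratZ.
Definition ratZ_scale (a : int) (x : ratZ) : ratZ := (x : rat) *~ a.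
Fact ratZ_scaleA a b x : ratZ_scale a (ratZ_scale b x) = ratZ_scale (a * b) x.
Proof. by rewrite /ratZ_scale mulrC mulrzA. Qed.
Fact ratZ_scale1 : left_id 1 ratZ_scale.
Proof. by move=> x; rewrite /ratZ_scale mulr1z. Qed.
Fact ratZ_scaleDr : right_distributive ratZ_scale +%R.
Proof. by move=> a x y; rewrite /ratZ_scale mulrzDl. Qed.
Fact ratZ_scaleDl x : {morph ratZ_scale^~ x : a b / a + b}.
Proof. by move=> a b; rewrite /ratZ_scale mulrzDr. Qed.
HB.instance Definition _ := GRing.Zmodule_isLmodule.Build int ratZ
  ratZ_scaleA ratZ_scale1 ratZ_scaleDr ratZ_scaleDl.

Fact ints_0 : exists n : int, (0 : ratZ) = (n%:~R : rat).
Proof. by exists 0. Qed.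
Fact ints_lin (a : int) (x y : ratZ) : (exists n : int, x = (n%:~R : rat)) ->
  (exists n : int, y = (n%:~R : rat)) -> exists n : int, a *: x + y = (n%:~R : rat).
Proof.
move=> [n ->] [k ->]; exists (a * n + k).
by rewrite /GRing.scale /= /ratZ_scale -mulrzr -intrM mulrC [RHS]intrD.
Qed.
Definition ints : submod (ratZ : lmodType int) :=
  @Submod _ (ratZ : lmodType int) (fun x => exists n : int, x = (n%:~R : rat)) ints_0 ints_lin.
Definition QZ : lmodType int := quom ints.

Lemma QZ_div (n : int) (d : QZ) : n != 0 -> exists e : QZ, n *: e = d.
Proof.
move=> n0; have [x <-] := qpi_surj d.
exists (qpi ints ((x : rat) / n%:~R : ratZ)); rewrite -linearZ_LR; congr (qpi ints _).
by rewrite /GRing.scale /= /ratZ_scale -mulrzr mulfVK // intr_eq0.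
Qed.

Lemma QZ_tors (n : nat) : (1 < n)%N -> exists2 e : QZ, e != 0 & n%:Z *: e = 0.
Proof.
move=> n1; have n0 : n%:R != 0 :> rat by rewrite pnatr_eq0 -lt0n ltnW.
exists (qpi ints (n%:R^-1 : rat)).
  apply/eqP => /qpi0 [k kE].
  have : (k%:~R * n%:R == 1 :> rat) by rewrite -kE mulVf.
  rewrite -[n%:R]/(n%:Z%:~R) -intrM -[1]/(1%:~R) eqr_int => /eqP/(congr1 absz).
  by rewrite abszM /= => /eqP; rewrite muln_eq1 => /andP[_ /eqP e]; rewrite e in n1.
rewrite -linearZ_LR; apply/qpi0; exists 1.
by rewrite /GRing.scale /= /ratZ_scale -mulrzr mulVf.
Qed.

(** Partial extensions of g are handled as graphs: N is a maximal submodule of B x Q/Z that contains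
    the graph of g over f and meets 0 x Q/Z only in 0. For b in B let n0 be the least positive n
    with n b in the domain of N; dividing the value at n0 b by n0 gives a value at b that is
    compatible with N, so N is defined everywhere. *)
Lemma QZ_inj : inj_mod QZ.
Proof.
move=> A B f g finj.
pose V : lmodType int := (B * QZ)%type.
have glin : linear (fun a => (f a, g a) : V).
  by move=> a x y; rewrite !linearP.
pose U := img (mklin glin).
have [|N [UN NQ Nmax]] := @zorn_avoid _ _ U (fun p : V => p.1 = 0 /\ p.2 <> 0).
  move=> _ [a ->] /= -[fa0 ga0]; apply: ga0.
  by rewrite (_ : a = 0) ?linear0 //; apply: finj; rewrite fa0 linear0.
have N0 (d : QZ) : N (0, d) -> d = 0.
  by move=> /NQ h; apply: contrapT => nd; apply: h.
have key b : exists e : QZ, forall n d, N (n *: b, d) -> n *: e = d.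
  pose P (n : nat) := `[< (0 < n)%N /\ exists d, N (n%:Z *: b, d) >].
  have [exP|nP] := pselect (exists n, P n); last first.
    exists 0 => n d h; rewrite scaler0.
    have [n0|n0] := eqVneq n 0; first by symmetry; apply: N0; move: h; rewrite n0 scale0r.
    exfalso; apply: nP; exists (absz n); apply/asboolP; split; first by rewrite absz_gt0.
    exists (Num.sg n *: d).
    have -> : (absz n)%:Z = Num.sg n * n by rewrite abszE normrEsg.
    by rewrite -scalerA; exact: (@subZ _ _ N _ (_, _)).
  case: (ex_minnP exP) => n0 /asboolP[n0gt [d dP]] n0min.
  have [|e eP] := @QZ_div n0%:Z d; first by rewrite -lt0n.
  exists e => n d' h.
  have rP : N ((n %% n0)%Z *: b, d' - (n %/ n0)%Z *: d).
    have -> : (n %% n0)%Z = n - (n %/ n0)%Z * n0%:Z.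
      by rewrite {2}(divz_eq n n0) addrC addKr.
    rewrite scalerBl -scalerA.
    by apply: (@subB _ _ N (_, _) (_, _)) => //; exact: (@subZ _ _ N _ (_, _)).
  have r0 : (n %% n0)%Z = 0.
    have rge : 0 <= (n %% n0)%Z by rewrite modz_ge0 // -lt0n.
    have rlt : (n %% n0)%Z < n0 by rewrite ltz_pmod // .
    case: (n %% n0)%Z rge rlt rP => // r _ rlt rP.
    case: (posnP r) => [-> //|rgt].
    suff : P r by move=> /n0min; rewrite leqNgt -ltz_nat rlt.
    by apply/asboolP; split => //; eexists; exact: rP.
  move: rP; rewrite r0 scale0r => /N0 /eqP; rewrite subr_eq0 => /eqP ->.
  by rewrite -eP scalerA -[in LHS](addr0 n) {1}(divz_eq n n0) r0 !addr0.
have tot b : exists d, N (b, d).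
  have [e eP] := key b.
  pose N' := spanm N [:: (b, e) : V].
  exists e; apply: (Nmax N').
  - by move=> x; exact: span_base.
  - move=> [x y] [c]; rewrite comb_cons comb_nil addr0 => h [/= x0 y0]; apply: y0.
    move: h; rewrite x0 => h.
    have := eP (- c 0%N) (y - c 0%N *: e).
    have -> : (- c 0%N *: b, y - c 0%N *: e) = ((0, y) : V) - c 0%N *: ((b, e) : V).
      by congr pair; rewrite /= scaleNr sub0r.
    move=> /(_ h) /eqP; rewrite scaleNr eq_sym addrC -subr_eq0 opprK addrAC addNr add0r.
    by move/eqP.
  - by apply: span_mem; rewrite mem_head.
have [h hP] := choice tot.
have uniq x d : N (x, d) -> d = h x.
  move=> Nd; apply/eqP; rewrite -subr_eq0; apply/eqP/N0.
  by rewrite -(subrr x); exact: (@subB _ _ N (_, _) (_, _)).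
have hlin : linear h.
  by move=> a x y; symmetry; apply: uniq; exact: (@sub_lin _ _ N a (_, _) (_, _)).
exists (mklin hlin) => x; symmetry; apply: uniq; apply: UN; by exists x.
Qed.
End QZ.

Lemma lin_sum (R : comPzRingType) (V N : lmodType R) (f : {linear V -> N}) I (r : seq I)
  (P : pred I) (F : I -> V) :
  f (\sum_(i <- r | P i) F i) = \sum_(i <- r | P i) f (F i).
Proof. exact: linear_sum. Qed.

Section ProductModule.
Variables (R : comPzRingType) (T : Type) (M : lmodType R).
Definition pfun : Type := T -> M.
HB.instance Definition _ := gen_eqMixin pfun.
HB.instance Definition _ := gen_choiceMixin pfun.
Definition pfun0 : pfun := fun=> 0.
Definition pfun_add (f g : pfun) : pfun := fun t => f t + g t.
Definition pfun_opp (f : pfun) : pfun := fun t => - f t.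
Definition pfun_scale a (f : pfun) : pfun := fun t => a *: f t.
Fact pfun_addA : associative pfun_add.
Proof. by move=> f g h; apply: funext => t; exact: addrA. Qed.
Fact pfun_addC : commutative pfun_add.
Proof. by move=> f g; apply: funext => t; exact: addrC. Qed.
Fact pfun_add0 : left_id pfun0 pfun_add.
Proof. by move=> f; apply: funext => t; exact: add0r. Qed.
Fact pfun_addN : left_inverse pfun0 pfun_opp pfun_add.
Proof. by move=> f; apply: funext => t; exact: addNr. Qed.
HB.instance Definition _ := GRing.isZmodule.Build pfun
  pfun_addA pfun_addC pfun_add0 pfun_addN.
Fact pfun_scaleA a b x : pfun_scale a (pfun_scale b x) = pfun_scale (a * b) x.
Proof. by apply: funext => t; exact: scalerA. Qed.
Fact pfun_scale1 : left_id 1 pfun_scale.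
Proof. by move=> x; apply: funext => t; exact: scale1r. Qed.
Fact pfun_scaleDr : right_distributive pfun_scale +%R.
Proof. by move=> a x y; apply: funext => t; exact: scalerDr. Qed.
Fact pfun_scaleDl x : {morph pfun_scale^~ x : a b / a + b}.
Proof. by move=> a b; apply: funext => t; exact: scalerDl. Qed.
HB.instance Definition _ := GRing.Zmodule_isLmodule.Build R pfun
  pfun_scaleA pfun_scale1 pfun_scaleDr pfun_scaleDl.
Fact peval_linear t : linear (fun f : pfun => f t). Proof. by []. Qed.
Definition peval t : {linear pfun -> M} := mklin (peval_linear t).
Lemma peval_joint (A : lmodType R) (f : T -> {linear A -> M}) :
  exists g : {linear A -> pfun}, forall x t, peval t (g x) = f t x.
Proof.
have lin : linear ((fun x t => f t x) : A -> pfun).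
  by move=> a x y; apply: funext => t; rewrite linearP.
by exists (mklin lin).
Qed.
Lemma inj_pfun : inj_mod M -> inj_mod pfun.
Proof.
move=> Minj A B f g finj.
have /choice [h hP] : forall t, exists h : {linear B -> M}, forall x, h (f x) = peval t (g x).
  by move=> t; have [h hP] := Minj A B f (peval t \o g) finj; exists h => x; rewrite hP.
have [k kP] := peval_joint h; exists k => x; apply: funext => t.
by rewrite -[k _ _]/(peval t _) kP hP.
Qed.
End ProductModule.

Section Cogenerator.
Variable R : comPzRingType.

Definition intR : {rmorphism int -> R} := intmul 1.
(** Hom_Z(R, Q/Z): by adjunction, R-linear maps V -> [cogen] are the additive characters of V. This
    makes it injective and, by [cogenP], a cogenerator. *)
Definition cogen : lmodType R := shom intR (R^o : lmodType R) QZ.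

Lemma cogen_inj : inj_mod cogen.
Proof. by apply: inj_shom; [exact: projective_free1 | exact: QZ_inj]. Qed.

Lemma cogenP (V : lmodType R) (v : V) : v != 0 ->
  exists f : {linear V -> cogen}, f v != 0.
Proof.
move=> v0; pose W : lmodType int := restr intR V.
(* A target for v that is compatible with its additive order: an element killed by that order if it
   is finite, and any nonzero element otherwise. *)
have [q q0 qP] : exists2 q : QZ, q != 0 & forall n : int, n *: (v : W) = 0 -> n *: q = 0.
  pose P (n : nat) := `[< (0 < n)%N /\ n%:Z *: (v : W) = 0 >].
  have [exP|nP] := pselect (exists n, P n); last first.
    have [q q0 _] := @QZ_tors 2 isT; exists q => // n nv.
    have [->|n0] := eqVneq n 0; first by rewrite scale0r.
    exfalso; apply: nP; exists (absz n); apply/asboolP; split; first by rewrite absz_gt0.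
    have -> : (absz n)%:Z = Num.sg n * n by rewrite abszE normrEsg.
    by rewrite -scalerA nv scaler0.
  case: (ex_minnP exP) => n /asboolP[ngt nv] nmin.
  have n1 : (1 < n)%N.
    rewrite ltn_neqAle ngt andbT eq_sym; apply: contra_neq v0 => n1.
    by move: nv; rewrite n1 scale1r.
  have [q q0 nq] := QZ_tors n1; exists q => // k kv.
  have kE := divz_eq k n.
  have rv : (k %% n)%Z *: (v : W) = 0.
    have -> : (k %% n)%Z = k - (k %/ n)%Z * n%:Z by rewrite {2}kE addrC addKr.
    by rewrite scalerBl -scalerA nv kv scaler0 subrr.
  suff r0 : (k %% n)%Z = 0 by rewrite kE r0 addr0 -scalerA nq scaler0.
  have rge : 0 <= (k %% n)%Z by rewrite modz_ge0 // -lt0n.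
  have rlt : (k %% n)%Z < n by rewrite ltz_pmod.
  case: (k %% n)%Z rge rlt rv => // r _ rlt rv.
  case: (posnP r) => [-> //|rgt].
  suff : P r by move=> /nmin; rewrite leqNgt -ltz_nat rlt.
  by apply/asboolP.
have zlin : linear (fun n : (int^o : lmodType int) => (n : int) *: (v : W)).
  by move=> a b c; rewrite scalerDl scalerA.
pose Z := img (mklin zlin).
have /choice [g gP] : forall x : subm Z, exists n : int, sinc Z x = n *: (v : W).
  by move=> x; have [n nE] := sincP x; exists n.
have glin : linear (fun x => g x *: q).
  move=> a x y; rewrite scalerA -scalerDl; apply/eqP; rewrite -subr_eq0 -scalerBl.
  apply/eqP/qP; rewrite scalerBl scalerDl -scalerA -!gP linearP; exact: subrr.
have [h hP] := QZ_inj (mklin glin) (@sinc_inj _ _ Z).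
have fP x (a : int) (r r' : R^o) :
  h ((intR a *: r + r') *: x) = a *: h (r *: x) + h (r' *: x).
  rewrite -linearP; congr (h _); rewrite scalerDl; congr (_ + _).
  by rewrite -[intR a *: r]/(intR a * r) -scalerA.
have flin : linear (fun x : V => mkshom (fP x) : cogen).
  move=> a x y; apply: shomP => r; rewrite shom_funD shom_funZ !mkshomE.
  rewrite scalerDr -[LHS]/(h (_ + _ : W)) linearD; congr (h _ + _).
  by rewrite scalerA mulrC.
exists (mklin flin); apply/eqP => e; have {e} := congr1 (fun f : cogen => shom_fun f (1 : R^o)) e.
have vZ : Z v by exists 1; rewrite /= scale1r.
rewrite shom_fun0 -[shom_fun _ _]/(h ((1 : R) *: v)) scale1r.
have := hP (mksub vZ); rewrite sincK => -> /=.
move=> gq; have := gP (mksub vZ); rewrite sincK => vE; move/eqP: q0; apply.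
rewrite -[q]scale1r -gq; apply/eqP; rewrite -subr_eq0 -scalerBl; apply/eqP/qP.
by rewrite scalerBl scale1r -vE subrr.
Qed.

Definition hull (V : lmodType R) : lmodType R := pfun {linear V -> cogen} cogen.
Lemma hull_inj (V : lmodType R) : inj_mod (hull V).
Proof. exact: inj_pfun cogen_inj. Qed.
Fact hull_in_linear (V : lmodType R) : linear ((fun x f => f x) : V -> hull V).
Proof. by move=> a x y; apply: funext => f; rewrite linearP. Qed.
Definition hull_in (V : lmodType R) : {linear V -> hull V} := mklin (@hull_in_linear V).
Lemma hull_in_inj (V : lmodType R) : injective (@hull_in V).
Proof.
move=> x y xy; apply/eqP; rewrite -subr_eq0; apply: contrapT => /negP.
move=> /cogenP [f]; rewrite linearB subr_eq0 => /eqP; apply.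
exact: (congr1 (fun h : hull V => h f) xy).
Qed.

Lemma inj_zero (M : lmodType R) : (forall x : M, x = 0) -> inj_mod M.
Proof. by move=> M0 A B f g _; exists \0 => x; rewrite [LHS]M0 [RHS]M0. Qed.

End Cogenerator.

(** * Finitely generated projective modules *)

Section FinGen.
Variable R : comPzRingType.
Implicit Types M N P Q : lmodType R.

Section RowMap.
Variables (n : nat) (M : lmodType R) (v : 'I_n -> M).
Fact rv_linear : linear (fun x : 'rV[R]_n => \sum_i x 0 i *: v i).
Proof.
move=> a x y; rewrite scaler_sumr -big_split; apply: eq_bigr => i _ /=.
by rewrite !mxE scalerDl scalerA.
Qed.
Definition rv_map : {linear 'rV[R]_n -> M} := mklin rv_linear.
Lemma rv_mapE x : rv_map x = \sum_i x 0 i *: v i. Proof. by []. Qed.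
End RowMap.

Lemma row_delta n (x : 'rV[R]_n) : x = \sum_i x 0 i *: delta_mx 0 i.
Proof.
apply/rowP => j; rewrite summxE (bigD1 j) //= !mxE !eqxx mulr1 big1 ?addr0 // => i.
by move=> /negPf nj; rewrite !mxE eq_sym nj andbF mulr0.
Qed.
Lemma rv_lin n M (f : {linear 'rV[R]_n -> M}) x :
  f x = \sum_i x 0 i *: f (delta_mx 0 i).
Proof.
by rewrite {1}(row_delta x) lin_sum; apply: eq_bigr => i _; rewrite linearZ_LR.
Qed.

Lemma fin_gen_surj M : fin_gen M ->
  exists n (f : {linear 'rV[R]_n -> M}), forall y, exists x, f x = y.
Proof.
move=> [s sP]; exists (size s), (rv_map (fun i => s`_i)) => y.
have [c ->] := sP y; exists (\row_i c i).
by rewrite rv_mapE; apply: eq_bigr => i _; rewrite mxE.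
Qed.

Lemma fin_gen_rv n : fin_gen ('rV[R]_n).
Proof.
exists [seq delta_mx 0 i | i <- enum 'I_n] => x.
exists (fun k => if insub k is Some i then x 0 i else 0).
rewrite {1}(row_delta x) size_map -cardE.
rewrite (reindex (fun i : 'I_#|'I_n| => cast_ord (card_ord n) i)); last first.
  by exists (cast_ord (esym (card_ord n))) => i _; rewrite ?cast_ordK ?cast_ordKV.
apply: eq_bigr => i _.
have lt : (i < n)%N by rewrite -[X in (_ < X)%N]card_ord.
have -> : cast_ord (card_ord n) i = Ordinal lt by apply: val_inj.
rewrite insubT; congr (_ *: _).
rewrite (nth_map (Ordinal lt)) ?size_enum_ord //; congr (delta_mx 0 _).
by apply: val_inj; rewrite /= nth_enum_ord.
Qed.

Lemma fin_gen_img M N (f : {linear M -> N}) : fin_gen M ->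
  (forall y, exists x, f x = y) -> fin_gen N.
Proof.
move=> [s sP] fs; exists (map f s) => y; have [x <-] := fs y; have [c ->] := sP x.
exists c; rewrite lin_sum size_map; apply: eq_bigr => k _.
by rewrite linearZ_LR (nth_map 0).
Qed.

Definition zero_sub M : submod M := ker (idfun : {linear M -> M}).

Lemma fin_gen_sub M (U : submod M) : noetherian R -> fin_gen M -> fin_gen (subm U).
Proof.
move=> noeth [s sP].
have [|t [tU tP]] := @fg_sub R noeth M (zero_sub M) U s.
  by move=> z _; have [c ->] := sP z; exists c; rewrite /comb /= subrr.
exists (pmap (fun x => if pselect (U x) is left h then Some (mksub h) else None) t).
move=> x; have [c cP] := tP _ (sincP x).
have E : [seq sinc U y | y <- pmap (fun x => if pselect (U x) is left h
    then Some (mksub h) else None) t] = t.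
  elim: t tU {tP c cP} => //= y t IHt tU; case: pselect => [h|[]] /=; last first.
    by apply: tU; rewrite mem_head.
  by rewrite IHt // => z zt; apply: tU; rewrite inE zt orbT.
exists c; apply: (@sinc_inj _ _ U); rewrite lin_sum.
move/eqP: cP; rewrite subr_eq0 => /eqP ->.
rewrite /comb -[in LHS]E size_map; apply: eq_bigr => k _.
by rewrite linearZ_LR (nth_map 0).
Qed.

Definition fgproj P : Prop := exists n (i : {linear P -> 'rV[R]_n})
  (r : {linear 'rV[R]_n -> P}), cancel i r.

Lemma fgproj_rv n : fgproj 'rV[R]_n.
Proof. by exists n, idfun, idfun. Qed.
Lemma projective_rv n : projective 'rV[R]_n.
Proof.
move=> M N g f gs.
have /choice [h hP] : forall i : 'I_n, exists x, g x = f (delta_mx 0 i) by move=> i.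
exists (rv_map h) => x; rewrite rv_mapE lin_sum [RHS]rv_lin.
by apply: eq_bigr => i _; rewrite linearZ_LR hP.
Qed.
Lemma projective_retract P Q (i : {linear P -> Q}) (r : {linear Q -> P}) :
  cancel i r -> projective Q -> projective P.
Proof.
move=> ir Qp M N g f gs; have [h hP] := Qp M N g (f \o r) gs.
by exists (h \o i) => x; rewrite /= hP /= ir.
Qed.
Lemma fgproj_projective P : fgproj P -> projective P.
Proof. by move=> [n [i [r ir]]]; exact: projective_retract ir (@projective_rv n). Qed.
Lemma fgproj_fin_gen P : fgproj P -> fin_gen P.
Proof.
move=> [n [i [r ir]]]; apply: (fin_gen_img (f := r)) (fin_gen_rv n) _ => y.
by exists (i y); exact: ir.
Qed.
Lemma projective_fgproj P : projective P -> fin_gen P -> fgproj P.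
Proof.
move=> Pp /fin_gen_surj [n [f fs]]; have [h hP] := Pp _ _ f idfun fs.
by exists n, h, f.
Qed.
Lemma fin_gen_prod M N : fin_gen M -> fin_gen N -> fin_gen (M * N)%type.
Proof.
move=> /fin_gen_surj [n [f fs]] /fin_gen_surj [k [g gs]].
have lin : linear (fun x : 'rV[R]_(n + k) => (f (lsubmx x), g (rsubmx x)) : (M * N)%type).
  by move=> a x y; rewrite !linearP.
apply: (fin_gen_img (f := mklin lin)) (fin_gen_rv _) _ => -[y z].
have [x xE] := fs y; have [x' xE'] := gs z.
by exists (row_mx x x'); rewrite /= row_mxKl row_mxKr xE xE'.
Qed.
Lemma projective_prod M N : projective M -> projective N -> projective (M * N)%type.
Proof.
move=> Mp Np A B g f gs.
have lM : linear (fun x : M => (x, 0) : (M * N)%type).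
  by move=> a x y; apply: injective_projections; rewrite /= ?scaler0 ?addr0.
have lN : linear (fun x : N => (0, x) : (M * N)%type).
  by move=> a x y; apply: injective_projections; rewrite /= ?scaler0 ?addr0.
have [h hP] := Mp A B g (f \o mklin lM) gs.
have [k kP] := Np A B g (f \o mklin lN) gs.
exists ((h \o fst) \+ (k \o snd)) => -[x y]; rewrite /= linearD hP kP /= -linearD.
by congr (f _); apply: injective_projections; rewrite /= ?addr0 ?add0r.
Qed.
Lemma fgproj_prod M N : fgproj M -> fgproj N -> fgproj (M * N)%type.
Proof.
move=> Mp Np; apply: projective_fgproj.
  by apply: projective_prod; exact: fgproj_projective.
by apply: fin_gen_prod; exact: fgproj_fin_gen.
Qed.
Lemma fgproj_zero M : (forall x : M, x = 0) -> fgproj M.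
Proof. by move=> M0; exists 0%N, \0, \0 => x; rewrite [LHS]M0 [RHS]M0. Qed.

End FinGen.

(** * Complexes and exact sequences *)

Section Complexes.
Variable R : comPzRingType.
Implicit Types X Y Z A B C : complex R.

(** The identity read as a map X i -> X j when i = j, and 0 otherwise: it lets
    elements move between propositionally equal degrees without casts. *)
Definition tr (X : int -> lmodType R) i j : {linear X i -> X j} :=
  if @eqP _ i j is ReflectT e then ecast j {linear X i -> X j} e idfun else \0.
Lemma trE (X : int -> lmodType R) i x : tr X i i x = x.
Proof. by rewrite /tr; case: eqP => // e; rewrite (eq_irrelevance e erefl). Qed.
Lemma tr_ne (X : int -> lmodType R) i j x : i != j -> tr X i j x = 0.
Proof. by rewrite /tr; case: eqP. Qed.
Lemma tr_tr (X : int -> lmodType R) i j k x : i = j -> tr X j k (tr X i j x) = tr X i k x.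
Proof. by move=> <-; rewrite trE. Qed.
Lemma trK (X : int -> lmodType R) i j x : i = j -> tr X j i (tr X i j x) = x.
Proof. by move=> ij; rewrite tr_tr // trE. Qed.
Lemma tr_map (X Y : int -> lmodType R) (f : forall i, {linear X i -> Y i}) i j x :
  tr Y i j (f i x) = f j (tr X i j x).
Proof.
have [ij|ij] := eqVneq i j; first by case: _ / ij; rewrite !trE.
by rewrite !tr_ne // linear0.
Qed.
Lemma cd_tr X i j k x : i = j -> cd X j k (tr X i j x) = cd X i k x.
Proof. by move=> <-; rewrite trE. Qed.
Lemma tr_cd X i j k x : j = k -> tr X j k (cd X i j x) = cd X i k x.
Proof. by move=> <-; rewrite trE. Qed.

Lemma bdP X i (z : X i) : is_boundary z <-> exists w : X (i + 1), z = cd X (i + 1) i w.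
Proof.
split=> [[j [w ->]]|[w ->]]; last by exists (i + 1), w.
have [ji|ji] := eqVneq j (i + 1); first by case: _ / ji; exists w.
by exists 0; rewrite linear0 cd_shape.
Qed.
Lemma bd_at X i j (z : X i) : j = i + 1 -> is_boundary z -> exists w : X j, z = cd X j i w.
Proof. by move=> -> /bdP. Qed.
Lemma cyP X i (z : X i) : is_cycle z <-> cd X i (i - 1) z = 0.
Proof.
split=> [//|z0 j]; have [->//|ij] := eqVneq j (i - 1).
by apply: cd_shape; apply: contraNneq ij => ->; rewrite addrK.
Qed.
Lemma cy_at X i j (z : X i) : j = i - 1 -> cd X i j z = 0 -> is_cycle z.
Proof. by move=> -> /cyP. Qed.

Lemma cy_bd X i (z : X i) : is_boundary z -> is_cycle z.
Proof. by move=> [j [w ->]] k; exact: cd_cd. Qed.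
Lemma bd0 X i : is_boundary (0 : X i).
Proof. by exists i, 0; rewrite linear0. Qed.
Lemma bdL X i a (z w : X i) : is_boundary z -> is_boundary w -> is_boundary (a *: z + w).
Proof.
move=> /bdP[z' ->] /bdP[w' ->]; exists (i + 1), (a *: z' + w').
by rewrite linearP.
Qed.
Lemma cyL X i a (z w : X i) : is_cycle z -> is_cycle w -> is_cycle (a *: z + w).
Proof. by move=> zc wc j; rewrite linearP zc wc scaler0 addr0. Qed.
Lemma cy0 X i : is_cycle (0 : X i).
Proof. by move=> j; exact: linear0. Qed.
Definition bdm X i : submod (X i) := @Submod R (X i) (@is_boundary R X i) (@bd0 X i) (@bdL X i).
Definition cym X i : submod (X i) := @Submod R (X i) (@is_cycle R X i) (@cy0 X i) (@cyL X i).
Lemma bdD X i (z w : X i) : is_boundary z -> is_boundary w -> is_boundary (z + w).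
Proof. exact: (@subD _ _ (bdm X i)). Qed.
Lemma bdB X i (z w : X i) : is_boundary z -> is_boundary w -> is_boundary (z - w).
Proof. exact: (@subB _ _ (bdm X i)). Qed.
Lemma bdN X i (z : X i) : is_boundary z -> is_boundary (- z).
Proof. exact: (@subN _ _ (bdm X i)). Qed.
Lemma bdZ X i a (z : X i) : is_boundary z -> is_boundary (a *: z).
Proof. exact: (@subZ _ _ (bdm X i)). Qed.
Lemma cyB X i (z w : X i) : is_cycle z -> is_cycle w -> is_cycle (z - w).
Proof. exact: (@subB _ _ (cym X i)). Qed.
Lemma cyN X i (z : X i) : is_cycle z -> is_cycle (- z).
Proof. exact: (@subN _ _ (cym X i)). Qed.
Lemma chmap_cy X Y (f : chmap X Y) i (z : X i) : is_cycle z -> is_cycle (f i z).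
Proof. by move=> zc j; rewrite chmapP zc linear0. Qed.
Lemma chmap_bd X Y (f : chmap X Y) i (z : X i) : is_boundary z -> is_boundary (f i z).
Proof. by move=> [j [w ->]]; exists j, (f j w); rewrite chmapP. Qed.
Lemma bd_cd X i j (w : X j) : is_boundary (cd X j i w).
Proof. by exists j, w. Qed.
Lemma cy_cd X i j (w : X j) : is_cycle (cd X j i w).
Proof. exact/cy_bd/bd_cd. Qed.

Definition cx_zero_at X i : Prop := forall x : X i, x = 0.
Lemma hzero_zero_at X i : cx_zero_at X i -> hzero X i.
Proof. by move=> X0 z _; rewrite [z]X0; exact: bd0. Qed.

Definition chcomp X Y Z (g : chmap Y Z) (f : chmap X Y) : chmap X Z.
Proof.
exists (fun i => g i \o f i) => i j x; by rewrite /= chmapP chmapP.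
Defined.
Lemma chcompE X Y Z (g : chmap Y Z) (f : chmap X Y) i x :
  chcomp g f i x = g i (f i x). Proof. by []. Qed.
Definition chmap0 X Y : chmap X Y.
Proof. exists (fun i => \0) => i j x; exact: linear0. Defined.
Definition chmap_scale X Y (a : R) (f : chmap X Y) : chmap X Y.
Proof. by exists (fun i => a \*: f i) => i j x; rewrite /= linearZ_LR chmapP. Defined.

Lemma qiso_comp X Y Z (g : chmap Y Z) (f : chmap X Y) :
  qiso f -> qiso g -> qiso (chcomp g f).
Proof.
move=> qf qg i; split=> [z zc|w wc].
  rewrite chcompE => h; apply: (qf i).1 => //; apply: (qg i).1 => //.
  exact: chmap_cy.
have [y yc yP] := (qg i).2 w wc; have [x xc xP] := (qf i).2 y yc.
exists x => //; rewrite chcompE -(subrKA (g i y)); apply: bdD => //.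
by rewrite -linearB; exact: chmap_bd.
Qed.
Lemma qiso_cancel_r X Y Z (g : chmap Y Z) (f : chmap X Y) :
  qiso g -> qiso (chcomp g f) -> qiso f.
Proof.
move=> qg qgf i; split=> [z zc h|y yc].
  by apply: (qgf i).1 => //; exact: (chmap_bd g).
have [x xc xP] := (qgf i).2 (g i y) (chmap_cy g yc); exists x => //.
apply: (qg i).1; first by apply: cyB => //; exact: chmap_cy.
by rewrite linearB.
Qed.
Lemma qiso_cancel_l X Y Z (g : chmap Y Z) (f : chmap X Y) :
  qiso f -> qiso (chcomp g f) -> qiso g.
Proof.
move=> qf qgf i; split=> [y yc h|w wc].
  have [x xc xP] := (qf i).2 y yc.
  suff bx : is_boundary x by rewrite -(subrK (f i x) y); apply: bdD => //; exact: chmap_bd.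
  apply: (qgf i).1 => //; rewrite chcompE -(subKr (g i y) (g i (f i x))) -linearB.
  by apply: bdB => //; exact: chmap_bd.
have [x xc xP] := (qgf i).2 w wc; exists (f i x) => //; exact: chmap_cy.
Qed.
Definition hequal X Y (f g : chmap X Y) : Prop :=
  forall i (z : X i), is_cycle z -> is_boundary (f i z - g i z).
Lemma qiso_hequal X Y (f g : chmap X Y) : hequal f g -> qiso f -> qiso g.
Proof.
move=> fg qf i; split=> [z zc gz|w wc].
  apply: (qf i).1 => //; rewrite -(subrK (g i z) (f i z)); apply: bdD => //; exact: fg.
have [z zc zP] := (qf i).2 w wc; exists z => //.
by rewrite -(subrKA (f i z)); apply: bdD => //; exact: fg.
Qed.
Lemma qiso_id X : qiso (chmap_id X).
Proof. by move=> i; split=> // w wc; exists w => //; rewrite subrr; exact: bd0. Qed.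
Lemma qiso_hzero X Y (f : chmap X Y) i : qiso f -> hzero X i <-> hzero Y i.
Proof.
move=> qf; split=> h z zc.
  have [x xc xP] := (qf i).2 z zc; rewrite -(subrK (f i x) z); apply: bdD => //.
  by apply: chmap_bd; exact: h.
by apply: (qf i).1 => //; apply: h; exact: chmap_cy.
Qed.
Lemma qiso_bij X Y (f : chmap X Y) : (forall i, injective (f i)) ->
  (forall i y, exists x, f i x = y) -> qiso f.
Proof.
move=> fi fs i; split=> [z zc /bdP[w wP]|w wc].
  have [x xP] := fs _ w; exists (i + 1), x; apply: (fi i).
  by rewrite wP -xP chmapP.
have [x xP] := fs _ w; exists x; last by rewrite xP subrr; exact: bd0.
by move=> j; apply: (fi j); rewrite -chmapP xP linear0.
Qed.
Lemma qiso_acyclic X Y (f : chmap X Y) : acyclic X -> acyclic Y -> qiso f.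
Proof.
move=> Xa Ya i; split=> [z zc _|w wc]; first exact: Xa.
by exists 0; [exact: cy0 | rewrite linear0 subr0; exact: Ya].
Qed.
Lemma qiso_hfin X Y (f : chmap X Y) i : qiso f -> hfin_gen X i <-> hfin_gen Y i.
Proof.
move=> qf; split=> -[s [sc sP]].
  exists (map (f i) s); split=> [z /mapP[x /sc xc ->]|z zc]; first exact: chmap_cy.
  have [x xc xP] := (qf i).2 z zc; have [c cP] := sP x xc; exists c.
  rewrite -(subrKA (f i x)); apply: bdD => //.
  have -> : \sum_(k < size (map (f i) s)) c k *: (map (f i) s)`_k =
     f i (\sum_(k < size s) c k *: s`_k).
    rewrite lin_sum size_map; apply: eq_bigr => k _.
    by rewrite linearZ_LR (nth_map 0).
  by rewrite -linearB; exact: chmap_bd.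
have /choice [g gP] : forall y : Y i, exists x : X i, is_cycle y ->
    is_cycle x /\ is_boundary (y - f i x).
  move=> y; have [yc|nyc] := pselect (is_cycle y); last by exists 0.
  by have [x xc xP] := (qf i).2 y yc; exists x.
exists (map g s); split=> [z /mapP[y /sc yc ->]|z zc]; first exact: (gP y yc).1.
have [c cP] := sP _ (chmap_cy f zc); exists c; apply: (qf i).1.
  apply: cyB => //; apply: (@sub_sum _ _ (cym X i)) => k _; apply: (@subZ _ _ (cym X i)).
  rewrite size_map in k *; rewrite (nth_map 0) //.
  by apply: (gP _ _).1; apply: sc; exact: mem_nth.
rewrite -(subrK (\sum_(k < size s) c k *: s`_k) (f i _)) .
have -> : f i (z - \sum_(k < size (map g s)) c k *: (map g s)`_k) =
   (f i z - \sum_(k < size s) c k *: s`_k) +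
   \sum_(k < size s) c k *: (s`_k - f i (g s`_k)).
  under [X in _ = _ + X]eq_bigr do rewrite scalerBr.
  rewrite sumrB linearB lin_sum size_map.
  have -> : \sum_(k < size s) f i (c k *: (map g s)`_k) =
     \sum_(k < size s) c k *: f i (g s`_k).
    by apply: eq_bigr => k _; rewrite linearZ_LR (nth_map 0).
  by zm.
rewrite subrK; apply: bdD => //; apply: (@sub_sum _ _ (bdm Y i)) => k _.
by apply: bdZ; apply: (gP _ _).2; apply: sc; exact: mem_nth.
Qed.

Lemma finite_int_bounded (A : set int) :
  finite_set A <-> exists a b, forall i, A i -> a <= i < b.
Proof.
split=> [/finite_seqP[s ->]|[a [b ab]]].
  elim: s => [|x s [a [b ab]]]; first by exists 0, 0.
  exists (Num.min a x), (Num.max b (x + 1)) => i; rewrite /= inE => /orP[/eqP->|/ab/andP[h1 h2]].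
    by rewrite ge_min lexx orbT lt_max ltzD1 lexx orbT.
  by rewrite ge_min h1 lt_max h2.
apply: (@sub_finite_set _ _ [set` [seq a + n%:Z | n <- iota 0 `|b - a|%N]]%classic).
  move=> i /ab /andP[h1 h2]; rewrite /=; apply/mapP.
  exists `|i - a|%N; last by rewrite gez0_abs ?subr_ge0 //; zm.
  rewrite mem_iota /= add0n -ltz_nat !gez0_abs ?ltrD2r // subr_ge0 //.
  by apply: ltW; exact: le_lt_trans h2.
exact: finite_seq.
Qed.
Lemma hboundedP X : hbounded X <-> exists a b, (forall i, i < a -> hzero X i) /\
  (forall i, b <= i -> hzero X i).
Proof.
split=> [/finite_int_bounded[a [b h]]|[a [b [h1 h2]]]].
  exists a, b; split=> i ib; apply: contrapT => /h; first by rewrite leNgt ib.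
  by rewrite [i < b]ltNge ib andbF.
apply/finite_int_bounded; exists a, b => i /= nz; rewrite leNgt [i < b]ltNge.
by apply/andP; split; apply/negP => lt; apply: nz; [exact: h1 | exact: h2].
Qed.
Lemma qiso_hbounded X Y (f : chmap X Y) : qiso f -> hbounded X <-> hbounded Y.
Proof.
move=> qf; rewrite !hboundedP; split=> -[a [b [h1 h2]]]; exists a, b; split=> i ib.
- by rewrite -(qiso_hzero _ qf); exact: h1.
- by rewrite -(qiso_hzero _ qf); exact: h2.
- by rewrite (qiso_hzero _ qf); exact: h1.
- by rewrite (qiso_hzero _ qf); exact: h2.
Qed.
Lemma qiso_hfinite X Y (f : chmap X Y) : qiso f -> hfinite X <-> hfinite Y.
Proof.
move=> qf; rewrite /hfinite (qiso_hbounded qf).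
by split=> -[h1 h2]; split=> // i; have := h2 i; rewrite (qiso_hfin i qf).
Qed.

Definition sh (k : int) X : complex R.
Proof.
refine (@Complex R (fun i => X (i - k)) (fun i j =>
  ((-1) ^+ absz k) \*: cd X (i - k) (j - k)) _ _) => [i j x ij|i j l x] /=.
  rewrite cd_shape ?scaler0 //; apply: contraNneq ij => e.
  by rewrite -(subrK k i) e addrAC subrK.
by rewrite linearZ_LR cd_cd !scaler0.
Defined.
Lemma sh_cdE k X i j x : cd (sh k X) i j x = (-1) ^+ absz k *: cd X (i - k) (j - k) x.
Proof. by []. Qed.
Lemma sign_inj (V : lmodType R) k : injective (fun x : V => (-1) ^+ k *: x).
Proof.
move=> x y /= /(congr1 (fun z => (-1) ^+ k *: z)).
by rewrite !scalerA -!expr2 !sqrr_sign !scale1r.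
Qed.
Lemma signK (V : lmodType R) k (x : V) : (-1) ^+ k *: ((-1) ^+ k *: x) = x.
Proof. by rewrite scalerA -expr2 sqrr_sign scale1r. Qed.
Lemma sh_cy k X i (z : X (i - k)) : is_cycle (z : sh k X i) <-> is_cycle z.
Proof.
split=> zc; last by move=> j; rewrite sh_cdE zc scaler0.
by apply/cyP; apply: (@sign_inj _ (absz k)); rewrite scaler0 addrAC; exact: (zc (i - 1)).
Qed.
Lemma sh_bd k X i (z : X (i - k)) : is_boundary (z : sh k X i) <-> is_boundary z.
Proof.
split=> [[j [w]]|h].
  by rewrite sh_cdE => ->; apply: bdZ; exact: bd_cd.
have [w ->] := bd_at (addrAC i 1 (- k)) h.
by exists (i + 1), ((-1) ^+ absz k *: w); rewrite sh_cdE linearZ_LR signK.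
Qed.
Lemma sh_hzero k X i : hzero (sh k X) i <-> hzero X (i - k).
Proof. by split=> h z /sh_cy/h/sh_bd. Qed.
Definition sh_map k X Y (f : chmap X Y) : chmap (sh k X) (sh k Y).
Proof.
by exists (fun i => f (i - k)) => i j x; rewrite !sh_cdE chmapP linearZ_LR.
Defined.
Lemma sh_qiso k X Y (f : chmap X Y) : qiso f -> qiso (sh_map k f).
Proof.
move=> qf i; split=> [z zc /sh_bd h|w /sh_cy wc].
  by apply/sh_bd; apply: (qf _).1 => //; exact/sh_cy.
by have [z zc zP] := (qf _).2 w wc; exists z; [exact/sh_cy | exact/sh_bd].
Qed.

(** An extension of C by A, degreewise split, with differential
    (a, c) |-> (d a + s c, d c). *)
Record twisting A C := Twisting {
  tw_map :> forall i j, {linear C i -> A j};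
  tw_shape : forall i j x, i != j + 1 -> tw_map i j x = 0;
  tw_anti : forall i j k x, cd A j k (tw_map i j x) + tw_map j k (cd C i j x) = 0 }.

Section Twist.
Variables (A C : complex R) (s : twisting A C).
Definition twd_fun i j (p : A i * C i) : A j * C j :=
  (cd A i j p.1 + s i j p.2, cd C i j p.2).
Fact twd_linear i j : linear (@twd_fun i j).
Proof.
move=> a [x y] [x' y']; rewrite /twd_fun /= !linearP; congr pair.
by rewrite /= scalerDr addrACA.
Qed.
Definition twd i j : {linear (A i * C i)%type -> (A j * C j)%type} := mklin (@twd_linear i j).
Definition twist : complex R.
Proof.
refine (@Complex R (fun i => (A i * C i)%type) twd _ _) => [i j [a c] ij|i j k [a c]] /=.
  by rewrite /twd_fun /= !cd_shape // tw_shape // addr0.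
by rewrite /twd_fun /= linearD !cd_cd add0r tw_anti.
Defined.
Lemma twist_cdE i j a c : cd twist i j (a, c) = (cd A i j a + s i j c, cd C i j c).
Proof. by []. Qed.
Fact tw_in_linear i : linear (fun a : A i => (a, 0) : twist i).
Proof. by move=> r x y; apply: injective_projections; rewrite /= ?scaler0 ?addr0. Qed.
Fact tw_inP i j x : cd twist i j (mklin (@tw_in_linear i) x) =
  mklin (@tw_in_linear j) (cd A i j x).
Proof. by rewrite [LHS]twist_cdE !linear0 addr0. Qed.
Definition tw_in : chmap A twist := Chmap tw_inP.
Lemma tw_inE i a : tw_in i a = (a, 0). Proof. by []. Qed.
Definition tw_out : chmap twist C.
Proof. by exists (fun i => snd : {linear twist i -> C i}). Defined.
End Twist.

Definition ses A B C (f : chmap A B) (g : chmap B C) : Prop :=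
  [/\ forall i, injective (f i), forall i y, exists x, g i x = y,
      forall i x, g i (f i x) = 0 & forall i y, g i y = 0 -> exists x, y = f i x].

Lemma ses_twist A C (s : twisting A C) : ses (tw_in s) (tw_out s).
Proof.
split=> //; first by move=> i x y [].
  by move=> i y; exists (0, y).
by move=> i [a c] /= ->; exists a.
Qed.

Section Cone.
Variables (X Y : complex R) (f : chmap X Y).
Definition cone_tw : twisting Y (sh 1 X).
Proof.
exists (fun i j => f j \o tr X (i - 1) j : {linear sh 1 X i -> Y j}) => [i j x ij|i j k x] /=.
  by rewrite tr_ne ?linear0 // subr_eq.
rewrite chmapP -linearD; rewrite expr1 scaleN1r linearN.
have [ij|ij] := eqVneq (i - 1) j.
  rewrite cd_tr //; have [jk|jk] := eqVneq (j - 1) k.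
    by rewrite tr_cd // subrr linear0.
  rewrite [tr _ (j - 1) k _]tr_ne // oppr0 addr0 cd_shape ?linear0 //.
  by rewrite ij -subr_eq.
rewrite [tr _ (i - 1) j _]tr_ne // linear0 add0r [cd X (i - 1) _ _]cd_shape ?subrK //.
by rewrite linear0 oppr0 linear0.
Defined.
Definition cone : complex R := twist cone_tw.
Definition cone_in : chmap Y cone := tw_in cone_tw.
Definition cone_out : chmap cone (sh 1 X) := tw_out cone_tw.
Lemma ses_cone : ses cone_in cone_out.
Proof. exact: ses_twist. Qed.
Lemma cone_cdE i j y x : cd cone i j (y, x) =
  (cd Y i j y + f j (tr X (i - 1) j x), - cd X (i - 1) (j - 1) x).
Proof.
rewrite [LHS]twist_cdE; congr pair.
by rewrite sh_cdE expr1 scaleN1r.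
Qed.
End Cone.

(** * The long exact homology sequence *)

Section LongExact.
Variables (A B C : complex R) (f : chmap A B) (g : chmap B C).
Hypothesis fg : ses f g.

(** Exactness at H_i(B), in terms of cycles. Together with the representatives b and a of the
    connecting map in [ses_connect] it replaces the long exact sequence. *)
Lemma ses_mid i (z : B i) : is_cycle z -> is_boundary (g i z) ->
  exists2 a : A i, is_cycle a & is_boundary (z - f i a).
Proof.
case: fg => fi gs gf ex zc /bdP[c cP]; have [b bP] := gs _ c.
have [|a aP] := ex i (z - cd B (i + 1) i b).
  by rewrite linearB -chmapP bP cP subrr.
exists a; last by rewrite -aP opprB addrC subrK; exact: bd_cd.
move=> j; apply: (fi j); rewrite -chmapP -aP linearB zc cd_cd subr0 linear0 //.
Qed.
Lemma ses_connect i (c : C i) : is_cycle c -> exists b a,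
  [/\ g i b = c, cd B i (i - 1) b = f (i - 1) a & is_cycle (a : A (i - 1))].
Proof.
case: fg => fi gs gf ex cc; have [b bP] := gs _ c.
have [|a aP] := ex (i - 1) (cd B i (i - 1) b); first by rewrite -chmapP bP cc.
exists b, a; split=> // j; apply: (fi j).
by rewrite -chmapP -aP cd_cd linear0.
Qed.
Lemma ses_hzero_mid i : hzero A i -> hzero C i -> hzero B i.
Proof.
move=> Ai Ci z zc; have [|a /Ai ab h] := ses_mid zc; first by apply: Ci; exact: chmap_cy.
by rewrite -(subrK (f i a) z); apply: bdD => //; exact: chmap_bd.
Qed.
Lemma ses_hzero_right i : hzero B i -> hzero A (i - 1) -> hzero C i.
Proof.
move=> Bi Ai c cc; have [b [a [bP dbP ac]]] := ses_connect cc.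
have [a' a'P] := bd_at (esym (subrK 1 i)) (Ai _ ac).
rewrite -bP; have -> : g i b = g i (b - f i a').
  by case: fg => _ _ gf _; rewrite linearB gf subr0.
apply/chmap_bd/Bi/cyP; by rewrite linearB chmapP -a'P dbP subrr.
Qed.
Lemma ses_hzero_left i : hzero C (i + 1) -> hzero B i -> hzero A i.
Proof.
case: (fg) => fi gs gf ex Ci Bi a ac.
have /bdP[b bP] := Bi _ (chmap_cy f ac).
have bc : is_cycle (g _ b).
  by apply: (cy_at (esym (addrK 1 i))); rewrite chmapP -bP gf.
have /bdP[c cP] := Ci _ bc; have [b' b'P] := gs _ c.
have [|a' a'P] := ex _ (b - cd B (i + 1 + 1) (i + 1) b').
  by rewrite linearB -chmapP b'P cP subrr.
exists (i + 1), a'; apply: (fi i).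
by rewrite -chmapP -a'P linearB cd_cd subr0.
Qed.

Hypothesis noethR : noetherian R.

Lemma hfin_subset X i (U : submod (X i)) : hfin_gen X i -> (forall z, U z -> is_cycle z) ->
  exists t : seq (X i), (forall z, z \in t -> U z) /\
    forall z, U z -> spanm (bdm X i) t z.
Proof.
move=> [s [sc sP]] Uc; apply: (fg_sub noethR (s := s)) => z /Uc zc.
by have [c cP] := sP z zc; exists c.
Qed.

Lemma chmap_pick X Y (h : chmap X Y) i (t : seq (Y i)) (U : Y i -> X i -> Prop) :
  (forall y, y \in t -> exists x, U y x) ->
  exists k : Y i -> X i, forall y, y \in t -> U y (k y).
Proof.
move=> tU; have /choice [k kP] : forall y, exists x, y \in t -> U y x.
  move=> y; have [/tU[x xP]|] := boolP (y \in t); first by exists x.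
  by move=> _; exists 0.
by exists k.
Qed.

Lemma ses_hfin_mid i : hfin_gen A i -> hfin_gen C i -> hfin_gen B i.
Proof.
move=> [sA [sAc sAP]] Ci.
pose U : submod (C i) := img (g i \o sinc (cym B i)).
have [|t [tU tP]] := hfin_subset (U := U) Ci.
  by move=> _ [z ->]; apply: chmap_cy; exact: (sincP z).
have [k kP] := @chmap_pick B C g i t (fun c b => is_cycle b /\ g i b = c)
  (fun c ct => let: ex_intro z zE := tU c ct in
     ex_intro _ (sinc _ z) (conj (sincP z) (esym zE))).
exists (map k t ++ map (f i) sA); split=> [z|z zc].
  rewrite mem_cat => /orP[/mapP[c ct ->]|/mapP[a /sAc ac ->]]; first exact: (kP _ ct).1.
  exact: chmap_cy.
suff : spanm (bdm B i) (map k t ++ map (f i) sA) z by [].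
have [c cP] := tP (g i z) (ex_intro _ (mksub (U := cym B i) zc) erefl).
pose w := \sum_(j < size t) c j *: k t`_j.
have wc : is_cycle w.
  apply: (@sub_sum _ _ (cym B i)) => j _; apply: (@subZ _ _ (cym B i)).
  exact: (kP _ (mem_nth 0 (ltn_ord j))).1.
have gw : g i w = comb t c.
  rewrite lin_sum; apply: eq_bigr => j _; rewrite linearZ_LR.
  by rewrite (kP _ (mem_nth 0 (ltn_ord j))).2.
have [|a ac aP] := ses_mid (cyB zc wc); first by rewrite linearB gw.
have [c' c'P] := sAP a ac.
rewrite -(subrK w z); apply: subD; last first.
  apply: sub_sum => j _; apply/subZ/span_mem; rewrite mem_cat map_f //.
  exact: mem_nth.
rewrite -(subrK (f i a) (z - w)); apply: subD; first exact: span_base.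
rewrite -(subrK (comb sA c') a) linearD; apply: subD.
  by apply: span_base; exact: chmap_bd.
rewrite lin_sum; apply: sub_sum => j _; rewrite linearZ_LR; apply/subZ/span_mem.
by rewrite mem_cat map_f ?orbT // mem_nth.
Qed.
Lemma ses_hfin_right i : hfin_gen B i -> hfin_gen A (i - 1) -> hfin_gen C i.
Proof.
move=> [sB [sBc sBP]] Ai.
(* U0 represents the kernel of H_{i-1}(A) -> H_{i-1}(B), the image of the connecting map. Lifts of
   its generators provide the classes of C that do not come from B. *)
pose U0 : submod (A (i - 1)) := @Submod R _ (fun a => exists b : B i, f (i - 1) a = cd B i (i - 1) b)
  (ex_intro _ 0 (etrans (linear0 _) (esym (linear0 _))))
  (fun r x y h h' => let: ex_intro b bE := h in let: ex_intro b' b'E := h' in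
     ex_intro _ (r *: b + b') (etrans (linearP _ _ _ _) (etrans
        (congr2 (fun u v => r *: u + v) bE b'E) (esym (linearP _ _ _ _))))).
have U0c a : U0 a -> is_cycle a.
  case: fg => fi _ _ _ [b bP] j; apply: (fi j).
  by rewrite -chmapP bP cd_cd linear0.
have [t [tU tP]] := hfin_subset Ai U0c.
have /choice [k kP] : forall a, exists b : B i, a \in t -> f (i - 1) a = cd B i (i - 1) b.
  move=> a; have [/tU[b bP]|_] := boolP (a \in t); first by exists b.
  by exists 0.
have gkc a : a \in t -> is_cycle (g i (k a)).
  move=> /kP ka; apply/cyP; rewrite chmapP -ka; by case: fg.
exists (map (fun a => g i (k a)) t ++ map (g i) sB); split=> [z|z zc].
  rewrite mem_cat => /orP[/mapP[a at_ ->]|/mapP[b /sBc bc ->]]; first exact: gkc.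
  exact: chmap_cy.
suff : spanm (bdm C i) (map (fun a => g i (k a)) t ++ map (g i) sB) z by [].
have [b [a [bP dbP ac]]] := ses_connect zc.
have [c cP] := tP a (ex_intro _ b (esym dbP)).
have [a' a'P] := bd_at (esym (subrK 1 i)) cP.
pose w := \sum_(j < size t) c j *: k t`_j.
have bwc : is_cycle (b - w - f i a').
  apply/cyP; rewrite !linearB chmapP -a'P dbP linearB lin_sum.
  have -> : \sum_(j < size t) cd B i (i - 1) (c j *: k t`_j) = f (i - 1) (comb t c).
    rewrite lin_sum; apply: eq_bigr => j _; rewrite !linearZ_LR kP //.
    exact: mem_nth.
  by zm.
have [c' c'P] := sBP _ bwc.
have -> : z = g i w + g i (b - w - f i a').
  have [_ _ gf _] := fg; rewrite !linearB gf bP; zm.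
apply: subD.
  rewrite lin_sum; apply: sub_sum => j _; rewrite linearZ_LR; apply/subZ/span_mem.
  by rewrite mem_cat (map_f (fun a => g i (k a))) // mem_nth.
rewrite -(subrK (comb sB c') (b - w - f i a')) linearD; apply: subD.
  by apply: span_base; exact: chmap_bd.
rewrite lin_sum; apply: sub_sum => j _; rewrite linearZ_LR; apply/subZ/span_mem.
by rewrite mem_cat map_f ?orbT // mem_nth.
Qed.
End LongExact.

End Complexes.

Lemma dep_choice (T : Type) (Y : T -> Type) (P : forall x, Y x -> Prop) :
  (forall x, exists y, P x y) -> exists f : forall x, Y x, forall x, P x (f x).
Proof. by move=> h; exists (fun x => projT1 (cid (h x))) => x; case: (cid (h x)). Qed.

(** * The Hom complex *)

Section HomApi.
Variables (R S : comPzRingType) (phi : {rmorphism R -> S}).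
Implicit Types (X : complex S) (Y : complex R).

Definition ha X Y n (h : homC phi X Y n) i j (x : X i) : Y j :=
  shom_fun (hcomp (h : homdeg phi X Y n) i j) x.

Lemma haP X Y n (h : homC phi X Y n) i j a x y :
  ha h j (phi a *: x + y : X i) = a *: ha h j x + ha h j y.
Proof. exact: shom_linP. Qed.
Lemma haD X Y n (h : homC phi X Y n) i j (x y : X i) : ha h j (x + y) = ha h j x + ha h j y.
Proof. exact: shom_fun_atD. Qed.
Lemma ha0 X Y n (h : homC phi X Y n) i j : ha h j (0 : X i) = 0.
Proof. exact: shom_fun_at0. Qed.
Lemma haN X Y n (h : homC phi X Y n) i j (x : X i) : ha h j (- x) = - ha h j x.
Proof. exact: shom_fun_atN. Qed.
Lemma haB X Y n (h : homC phi X Y n) i j (x y : X i) : ha h j (x - y) = ha h j x - ha h j y.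
Proof. by rewrite haD haN. Qed.
Lemma ha_sign X Y n (h : homC phi X Y n) i j k (x : X i) :
  ha h j ((-1) ^+ k *: x) = (-1) ^+ k *: ha h j x.
Proof.
rewrite -[in LHS]signr_odd -[in RHS]signr_odd; case: (odd k); last by rewrite !scale1r.
by rewrite !scaleN1r haN.
Qed.
Lemma hDa X Y n (h k : homC phi X Y n) i j (x : X i) : ha (h + k) j x = ha h j x + ha k j x.
Proof. by []. Qed.
Lemma hNa X Y n (h : homC phi X Y n) i j (x : X i) : ha (- h) j x = - ha h j x.
Proof. by []. Qed.
Lemma hBa X Y n (h k : homC phi X Y n) i j (x : X i) : ha (h - k) j x = ha h j x - ha k j x.
Proof. by []. Qed.
Lemma h0a X Y n i j (x : X i) : ha (0 : homC phi X Y n) j x = 0.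
Proof. by []. Qed.
Lemma hZa X Y n a (h : homC phi X Y n) i j (x : X i) : ha (a *: h) j x = ha h j (a *: x).
Proof. by []. Qed.
Lemma hsign_a X Y n k (h : homC phi X Y n) i j (x : X i) :
  ha ((-1) ^+ k *: h) j x = (-1) ^+ k *: ha h j x.
Proof. by rewrite hZa ha_sign. Qed.
Lemma ha_ne X Y n (h : homC phi X Y n) i j (x : X i) : j != i + n -> ha h j x = 0.
Proof. by move=> ij; rewrite /ha hcompP. Qed.
Lemma hext X Y n (h k : homC phi X Y n) :
  (forall i j (x : X i), j = i + n -> ha h j x = ha k j x) -> h = k.
Proof.
move=> hk; apply: homdegP => i j; apply: shomP => x.
have [ij|ij] := eqVneq j (i + n); first exact: hk.
by rewrite -[LHS]/(ha h j x) -[RHS]/(ha k j x) !ha_ne.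
Qed.

Fact mkh_subproof X Y n (f : forall i j, shom phi (X i) (Y j)) i j :
  j != i + n -> (if j == i + n then f i j else 0) = 0.
Proof. by move/negPf ->. Qed.
(** The cut-off outside j = i + n allows a family to be given in all bidegrees without a proof that
    it vanishes. *)
Definition mkh X Y n (f : forall i j, shom phi (X i) (Y j)) : homC phi X Y n :=
  Homdeg (mkh_subproof f).
Lemma ha_mkh X Y n (f : forall i j, shom phi (X i) (Y j)) i j (x : X i) :
  j = i + n -> ha (mkh n f) j x = shom_fun (f i j) x.
Proof. by move/eqP=> e; rewrite /ha /= e. Qed.

Lemma homC_cd X Y n m (h : homC phi X Y n) i j i' j' (x : X i) :
  n = m + 1 -> j' = j + 1 -> i' = i - 1 ->
  ha (cd (homC phi X Y) n m h) j x =
  cd Y j' j (ha h j' x) - (-1) ^+ absz n *: ha h j (cd X i i' x).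
Proof. by move=> nm -> ->; rewrite /ha /= homd_compE. Qed.

Lemma homC_cyP X Y n (h : homC phi X Y n) : is_cycle h <->
  forall i i' j' j (x : X i), j' = i + n -> j' = j + 1 -> i' = i - 1 ->
    cd Y j' j (ha h j' x) = (-1) ^+ absz n *: ha h j (cd X i i' x).
Proof.
split=> [hc i i' j' j x _ e1 e2|hP].
  apply/eqP; rewrite -subr_eq0 -(@homC_cd _ _ _ (n - 1)) ?subrK //; apply/eqP.
  by rewrite hc.
apply/cyP; apply: hext => i j x e; rewrite (@homC_cd _ _ _ (n - 1) h i j _ _ x _ erefl erefl) ?subrK //.
rewrite h0a; apply/eqP; rewrite subr_eq0; apply/eqP/hP => //.
by rewrite e addrA subrK.
Qed.

Section Pre.
Variables (X X' : complex S) (Y : complex R) (f : chmap X X').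
Definition hpre_fun n (h : homC phi X' Y n) : homC phi X Y n :=
  mkh n (fun i j => pre_lin phi (Y j) (f i) (hcomp (h : homdeg phi X' Y n) i j)).
Lemma hpre_funE n (h : homC phi X' Y n) i j (x : X i) : ha (hpre_fun h) j x = ha h j (f i x).
Proof.
have [e|e] := eqVneq j (i + n); first by rewrite ha_mkh.
by rewrite !ha_ne.
Qed.
Fact hpre_linear n : linear (@hpre_fun n).
Proof.
move=> a h k; apply: hext => i j x _; rewrite hDa hZa !hpre_funE hDa hZa.
by rewrite linearZ_LR.
Qed.
Definition hpre_lin n : {linear homC phi X' Y n -> homC phi X Y n} :=
  mklin (@hpre_linear n).
Lemma hpre_linE n (h : homC phi X' Y n) i j (x : X i) :
  ha (hpre_lin n h) j x = ha h j (f i x).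
Proof. exact: hpre_funE. Qed.
Fact hpreP n m (h : homC phi X' Y n) :
  cd (homC phi X Y) n m (hpre_lin n h) = hpre_lin m (cd (homC phi X' Y) n m h).
Proof.
have [nm|nm] := eqVneq n (m + 1); last by rewrite !cd_shape ?linear0.
apply: hext => i j x _; rewrite hpre_linE !(homC_cd _ _ nm erefl erefl).
by rewrite !hpre_linE chmapP.
Qed.
Definition hpre : chmap (homC phi X' Y) (homC phi X Y) := Chmap hpreP.
Lemma hpreE n (h : homC phi X' Y n) i j (x : X i) : ha (hpre n h) j x = ha h j (f i x).
Proof. exact: hpre_funE. Qed.
End Pre.

Section Post.
Variables (X : complex S) (Y Y' : complex R) (g : chmap Y Y').
Definition hpost_fun n (h : homC phi X Y n) : homC phi X Y' n :=
  mkh n (fun i j => shom_post (g j) (hcomp (h : homdeg phi X Y n) i j)).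
Lemma hpost_funE n (h : homC phi X Y n) i j (x : X i) : ha (hpost_fun h) j x = g j (ha h j x).
Proof.
have [e|e] := eqVneq j (i + n); first by rewrite ha_mkh.
by rewrite !ha_ne // linear0.
Qed.
Fact hpost_linear n : linear (@hpost_fun n).
Proof.
by move=> a h k; apply: hext => i j x _; rewrite hDa hZa !hpost_funE hDa hZa linearD.
Qed.
Definition hpost_lin n : {linear homC phi X Y n -> homC phi X Y' n} :=
  mklin (@hpost_linear n).
Lemma hpost_linE n (h : homC phi X Y n) i j (x : X i) :
  ha (hpost_lin n h) j x = g j (ha h j x).
Proof. exact: hpost_funE. Qed.
Fact hpostP n m (h : homC phi X Y n) :
  cd (homC phi X Y') n m (hpost_lin n h) = hpost_lin m (cd (homC phi X Y) n m h).
Proof.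
have [nm|nm] := eqVneq n (m + 1); last by rewrite !cd_shape ?linear0.
apply: hext => i j x _; rewrite hpost_linE !(homC_cd _ _ nm erefl erefl).
by rewrite !hpost_linE linearB [g j (_ *: _)]linearZ_LR chmapP.
Qed.
Definition hpost : chmap (homC phi X Y) (homC phi X Y') := Chmap hpostP.
Lemma hpostE n (h : homC phi X Y n) i j (x : X i) : ha (hpost n h) j x = g j (ha h j x).
Proof. exact: hpost_funE. Qed.
End Post.

Lemma shom_factor_in (M : lmodType S) (N N' : lmodType R) (f : {linear N -> N'})
  (h : shom phi M N') : injective f -> (forall x, exists y, shom_fun h x = f y) ->
  exists k : shom phi M N, forall x, f (shom_fun k x) = shom_fun h x.
Proof.
move=> fi /choice [k kP].
have kl a x y : k (phi a *: x + y) = a *: k x + k y.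
  by apply: fi; rewrite -kP shom_linP linearP -!kP.
by exists (mkshom kl) => x; rewrite mkshomE.
Qed.
Lemma shom_factor_out (M M' : lmodType S) (N : lmodType R) (g : {linear M -> M'})
  (h : shom phi M N) : (forall y, exists x, g x = y) ->
  (forall x, g x = 0 -> shom_fun h x = 0) ->
  exists k : shom phi M' N, forall x, shom_fun k (g x) = shom_fun h x.
Proof.
move=> /choice [s sP] h0.
have E x y : g x = g y -> shom_fun h x = shom_fun h y.
  move=> e; apply/eqP; rewrite -subr_eq0 -shom_fun_atN -shom_fun_atD; apply/eqP/h0.
  by rewrite linearB e subrr.
have kl a x y : shom_fun h (s (phi a *: x + y)) = a *: shom_fun h (s x) + shom_fun h (s y).
  by rewrite -shom_linP; apply: E; rewrite linearP !sP.
by exists (mkshom kl) => x; rewrite mkshomE; apply: E.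
Qed.

Lemma fam_choice X Y (P : forall i j, shom phi (X i) (Y j) -> Prop) :
  (forall i j, exists k, P i j k) ->
  exists k : forall i j, shom phi (X i) (Y j), forall i j, P i j (k i j).
Proof.
move=> h; apply: (dep_choice (P := fun i (k : forall j, shom phi (X i) (Y j)) =>
  forall j, P i j (k j))) => i.
exact: (dep_choice (P := fun j (k : shom phi (X i) (Y j)) => P i j k)).
Qed.

Lemma ses_hpost X (A B C : complex R) (f : chmap A B) (g : chmap B C) : ses f g ->
  (forall i j (h : shom phi (X i) (C j)), exists k : shom phi (X i) (B j),
     forall x, g j (shom_fun k x) = shom_fun h x) ->
  ses (hpost X f) (hpost X g).
Proof.
move=> [fi gs gf ex] lft; split=> n.
- move=> h k e; apply: hext => i j x _; apply: (fi j).
  by rewrite -!hpostE e.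
- move=> h; have [k kP] := @fam_choice X B
    (fun i j k => forall x, g j (shom_fun k x) = ha h j x) (fun i j => lft i j _).
  exists (mkh n k); apply: hext => i j x e; by rewrite hpostE ha_mkh // kP.
- by move=> h; apply: hext => i j x _; rewrite !hpostE gf.
- move=> h h0; have [|k kP] := @fam_choice X A
    (fun i j k => forall x, f j (shom_fun k x) = ha h j x).
    move=> i j; apply: shom_factor_in => [|x]; first exact: fi.
    by apply: ex; rewrite -[shom_fun _ _]/(ha h j x) -hpostE h0.
  exists (mkh n k); apply: hext => i j x e; by rewrite hpostE ha_mkh // kP.
Qed.

Lemma ses_hpre (A B C : complex S) Y (f : chmap A B) (g : chmap B C) : ses f g ->
  (forall i j (h : shom phi (A i) (Y j)), exists k : shom phi (B i) (Y j),
     forall x, shom_fun k (f i x) = shom_fun h x) ->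
  ses (hpre Y g) (hpre Y f).
Proof.
move=> [fi gs gf ex] ext; split=> n.
- move=> h k e; apply: hext => i j x _; have [y <-] := gs _ x.
  by rewrite -!hpreE e.
- move=> h; have [k kP] := @fam_choice B Y
    (fun i j k => forall x, shom_fun k (f i x) = ha h j x) (fun i j => ext i j _).
  exists (mkh n k); apply: hext => i j x e; by rewrite hpreE ha_mkh // kP.
- by move=> h; apply: hext => i j x _; rewrite !hpreE gf ha0.
- move=> h h0; have [|k kP] := @fam_choice C Y
    (fun i j k => forall x, shom_fun k (g i x) = ha h j x).
    move=> i j; apply: shom_factor_out => [|x /ex [y ->]]; first exact: gs.
    by rewrite -[shom_fun _ _]/(ha h j (f i y)) -hpreE h0.
  exists (mkh n k); apply: hext => i j x e; by rewrite hpreE ha_mkh // kP.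
Qed.

Definition dg_inj Y := forall i, inj_mod (Y i).
Definition dg_proj (X : complex S) := forall i, projective (X i).
Definition dg_fgproj (X : complex S) := forall i, fgproj (X i).

Lemma ses_hpre_inj (A B C : complex S) Y (f : chmap A B) (g : chmap B C) : ses f g ->
  dg_inj Y -> ses (hpre Y g) (hpre Y f).
Proof.
move=> s Yi; apply: ses_hpre => // i j h; case: s => fi _ _ _.
have [|k kP] := Yi j (restr phi (A i)) (restr phi (B i)) (restr_map phi (f i)) h.
  exact: fi.
by exists k.
Qed.

End HomApi.

Section HomCone.
Variables (R S : comPzRingType) (phi : {rmorphism R -> S}).
Implicit Types (X : complex S) (Y : complex R).

Lemma tr_ha X Y n (v : homC phi X Y n) i a b (x : X i) : a = b ->
  tr Y a b (ha v a x) = ha v b x.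
Proof. by move=> <-; rewrite trE. Qed.

Section Pre.
Variables (X X' : complex S) (f : chmap X X') (Y : complex R).

Section Pair.
Variables (n : int) (u : homC phi X' Y n) (v : homC phi X Y (n + 1)).
Fact hpair_subproof i j a (p q : (X' i * X (i - 1))%type) :
  ha u j (phi a *: p + q).1 + ha v j (phi a *: p + q).2 =
  a *: (ha u j p.1 + ha v j p.2) + (ha u j q.1 + ha v j q.2).
Proof. by rewrite !haP scalerDr; zm. Qed.
Definition hpair : homC phi (cone f) Y n :=
  mkh n (fun i j => mkshom (M := cone f i) (@hpair_subproof i j)).
Lemma hpairE i j (y : X' i) (x : X (i - 1)) : j = i + n ->
  ha hpair j ((y, x) : cone f i) = ha u j y + ha v j x.
Proof. by move=> e; rewrite ha_mkh. Qed.
Lemma hpair_cy : is_cycle u ->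
  (forall i i' j' j (x : X i), j' = i + (n + 1) -> j' = j + 1 -> i' = i - 1 ->
     cd Y j' j (ha v j' x) =
     (-1) ^+ absz n *: ha u j (f i x) - (-1) ^+ absz n *: ha v j (cd X i i' x)) ->
  is_cycle hpair.
Proof.
move=> /homC_cyP uc vP; apply/homC_cyP => i i' j' j -[y x] e1 e2 e3.
rewrite hpairE // linearD (uc i i') //.
have e4 : j' = i - 1 + (n + 1) by rewrite e1; zm.
rewrite (vP _ (i' - 1) _ j x e4 e2) ?e3 // cone_cdE hpairE; last first.
  by apply: (addIr 1); rewrite -e2 e1; zm.
rewrite trE haD haN !scalerDr scalerN; zm.
Qed.
End Pair.

Section Second.
Variables (n : int) (h : homC phi (cone f) Y n).
Definition hsnd : homC phi X Y (n + 1).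
Proof.
refine (mkh (n + 1) (fun i j => @mkshom _ _ phi (X i) (Y j)
  (fun x => ha h j ((0, tr X i (i + 1 - 1) x) : cone f (i + 1))) _)).
abstract (by move=> a x y; rewrite -haP; congr (ha h j _);
  apply: injective_projections; rewrite /= ?linearP ?scaler0 ?addr0).
Defined.
Lemma hsndE i k j (x : X i) : k = i + 1 -> j = i + (n + 1) ->
  ha hsnd j x = ha h j ((0, tr X i (k - 1) x) : cone f k).
Proof. by move=> -> e; rewrite ha_mkh. Qed.
Lemma hsndE' i j (x : X (i - 1)) : j = i + n ->
  ha hsnd j x = ha h j ((0, x) : cone f i).
Proof. by move=> e; rewrite (hsndE (k := i)) ?trE // ?e; zm. Qed.
End Second.

(** A cycle of degree n in Hom(cone f, Y) is a pair (u, v) in which u is a cycle and v exhibits u f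
    as a boundary, up to sign. Bounding such a pair makes u a boundary, which is injectivity;
    bounding the pair (0, v) in degree n - 1 extends v to X' up to a boundary, which is
    surjectivity. *)
Lemma qiso_hpre : acyclic (homC phi (cone f) Y) -> qiso (hpre phi Y f).
Proof.
move=> ac n; split=> [u uc /bdP[v vP]|v vc].
  pose w := (-1) ^+ absz n *: v.
  have [|h hP] := (bdP (hpair u w)).1 (ac n _ _).
    apply: hpair_cy => // i i' j' j x e1 e2 e3.
    rewrite /w !hsign_a linearZ_LR -!scalerBr -hpreE vP.
    rewrite (homC_cd _ _ _ e2 e3) // signr_absz_addr1 scaleNr opprK.
    rewrite [(-1) ^+ _ *: (_ + _)]scalerDr scalerDr scalerN; zm.
  apply/bdP; exists (hpre phi Y (cone_in f) _ h); rewrite chmapP -hP.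
  apply: hext => i j x e; rewrite hpreE.
  by rewrite [cone_in f i x]tw_inE hpairE // ha0 addr0.
pose v' : homC phi X Y (n - 1 + 1) := tr (homC phi X Y) n (n - 1 + 1) v.
have vE i j (x : X i) : ha v' j x = ha v j x.
  have e : n = n - 1 + 1 by rewrite subrK.
  by rewrite /v'; move: (n - 1 + 1) e => n' <-; rewrite trE.
have [|h hP] := (bdP (hpair 0 v')).1 (ac (n - 1) _ _).
  apply: hpair_cy => [|i i' j' j x e1 e2 e3]; first exact: cy0.
  rewrite h0a scaler0 sub0r !vE ((homC_cyP v).1 vc _ _ _ _ _ _ e2 e3) //; last first.
    by rewrite e1 subrK.
  by rewrite -scaleNr -signr_absz_addr1 subrK.
rewrite subrK in h hP *.
exists ((-1) ^+ absz n *: - hpre phi Y (cone_in f) _ h).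
  apply: cycleZ; apply: cyN; apply/cyP; rewrite chmapP -hP.
  apply: hext => i j x e; rewrite hpreE [cone_in f i x]tw_inE hpairE // ha0.
  by rewrite h0a addr0.
apply/bdP; exists (hsnd h); apply: hext => i; rewrite -(addrK 1 i).
move: (i + 1) => {i} k j x e.
rewrite hBa (homC_cd _ _ erefl erefl erefl) hpreE hsign_a hNa hpreE.
rewrite hsndE'; last by rewrite e; zm.
rewrite hsndE' // scalerN opprK -vE.
have := congr1 (fun u => ha u j ((0, x) : cone f k)) hP.
rewrite hpairE; last by rewrite e; zm.
rewrite ha0 add0r => ->; rewrite (homC_cd _ _ (esym (subrK 1 n)) erefl erefl).
rewrite cone_cdE linear0 add0r trE signr_absz_addr1 scaleNr opprK.
have -> : ((f (k - 1) x, - cd X (k - 1) (k - 1 - 1) x) : cone f (k - 1)) =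
  cone_in f (k - 1) (f (k - 1) x) - (0, cd X (k - 1) (k - 1 - 1) x).
  by apply: injective_projections; rewrite /= ?subr0 ?sub0r.
by rewrite haB scalerBr; zm.
Qed.
End Pre.

Section Post.
Variables (X : complex S) (Y Y' : complex R) (g : chmap Y Y').

Section Pair.
Variables (n k : int) (u : homC phi X Y' n) (v : homC phi X Y k).
Hypothesis nk : n = k + 1.
Fact hpair'_subproof i j a (x y : X i) :
  ((ha u j (phi a *: x + y), ha v (j - 1) (phi a *: x + y)) : cone g j) =
  a *: ((ha u j x, ha v (j - 1) x) : cone g j) + (ha u j y, ha v (j - 1) y).
Proof. by rewrite !haP. Qed.
Definition hpair' : homC phi X (cone g) n :=
  mkh n (fun i j => mkshom (N := cone g j) (@hpair'_subproof i j)).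
Lemma hpair'E i j (x : X i) : j = i + n -> ha hpair' j x = (ha u j x, ha v (j - 1) x).
Proof. by move=> e; rewrite ha_mkh. Qed.
Lemma hpair'_cy : is_cycle v ->
  (forall i i' j' j (x : X i), j' = i + n -> j' = j + 1 -> i' = i - 1 ->
     cd Y' j' j (ha u j' x) =
     (-1) ^+ absz n *: ha u j (cd X i i' x) - g j (ha v j x)) ->
  is_cycle hpair'.
Proof.
move=> /homC_cyP vc uP; apply/homC_cyP => i i' j' j x e1 e2 e3.
have e4 : j' - 1 = j by rewrite e2 addrK.
have e5 : j = i' + n by apply: (addIr 1); rewrite -e2 e1 e3; zm.
rewrite !hpair'E // cone_cdE (uP i i') // tr_ha //.
apply: injective_projections => /=; first by rewrite subrK.
rewrite (vc i i' (j' - 1) (j - 1)) //; first last.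
- by rewrite e2; zm.
- by rewrite e1 nk; zm.
by rewrite nk signr_absz_addr1 scaleNr.
Qed.
End Pair.

Section Second.
Variables (n k : int) (h : homC phi X (cone g) n).
Hypothesis nk : n = k + 1.
Definition hsnd' : homC phi X Y k.
Proof.
refine (mkh k (fun i j => @mkshom _ _ phi (X i) (Y j)
  (fun x => tr Y (j + 1 - 1) j (ha h (j + 1) x).2) _)).
abstract (by move=> a x y; rewrite haP /= linearP).
Defined.
Lemma hsnd'E i j j' (x : X i) : j' = j - 1 -> ha hsnd' j' x = tr Y (j - 1) j' (ha h j x).2.
Proof.
move=> ->; have [e|e] := eqVneq (j - 1) (i + k); last first.
  rewrite !ha_ne //; first by rewrite linear0.
  by apply: contraNneq e => ->; rewrite nk; apply/eqP; zm.
rewrite ha_mkh //.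
by rewrite mkshomE; have := subrK 1 j; move: (j - 1 + 1) => l ->.
Qed.
End Second.

Definition hfst n (h : homC phi X (cone g) n) : homC phi X Y' n.
Proof.
refine (mkh n (fun i j => @mkshom _ _ phi (X i) (Y' j) (fun x => (ha h j x).1) _)).
abstract (by move=> a x y; rewrite haP).
Defined.
Lemma hfstE n (h : homC phi X (cone g) n) i j (x : X i) : ha (hfst h) j x = (ha h j x).1.
Proof.
have [e|e] := eqVneq j (i + n); first by rewrite ha_mkh.
by rewrite !ha_ne.
Qed.

Lemma qiso_hpost : acyclic (homC phi X (cone g)) -> qiso (hpost phi X g).
Proof.
have dcone n m (h : homC phi X (cone g) n) i i' j j' (x : X i) :
    n = m + 1 -> j' = j + 1 -> i' = i - 1 -> ha (cd (homC phi X (cone g)) n m h) j x =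
    (cd Y' j' j (ha h j' x).1 + g j (tr Y (j' - 1) j (ha h j' x).2)
       - (-1) ^+ absz n *: (ha h j (cd X i i' x)).1,
     - cd Y (j' - 1) (j - 1) (ha h j' x).2
       - (-1) ^+ absz n *: (ha h j (cd X i i' x)).2).
  move=> e1 e2 e3; rewrite (homC_cd _ _ e1 e2 e3).
  by case: (ha h j' x) => y y'; rewrite cone_cdE.
move=> ac m; split=> [v vc /bdP[u uP]|u uc].
  have [|h hP] := (bdP (hpair' (- u) v)).1 (ac (m + 1) _ _).
    apply: hpair'_cy => // i i' j' j x e1 e2 e3.
    rewrite hNa hNa -hpostE uP (homC_cd _ _ erefl e2 e3) scalerN linearN; zm.
  apply/bdP; exists (- hsnd' (m + 1) h).
  apply: hext => i j x e.
  have := congr1 (fun u => ha u (j + 1) x) hP.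
  rewrite hpair'E; last by rewrite e; zm.
  rewrite (dcone _ _ _ _ _ _ _ _ erefl erefl erefl) => /(congr1 snd) /= vE.
  have e1 : j + 1 - 1 = j by rewrite addrK.
  rewrite -(tr_ha v x e1) vE (homC_cd _ _ erefl erefl erefl) !hNa.
  rewrite (hsnd'E h erefl _ (esym (addrK 1 (j + 1)))) (hsnd'E h erefl _ (esym (addrK 1 j))).
  rewrite linearB linearN linearZ_LR signr_absz_addr1 linearN cd_tr ?addrK //.
  rewrite (tr_cd _ e1) scaleNr scalerN; zm.
have uE : m = m - 1 + 1 by rewrite subrK.
have [|h hP] := (bdP (hpair' u (0 : homC phi X Y (m - 1)))).1 (ac m _ _).
  apply: hpair'_cy => // [|i i' j' j x e1 e2 e3]; first exact: cy0.
  by rewrite h0a linear0 subr0 ((homC_cyP u).1 uc _ _ _ _ _ e1 e2 e3).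
exists (hsnd' m h); last first.
  apply/bdP; exists (hfst h); apply: hext => i j x e.
  have := congr1 (fun u => ha u j x) hP; rewrite hpair'E //.
  rewrite (dcone _ _ _ _ _ _ _ _ erefl erefl erefl) => /(congr1 fst) /= E.
  rewrite hBa hpostE (homC_cd _ _ erefl erefl erefl) !hfstE E.
  by rewrite (hsnd'E h erefl _ (esym (addrK 1 j))); zm.
apply/homC_cyP => i i' j' j x e1 e2 e3.
have := congr1 (fun u => ha u j' x) hP; rewrite hpair'E //.
rewrite (dcone _ _ _ _ _ _ _ _ erefl erefl e3) => /(congr1 snd) /= E.
have e4 : j' - 1 = j by rewrite e2 addrK.
rewrite (hsnd'E h erefl _ (esym (addrK 1 j'))) cd_tr ?addrK //.
rewrite (hsnd'E h erefl _ (esym e4)).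
have := congr1 (tr Y (j' - 1) j) E; rewrite h0a linear0 linearB linearN.
rewrite [tr _ _ _ (_ *: _)]linearZ_LR (tr_cd _ e4) signr_absz_addr1 scaleNr opprK.
by move/eqP; rewrite eq_sym addrC subr_eq0 => /eqP.
Qed.
End Post.
End HomCone.

(** * Contractions and resolutions *)

Section QisoCone.
Variable R : comPzRingType.
Implicit Types X Y A B C : complex R.
Local Notation idR := (idfun : {rmorphism R -> R}).

Lemma qisoP X Y (f : chmap X Y) : qiso f <-> acyclic (cone f).
Proof.
split=> [qf i [y x] zc|ac i].
  have := zc (i - 1); rewrite cone_cdE trE => -[/= h1 h2].
  have xc : is_cycle (x : X (i - 1)) by apply/cyP/eqP; rewrite -oppr_eq0 h2.
  have [|w wP] := bd_at (esym (subrK 1 i)) ((qf _).1 x xc _).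
    rewrite -[f _ x](addKr (cd Y i (i - 1) y)) h1 addr0; exact/bdN/bd_cd.
  have yc : is_cycle (y + f i w) by apply/cyP; rewrite linearD chmapP -wP.
  have [z zcy /bdP[v vP]] := (qf i).2 _ yc.
  have e : i = i + 1 - 1 by rewrite addrK.
  exists (i + 1), (v, tr X i (i + 1 - 1) (z - w)); rewrite cone_cdE trK // cd_tr //.
  by rewrite -vP [f i (_ - _)]linearB [cd X _ _ (_ - _)]linearB zcy -wP; congr pair; zm.
split=> [z zc /bdP[y yP]|w wc].
  have e : i = i + 1 - 1 by rewrite addrK.
  have [|w] := (bdP (((- y, tr X i (i + 1 - 1) z) : cone f (i + 1)))).1 (ac _ _ _).
    by apply: (cy_at e); rewrite cone_cdE trK // cd_tr // zc [cd Y _ _ _]linearN -yP addNr oppr0.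
  case: w => a b; rewrite cone_cdE => -[_ /(congr1 (tr X (i + 1 - 1) i))].
  rewrite trK // [tr _ _ _ (- _)]linearN (tr_cd _ (esym e)) => ->; exact/bdN/bd_cd.
have [|u] := (bdP (((w, 0) : cone f i))).1 (ac _ _ _).
  by move=> j; rewrite cone_cdE !linear0 wc addr0 ?oppr0.
have e : i = i + 1 - 1 by rewrite addrK.
case: u => a b; rewrite cone_cdE => -[wE bE]; exists (tr X (i + 1 - 1) i b); last first.
  by rewrite wE addrK; exact: bd_cd.
by apply/cyP; rewrite (cd_tr _ _ (esym e)); apply/eqP; rewrite -oppr_eq0 -bE.
Qed.

Section ConeMap.
Variables (X Y X' Y' : complex R) (f : chmap X Y) (f' : chmap X' Y').
Variables (u : chmap X X') (v : chmap Y Y').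
Hypothesis uv : forall i x, f' i (u i x) = v i (f i x).
Fact cone_map_linear i : linear (fun p : cone f i => (v i p.1, u (i - 1) p.2) : cone f' i).
Proof. by move=> a p q; apply: injective_projections; rewrite /= linearP. Qed.
Fact cone_mapP i j p : cd (cone f') i j (mklin (@cone_map_linear i) p) =
  mklin (@cone_map_linear j) (cd (cone f) i j p).
Proof.
case: p => y x; rewrite [LHS]cone_cdE cone_cdE; apply: injective_projections => /=.
  by rewrite chmapP linearD (tr_map u) uv.
by rewrite chmapP linearN.
Qed.
Definition cone_map : chmap (cone f) (cone f') := Chmap cone_mapP.
Lemma cone_mapE i y x : cone_map i (y, x) = (v i y, u (i - 1) x). Proof. by []. Qed.
End ConeMap.

Lemma ses_cones A B C A' B' C' (f : chmap A B) (g : chmap B C) (f' : chmap A' B')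
  (g' : chmap B' C') (a : chmap A A') (b : chmap B B') (c : chmap C C')
  (ab : forall i x, b i (f i x) = f' i (a i x)) (bc : forall i x, c i (g i x) = g' i (b i x)) :
  ses f g -> ses f' g' -> ses (cone_map ab) (cone_map bc).
Proof.
move=> [fi gs gf ex] [fi' gs' gf' ex']; split=> i.
- by move=> [y x] [y' x']; rewrite !cone_mapE => -[/fi' -> /fi ->].
- move=> [y x]; have [z zP] := gs' _ y; have [w wP] := gs _ x.
  by exists (z, w); rewrite cone_mapE zP wP.
- by move=> [y x]; rewrite !cone_mapE gf gf'.
- move=> [y x]; rewrite cone_mapE => -[/ex' [z ->] /ex [w ->]].
  by exists (z, w).
Qed.

(** Only the maps s from degree i to its successor matter. With a single index the second summand
    would end in degree i - 1 + 1, which is not convertible to i. *)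
Definition contractible X := exists s : forall i j, {linear X i -> X j},
  forall i x, cd X (i + 1) i (s i (i + 1) x) + s (i - 1) i (cd X i (i - 1) x) = x.

Lemma contractible_acyclic X : contractible X -> acyclic X.
Proof.
move=> [s sP] i z zc; exists (i + 1), (s i (i + 1) z).
by rewrite -[LHS]sP zc linear0 addr0.
Qed.
Fact hlin_linear X Y n (h : homC idR X Y n) i j : linear (fun x : X i => ha h j x).
Proof. by move=> a x y; rewrite -[a *: x]/(idR a *: x) haP. Qed.
Definition hlin X Y n (h : homC idR X Y n) i j : {linear X i -> Y j} :=
  mklin (@hlin_linear X Y n h i j).

Lemma of_chmapE X Y (f : chmap X Y) i (x : X i) : ha (of_chmap f) i x = f i x.
Proof.
rewrite /ha /= /of_chmap_comp; case: eqP => // e.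
by rewrite (eq_irrelevance e erefl).
Qed.

Lemma contractible_of_id X : is_boundary (of_chmap (chmap_id X)) -> contractible X.
Proof.
move=> /bdP[s sP]; exists (hlin s) => i x.
have := congr1 (fun u => ha u i x) sP.
rewrite of_chmapE (homC_cd _ _ erefl erefl erefl) => E.
by rewrite -[RHS]/(chmap_id X i x) E expr1 scaleN1r opprK.
Qed.
Lemma Kinj_contractible A : Kinjective A -> acyclic A -> contractible A.
Proof. by move=> KA Aa; apply: contractible_of_id; apply: KA => //; exact: of_chmap_cycle. Qed.

End QisoCone.

Section Contractions.
Variables (R S : comPzRingType) (phi : {rmorphism R -> S}).

Lemma contr_hom_post (X : complex S) (A : complex R) :
  contractible A -> acyclic (homC phi X A).
Proof.
move=> [s sP] n h hc; apply/bdP.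
have kl i j a (x y : X i) : s (j - 1) j (ha h (j - 1) (phi a *: x + y)) =
  a *: s (j - 1) j (ha h (j - 1) x) + s (j - 1) j (ha h (j - 1) y).
  by rewrite haP linearP.
exists (mkh (n + 1) (fun i j => mkshom (kl i j))); apply: hext => i j x e.
rewrite (homC_cd _ _ erefl erefl erefl) !ha_mkh; first last.
- by rewrite e; zm.
- by rewrite e; zm.
rewrite !mkshomE -[LHS]sP signr_absz_addr1 scaleNr opprK.
have e1 : j = j + 1 - 1 by rewrite addrK.
congr (_ + _).
  by congr (cd A _ _ _); move: (j + 1 - 1) e1 => k <-.
rewrite ((homC_cyP h).1 hc _ _ _ _ _ e _ erefl) ?subrK //.
by rewrite [s _ _ (_ *: _)]linearZ_LR.
Qed.

Lemma contr_hom_pre (A : complex S) (Y : complex R) :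
  contractible A -> acyclic (homC phi A Y).
Proof.
move=> [s sP] n h hc; apply/bdP.
have kl i j a (x y : A i) : ha h j (s i (i + 1) (phi a *: x + y)) =
  a *: ha h j (s i (i + 1) x) + ha h j (s i (i + 1) y).
  by rewrite linearP haP.
exists ((-1) ^+ absz n *: mkh (n + 1) (fun i j => mkshom (kl i j))).
rewrite linearZ_LR; apply: hext => i j x e; rewrite hsign_a.
rewrite (homC_cd _ _ erefl erefl erefl) !ha_mkh; first last.
- by rewrite e; zm.
- by rewrite e; zm.
rewrite !mkshomE signr_absz_addr1 scaleNr opprK.
rewrite ((homC_cyP h).1 hc (i + 1) i (j + 1) j _); first last.
- by rewrite addrK.
- by [].
- by rewrite e; zm.
rewrite -scalerDr signK -[in LHS](sP i x) haD; congr (_ + _).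
by have := subrK 1 i; move: (i - 1 + 1) => k ->.
Qed.

End Contractions.

Section Shifts.
Variables (R S : comPzRingType) (phi : {rmorphism R -> S}).

(** A bijection in one degree that respects cycles and boundaries suffices. Identifications across a
    shift, such as [hsh_post], commute with the differentials only up to sign and hence are no chain
    maps. *)
Lemma hom_transfer (X X' : complex R) n n' (E : {linear X n -> X' n'}) :
  injective E -> (forall y, exists x, E x = y) ->
  (forall x, is_cycle (E x) <-> is_cycle x) ->
  (forall x, is_boundary (E x) <-> is_boundary x) ->
  (hzero X n <-> hzero X' n') /\ (hfin_gen X n <-> hfin_gen X' n').
Proof.
move=> Ei Es Ec Eb; split; split.
- by move=> h z; have [x <-] := Es z; move=> /Ec/h/Eb.
- by move=> h x /Ec/h/Eb.
- move=> [s [sc sP]]; exists (map E s); split=> [z /mapP[x /sc xc ->]|z]; first exact/Ec.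
  have [x <-] := Es z => /Ec/sP[c cP]; exists c; move/Eb: cP.
  rewrite linearB lin_sum size_map.
  under eq_bigr do rewrite linearZ_LR.
  by under [X in _ -> is_boundary (_ - X)]eq_bigr do rewrite (nth_map 0) //.
have /choice [F FK] := Es.
move=> [s [sc sP]]; exists (map F s); split=> [z /mapP[x /sc xc ->]|z].
  by apply/Ec; rewrite FK.
move=> /Ec/sP[c cP]; exists c; apply/Eb; rewrite linearB lin_sum size_map.
under [X in is_boundary (_ - X)]eq_bigr do rewrite linearZ_LR (nth_map 0) // FK.
exact: cP.
Qed.
End Shifts.

Section HomShift.
Variables (R S : comPzRingType) (phi : {rmorphism R -> S}).
Variables (X : complex S) (Y : complex R) (k : int).

Lemma sign_mul (V : lmodType R) a b (x : V) :
  (-1) ^+ absz a *: ((-1) ^+ absz b *: x) = (-1) ^+ absz (a + b) *: x.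
Proof.
rewrite scalerA -signr_odd -[X in _ * X]signr_odd -[in RHS]signr_odd.
suff -> : odd (absz (a + b)) = odd (absz a) (+) odd (absz b) by rewrite signr_addb.
have H (n : nat) c : odd (absz (c + n%:Z)) = odd (absz c) (+) odd n.
  elim: n => [|n IHn]; first by rewrite addr0 addbF.
  by rewrite -addn1 PoszD addrA odd_absz_addr1 IHn addn1 /= addbN.
case: b => n; first exact: H.
have := H n.+1 (a + Negz n); rewrite NegzE subrK abszN absz_nat => ->.
by rewrite -addbA addbb addbF.
Qed.

Fact hsh_post_linear n : linear (fun h : homC phi X Y (n - k) =>
  mkh (Y := sh k Y) n (fun i j => hcomp (h : homdeg phi X Y (n - k)) i (j - k) :
    shom phi (X i) (sh k Y j)) : homC phi X (sh k Y) n).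
Proof. by move=> a h h'; apply: hext => i j x e; rewrite hDa hZa !ha_mkh. Qed.
Definition hsh_post n : {linear homC phi X Y (n - k) -> homC phi X (sh k Y) n} :=
  mklin (@hsh_post_linear n).
Lemma hsh_postE n (h : homC phi X Y (n - k)) i j (x : X i) :
  ha (hsh_post n h) j x = ha h (j - k) x :> Y (j - k).
Proof.
have [e|e] := eqVneq j (i + n); first by rewrite ha_mkh.
rewrite !ha_ne //; apply: contraNneq e => e; apply/eqP/(addIr (- k)); rewrite e; zm.
Qed.
Lemma hsh_post_cd n m (h : homC phi X Y (n - k)) :
  cd (homC phi X (sh k Y)) n m (hsh_post n h) =
  (-1) ^+ absz k *: hsh_post m (cd (homC phi X Y) (n - k) (m - k) h).
Proof.
have [nm|nm] := eqVneq n (m + 1); last first.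
  rewrite cd_shape // cd_shape ?linear0 ?scaler0 //.
  by apply: contraNneq nm => e; apply/eqP/(addIr (- k)); rewrite e; zm.
apply: hext => i j x e; rewrite hsign_a hsh_postE (homC_cd _ _ nm erefl erefl).
have nm' : n - k = m - k + 1 by rewrite nm; zm.
rewrite (homC_cd h _ nm' (_ : j + 1 - k = j - k + 1) erefl); last by zm.
rewrite !hsh_postE sh_cdE scalerBr sign_mul.
by have -> : k + (n - k) = n by zm.
Qed.
Lemma hom_sh_post n :
  (hzero (homC phi X Y) (n - k) <-> hzero (homC phi X (sh k Y)) n) /\ (hfin_gen (homC phi X Y) (n - k) <-> hfin_gen (homC phi X (sh k Y)) n).
Proof.
have inj m : injective (hsh_post m).
  move=> h h' e; apply: hext => i j x _.
  have := hsh_postE h (j + k) x; have := hsh_postE h' (j + k) x; rewrite e => ->.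
  by rewrite addrK.
have surj m y : exists x, hsh_post m x = y.
  have kl i j a (x x' : X i) :
     tr Y (j + k - k) j (ha (y : homC phi X (sh k Y) m) (j + k) (phi a *: x + x')) =
     a *: tr Y (j + k - k) j (ha y (j + k) x) + tr Y (j + k - k) j (ha y (j + k) x').
    by rewrite haP linearP.
  exists (mkh (m - k) (fun i j => mkshom (kl i j))).
  apply: hext => i j x e; rewrite hsh_postE ha_mkh; last by rewrite e; zm.
  by rewrite mkshomE; have := subrK k j; move: (j - k + k) => l ->; rewrite trE.
have e1 : n - 1 - k = n - k - 1 by zm.
have e2 : n + 1 - k = n - k + 1 by zm.
apply: (hom_transfer (E := hsh_post n)) => // h; split=> [hc|hc].
- apply: (cy_at e1); apply: (inj (n - 1)); apply: (@sign_inj _ _ (absz k)).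
  by rewrite -hsh_post_cd hc linear0 scaler0.
- by apply/cyP; rewrite hsh_post_cd hc linear0 scaler0.
- have [w wP] := (bdP _).1 hc; have [v vE] := surj _ w.
  exists (n + 1 - k), ((-1) ^+ absz k *: v); apply: (inj n).
  by rewrite wP -vE hsh_post_cd !linearZ_LR.
- have [w ->] := bd_at e2 hc; exists (n + 1), (hsh_post (n + 1) ((-1) ^+ absz k *: w)).
  by rewrite hsh_post_cd !linearZ_LR signK.
Qed.
End HomShift.

(** * K-projective and K-injective complexes *)

Section KTheory.
Variable R : comPzRingType.
Implicit Types X Y A B C I J P Q : complex R.
Local Notation idR := (idfun : {rmorphism R -> R}).

Lemma qiso_hpre_Kinj I X X' (f : chmap X X') :
  Kinjective I -> qiso f -> qiso (hpre idR I f).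
Proof. by move=> KI /qisoP fq; apply: qiso_hpre; exact: KI. Qed.
Lemma qiso_hpost_Kproj P Y Y' (g : chmap Y Y') :
  Kprojective P -> qiso g -> qiso (hpost idR P g).
Proof. by move=> KP /qisoP gq; apply: qiso_hpost; exact: KP. Qed.

Lemma Kinj_sh k I : Kinjective I -> Kinjective (sh k I).
Proof. by move=> KI A Aa n; apply/(hom_sh_post _ _ _ _ _).1; exact: KI. Qed.

Lemma ses_hpost_split X A C (s : twisting A C) :
  ses (hpost idR X (tw_in s)) (hpost idR X (tw_out s)).
Proof.
apply: ses_hpost; first exact: ses_twist.
move=> i j h.
have lin a x y : ((0, shom_fun h (idR a *: x + y)) : (A j * C j)%type) =
   a *: ((0, shom_fun h x) : (A j * C j)%type) + (0, shom_fun h y).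
  by apply: injective_projections; rewrite /= ?scaler0 ?addr0 // shom_linP.
by exists (mkshom lin).
Qed.
Lemma ses_hpost_proj X A B C (f : chmap A B) (g : chmap B C) : ses f g -> dg_proj X ->
  ses (hpost idR X f) (hpost idR X g).
Proof.
move=> s Xp; apply: ses_hpost => // i j h; case: s => _ gs _ _.
have hl : linear (shom_fun h : X i -> C j) by move=> a x y; rewrite -[a *: x]/(idR a *: x) shom_linP.
have [k kP] := Xp i _ _ (g j) (mklin hl) (gs j).
have kl a x y : k (idR a *: x + y) = a *: k x + k y by rewrite linearP.
by exists (mkshom kl) => x; rewrite mkshomE kP.
Qed.

Lemma Kinj_twist A C (s : twisting A C) : Kinjective A -> Kinjective C -> Kinjective (twist s).
Proof.
move=> KA KC X Xa n; apply: (ses_hzero_mid (ses_hpost_split X s)); [exact: KA | exact: KC].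
Qed.
Lemma Kinj_cone X Y (f : chmap X Y) : Kinjective X -> Kinjective Y -> Kinjective (cone f).
Proof. by move=> KX KY; apply: Kinj_twist => //; exact: Kinj_sh. Qed.

Lemma qiso_Kinj_contr I J (g : chmap I J) : Kinjective I -> Kinjective J -> qiso g ->
  contractible (cone g).
Proof. by move=> KI KJ /qisoP gq; apply: Kinj_contractible => //; exact: Kinj_cone. Qed.

Fact chmap_of_subproof X Y (h : homC idR X Y 0) (hc : is_cycle h) i j (x : X i) :
  cd Y i j (hlin h i i x) = hlin h j j (cd X i j x).
Proof.
have [e|e] := eqVneq i (j + 1); last by rewrite !cd_shape ?linear0.
have e' : j = i - 1 by rewrite e addrK.
rewrite [LHS]((homC_cyP h).1 hc i j i j x _ e e') ?addr0 //.
by rewrite expr0 scale1r.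
Qed.
Definition chmap_of X Y (h : homC idR X Y 0) (hc : is_cycle h) : chmap X Y :=
  Chmap (chmap_of_subproof hc).
Lemma chmap_ofE X Y (h : homC idR X Y 0) (hc : is_cycle h) i (x : X i) :
  chmap_of hc i x = ha h i x.
Proof. by []. Qed.

(** The homotopies are recorded, since they are also needed after tensoring. *)
Definition homotopic X Y (f g : chmap X Y) : Prop :=
  exists s : forall i j, {linear X i -> Y j}, forall i x,
    f i x - g i x = cd Y (i + 1) i (s i (i + 1) x) + s (i - 1) i (cd X i (i - 1) x).
Lemma homotopic_hequal X Y (f g : chmap X Y) : homotopic f g -> hequal f g.
Proof.
by move=> [s sP] i z zc; rewrite sP zc linear0 addr0; exact: bd_cd.
Qed.
Lemma bd_homotopic X Y (f g : chmap X Y) (h : homC idR X Y 0) :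
  (forall i (x : X i), ha h i x = f i x - g i x) -> is_boundary h -> homotopic f g.
Proof.
move=> hE /bdP[s hs]; exists (hlin s) => i x.
by rewrite -hE hs (homC_cd _ _ erefl erefl erefl) expr1 scaleN1r opprK.
Qed.

Lemma Kproj_lift P Y Y' (g : chmap Y Y') (f : chmap P Y') : Kprojective P -> qiso g ->
  exists f' : chmap P Y, homotopic f (chcomp g f').
Proof.
move=> KP gq; have [z zc zP] := (qiso_hpost_Kproj KP gq 0).2 _ (of_chmap_cycle f).
exists (chmap_of zc); apply: (bd_homotopic _ zP) => i x.
by rewrite hBa hpostE chcompE chmap_ofE of_chmapE.
Qed.
Lemma Kinj_ext I X X' (f : chmap X X') (g : chmap X I) : Kinjective I -> qiso f ->
  exists g' : chmap X' I, homotopic g (chcomp g' f).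
Proof.
move=> KI fq; have [z zc zP] := (qiso_hpre_Kinj KI fq 0).2 _ (of_chmap_cycle g).
exists (chmap_of zc); apply: (bd_homotopic _ zP) => i x.
by rewrite hBa hpreE chcompE chmap_ofE of_chmapE.
Qed.
Lemma Kproj_homotopic P Y Y' (g : chmap Y Y') (f f' : chmap P Y) : Kprojective P -> qiso g ->
  homotopic (chcomp g f) (chcomp g f') -> homotopic f f'.
Proof.
move=> KP gq [s sP].
apply: (bd_homotopic (h := (of_chmap f : homC idR P Y 0) - of_chmap f')).
  by move=> i x; rewrite hBa !of_chmapE.
apply: ((qiso_hpost_Kproj KP gq) 0).1; first by apply: cyB; exact: of_chmap_cycle.
have kl i j a (x y : P i) : s i j (idR a *: x + y) = a *: s i j x + s i j y by rewrite linearP.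
apply/bdP; exists (mkh (0 + 1) (fun i j => mkshom (@kl i j))); apply: hext => i j x.
rewrite addr0 => e; case: _ / (esym e).
rewrite hpostE hBa !of_chmapE linearB -[LHS]/(chcomp g f i x - chcomp g f' i x) sP.
rewrite (homC_cd _ _ erefl erefl erefl) !ha_mkh ?addr0 //; last by rewrite subrK.
by rewrite expr1 scaleN1r opprK.
Qed.

End KTheory.

Section Steps.
Variable R : comPzRingType.
Local Notation idR := (idfun : {rmorphism R -> R}).

Lemma img_factor (M N V : lmodType R) (g : {linear M -> N}) (f : {linear V -> N}) :
  (forall x, exists y, f x = g y) ->
  exists f' : {linear V -> subm (img g)}, forall x, sinc (img g) (f' x) = f x.
Proof.
move=> fg; pose f' x : subm (img g) := mksub (U := img g) (fg x).
have lin : linear f' by move=> a x y; apply: (@sinc_inj _ _ (img g)); rewrite [RHS]linearP; exact: (linearP f).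
by exists (mklin lin).
Qed.
Lemma img_onto (M N : lmodType R) (g : {linear M -> N}) :
  exists g' : {linear M -> subm (img g)}, (forall x, sinc (img g) (g' x) = g x) /\
    forall y, exists x, g' x = y.
Proof.
have [|g' g'P] := @img_factor _ _ _ g g; first by move=> x; exists x.
exists g'; split=> // y; have [x xP] := sincP y; exists x.
by apply: (@sinc_inj _ _ (img g)); rewrite g'P -xP.
Qed.
Lemma proj_lift_im (P M N : lmodType R) (g : {linear M -> N}) (f : {linear P -> N}) :
  projective P -> (forall x, exists y, f x = g y) ->
  exists h : {linear P -> M}, forall x, g (h x) = f x.
Proof.
move=> Pp /img_factor[f' f'P]; have [g' [g'P gs]] := img_onto g.
by have [h hP] := Pp _ _ g' f' gs; exists h => x; rewrite -g'P hP f'P.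
Qed.
Lemma inj_ext_ker (J V N : lmodType R) (f : {linear V -> N}) (r : {linear V -> J}) :
  inj_mod J -> (forall x, f x = 0 -> r x = 0) ->
  exists g : {linear N -> J}, forall x, g (f x) = r x.
Proof.
move=> Ji fr; have [f' [f'P fs]] := img_onto f.
have /choice [s sP] := fs.
have E x : r (s (f' x)) = r x.
  apply/eqP; rewrite -subr_eq0 -linearB; apply/eqP/fr.
  by rewrite linearB -!f'P sP subrr.
have lin : linear (r \o s).
  move=> a y y'; have [x <-] := fs y; have [x' <-] := fs y'.
  by rewrite -linearP /= !E linearP.
have [g gP] := Ji _ _ (sinc (img f)) (mklin lin) (@sinc_inj _ _ (img f)).
by exists g => x; rewrite -f'P gP /= E.
Qed.

Lemma iterate (T : Type) (Q : nat -> T -> Prop) (A : nat -> T -> T -> Prop) (t0 : T) :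
  Q 0%N t0 -> (forall n t, Q n t -> exists t', Q n.+1 t' /\ A n t t') ->
  exists s : nat -> T, (forall n, Q n (s n)) /\ forall n, A n (s n) (s n.+1).
Proof.
move=> Q0 step.
have /choice [F FP] : forall p : nat * T, exists t', Q p.1 p.2 -> Q p.1.+1 t' /\ A p.1 p.2 t'.
  move=> [n t]; have [Qt|nQ] := pselect (Q n t); last by exists t.
  by have [t' h] := step n t Qt; exists t'.
pose s := fix s n := if n is k.+1 then F (k, s k) else t0.
have Qs n : Q n (s n) by elim: n => //= n IHn; case: (FP (n, s n) IHn).
by exists s; split=> // n; case: (FP (n, s n) (Qs n)).
Qed.

Section Single.
Variables (X Y : complex R) (n i0 : int) (g : {linear X i0 -> Y (i0 + n)}).
Fact hsingle_subproof i j a (x y : X i) :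
  tr Y (i0 + n) j (g (tr X i i0 (idR a *: x + y))) =
  a *: tr Y (i0 + n) j (g (tr X i i0 x)) + tr Y (i0 + n) j (g (tr X i i0 y)).
Proof. by rewrite !linearP. Qed.
Definition hsingle : homC idR X Y n := mkh n (fun i j => mkshom (@hsingle_subproof i j)).
Lemma hsingle_ne i j (x : X i) : i != i0 -> ha hsingle j x = 0.
Proof.
move=> ne; have [e|e] := eqVneq j (i + n); last by rewrite ha_ne.
by rewrite ha_mkh // mkshomE [tr X _ _ _]tr_ne // !linear0.
Qed.
Lemma hsingleE j (x : X i0) : j = i0 + n -> ha hsingle j x = tr Y (i0 + n) j (g x).
Proof. by move=> e; rewrite ha_mkh // mkshomE trE. Qed.
End Single.

(** Given a cycle f of Hom(P, A), a map h with d h = f is built from the bottom of P upwards. At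
    stage t, f - d h vanishes below a + t; hence on P_{a+t} it takes values in boundaries of A and
    lifts by projectivity. The correction [hsingle] lives on that single degree of P, so nothing
    below is disturbed. *)
Lemma Kproj_bounded (P : complex R) (a : int) : dg_proj P ->
  (forall i, i < a -> cx_zero_at P i) -> Kprojective P.
Proof.
move=> Pp P0 A Aa n f fc.
pose Q (t : nat) (h : homC idR P A (n + 1)) := forall i (x : P i), i < a + t%:Z ->
  ha (f - cd (homC idR P A) (n + 1) n h) (i + n) x = 0.
pose Agr (t : nat) (h h' : homC idR P A (n + 1)) := forall i j (x : P i), i < a + t%:Z ->
  ha h j x = ha h' j x.
have [||s [sQ sA]] := @iterate _ Q Agr 0.
- by move=> i x; rewrite addr0 => lt; rewrite (P0 _ lt x) ha0.
- move=> t h Qh; pose r := f - cd (homC idR P A) (n + 1) n h; rewrite /Q -/r in Qh; pose i0 := a + t%:Z.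
  have rc : is_cycle r by apply: cyB => //; exact: cy_cd.
  have [|g gP] := proj_lift_im (Pp i0) (g := cd A (i0 + (n + 1)) (i0 + n)) (f := hlin r i0 (i0 + n)).
    move=> x; have /(bd_at (j := i0 + (n + 1))) : is_boundary (ha r (i0 + n) x).
      apply: Aa; apply/cyP.
      rewrite ((homC_cyP r).1 rc i0 (i0 - 1) (i0 + n) (i0 + n - 1) x) ?subrK //.
      have -> : i0 + n - 1 = i0 - 1 + n by zm.
      by rewrite Qh ?scaler0 // gtrDl.
    by rewrite addrA => /(_ erefl).
  exists (h + hsingle g); split=> [i x|i j x lt]; last first.
    by rewrite hDa hsingle_ne ?addr0 // lt_eqF.
  rewrite -addn1 PoszD addrA ltzD1 -/i0 => le.
  have -> : f - cd (homC idR P A) (n + 1) n (h + hsingle g) =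
    r - cd (homC idR P A) (n + 1) n (hsingle g) by rewrite linearD /r; zm.
  rewrite hBa (homC_cd _ _ erefl erefl erefl) [ha _ _ (cd P i _ x)]hsingle_ne; last first.
    by rewrite lt_eqF // ltrBlDr ltzD1.
  rewrite scaler0 subr0; move: le; rewrite le_eqVlt => /orP[/eqP e|lt].
    case: _ / (esym e) in x *; rewrite hsingleE ?addrA // cd_tr ?addrA //.
    by rewrite gP subrr.
  by rewrite hsingle_ne ?lt_eqF // linear0 subr0 Qh.
have sA' t t' : (t <= t')%N -> Agr t (s t) (s t').
  elim: t' => [|t' IH]; first by rewrite leqn0 => /eqP->.
  rewrite leq_eqVlt => /orP[/eqP->//|]; rewrite ltnS => le i j x lt.
  rewrite (IH le) // sA //; apply: lt_le_trans lt _; by rewrite lerD2l.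
(* As i < a + T i, the stages from T i on agree on P_i; the limit takes its value there. *)
pose T i : nat := `|i - a|.+1.
have TP i : i < a + (T i)%:Z.
  by rewrite -ltrBlDl /T -addn1 PoszD ltzD1 abszE ler_norm.
exists (n + 1), (mkh (n + 1) (fun i j => hcomp (s (T i) : homdeg idR P A (n + 1)) i j)).
apply: hext => i j x e; rewrite (homC_cd _ _ erefl erefl erefl).
have E k l (y : P k) : ha (mkh (n + 1) (fun i j => hcomp (s (T i) : homdeg idR P A (n + 1)) i j)) l y =
    ha (s (T k)) l y.
  have [e'|e'] := eqVneq l (k + (n + 1)); first by rewrite ha_mkh.
  by rewrite !ha_ne.
rewrite !E; have := sQ (T i) i x (TP i); rewrite -e hBa (homC_cd _ _ erefl erefl erefl).
move/eqP; rewrite subr_eq0 => /eqP ->; congr (_ - _ *: _).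
have [lt|le] := ltP (i - 1) a; first by rewrite [cd P i _ x](P0 _ lt) !ha0.
symmetry; apply: sA'; last exact: TP.
rewrite /T ltnS -lez_nat !gez0_abs ?subr_ge0 // ?lerD2r ?gerBl //.
by apply: le_trans le _; rewrite gerBl.
Qed.

Lemma Kinj_bounded (I : complex R) (b : int) : dg_inj I ->
  (forall i, b < i -> cx_zero_at I i) -> Kinjective I.
Proof.
move=> Ii I0 A Aa n f fc.
pose Q (t : nat) (h : homC idR A I (n + 1)) := forall i j (x : A i), b - t%:Z < j ->
  ha (f - cd (homC idR A I) (n + 1) n h) j x = 0.
pose Agr (t : nat) (h h' : homC idR A I (n + 1)) := forall i j (x : A i), b - t%:Z < j ->
  ha h j x = ha h' j x.
have [||s [sQ sA]] := @iterate _ Q Agr 0.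
- by move=> i j x; rewrite subr0 => lt; exact: (I0 _ lt).
- move=> t h Qh; pose r := f - cd (homC idR A I) (n + 1) n h; rewrite /Q -/r in Qh; pose j0 := b - t%:Z.
  have rc : is_cycle r by apply: cyB => //; exact: cy_cd.
  pose i0 := j0 - (n + 1).
  have j0E : j0 = i0 + (n + 1) by rewrite subrK.
  have [|g gP] := inj_ext_ker (Ii j0) (f := cd A (i0 + 1) i0) (r := hlin r (i0 + 1) j0).
    move=> x x0; have [|w ->] := (bdP x).1 (Aa _ x _).
      by apply: (cy_at (esym (addrK 1 i0))).
    have e2 : i0 + 1 = i0 + 1 + 1 - 1 by rewrite addrK.
    apply: (@sign_inj _ _ (absz n)); rewrite scaler0 /=.
    rewrite -((homC_cyP r).1 rc _ _ (j0 + 1) j0 w _ erefl e2); last by rewrite j0E; zm.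
    by rewrite Qh ?linear0 // ltzD1.
  have gl : linear (fun x => (-1) ^+ absz n *: tr I j0 (i0 + (n + 1)) (g x)).
    by by move=> c x y; rewrite !linearP.
  exists (h + hsingle (mklin gl)); split=> [i j x|i j x lt]; last first.
    have [e|e] := eqVneq i i0.
      by rewrite hDa [ha (hsingle _) _ _]ha_ne ?addr0 // gt_eqF // e -j0E.
    by rewrite hDa hsingle_ne ?addr0.
  rewrite -addn1 PoszD opprD addrA ltrBlDr ltzD1 -/j0 => le.
  have -> : f - cd (homC idR A I) (n + 1) n (h + hsingle (mklin gl)) =
    r - cd (homC idR A I) (n + 1) n (hsingle (mklin gl)) by rewrite linearD /r; zm.
  rewrite hBa (homC_cd _ _ erefl erefl erefl) [ha _ (j + 1) x](_ : _ = 0); last first.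
    have [e|e] := eqVneq i i0; last by rewrite hsingle_ne.
    by rewrite ha_ne // gt_eqF // e -j0E ltzD1.
  rewrite linear0 sub0r opprK.
  have [e|e] := eqVneq i (i0 + 1); last first.
    rewrite hsingle_ne ?scaler0 ?addr0; last by apply: contraNneq e => <-; rewrite subrK.
    move: le; rewrite le_eqVlt => /orP[/eqP e'|]; last exact: Qh.
    rewrite ha_ne // -e' j0E; apply: contraNneq e => e.
    by apply/eqP/(addIr n); rewrite -e; zm.
  case: _ / (esym e) in x *.
  move: le; rewrite le_eqVlt => /orP[/eqP e'|lt]; last first.
    rewrite Qh // add0r ha_ne ?scaler0 // gt_eqF // addrK -j0E //.
  case: _ / e'; rewrite (addrK 1 i0) hsingleE // /= [tr I _ _ (_ *: _)]linearZ_LR trK //.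
  by rewrite signr_absz_addr1 scaleNr signK gP subrr.
have sA' t t' : (t <= t')%N -> Agr t (s t) (s t').
  elim: t' => [|t' IH]; first by rewrite leqn0 => /eqP->.
  rewrite leq_eqVlt => /orP[/eqP->//|]; rewrite ltnS => le i j x lt.
  rewrite (IH le) // sA //; apply: le_lt_trans lt; by rewrite lerD2l lerN2.
pose T j : nat := `|b - j|.+1.
have TP j : b - (T j)%:Z < j.
  by rewrite ltrBlDr -ltrBlDl /T -addn1 PoszD ltzD1 abszE ler_norm.
exists (n + 1), (mkh (n + 1) (fun i j => hcomp (s (T j) : homdeg idR A I (n + 1)) i j)).
apply: hext => i j x e; rewrite (homC_cd _ _ erefl erefl erefl).
have E k l (y : A k) : ha (mkh (n + 1) (fun i j => hcomp (s (T j) : homdeg idR A I (n + 1)) i j)) l y =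
    ha (s (T l)) l y.
  have [e'|e'] := eqVneq l (k + (n + 1)); first by rewrite ha_mkh.
  by rewrite !ha_ne.
rewrite !E; have := sQ (T j) i j x (TP j); rewrite hBa (homC_cd _ _ erefl erefl erefl).
move/eqP; rewrite subr_eq0 => /eqP ->; congr (cd I _ _ _ - _).
have [lt|le] := ltP b (j + 1); first by rewrite [LHS](I0 _ lt) [RHS](I0 _ lt).
symmetry; apply: sA'; last exact: TP.
rewrite /T ltnS -lez_nat !gez0_abs ?subr_ge0 // ?lerD2l ?lerN2 ?lerDl //.
by apply: le_trans _ le; rewrite lerDl.
Qed.
End Steps.

Section MoreComplexes.
Variable R : comPzRingType.
Implicit Types X Y A B C : complex R.

Lemma ses_qiso_mid A B C A' B' C' (f : chmap A B) (g : chmap B C) (f' : chmap A' B')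
  (g' : chmap B' C') (a : chmap A A') (b : chmap B B') (c : chmap C C') :
  ses f g -> ses f' g' -> (forall i x, b i (f i x) = f' i (a i x)) ->
  (forall i x, c i (g i x) = g' i (b i x)) -> qiso a -> qiso c -> qiso b.
Proof.
move=> s s' ab bc /qisoP qa /qisoP qc; apply/qisoP => i.
by apply: (ses_hzero_mid (ses_cones ab bc s s')).
Qed.
Lemma ses_acyclic_mid A B C (f : chmap A B) (g : chmap B C) : ses f g ->
  acyclic A -> acyclic C -> acyclic B.
Proof. by move=> s Aa Ca i; apply: (ses_hzero_mid s). Qed.
Lemma ses_acyclic_right A B C (f : chmap A B) (g : chmap B C) : ses f g ->
  acyclic A -> acyclic B -> acyclic C.
Proof. by move=> s Aa Ba i; apply: (ses_hzero_right s). Qed.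

Lemma ses_qiso_out A B C (f : chmap A B) (g : chmap B C) : ses f g -> acyclic A -> qiso g.
Proof.
move=> s Aa i; split=> [z zc gz|w wc].
  have [a /Aa ab h] := ses_mid s zc gz.
  by rewrite -(subrK (f i a) z); apply: bdD => //; exact: chmap_bd.
have [b [a [bP dbP ac]]] := ses_connect s wc.
have [a' a'P] := bd_at (esym (subrK 1 i)) (Aa _ _ ac).
exists (b - f i a'); first by apply/cyP; rewrite linearB chmapP -a'P dbP subrr.
by case: s => _ _ gf _; rewrite linearB gf subr0 bP subrr; exact: bd0.
Qed.
Lemma ses_qiso_in A B C (f : chmap A B) (g : chmap B C) : ses f g -> acyclic C -> qiso f.
Proof.
move=> s Ca i; split=> [z zc /bdP[b bP]|w wc].
  case: (s) => fi gs gf ex.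
  have [|c cP] := (bdP (g _ b)).1 (Ca _ _ _).
    by apply: (cy_at (esym (addrK 1 i))); rewrite chmapP -bP gf.
  have [b' b'P] := gs _ c.
  have [|a aP] := ex _ (b - cd B _ _ b'); first by rewrite linearB -chmapP b'P -cP subrr.
  exists (i + 1), a; apply: (fi i); rewrite -chmapP -aP linearB cd_cd subr0 //.
have [|a ac h] := ses_mid s wc; first by apply: Ca; exact: chmap_cy.
by exists a.
Qed.

Section SubQuotient.
Variables (X : complex R) (U : forall i, submod (X i)).
Hypothesis dU : forall i j x, U i x -> U j (cd X i j x).

Lemma subm_map_exists (V W : lmodType R) (A : submod V) (B : submod W) (f : {linear V -> W}) :
  (forall x, A x -> B (f x)) -> exists g : {linear subm A -> subm B},
    forall x, sinc B (g x) = f (sinc A x).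
Proof.
move=> AB; pose g x : subm B := mksub (AB _ (sincP x)).
have lin : linear g.
  by move=> a x y; apply: (@sinc_inj _ _ B); rewrite [RHS]linearP; exact: (linearP f).
by exists (mklin lin).
Qed.
Definition subd i j := projT1 (cid (subm_map_exists (@dU i j))).
Lemma subdE i j x : sinc (U j) (subd i j x) = cd X i j (sinc (U i) x).
Proof. exact: (projT2 (cid (subm_map_exists (@dU i j)))). Qed.
Definition subcx : complex R.
Proof.
refine (@Complex R (fun i => subm (U i)) subd _ _) => [i j x ij|i j k x].
  abstract by apply: (@sinc_inj _ _ (U j)); rewrite subdE cd_shape ?linear0.
abstract by apply: (@sinc_inj _ _ (U k)); rewrite !subdE cd_cd linear0.
Defined.
Definition sub_in : chmap subcx X.
Proof. by exists (fun i => sinc (U i)) => i j x; symmetry; exact: subdE. Defined.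
Lemma sub_in_cy i (z : subcx i) : is_cycle (sub_in i z) <-> is_cycle z.
Proof.
split=> [h j|]; last exact: chmap_cy.
by apply: (@sinc_inj _ _ (U j)); rewrite linear0 -[sinc _ _]/(sub_in j _) -chmapP h.
Qed.
Fact quod_subproof i j : factors (U i) (qpi (U j) \o cd X i j).
Proof. by move=> x Ux; apply/qpi0/dU. Qed.
Definition quod i j : {linear quom (U i) -> quom (U j)} := qlift (@quod_subproof i j).
Lemma quodE i j x : quod i j (qpi (U i) x) = qpi (U j) (cd X i j x).
Proof. exact: qliftE. Qed.
Definition quocx : complex R.
Proof.
refine (@Complex R (fun i => quom (U i)) quod _ _) => [i j x ij|i j k x].
  abstract by have [y <-] := qpi_surj x; rewrite quodE cd_shape ?linear0.
abstract by have [y <-] := qpi_surj x; rewrite !quodE cd_cd linear0.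
Defined.
Definition quo_out : chmap X quocx.
Proof. by exists (fun i => qpi (U i)) => i j x; exact: quodE. Defined.
Lemma ses_subquo : ses sub_in quo_out.
Proof.
split=> i.
- exact: sinc_inj.
- exact: qpi_surj.
- by move=> x; apply/qpi0; exact: sincP.
- by move=> y /qpi0 Uy; exists (mksub Uy).
Qed.
End SubQuotient.

Lemma ltS (i : int) : i < i + 1. Proof. by rewrite ltzD1. Qed.
Lemma leS_lt (a i : int) : a <= i -> i + 1 < a -> False.
Proof. by move=> le lt; move: (lt_le_trans lt le); rewrite ltNge lerDl. Qed.
Lemma leS_eq (a i : int) : a <= i -> i + 1 = a -> False.
Proof. by move=> le e; move: le; rewrite -e leNgt ltS. Qed.

(** Z_a or B_a in degree a, everything above and nothing below. *)
Section Truncation.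
Variables (X : complex R) (a : int).
Fact tru_0 (Q : forall i, submod (X i)) i :
  (i < a -> (0 : X i) = 0) /\ (i = a -> Q i 0).
Proof. by split=> // _; exact: sub_0. Qed.
Fact tru_lin (Q : forall i, submod (X i)) i c x y :
  (i < a -> (x : X i) = 0) /\ (i = a -> Q i x) -> (i < a -> (y : X i) = 0) /\ (i = a -> Q i y) ->
  (i < a -> c *: x + y = 0) /\ (i = a -> Q i (c *: x + y)).
Proof.
move=> [h1 h2] [h3 h4]; split=> h; first by rewrite h1 // h3 // scaler0 addr0.
by apply: sub_lin; auto.
Qed.
Definition tru (Q : forall i, submod (X i)) i : submod (X i) := @Submod R (X i)
  (fun x => (i < a -> x = 0) /\ (i = a -> Q i x)) (tru_0 Q i) (@tru_lin Q i).
Fact tru_cy i j x : tru (cym X) i x -> tru (cym X) j (cd X i j x).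
Proof.
move=> [h1 h2]; split=> [lt|_]; last exact: cy_cd.
have [e|e] := eqVneq i (j + 1); last exact: cd_shape.
have [/h1 ->|gt|/h2 h] := ltgtP i a; [by rewrite linear0 | | by rewrite h] => //.
by exfalso; move: gt; rewrite e ltzD1 leNgt lt.
Qed.
Fact tru_bd i j x : tru (bdm X) i x -> tru (bdm X) j (cd X i j x).
Proof.
move=> [h1 h2]; split=> [lt|_]; last exact: bd_cd.
have [e|e] := eqVneq i (j + 1); last exact: cd_shape.
have [/h1 ->|gt|/h2/cy_bd h] := ltgtP i a; [by rewrite linear0 | | by rewrite h] => //.
by exfalso; move: gt; rewrite e ltzD1 leNgt lt.
Qed.
Definition Tge := subcx tru_cy.
Definition Tgt := subcx tru_bd.
Definition Tge_in : chmap Tge X := sub_in tru_cy.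
Definition Tgt_in : chmap Tgt X := sub_in tru_bd.
(** Because [Tgt] retains B_a in degree a, it has no homology there, and the quotient keeps H_a: it
    is the truncation of X to homology in degrees at most a. *)
Definition Tle := quocx tru_bd.
Definition Tle_out : chmap X Tle := quo_out tru_bd.

Lemma sub_zero_below (Q : forall i, submod (X i)) (dQ : forall i j x, tru Q i x -> tru Q j (cd X i j x)) i :
  i < a -> cx_zero_at (subcx dQ) i.
Proof.
move=> lt x; apply: (@sinc_inj _ _ (tru Q i)); rewrite linear0.
by case: (sincP x) => h _; exact: h.
Qed.
Lemma Tge_qiso : (forall i, i < a -> hzero X i) -> qiso Tge_in.
Proof.
move=> X0 i; split=> [z /sub_in_cy zc h|w wc].
  have [lt|le] := ltP i a; first by apply: hzero_zero_at; [exact: sub_zero_below | exact/sub_in_cy].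
  have /bdP[w wE] := h.
  have Uw : tru (cym X) (i + 1) w.
    by split=> [/(leS_lt le)|/(leS_eq le)].
  exists (i + 1), (mksub Uw); apply: (@sinc_inj _ _ (tru (cym X) i)).
  by rewrite -[LHS]/(Tge_in i z) wE [RHS]subdE.
have [lt|le] := ltP i a; first by exists 0; [exact: cy0 | rewrite [Tge_in i _]linear0 subr0; exact: X0].
have Uw : tru (cym X) i w by split=> // lt; move: lt; rewrite ltNge le.
exists (mksub Uw); first exact/sub_in_cy.
by rewrite -[Tge_in i _]/w subrr; exact: bd0.
Qed.
Lemma Tgt_hzero i : i <= a -> hzero Tgt i.
Proof.
move=> le z /sub_in_cy zc; move: le; rewrite le_eqVlt => /orP[/eqP e|lt]; last first.
  by rewrite [z](@sub_zero_below _ _ _ lt z); exact: bd0.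
have [_ /(_ e)/bdP[w wE]] := sincP z.
have Uw : tru (bdm X) (i + 1) w.
  have le : a <= i by rewrite e.
  by split=> [/(leS_lt le)|/(leS_eq le)].
exists (i + 1), (mksub Uw); apply: (@sinc_inj _ _ (tru (bdm X) i)).
by rewrite wE [RHS]subdE.
Qed.
Lemma Tgt_hzero_gt i : a < i -> hzero X i -> hzero Tgt i.
Proof.
move=> lt Xi z /sub_in_cy/Xi/bdP[w wE].
have Uw : tru (bdm X) (i + 1) w.
  by split=> [/(leS_lt (ltW lt))|/(leS_eq (ltW lt))].
exists (i + 1), (mksub Uw); apply: (@sinc_inj _ _ (tru (bdm X) i)).
by rewrite -[LHS]/(Tgt_in i z) wE [RHS]subdE.
Qed.
Lemma Tle_qiso : (forall i, a < i -> hzero X i) -> qiso Tle_out.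
Proof.
move=> X0; apply: (ses_qiso_out (ses_subquo tru_bd)) => i.
by have [le|lt] := leP i a; [exact: Tgt_hzero | apply: Tgt_hzero_gt => //; exact: X0].
Qed.
Lemma Tle_zero i : a < i -> cx_zero_at Tle i.
Proof.
move=> lt x; have [y <-] := qpi_surj x; apply/qpi0; split=> [lt'|e].
  by move: (lt_trans lt lt'); rewrite ltxx.
by exfalso; move: lt; rewrite e ltxx.
Qed.
End Truncation.
End MoreComplexes.

(** * Resolutions by free and by injective modules *)

Section NatComplexes.
Variable R : comPzRingType.
Implicit Types X : complex R.

Definition ntr (M : nat -> lmodType R) n m : {linear M n -> M m} :=
  if @eqP _ n m is ReflectT e then ecast m {linear M n -> M m} e idfun else \0.
Lemma ntrE M n x : ntr M n n x = x.
Proof. by rewrite /ntr; case: eqP => // e; rewrite (eq_irrelevance e erefl). Qed.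
Lemma ntr_ne M n m x : n != m -> ntr M n m x = 0.
Proof. by rewrite /ntr; case: eqP. Qed.

Section Up.
Variables (M : nat -> lmodType R) (d : forall n, {linear M n.+1 -> M n}).
Hypothesis dd : forall n x, d n (d n.+1 x) = 0.
Definition updm n m : {linear M n -> M m} :=
  match n return {linear M n -> M m} with n'.+1 => ntr M n' m \o d n' | 0 => \0 end.
Lemma updmE n x : updm n.+1 n x = d n x. Proof. exact: ntrE. Qed.
Lemma updm_ne n m x : n != m.+1 -> updm n m x = 0.
Proof. by case: n x => // n x; rewrite eqSS => ne; exact: ntr_ne. Qed.
Lemma updm_dd n m k x : updm m k (updm n m x) = 0.
Proof.
have [e|ne] := eqVneq n m.+1; last by rewrite (updm_ne _ ne) linear0.
case: _ / (esym e) in x *; rewrite updmE.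
have [e'|ne] := eqVneq m k.+1; last by rewrite (updm_ne _ ne).
by case: _ / (esym e') in x *; rewrite updmE dd.
Qed.
Definition up_obj (i : int) : lmodType R := match i with Posz n => M n | Negz _ => 'rV[R]_0 end.
Definition up_d i j : {linear up_obj i -> up_obj j} :=
  match i, j return {linear up_obj i -> up_obj j} with
  | Posz n, Posz m => updm n m | _, _ => \0 end.
Definition upcx : complex R.
Proof.
refine (@Complex R up_obj up_d _ _) => [i j x ij|i j k x].
  abstract (case: i j x ij => [n|n] [m|m] x //= ne; apply: updm_ne;
    by apply: contraNneq ne => ->; rewrite -addn1 PoszD).
abstract (case: i j k x => [n|n] [m|m] [k|k] x //=; rewrite ?linear0 //; exact: updm_dd).
Defined.
Lemma upcx_cd n x : cd upcx n.+1%:Z n%:Z x = d n x. Proof. exact: updmE. Qed.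
Lemma upcx_zero i : i < 0 -> cx_zero_at upcx i.
Proof. by case: i => // n _ x; exact: thinmx0. Qed.

Variables (X : complex R) (f : forall n, {linear M n -> X n%:Z}).
Hypothesis X0 : forall i, i < 0 -> cx_zero_at X i.
Hypothesis fd : forall n x, cd X n.+1%:Z n%:Z (f n.+1 x) = f n (d n x).
Definition up_map_comp i : {linear upcx i -> X i} :=
  match i return {linear up_obj i -> X i} with Posz n => f n | Negz _ => \0 end.
Fact up_map_subproof i j x : cd X i j (up_map_comp i x) = up_map_comp j (cd upcx i j x).
Proof.
have [e|ne] := eqVneq i (j + 1); last by rewrite !cd_shape ?linear0.
case: j e => [m|m] e; last by rewrite [LHS]X0 // [RHS]X0.
move: e x; rewrite -PoszD addn1 => -> x; rewrite upcx_cd; exact: fd.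
Qed.
Definition up_map : chmap upcx X := Chmap up_map_subproof.
End Up.

Section Down.
Variables (M : nat -> lmodType R) (d : forall n, {linear M n -> M n.+1}).
Hypothesis dd : forall n x, d n.+1 (d n x) = 0.
Definition dndm n m : {linear M n -> M m} :=
  match m return {linear M n -> M m} with m'.+1 => d m' \o ntr M n m' | 0 => \0 end.
Lemma dndmE n x : dndm n n.+1 x = d n x. Proof. by rewrite /= ntrE. Qed.
Lemma dndm_ne n m x : m != n.+1 -> dndm n m x = 0.
Proof. by case: m => // m; rewrite eqSS eq_sym => ne; rewrite /= ntr_ne ?linear0. Qed.
Lemma dndm_dd n m k x : dndm m k (dndm n m x) = 0.
Proof.
have [e|ne] := eqVneq m n.+1; last by rewrite (dndm_ne _ ne) linear0.
case: _ / (esym e); rewrite dndmE.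
have [e'|ne] := eqVneq k n.+2; last by rewrite (dndm_ne _ ne).
by case: _ / (esym e'); rewrite dndmE dd.
Qed.
Definition dn_obj (i : int) : lmodType R :=
  match i with Posz 0 => M 0%N | Posz _.+1 => 'rV[R]_0 | Negz n => M n.+1 end.
Definition dn_d i j : {linear dn_obj i -> dn_obj j} :=
  match i, j return {linear dn_obj i -> dn_obj j} with
  | Posz 0, Posz 0 => \0
  | Posz 0, Negz m => dndm 0 m.+1 | Negz n, Negz m => dndm n.+1 m.+1
  | Posz 0, Posz _.+1 | Posz _.+1, _ | Negz _, Posz _ => \0 end.
Lemma NegzS1 n : Negz n.+1 + 1 = Negz n.
Proof. by rewrite !NegzE -[n.+2]addn1 PoszD opprD subrK. Qed.
Definition dncx : complex R.
Proof.
refine (@Complex R dn_obj dn_d _ _) => [i j x ij|i j k x].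
  abstract (case: i j x ij => [[|n]|n] [[|m]|m] x //= ne; rewrite ntr_ne ?linear0 //;
    by apply: contraNneq ne => <-; rewrite ?NegzS1).
abstract (case: i j k x => [[|n]|n] [[|m]|m] [[|k]|k] x; rewrite ?linear0 //;
 rewrite ?linear0 //; first [exact: (@dndm_dd 0 m.+1 k.+1)
  |exact: (@dndm_dd n.+1 m.+1 k.+1)]).
Defined.
Lemma dncx_zero i : 0 < i -> cx_zero_at dncx i.
Proof. by case: i => // -[|n] // _ x; exact: thinmx0. Qed.

Variables (X : complex R) (f : forall n, {linear X (- n%:Z) -> M n}).
Hypothesis X0 : forall i, 0 < i -> cx_zero_at X i.
Hypothesis fd : forall n x, d n (f n x) = f n.+1 (cd X (- n%:Z) (- n.+1%:Z) x).
Definition dn_map_comp i : {linear X i -> dncx i} :=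
  match i return {linear X i -> dn_obj i} with
  | Posz 0 => f 0%N | Posz _.+1 => \0 | Negz n => f n.+1 end.
Fact dn_map_subproof i j x : cd dncx i j (dn_map_comp i x) = dn_map_comp j (cd X i j x).
Proof.
have [e|ne] := eqVneq i (j + 1); last by rewrite !cd_shape ?linear0.
case: j e x => [j|[|n]] e x.
- by rewrite e in x *; rewrite (X0 _ x) ?linear0 // -PoszD addn1.
- have {}e : i = 0 by rewrite e.
  by rewrite e in x *; apply: etrans (dndmE (n := 0) _) _; exact: (@fd 0).
rewrite NegzS1 in e; rewrite e in x *.
by apply: etrans (dndmE (n := n.+1) _) _; exact: (@fd n.+1).
Qed.
Definition dn_map : chmap X dncx := Chmap dn_map_subproof.
End Down.

Section ProjRes.
Hypothesis noethR : noetherian R.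
Variable X : complex R.
Hypotheses (X0 : forall i, i < 0 -> cx_zero_at X i) (Xfg : forall i, hfin_gen X i).

(** Degree n of a partial free resolution. The cycles are stored as the submodule [pcyc], since the
    differential out of degree n ends in the previous stage, which is not visible here. *)
Record pstage (n : nat) := PStage {
  prk : nat; pmap : {linear 'rV[R]_prk -> X n%:Z}; pcyc : submod 'rV[R]_prk }.
Definition pnext n (s : pstage n) (s' : pstage n.+1) (d : {linear 'rV[R]_(prk s') -> 'rV[R]_(prk s)}) :=
  [/\ forall z, pcyc s (d z), forall z, cd X n.+1%:Z n%:Z (pmap s' z) = pmap s (d z),
    forall z, pcyc s' z <-> d z = 0,
    forall y, pcyc s y -> is_boundary (pmap s y) -> exists z, d z = y &
    forall x, is_cycle x -> exists2 z, pcyc s' z & is_boundary (x - pmap s' z)].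

Lemma rv_hits (V N : lmodType R) (g : {linear V -> N}) k (h : {linear 'rV[R]_k -> N}) :
  (forall i, exists x, g x = h (delta_mx 0 i)) ->
  exists f : {linear 'rV[R]_k -> V}, forall x, g (f x) = h x.
Proof.
move=> /choice[u uP]; exists (rv_map u) => x.
by rewrite rv_mapE lin_sum [RHS]rv_lin; apply: eq_bigr => i _; rewrite linearZ_LR uP.
Qed.
Lemma hfin_rv i : exists k (g : {linear 'rV[R]_k -> X i}), (forall x, is_cycle (g x)) /\
  forall x, is_cycle x -> exists z, is_boundary (x - g z).
Proof.
have [s [sc sP]] := Xfg i; exists (size s), (rv_map (fun i => s`_i)); split=> [x|x xc].
  rewrite rv_mapE; apply: (@sub_sum _ _ (cym X i)) => j _; apply: (@subZ _ _ (cym X i)).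
  by apply: sc; exact: mem_nth.
have [c cP] := sP x xc; exists (\row_i c i); rewrite rv_mapE.
by under [X in _ - X]eq_bigr do rewrite mxE.
Qed.
(** The next term has two free summands. One covers the cycles of degree n whose image in X bounds,
    which makes the map injective on H_n; the other has zero differential and maps onto
    H_{n+1}(X). *)
Lemma pnext_exists n (s : pstage n) : (forall z, pcyc s z -> is_cycle (pmap s z)) ->
  exists (s' : pstage n.+1) (d : {linear 'rV[R]_(prk s') -> 'rV[R]_(prk s)}), pnext d.
Proof.
move=> sc.
have U0l a x y : pcyc s x /\ is_boundary (pmap s x) -> pcyc s y /\ is_boundary (pmap s y) ->
   pcyc s (a *: x + y) /\ is_boundary (pmap s (a *: x + y)).
  by move=> [h1 h2] [h3 h4]; split; [exact: sub_lin | rewrite linearP; exact: bdL].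
have U00 : pcyc s 0 /\ is_boundary (pmap s 0) by split; [exact: sub_0 | rewrite linear0; exact: bd0].
pose U0 : submod 'rV[R]_(prk s) := @Submod R 'rV[R]_(prk s) (fun y => pcyc s y /\ is_boundary (pmap s y)) U00 U0l.
have [n0 [g gs]] := fin_gen_surj (fin_gen_sub U0 noethR (fin_gen_rv R (prk s))).
have [|u uP] := @rv_hits _ _ (cd X n.+1%:Z n%:Z) n0 (pmap s \o sinc U0 \o g).
  move=> i; have [_ h] := sincP (g (delta_mx 0 i)).
  by have [|w wE] := bd_at (j := n.+1%:Z) _ h; [rewrite -addn1 PoszD | exists w; symmetry].
have [k [v [vc vP]]] := hfin_rv n.+1%:Z.
pose f' : {linear 'rV[R]_(n0 + k) -> X n.+1%:Z} := (u \o lsubmx) \+ (v \o rsubmx).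
pose d : {linear 'rV[R]_(n0 + k) -> 'rV[R]_(prk s)} := sinc U0 \o g \o lsubmx.
exists (PStage f' (ker d)), d; split=> [z|z|z|y yc yb|x xc] //.
- by case: (sincP (g (lsubmx z))).
- by rewrite /= linearD uP vc addr0.
- have [z zP] := gs (mksub (U := U0) (conj yc yb)); exists (row_mx z 0).
  by rewrite /= row_mxKl zP.
have [z zP] := vP x xc; exists (row_mx 0 z); first by rewrite /= row_mxKl !linear0.
by rewrite /= row_mxKl row_mxKr linear0 add0r.
Qed.

(** The terms are literally row spaces, not just finitely generated projective modules, because
    [dual_regular] computes in coordinates. *)
Lemma proj_res0 : exists (P : complex R) (f : chmap P X),
  [/\ forall i, exists k, P i = 'rV[R]_k, forall i, i < 0 -> cx_zero_at P i & qiso f].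
Proof.
have [k [v [vc vP]]] := hfin_rv 0.
pose s0 : pstage 0 := PStage v (ker (\0 : {linear 'rV[R]_k -> 'rV[R]_k})).
pose ok n (s : pstage n) := forall z, pcyc s z -> is_cycle (pmap s z).
have s0ok : ok 0%N s0 by move=> z _; exact: vc.
have step n (s : {s : pstage n | ok n s}) : {s' : {s : pstage n.+1 | ok n.+1 s} &
   {d : {linear 'rV[R]_(prk (sval s')) -> 'rV[R]_(prk (sval s))} | pnext d}}.
  have [s' /cid[d dP]] := cid (pnext_exists (proj2_sig s)).
  have s'ok : ok n.+1 s'.
    case: dP => h1 h2 h3 _ _ z /h3 dz; apply: (cy_at (j := n%:Z)).
      by rewrite -addn1 PoszD addrK.
    by rewrite h2 dz linear0.
  by exists (exist _ s' s'ok), d.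
pose S := fix S n : {s : pstage n | ok n s} := match n with
  | 0 => @exist _ (@ok 0%N) s0 s0ok | n.+1 => projT1 (step n (S n)) end.
pose d n : {linear 'rV[R]_(prk (sval (S n.+1))) -> 'rV[R]_(prk (sval (S n)))} :=
  proj1_sig (projT2 (step n (S n))).
have dP n : pnext (d n) := proj2_sig (projT2 (step n (S n))).
have dd n x : d n (d n.+1 x) = 0.
  by have [h1 _ _ _ _] := dP n.+1; have [_ _ h3 _ _] := dP n; apply/h3/h1.
have fd n x : cd X n.+1%:Z n%:Z (pmap (sval (S n.+1)) x) = pmap (sval (S n)) (d n x).
  by case: (dP n).
have cyc n (z : upcx dd n%:Z) : is_cycle z -> pcyc (sval (S n)) z.
  case: n z => [//|n] z zc; have [_ _ h3 _ _] := dP n; apply/h3.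
  exact: etrans (esym (@upcx_cd _ _ dd n z)) (zc n%:Z).
exists (upcx dd), (up_map dd X0 fd); split=> [[n|n]||[n|n]].
- by exists (prk (sval (S n))).
- by exists 0%N.
- exact: upcx_zero.
- split=> [z /cyc zc zb|w wc].
    have [_ _ _ h4 _] := dP n; have [y yP] := h4 z zc zb.
    by exists n.+1%:Z, y; rewrite -yP; symmetry; exact: upcx_cd.
  case: n w wc => [|n] w wc.
    by have [z zP] := vP w wc; exists z => //; apply/cyP; exact: upcx_zero.
  have [_ _ h3 _ h5] := dP n; have [z /h3 zc zP] := h5 w wc; exists z => //.
  by apply: (cy_at (j := n%:Z)); [rewrite -addn1 PoszD addrK | apply: etrans zc; exact: upcx_cd].
split=> [z _ _|w _].
  by rewrite [z](@upcx_zero _ _ dd) //; exact: bd0.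
by exists 0; [exact: cy0 | rewrite [_ - _]X0 //; exact: bd0].
Qed.
End ProjRes.

Section InjRes.
Variable X : complex R.
Hypothesis X0 : forall i, 0 < i -> cx_zero_at X i.

Record istage (n : nat) := IStage {
  iob : lmodType R; imap : {linear X (- n%:Z) -> iob}; ibd : submod iob; iinj : inj_mod iob }.
Definition inext n (s : istage n) (s' : istage n.+1) (d : {linear iob s -> iob s'}) :=
  [/\ forall x, d (imap s x) = imap s' (cd X (- n%:Z) (- n.+1%:Z) x),
    forall u, ibd s u -> d u = 0, forall z, ibd s' z <-> exists y, z = d y,
    forall y, d y = 0 -> exists2 x, is_cycle x & ibd s (y - imap s x) &
    forall x, ibd s' (imap s' x) -> is_boundary x].
(** The next injective is the hull of a pushout: V/W is X_{-n-1} + I_{-n} with dX x identified with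
    the image of x and with the boundaries [ibd] divided out. An element of I_{-n} dies in V/W
    exactly when it comes, modulo boundaries, from a cycle of X, and x maps to a boundary only if it
    is one in X. *)
Lemma inext_exists n (s : istage n) :
  exists (s' : istage n.+1) (d : {linear iob s -> iob s'}), inext d.
Proof.
pose V : lmodType R := (X (- n.+1%:Z) * iob s)%type.
pose dX := cd X (- n%:Z) (- n.+1%:Z).
have W0 : exists x u, ibd s u /\ (0 : V) = (dX x, u - imap s x).
  by exists 0, 0; split; [exact: sub_0 | apply: injective_projections; rewrite /= !linear0 ?addr0].
have Wl a (p q : V) : (exists x u, ibd s u /\ p = (dX x, u - imap s x)) ->
   (exists x u, ibd s u /\ q = (dX x, u - imap s x)) ->
   exists x u, ibd s u /\ a *: p + q = (dX x, u - imap s x).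
  move=> [x [u [hu ->]]] [x' [u' [hu' ->]]]; exists (a *: x + x'), (a *: u + u').
  split; first exact: sub_lin.
  apply: injective_projections => /=; first by rewrite linearP.
  by rewrite [imap s (_ + _)]linearP scalerBr; zm.
pose W : submod V := @Submod R V (fun p => exists x u, ibd s u /\ p = (dX x, u - imap s x)) W0 Wl.
have l1 : linear (fun x : X (- n.+1%:Z) => (x, 0) : V).
  by move=> a x y; apply: injective_projections; rewrite /= ?scaler0 ?addr0.
have l2 : linear (fun y : iob s => (0, y) : V).
  by move=> a x y; apply: injective_projections; rewrite /= ?scaler0 ?addr0.
pose f' : {linear X (- n.+1%:Z) -> hull (quom W)} := hull_in (quom W) \o qpi W \o mklin l1.
pose d : {linear iob s -> hull (quom W)} := hull_in (quom W) \o qpi W \o mklin l2.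
have hq p q : hull_in (quom W) (qpi W p) = hull_in (quom W) (qpi W q) <-> W (p - q).
  by rewrite -qpiP; split=> [/(@hull_in_inj _ _)|->].
exists (@IStage n.+1 (hull (quom W)) f' (img d) (@hull_inj _ _)), d; split=> //=.
- move=> x; apply/hq; exists (- x), 0; split; first exact: sub_0.
  by apply: injective_projections; rewrite /= ?linearN ?sub0r ?subr0 ?opprK.
- move=> u hu; rewrite -(linear0 (hull_in (quom W))) -(linear0 (qpi W)); apply/hq.
  exists 0, u; split=> //; apply: injective_projections => /=; first by rewrite [dX 0]linear0; zm.
  by rewrite [imap s 0]linear0; zm.
- move=> y y0; have /hq : hull_in (quom W) (qpi W (0, y)) = hull_in (quom W) (qpi W 0).
    by rewrite (linear0 (qpi W)) (linear0 (hull_in _)); exact: y0.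
  rewrite subr0 => -[x [u [hu]]] [/= x0 ->]; exists (- x).
    apply: cyN; apply: (cy_at (j := - n.+1%:Z)); last by rewrite -x0.
    by rewrite -addn1 PoszD opprD.
  by rewrite [imap s (- _)]linearN opprK subrK.
move=> x [y /hq [x' [u [_ [/= e _]]]]]; exists (- n%:Z), x'.
by rewrite -e subr0.
Qed.

Lemma inj_res0 : exists (J : complex R) (f : chmap X J),
  [/\ dg_inj J, forall i, 0 < i -> cx_zero_at J i & qiso f].
Proof.
pose s0 : istage 0 := IStage (hull_in (X (- 0%:Z))) (ker (idfun : {linear hull (X (- 0%:Z)) -> _})) (@hull_inj _ _).
pose step n (s : istage n) : {s' : istage n.+1 & {d : {linear iob s -> iob s'} | inext d}} :=
  let: exist s' h := cid (inext_exists s) in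
  existT _ s' (cid h).
pose S := fix S n : istage n := match n with
  | 0 => s0 | n.+1 => projT1 (step n (S n)) end.
pose d n : {linear iob (S n) -> iob (S n.+1)} := proj1_sig (projT2 (step n (S n))).
have dP n : inext (d n) := proj2_sig (projT2 (step n (S n))).
have dd n x : d n.+1 (d n x) = 0.
  by have [_ _ h3 _ _] := dP n; have [_ h2 _ _ _] := dP n.+1; apply/h2/h3; exists x.
have fd n x : d n (imap (S n) x) = imap (S n.+1) (cd X (- n%:Z) (- n.+1%:Z) x).
  by case: (dP n).
exists (dncx dd), (dn_map dd X0 fd); split=> [[[|n]|n]||].
- exact: hull_inj.
- by apply: inj_zero => x; exact: thinmx0.
- exact (@iinj n.+1 (S n.+1)).
- exact: dncx_zero.
have main n : (forall x : X (- n%:Z), ibd (S n) (imap (S n) x) -> is_boundary x) /\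
    forall z : iob (S n), d n z = 0 -> exists2 x : X (- n%:Z), is_cycle x & ibd (S n) (z - imap (S n) x).
  split; last by case: (dP n).
  case: n => [x h|n]; last by case: (dP n).
  have -> : x = 0 by apply: (@hull_in_inj _ (X (- 0%:Z))); rewrite linear0.
  exact: bd0.
move=> [[|n]|[|n]].
- have [h1 h2] := main 0%N; split=> [z zc /bdP[w wE]|w wc].
    apply: h1; change (dn_map dd X0 fd 0 z = 0); rewrite wE.
    by rewrite [w](@dncx_zero _ _ dd) // linear0.
  have [|x xc xP] := h2 w; first by rewrite -(dndmE d (n := 0)); exact: (wc (Negz 0)).
  by exists x => //; move: xP => /= ->; exact: bd0.
- split=> [z _ _|w _]; first by rewrite [z]X0 //; exact: bd0.
  by exists 0; [exact: cy0 | rewrite [_ - _](@dncx_zero _ _ dd) //; exact: bd0].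
- have [h1 h2] := main 1%N; have [_ _ h3 _ _] := dP 0%N.
  have e : 0 = Negz 0 + 1 by rewrite ?NegzS1.
  split=> [z zc /(bd_at e)[w wE]|w wc].
    apply: h1; apply/h3; exists w.
    by apply: etrans wE _; exact: (dndmE d (n := 0)).
  have [|x xc /h3[y yE]] := h2 w.
    by apply: etrans (wc (Negz 1)); symmetry; exact: (dndmE d (n := 1)).
  exists x => //; exists (0), y; apply: etrans yE _; symmetry; exact: (dndmE d (n := 0)).
- have [h1 h2] := main n.+1.+1; have [_ _ h3 _ _] := dP n.+1.
  have e : Negz n = Negz n.+1 + 1 by rewrite ?NegzS1.
  split=> [z zc /(bd_at e)[w wE]|w wc].
    apply: h1; apply/h3; exists w.
    by apply: etrans wE _; exact: (dndmE d (n := n.+1)).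
  have [|x xc /h3[y yE]] := h2 w.
    by apply: etrans (wc (Negz n.+1.+1)); symmetry; exact: (dndmE d (n := n.+1.+1)).
  exists x => //; exists (Negz n), y; apply: etrans yE _; symmetry; exact: (dndmE d (n := n.+1)).
Qed.
End InjRes.
End NatComplexes.

Section Niceness.
Variable R : comPzRingType.
Implicit Types X Y A B C M P Q : complex R.
Local Notation idR := (idfun : {rmorphism R -> R}).

Lemma subKN (a k : int) : k - a - - a = k. Proof. by rewrite opprK subrK. Qed.
Definition shK_out a X : chmap (sh a (sh (- a) X)) X.
Proof.
exists (fun i => tr X (i - a - - a) i) => i j x.
abstract by rewrite /= (cd_tr _ _ (subKN a i)) abszN signK (tr_cd _ (subKN a j)).
Defined.
Definition shK_in a X : chmap X (sh a (sh (- a) X)).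
Proof.
exists (fun i => tr X i (i - a - - a)) => i j x.
abstract by rewrite /= abszN signK (cd_tr _ _ (esym (subKN a i))) (tr_cd _ (esym (subKN a j))).
Defined.
Lemma tr_bij X i j : i = j -> injective (tr X i j) /\ forall y, exists x, tr X i j x = y.
Proof. by case: j /; split=> [x y|y]; [rewrite !trE | exists y; rewrite trE]. Qed.
Lemma qiso_shK_out a X : qiso (shK_out a X).
Proof.
have e k : k - a - - a = k :> int by rewrite opprK subrK.
by apply: qiso_bij => i; have [h1 h2] := @tr_bij X _ _ (e i).
Qed.
Lemma qiso_shK_in a X : qiso (shK_in a X).
Proof.
have e k : k = k - a - - a :> int by rewrite opprK subrK.
by apply: qiso_bij => i; have [h1 h2] := @tr_bij X _ _ (e i).
Qed.

Lemma sh_hfin k X i : hfin_gen (sh k X) i <-> hfin_gen X (i - k).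
Proof.
apply: iff_sym.
apply: (proj2 (@hom_transfer R X (sh k X) (i - k) i idfun _ _ _ _)) => //.
- by move=> y; exists y.
- by move=> x; exact: sh_cy.
- by move=> x; exact: sh_bd.
Qed.

Lemma proj_res_exists (noethR : noetherian R) X a :
  (forall i, i < a -> hzero X i) -> (forall i, hfin_gen X i) ->
  exists P (f : chmap P X), [/\ forall i, exists k, P i = 'rV[R]_k,
    forall i, i < a -> cx_zero_at P i & qiso f].
Proof.
move=> X0 Xf; have qT := Tge_qiso X0; set T := Tge X a in qT.
have [||P [f [Pk P0 qf]]] := @proj_res0 R noethR (sh (- a) T).
- move=> i lt; apply: (@sub_zero_below _ _ _ _ (@tru_cy R X a)).
  by rewrite opprK -ltrBrDr subrr.
- by move=> i; apply/sh_hfin; apply/(qiso_hfin _ qT).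
exists (sh a P), (chcomp (Tge_in X a) (chcomp (shK_out a T) (sh_map a f))); split=> [i|i lt|].
- exact: Pk.
- by apply: P0; rewrite subr_lt0.
by apply: qiso_comp qT; apply: qiso_comp (qiso_shK_out _ _); exact: sh_qiso.
Qed.
Lemma inj_res_exists X b : (forall i, b < i -> hzero X i) ->
  exists J (f : chmap X J), [/\ dg_inj J, forall i, b < i -> cx_zero_at J i & qiso f].
Proof.
move=> X0; have qT := Tle_qiso X0; set T := Tle X b in qT.
have [|J [f [Ji J0 qf]]] := @inj_res0 R (sh (- b) T).
  by move=> i gt; apply: (@Tle_zero R X b); rewrite opprK ltrDr.
exists (sh b J), (chcomp (chcomp (sh_map b f) (shK_in b T)) (Tle_out X b)); split=> [i|i lt|].
- exact: Ji.
- by apply: J0; rewrite subr_gt0.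
by apply: qiso_comp => //; apply: qiso_comp (qiso_shK_in _ _) _; exact: sh_qiso.
Qed.

Lemma hzero_hfin X i : hzero X i -> hfin_gen X i.
Proof.
move=> X0; exists [::]; split=> // z /X0 zb; exists (fun=> 0).
by rewrite big_ord0 subr0.
Qed.
Lemma Tgt_hfin X a i : hfin_gen X i -> hfin_gen (Tgt X a) i.
Proof.
have [le _|lt] := leP i a; first exact/hzero_hfin/Tgt_hzero.
apply: (proj2 (@hom_transfer R (Tgt X a) X i i (sinc _) _ _ _ _)).2.
- exact: sinc_inj.
- have Uy (y : X i) : tru a (bdm X) i y.
    split=> [lt'|e]; first by move: (lt_trans lt lt'); rewrite ltxx.
    by exfalso; move: lt; rewrite e ltxx.
  by move=> y; exists (mksub (Uy y)).
- by move=> x; exact: sub_in_cy.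
- move=> x; split=> [/bdP[w wE]|h]; last exact: (chmap_bd (Tgt_in X a)).
  have Uw : tru a (bdm X) (i + 1) w.
    by split=> [/(leS_lt (ltW lt))|/(leS_eq (ltW lt))].
  by exists (i + 1), (mksub Uw); apply: sinc_inj; rewrite wE [RHS]subdE.
Qed.

(** Induction on the width b - a, splitting off the lowest homology module. After truncation X
    vanishes below a, so all of X_a consists of cycles and the quotient X_a/B_a is H_a(X), which is
    finitely generated. *)
Lemma devissage (Q : complex R -> Prop) (a b : int) :
  (forall X Y (f : chmap X Y), qiso f -> Q X <-> Q Y) ->
  (forall A B C (f : chmap A B) (g : chmap B C), ses f g -> Q A -> Q C -> Q B) ->
  (forall X, acyclic X -> Q X) ->
  (forall X l, a <= l < b -> (forall i, i != l -> cx_zero_at X i) -> fin_gen (X l) -> Q X) ->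
  forall X, (forall i, i < a -> hzero X i) -> (forall i, b <= i -> hzero X i) ->
    (forall i, hfin_gen X i) -> Q X.
Proof.
move=> Qq Qs Qa Qb X.
have [n le] : exists n : nat, b - a <= n%:Z by exists `|b - a|%N; rewrite abszE ler_norm.
elim: n a le Qb X => [|n IHn] a le Qb X Xa Xb Xf.
  apply: Qa => i; have [/Xa//|ge] := ltP i a; apply: Xb; apply: le_trans ge.
  by rewrite -subr_le0.
have [ba|ab] := leP b a.
  by apply: Qa => i; have [/Xa//|ge] := ltP i a; apply: Xb; exact: le_trans ge.
have qT := Tge_qiso Xa; set T := Tge X a in qT; apply/(Qq _ _ _ qT).
have Tf i : hfin_gen T i by apply/(qiso_hfin _ qT).
have T0 i : i < a -> cx_zero_at T i by move=> lt; exact: sub_zero_below.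
apply: (Qs _ _ _ _ _ (ses_subquo (@tru_bd R T a))).
  apply: (IHn (a + 1)).
  - by rewrite opprD addrA lerBlDr -[1]/(1%:Z) -PoszD addn1.
  - move=> Y l /andP[le1 le2]; apply: Qb; rewrite le2 andbT.
    by apply: le_trans le1; rewrite lerDl.
  - by move=> i; rewrite ltzD1; exact: Tgt_hzero.
  - move=> i le'; apply: Tgt_hzero_gt; first exact: lt_le_trans ab le'.
    by apply/(qiso_hzero _ qT); exact: Xb.
  - by move=> i; apply: Tgt_hfin.
apply: (Qb _ a); first by rewrite lexx.
  move=> i; case: ltgtP => // [lt _|gt _]; last exact: Tle_zero.
  by move=> x; have [y <-] := qpi_surj x; rewrite [y]T0 // linear0.
have [s [sc sP]] := Tf a; exists (map (qpi _) s) => y; have [x <-] := qpi_surj y.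
have [|c cP] := sP x; first by apply/cyP; rewrite [LHS]T0 // ltrBlDr ltS.
exists c; rewrite size_map.
under eq_bigr do rewrite (nth_map 0) // -linearZ_LR.
rewrite -lin_sum; apply/qpiP; split=> // lt.
by move: lt; rewrite ltxx.
Qed.

Lemma fin_gen_hfin (noethR : noetherian R) X i : fin_gen (X i) -> hfin_gen X i.
Proof.
move=> [s sP]; have [|t [tU tP]] := @fg_sub R noethR _ (bdm X i) (cym X i) s.
  by move=> z _; have [c ->] := sP z; exists c; rewrite subrr; exact: bd0.
by exists t.
Qed.
Lemma fin_gen_embed (noethR : noetherian R) (M N : lmodType R) (f : {linear M -> N}) :
  injective f -> fin_gen N -> fin_gen M.
Proof.
move=> fi Nf; have [s sP] := fin_gen_sub (img f) noethR Nf.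
have /choice [g gP] : forall y : subm (img f), exists x, f x = sinc (img f) y.
  by move=> y; have [x ->] := sincP y; exists x.
exists (map g s) => x; have [c cP] := sP (mksub (U := img f) (ex_intro _ x erefl)).
exists c; apply: fi; rewrite lin_sum size_map.
have := congr1 (sinc (img f)) cP; rewrite lin_sum sincK => ->.
by apply: eq_bigr => k _; rewrite linearZ_LR [RHS]linearZ_LR (nth_map 0) // gP.
Qed.
Lemma fin_gen_shom (P N : lmodType R) : fgproj P -> fin_gen N -> fin_gen (shom idR P N).
Proof.
move=> [n [i [r ir]]] /fin_gen_surj [k [g gs]].
have hl (A : 'rV[R]_(n * k)) a (x y : P) : g (i (idR a *: x + y) *m vec_mx A) =
    a *: g (i x *m vec_mx A) + g (i y *m vec_mx A).
  by rewrite linearP mulmxDl -scalemxAl linearP.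
have El : linear (fun z : 'rV[R]_(n * k) => mkshom (hl z) : shom idR P N).
  move=> a z w; apply: shomP => x; rewrite shom_funD shom_funZ !mkshomE.
  rewrite linearP mulmxDr linearD linearZ_LR -scalemxAl -scalemxAr //.
apply: (fin_gen_img (f := mklin El)) (fin_gen_rv _ _) _ => h.
have /choice [u uP] : forall j : 'I_n, exists z, g z = shom_fun h (r (delta_mx 0 j)).
  by move=> j; exact: gs.
exists (mxvec (\matrix_j u j)); apply: shomP => x; rewrite mkshomE mxvecK.
rewrite -[in RHS](ir x) (row_delta (i x)) lin_sum mulmx_suml lin_sum.
rewrite -[RHS]/((h : {linear restr idR P -> N}) _).
rewrite (lin_sum (h : {linear restr idR P -> N})); apply: eq_bigr => j _.
rewrite linearZ_LR -scalemxAl linearZ_LR -rowE rowK uP.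
by rewrite -shom_fun_atZ.
Qed.

(** By dévissage M sits in one degree l; then Hom(L, M) in degree n is the single module
    Hom(L_{l-n}, M_l). *)
Lemma hom_fin_gen (noethR : noetherian R) (L M : complex R) : dg_fgproj L -> Kprojective L ->
  hfinite M -> forall n, hfin_gen (homC idR L M) n.
Proof.
move=> Lp KL [/hboundedP[a [b [Ma Mb]]] Mf].
apply: (@devissage (fun M => forall n, hfin_gen (homC idR L M) n) a b) Ma Mb Mf.
- move=> X Y f qf; have q := qiso_hpost_Kproj KL qf.
  by split=> h n; apply/(qiso_hfin n q).
- move=> A B C f g s hA hC n; apply: (ses_hfin_mid (ses_hpost_proj s _) noethR) => //.
  by move=> i; exact: fgproj_projective.
- by move=> X Xa n; apply: hzero_hfin; exact: KL.
move=> X l _ X0 Xl n; apply: fin_gen_hfin => //.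
have El : linear (fun h : homC idR L X n => hcomp (h : homdeg idR L X n) (l - n) l) by [].
apply: (fin_gen_embed noethR (f := mklin El)); last exact: fin_gen_shom.
move=> h k e; apply: hext => i j x ij.
have [jl|jl] := eqVneq j l; last by rewrite [LHS](X0 _ jl) [RHS](X0 _ jl).
have il : i = l - n by rewrite -jl ij addrK.
by rewrite jl in x *; rewrite il in x *; rewrite /ha -[hcomp _ _ _]/(mklin El h) e.
Qed.

Section HomStructure.
Variables (T : comPzRingType) (phi : {rmorphism R -> T}).
Lemma dg_inj_hom (X : complex T) (Y : complex R) :
  (forall i j, inj_mod (shom phi (X i) (Y j))) -> dg_inj (homC phi X Y).
Proof.
move=> XY n A B f g fi.
have gl i j : linear (fun a => hcomp (g a : homdeg phi X Y n) i j).
  by move=> c x y; rewrite linearP.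
have ex i j : exists h : {linear B -> shom phi (X i) (Y j)}, forall a, h (f a) = hcomp (g a : homdeg phi X Y n) i j.
  by have [h hP] := XY i j _ _ f (mklin (gl i j)) fi; exists h.
pose hh i j := proj1_sig (cid (ex i j)).
have hP i j a : hh i j (f a) = hcomp (g a : homdeg phi X Y n) i j := proj2_sig (cid (ex i j)) a.
have kl : linear (fun b => mkh n (fun i j => hh i j b) : homC phi X Y n).
  move=> c x y; apply: hext => i j z e; rewrite hDa hZa !ha_mkh //.
  by rewrite linearP.
exists (mklin kl) => a; apply: hext => i j x e.
by rewrite ha_mkh // hP.
Qed.
Lemma hom_zero (X : complex T) (Y : complex R) n :
  (forall i j, j = i + n -> cx_zero_at X i \/ cx_zero_at Y j) -> cx_zero_at (homC phi X Y) n.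
Proof.
move=> h f; apply: hext => i j x e; case: (h i j e) => [X0|Y0].
  by rewrite [x]X0 !ha0.
by rewrite [LHS]Y0 [RHS]Y0.
Qed.
End HomStructure.

End Niceness.

(** * Perfect complexes *)

Section Thick.
Variable R : comPzRingType.
Implicit Types A B C V W F G X Y : complex R.
Local Notation idR := (idfun : {rmorphism R -> R}).

Definition dsplit A B C (f : chmap A B) (g : chmap B C) : Prop := ses f g /\
  forall i, exists (r : {linear B i -> A i}) (s : {linear C i -> B i}),
    (forall a, r (f i a) = a) /\ forall c, g i (s c) = c.

Lemma dsplit_twist A C (s : twisting A C) : dsplit (tw_in s) (tw_out s).
Proof.
split=> [|i]; first exact: ses_twist.
have l : linear (fun c : C i => (0, c) : (A i * C i)%type).
  by move=> a x y; apply: injective_projections; rewrite /= ?scaler0 ?addr0.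
by exists (fst : {linear (A i * C i)%type -> A i}), (mklin l).
Qed.
Lemma dsplit_cone X Y (f : chmap X Y) : dsplit (cone_in f) (cone_out f).
Proof. exact: dsplit_twist. Qed.

Section Fam.
Variables (A B : complex R) (s : forall i, {linear A i -> B i}) (Y : complex R) (n : int).
Fact hfam_linear : linear (fun h : homC idR B Y n =>
  mkh n (fun i j => pre_lin idR (Y j) (s i) (hcomp (h : homdeg idR B Y n) i j)) : homC idR A Y n).
Proof. by move=> a h k; apply: hext => i j x e; rewrite hDa hZa !ha_mkh // linearP. Qed.
Definition hfam : {linear homC idR B Y n -> homC idR A Y n} := mklin hfam_linear.
Lemma hfamE h i j (x : A i) : ha (hfam h) j x = ha h j (s i x).
Proof.
have [e|e] := eqVneq j (i + n); first by rewrite ha_mkh.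
by rewrite !ha_ne.
Qed.
End Fam.

Lemma dsplit_hpre Y A B C (f : chmap A B) (g : chmap B C) : dsplit f g ->
  dsplit (hpre idR Y g) (hpre idR Y f).
Proof.
move=> [fg /dep_choice[r /dep_choice[s rs]]]; split=> [|n].
  apply: ses_hpre => // i j h; exists (pre_lin idR (Y j) (r i) h) => x.
  by rewrite pre_linE (rs i).1.
exists (hfam s Y n), (hfam r Y n); split=> h; apply: hext => i j x e.
  by rewrite hfamE hpreE (rs i).2.
by rewrite hpreE hfamE (rs i).1.
Qed.

(** Only degreewise split sequences are considered: Hom(-, Y) keeps them exact and split for every
    Y, so no assumption on Y enters. *)
Record thick (Q : complex R -> Prop) : Prop := Thick {
  th_mid : forall A B C (f : chmap A B) (g : chmap B C), dsplit f g -> Q A -> Q C -> Q B;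
  th_left : forall A B C (f : chmap A B) (g : chmap B C), dsplit f g -> Q B -> Q C -> Q A;
  th_contr : forall A, contractible A -> Q A;
  th_retr : forall V W (i : chmap V W) (r : chmap W V), (forall k x, r k (i k x) = x) ->
    Q W -> Q V }.

Fact cone_id_s_linear X i j : linear (fun p : cone (chmap_id X) i =>
  ((0 : X j, tr X i (j - 1) p.1) : cone (chmap_id X) j)).
Proof. by move=> a x y; apply: injective_projections; rewrite /= ?linearP ?scaler0 ?addr0. Qed.
Definition cone_id_s X i j : {linear cone (chmap_id X) i -> cone (chmap_id X) j} :=
  mklin (@cone_id_s_linear X i j).
Lemma cone_id_sE X i j (y : X i) (x : X (i - 1)) : cone_id_s X i j (y, x) = (0, tr X i (j - 1) y).
Proof. by []. Qed.
Lemma cone_id_contractible X : contractible (cone (chmap_id X)).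
Proof.
exists (cone_id_s X) => i [y x].
have e : i = i + 1 - 1 by rewrite addrK.
rewrite !cone_id_sE !cone_cdE linear0 add0r trK // cd_tr // /= !trE.
apply: injective_projections => /=; first by rewrite addr0.
by zm.
Qed.
Fact hcontr_linear A Y (s : forall i j, {linear A i -> A j}) n m :
  linear (fun h : homC idR A Y n => mkh m (fun i j =>
     (-1) ^+ absz n *: pre_lin idR (Y j) (s i (i + 1)) (hcomp (h : homdeg idR A Y n) (i + 1) j)) : homC idR A Y m).
Proof.
move=> a h k; apply: hext => i j x e; rewrite hDa hZa !ha_mkh //.
rewrite !shom_fun_sign !pre_linE -scalerDr; congr (_ *: _).
by rewrite -[LHS]/(ha (a *: h + k) j _) hDa hZa linearZ_LR.
Qed.
Lemma hom_contractible A Y : contractible A -> contractible (homC idR A Y).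
Proof.
move=> [s sP]; exists (fun n m => mklin (@hcontr_linear A Y s n m)) => n h.
apply: hext => i j x e; rewrite hDa (homC_cd _ _ erefl erefl erefl).
rewrite !ha_mkh; first last.
- by rewrite e; zm.
- by rewrite e; zm.
- by [].
rewrite !shom_fun_sign !pre_linE -![shom_fun _ _]/(ha _ _ _).
rewrite (homC_cd _ _ (esym (subrK 1 n)) erefl erefl).
have e1 : i = i + 1 - 1 by rewrite addrK.
have e2 : i - 1 + 1 = i by rewrite subrK.
have -> : ha h j (cd A (i + 1) (i + 1 - 1) (s i (i + 1) x)) = ha h j (cd A (i + 1) i (s i (i + 1) x)).
  by case: _ / e1.
have -> : ha h j (s (i - 1) (i - 1 + 1) (cd A i (i - 1) x)) = ha h j (s (i - 1) i (cd A i (i - 1) x)).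
  by case: _ / (esym e2).
rewrite -[X in _ = ha h j X](sP i x) haD [cd Y _ _ (_ *: _)]linearZ_LR.
have -> : (-1) ^+ `|n - 1| = - (-1) ^+ `|n| :> R.
  by rewrite -{2}(subrK 1 n) signr_absz_addr1 opprK.
rewrite signr_absz_addr1 !scaleNr !scalerBr !signK; zm.
Qed.

Section Deg0.
Variables (M N : lmodType R) (f : {linear M -> N}).
Definition deg0_comp i : {linear in_deg0 M i -> in_deg0 N i} :=
  match i return {linear in_deg0_obj M i -> in_deg0_obj N i} with
  | Posz 0 => f | Posz _.+1 => \0 | Negz _ => \0 end.
Fact deg0P i j x : cd (in_deg0 N) i j (deg0_comp i x) = deg0_comp j (cd (in_deg0 M) i j x).
Proof. by rewrite [RHS]linear0. Qed.
Definition deg0_map : chmap (in_deg0 M) (in_deg0 N) := Chmap deg0P.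
End Deg0.
Lemma in_deg0_zero (M : lmodType R) i : i != 0 -> cx_zero_at (in_deg0 M) i.
Proof. by case: i => [[|n]|n] // _ x; exact: thinmx0. Qed.
Lemma ses_deg0 (M N L : lmodType R) (f : {linear M -> N}) (g : {linear N -> L}) :
  injective f -> (forall y, exists x, g x = y) -> (forall x, g (f x) = 0) ->
  (forall y, g y = 0 -> exists x, y = f x) -> ses (deg0_map f) (deg0_map g).
Proof.
move=> fi gs gf ex; split=> -[[|n]|n] //.
- by move=> x y _; rewrite [x]thinmx0 [y]thinmx0.
- by move=> x y _; rewrite [x]thinmx0 [y]thinmx0.
- by move=> y; exists 0; rewrite [LHS]thinmx0 [RHS]thinmx0.
- by move=> y; exists 0; rewrite [LHS]thinmx0 [RHS]thinmx0.
- by move=> y _; exists 0; rewrite [LHS]thinmx0 [RHS]thinmx0.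
- by move=> y _; exists 0; rewrite [LHS]thinmx0 [RHS]thinmx0.
Qed.
Lemma deg0_mapK (M N : lmodType R) (f : {linear M -> N}) (g : {linear N -> M}) :
  cancel f g -> forall i x, deg0_map g i (deg0_map f i x) = x.
Proof.
move=> fK [[|n]|n] x; first exact: fK.
  by rewrite [LHS]thinmx0 [RHS]thinmx0.
by rewrite [LHS]thinmx0 [RHS]thinmx0.
Qed.

Section Eval.
Variables (F V : complex R) (u : F 0).
Hypothesis uc : is_cycle u.
Fact hev_linear n : linear (fun h : homC idR F V n => ha h n u).
Proof. by move=> a h k; rewrite hDa hZa -[a *: u]addr0 haP ha0 addr0. Qed.
Fact hev_subproof n m (h : homC idR F V n) :
  cd V n m (mklin (@hev_linear n) h) = mklin (@hev_linear m) (cd (homC idR F V) n m h).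
Proof.
have [e|ne] := eqVneq n (m + 1); last by rewrite !cd_shape ?linear0.
rewrite [RHS](homC_cd _ _ e e erefl) uc ha0 scaler0 subr0 //.
Qed.
Definition hev : chmap (homC idR F V) V := Chmap hev_subproof.
Lemma hevE n h : hev n h = ha h n u. Proof. by []. Qed.
End Eval.

Section ConeTo.
Variables (A B C : complex R) (f : chmap A B) (g : chmap B C).
Hypothesis gf : forall i x, g i (f i x) = 0.
Definition cone_to : chmap (cone f) C.
Proof.
exists (fun i => g i \o fst : {linear cone f i -> C i}) => i j [y x].
abstract by rewrite cone_cdE /= linearD gf addr0 chmapP.
Defined.
Lemma cone_toE i y x : cone_to i (y, x) = g i y. Proof. by []. Qed.
End ConeTo.
Lemma cone_to_qiso A B C (f : chmap A B) (g : chmap B C) (s : ses f g)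
  (gf : forall i x, g i (f i x) = 0) : qiso (cone_to gf).
Proof.
case: (s) => fi gs _ ex i; split=> [[y x] zc|w wc].
  rewrite cone_toE => /bdP[c cP]; have [b bP] := gs _ c.
  have [|a aP] := ex i (y - cd B (i + 1) i b).
    by rewrite linearB -chmapP bP cP subrr.
  have e : i = i + 1 - 1 by rewrite addrK.
  exists (i + 1), (b, tr A i (i + 1 - 1) a); rewrite cone_cdE trK // cd_tr //.
  rewrite -aP; apply: injective_projections => /=; first by zm.
  have := zc (i - 1); rewrite cone_cdE trE => -[/= h1 h2].
  apply: (fi (i - 1)); rewrite linearN -chmapP -aP linearB cd_cd subr0.
  by apply/eqP; rewrite -addr_eq0; apply/eqP; apply: etrans h1; exact: addrC.
have [b [a [bP dbP ac]]] := ses_connect s wc.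
exists (b, - a); last by rewrite cone_toE bP subrr; exact: bd0.
by apply/cyP; rewrite cone_cdE trE dbP linearN subrr [cd A _ _ _]linearN ac oppr0 oppr0.
Qed.
Lemma cone_map_qiso X Y X' Y' (f : chmap X Y) (f' : chmap X' Y') (u : chmap X X')
  (v : chmap Y Y') (uv : forall i x, f' i (u i x) = v i (f i x)) :
  qiso u -> qiso v -> qiso (cone_map uv).
Proof.
move=> qu qv; apply: (ses_qiso_mid (ses_cone f) (ses_cone f') (a := v) (c := sh_map 1 u)) => //.
  by move=> i x; apply: injective_projections; rewrite //= linear0.
exact: sh_qiso.
Qed.

Lemma hom_deg0_R V : exists (i : chmap (homC idR (in_deg0 (R^o : lmodType R)) V) V)
  (r : chmap V (homC idR (in_deg0 (R^o : lmodType R)) V)), forall k x, r k (i k x) = x.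
Proof.
have uc : is_cycle (1 : in_deg0 (R^o : lmodType R) 0) by [].
have kl n (v : V n) i j a (x y : in_deg0 (R^o : lmodType R) i) :
   (tr (in_deg0 (R^o : lmodType R)) i 0 (idR a *: x + y) : R) *: tr V n j v =
   a *: ((tr (in_deg0 (R^o : lmodType R)) i 0 x : R) *: tr V n j v) +
   (tr (in_deg0 (R^o : lmodType R)) i 0 y : R) *: tr V n j v.
  by rewrite linearP scalerDl scalerA.
have rl n : linear (fun v : V n => mkh n (fun i j => mkshom (kl n v i j)) :
    homC idR (in_deg0 (R^o : lmodType R)) V n).
  move=> a v w; apply: hext => i j x e; rewrite hDa hZa !ha_mkh // !mkshomE.
  rewrite [tr V n j _]linearP scalerDr scalerA mulrC; congr (_ *: _ + _).
  by rewrite [tr _ i 0 (_ *: _)]linearZ_LR.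
have rE n (v : V n) j (x : R) : j = n ->
    ha (mklin (rl n) v) j (x : in_deg0 (R^o : lmodType R) 0) = x *: tr V n j v.
  by move=> e; rewrite ha_mkh ?add0r // mkshomE trE.
have rP i j (v : V i) : cd (homC idR (in_deg0 (R^o : lmodType R)) V) i j (mklin (rl i) v) =
    mklin (rl j) (cd V i j v).
  have [e|ne] := eqVneq i (j + 1); last by rewrite !cd_shape ?linear0.
  apply: hext => k l x kl'; rewrite (homC_cd _ _ e erefl erefl) [cd (in_deg0 _) _ _ x]/(0 : _).
  rewrite ha0 scaler0 subr0.
  have [k0|nk] := eqVneq k 0; last by rewrite [x](in_deg0_zero nk) !ha0 linear0.
  rewrite k0 in x kl' *; rewrite add0r in kl'.
  rewrite !rE //; last by rewrite kl' e.
  by rewrite linearZ_LR cd_tr ?tr_cd // kl' e.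
exists (hev V uc), (Chmap rP) => n h; apply: hext => i j x e.
have [k0|nk] := eqVneq i 0; last by rewrite [x](in_deg0_zero nk) !ha0.
rewrite k0 in x e *; rewrite add0r in e; rewrite [LHS]rE // hevE tr_ha //.
by rewrite -[RHS]/(ha h j x) -[in RHS](mulr1 (x : R)) -shom_fun_atZ.
Qed.

(** Finitely generated projectives in degrees 0 to n. The cone of g has P in degree 0 and G moved up
    by one, so each step extends the complex at its lower end; the inductive form lets [thick]
    properties pass from V to Hom(F, V). *)
Inductive perf : nat -> complex R -> Prop :=
| perf0 P : fgproj P -> perf 0 (in_deg0 P)
| perfS n G P (g : chmap G (in_deg0 P)) : perf n G -> fgproj P -> perf n.+1 (cone g).

Lemma thick_hom_deg0 Q V P : thick Q -> Q V -> fgproj P -> Q (homC idR (in_deg0 P) V).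
Proof.
move=> tQ QV [n [i [r ir]]].
suff h : Q (homC idR (in_deg0 'rV[R]_n) V).
  apply: (th_retr tQ (i := hpre idR V (deg0_map r)) (r := hpre idR V (deg0_map i))) h => k x.
  by apply: hext => a b y _; rewrite !hpreE deg0_mapK.
elim: n {i r ir} => [|n IHn].
  apply: (th_contr tQ); exists (fun _ _ => \0) => k x; apply: hext => a b y _.
  have -> : y = 0 by case: a y => [[|a]|a] y; exact: thinmx0.
  by rewrite !ha0.
have fl : linear (fun x : 'rV[R]_n => row_mx (0 : 'rV[R]_1) x).
  by move=> a x y; rewrite scale_row_mx add_row_mx scaler0 addr0.
have gl : linear (fun x : 'rV[R]_(1 + n) => x 0 (lshift n 0) : R^o).
  by move=> a x y; rewrite !mxE.
have sl : linear (fun c : R^o => row_mx ((c : R)%:M : 'rV[R]_1) (0 : 'rV[R]_n)).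
  move=> a x y; rewrite scale_row_mx add_row_mx scaler0 addr0; congr row_mx.
  by rewrite raddfD /= -mul_scalar_mx -scalar_mxM.
have ds : dsplit (deg0_map (mklin fl)) (deg0_map (mklin gl)).
  split=> [|k].
    apply: ses_deg0 => [x y /eq_row_mx[]|c|x|y y0] //.
    - by exists (row_mx c%:M 0); rewrite /= row_mxEl mxE.
    - by rewrite /= row_mxEl mxE.
    exists (rsubmx y); rewrite /= -[LHS]hsubmxK; congr row_mx.
    by apply/rowP => j; rewrite !ord1 !mxE.
  exists (deg0_map (rsubmx : {linear 'rV[R]_(1 + n) -> 'rV[R]_n}) k), (deg0_map (mklin sl) k).
  split=> x; apply: deg0_mapK => y; first exact: row_mxKr.
  by rewrite /= row_mxEl mxE.
apply: (th_mid tQ (dsplit_hpre V ds)) => //.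
by have [i [r ir]] := hom_deg0_R V; exact: (th_retr tQ ir).
Qed.

(** The suspension of G is the quotient of the contractible cone of its identity by G, so closure
    under shifts need not be postulated in [thick]. *)
Lemma thick_hom_sh Q V G : thick Q -> Q (homC idR G V) -> Q (homC idR (sh 1 G) V).
Proof.
move=> tQ h; apply: (th_left tQ (dsplit_hpre V (dsplit_cone (chmap_id G)))) => //.
by apply: (th_contr tQ); apply: hom_contractible; exact: cone_id_contractible.
Qed.
Lemma thick_hom_perf Q V n F : thick Q -> Q V -> perf n F -> Q (homC idR F V).
Proof.
move=> tQ QV; elim=> [P|m G P g _ IH] Pp; first exact: thick_hom_deg0.
apply: (th_mid tQ (dsplit_hpre V (dsplit_cone g))); first exact: thick_hom_sh.
exact: thick_hom_deg0.
Qed.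

Lemma hzero_retract V W (i : chmap V W) (r : chmap W V) n : (forall x, r n (i n x) = x) ->
  hzero W n -> hzero V n.
Proof. by move=> ri W0 z zc; rewrite -(ri z); apply/chmap_bd/W0/chmap_cy. Qed.
Lemma hpre_id Y V W (i : chmap V W) (r : chmap W V) : (forall k x, r k (i k x) = x) ->
  forall k x, hpre idR Y i k (hpre idR Y r k x) = x.
Proof. by move=> ri k x; apply: hext => a b y _; rewrite !hpreE ri. Qed.
Lemma Kproj_thick : thick (@Kprojective R).
Proof.
split=> [A B C f g ds KA KC X Xa|A B C f g ds KB KC X Xa|A cA X Xa|V W i r ri KW X Xa].
- by have [s _] := dsplit_hpre X ds; apply: ses_acyclic_mid s _ _; [exact: KC | exact: KA].
- by have [s _] := dsplit_hpre X ds; apply: ses_acyclic_right s _ _; [exact: KC | exact: KB].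
- exact: contr_hom_pre.
- by move=> n; apply: (hzero_retract (hpre_id ri (k := n))); exact: KW.
Qed.
Lemma ses_hbounded_mid A B C (f : chmap A B) (g : chmap B C) : ses f g ->
  hbounded A -> hbounded C -> hbounded B.
Proof.
move=> s /hboundedP[a [b [h1 h2]]] /hboundedP[a' [b' [h1' h2']]]; apply/hboundedP.
exists (Num.min a a'), (Num.max b b'); split=> i.
  by rewrite lt_min => /andP[l1 l2]; apply: (ses_hzero_mid s); auto.
by rewrite ge_max => /andP[l1 l2]; apply: (ses_hzero_mid s); auto.
Qed.
Lemma ses_hbounded_right A B C (f : chmap A B) (g : chmap B C) : ses f g ->
  hbounded A -> hbounded B -> hbounded C.
Proof.
move=> s /hboundedP[a [b [h1 h2]]] /hboundedP[a' [b' [h1' h2']]]; apply/hboundedP.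
exists (Num.min a a'), (Num.max (b + 1) b'); split=> i.
  rewrite lt_min => /andP[l1 l2]; apply: (ses_hzero_right s); first exact: h1'.
  by apply: h1; apply: lt_trans l1; rewrite ltrBlDr ltS.
rewrite ge_max => /andP[l1 l2]; apply: (ses_hzero_right s); first exact: h2'.
by apply: h2; rewrite lerBrDr.
Qed.
Lemma ses_hbounded_left A B C (f : chmap A B) (g : chmap B C) : ses f g ->
  hbounded B -> hbounded C -> hbounded A.
Proof.
move=> s /hboundedP[a [b [h1 h2]]] /hboundedP[a' [b' [h1' h2']]]; apply/hboundedP.
exists (Num.min a (a' - 1)), (Num.max b b'); split=> i.
  rewrite lt_min => /andP[l1 l2]; apply: (ses_hzero_left s); last exact: h1.
  by apply: h1'; rewrite -ltrBrDr.
rewrite ge_max => /andP[l1 l2]; apply: (ses_hzero_left s); last exact: h2.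
by apply: h2'; apply: le_trans l2 _; exact: ltW (ltS _).
Qed.
Lemma acyclic_hbounded X : acyclic X -> hbounded X.
Proof. by move=> Xa; apply/hboundedP; exists 0, 0; split=> i _; exact: Xa. Qed.
Lemma hbounded_hom_thick Y : thick (fun V => hbounded (homC idR V Y)).
Proof.
split=> [A B C f g ds KA KC|A B C f g ds KB KC|A cA|V W i r ri].
- by have [s _] := dsplit_hpre Y ds; exact: (ses_hbounded_mid s).
- by have [s _] := dsplit_hpre Y ds; exact: (ses_hbounded_right s).
- by apply: acyclic_hbounded; exact: contr_hom_pre.
move=> /hboundedP[a [b [h1 h2]]]; apply/hboundedP; exists a, b.
by split=> j l; apply: (hzero_retract (hpre_id ri (k := j))); auto.
Qed.

Lemma perf_fgproj n F : perf n F -> dg_fgproj F /\ forall i, ~~ (0 <= i <= n%:Z) -> cx_zero_at F i.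
Proof.
have d0 P : fgproj P -> dg_fgproj (in_deg0 P).
  by move=> Pp [[|k]|k] //; apply: fgproj_zero => x; exact: thinmx0.
elim=> [P Pp|m G P g _ [Gp G0] Pp].
  split=> [|i]; first exact: d0.
  by move=> ni; apply: in_deg0_zero; apply: contraNneq ni => ->.
split=> [i|i ni [y x]]; first by apply: fgproj_prod; [exact: d0 | exact: Gp].
have y0 : y = 0 by apply: in_deg0_zero; apply: contraNneq ni => ->.
have x0 : x = 0.
  apply: G0; apply: contra ni => /andP[l1 l2].
  rewrite (le_trans l1) ?gerBl //=; by rewrite -addn1 PoszD -lerBlDr.
by rewrite y0 x0.
Qed.
Lemma perf_Kproj n F : perf n F -> Kprojective F.
Proof.
move=> /perf_fgproj[Fp F0]; apply: (@Kproj_bounded R F 0).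
  by move=> i; exact: fgproj_projective.
by move=> i lt; apply: F0; rewrite leNgt lt.
Qed.

Inductive fpd : nat -> lmodType R -> Prop :=
| fpd0 N : fgproj N -> fpd 0 N
| fpdS n (K P N : lmodType R) (i : {linear K -> P}) (g : {linear P -> N}) : fgproj P ->
    injective i -> (forall y, exists x, g x = y) -> (forall x, g (i x) = 0) ->
    (forall y, g y = 0 -> exists x, y = i x) -> fpd n K -> fpd n.+1 N.

Lemma fpd_perf n N : fpd n N -> exists F (f : chmap F (in_deg0 N)), perf n F /\ qiso f.
Proof.
elim=> {n N} [N Np|n K P N i g Pp fi gs gf ex _ [F [f [Fp qf]]]].
  by exists (in_deg0 N), (chmap_id _); split; [constructor | exact: qiso_id].
have s := ses_deg0 fi gs gf ex.
have gf' j x : deg0_map g j (deg0_map i j x) = 0 by case: s.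
have uv j x : deg0_map i j (f j x) = chmap_id _ j (chcomp (deg0_map i) f j x) by [].
exists (cone (chcomp (deg0_map i) f)), (chcomp (cone_to gf') (cone_map uv)); split.
  by constructor.
apply: qiso_comp; last exact: cone_to_qiso s _.
by apply: cone_map_qiso => //; exact: qiso_id.
Qed.
End Thick.

(** * Finite flat dimension and perfect resolutions *)

Section TensorTheory.
Variables (R S : comPzRingType) (phi : {rmorphism R -> S}).
Implicit Types (M : lmodType R) (N : lmodType S).

Definition pure M N (x : M) (y : N) : tens phi M N := tens_class phi [:: (x, y)].
Lemma tens_classE M N (s : seq (M * N)) : tens_class phi s = \sum_(p <- s) pure p.1 p.2.
Proof.
elim: s => [|[x y] s IHs]; first by rewrite big_nil.
by rewrite big_cons -IHs -[RHS]/(tens_add _ _) tens_addE.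
Qed.
Lemma pureDl M N (x x' : M) (y : N) : pure (x + x') y = pure x y + pure x' y.
Proof.
rewrite -[RHS]/(tens_add _ _) tens_addE; apply/tens_classP; exact: TensAddl.
Qed.
Lemma pureDr M N (x : M) (y y' : N) : pure x (y + y') = pure x y + pure x y'.
Proof. rewrite -[RHS]/(tens_add _ _) tens_addE; apply/tens_classP; exact: TensAddr. Qed.
Lemma pureZl M N a (x : M) (y : N) : pure (a *: x) y = pure x (phi a *: y).
Proof. by apply/tens_classP; exact: TensScale. Qed.
Lemma pureZr M N a (x : M) (y : N) : pure x (a *: y) = a *: pure x y.
Proof. by rewrite -[RHS]/(tens_scale _ _) tens_scaleE. Qed.
Lemma tens_map_pure M M' N (f : {linear M -> M'}) (x : M) (y : N) :
  tens_map phi f N (pure x y) = pure (f x) y.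
Proof. exact: tens_mapE. Qed.
Lemma tens_eq M N (V : lmodType S) (f g : {linear tens phi M N -> V}) :
  (forall x y, f (pure x y) = g (pure x y)) -> forall u, f u = g u.
Proof.
move=> fg; elim/tens_ind => s; rewrite tens_classE !lin_sum.
by apply: eq_bigr => p _; exact: fg.
Qed.
Lemma tens_lift M N (V : lmodType S) (b : M -> N -> V) :
  (forall x x' y, b (x + x') y = b x y + b x' y) ->
  (forall x, linear (b x)) -> (forall a x y, b (a *: x) y = b x (phi a *: y)) ->
  exists h : {linear tens phi M N -> V}, forall x y, h (pure x y) = b x y.
Proof.
move=> bD bl bZ; pose B (s : seq (M * N)) : V := \sum_(p <- s) b p.1 p.2.
have BC s t : B (s ++ t) = B s + B t by rewrite /B big_cat.
have Bd x y y' : b x (y + y') = b x y + b x y' by rewrite -[y]scale1r bl !scale1r.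
have B0 y : b 0 y = 0 by apply: (addrI (b 0 y)); rewrite -bD !addr0.
have Br s t : tens_rel phi s t -> B s = B t.
  elim=> {s t} //.
  - by move=> s t u _ -> _ ->.
  - by move=> s s' t t' _ h1 _ h2; rewrite !BC h1 h2.
  - by move=> s t; rewrite !BC addrC.
  - by move=> y; rewrite /B big_seq1 big_nil B0.
  - by move=> x x' y; rewrite /B !big_cons !big_nil !addr0 /= bD.
  - by move=> x y y'; rewrite /B !big_cons !big_nil !addr0 /= Bd.
  - by move=> a x y; rewrite /B !big_seq1 /= bZ.
pose h (u : tens phi M N) := B (tens_repr u).
have hE s : h (tens_class phi s) = B s by apply: Br; exact: tens_reprP.
have hl : linear h.
  move=> a; elim/tens_ind => s; elim/tens_ind => t.
  rewrite -[a *: _]/(tens_scale a _) tens_scaleE -[_ + tens_class _ _]/(tens_add _ _) tens_addE.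
  rewrite !hE BC; congr (_ + _); rewrite /B big_map scaler_sumr; apply: eq_bigr => p _ /=.
  by rewrite -[a *: p.2]addr0 bl -[b p.1 0]addr0 -[RHS]addr0; congr (_ + _);
    apply: (addrI (b p.1 0)); rewrite addr0 -Bd addr0.
by exists (mklin hl) => x y; rewrite [LHS]hE /B big_seq1.
Qed.
End TensorTheory.

Section Flat.
Variable R : comPzRingType.
Local Notation idR := (idfun : {rmorphism R -> R}).

(** Maps A -> Hom(P, [cogen]) are maps from the tensor product of A and P to [cogen], and flatness
    keeps A -> B injective after tensoring. *)
Lemma flat_dual_inj (P : lmodType R) : flat P -> inj_mod (shom idR P (cogen R)).
Proof.
move=> Pf A B f g fi.
have [|||h hP] := @tens_lift R R idR A P (cogen R) (fun a p => shom_fun (g a) p).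
- by move=> x x' y; rewrite linearD.
- by move=> x a y z; rewrite -[a *: y]/(idR a *: y) shom_linP.
- by move=> a x y; rewrite linearZ_LR shom_funZ.
have [k kP] := @cogen_inj R _ _ (tens_map idR f P) h (Pf _ _ f fi).
have kl b a (x y : P) : k (pure idR b (idR a *: x + y)) = a *: k (pure idR b x) + k (pure idR b y).
  by rewrite pureDr pureZr linearP.
have gl : linear (fun b => mkshom (kl b) : shom idR P (cogen R)).
  move=> a x y; apply: shomP => z; rewrite shom_funD shom_funZ !mkshomE.
  by rewrite pureDl pureZl linearD.
exists (mklin gl) => a; apply: shomP => p; rewrite mkshomE.
apply: etrans (etrans _ (kP (pure idR a p))) (hP a p).
by congr (k _); symmetry; exact: tens_map_pure.
Qed.

(** A map of free modules of finite rank whose Q/Z-dual is regular is regular: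
    a functional vanishing on all d T d kills d by a trace computation. *)
Lemma dual_regular a b (d : {linear 'rV[R]_a -> 'rV[R]_b})
  (s : {linear shom idR 'rV[R]_a (cogen R) -> shom idR 'rV[R]_b (cogen R)}) :
  (forall h, pre_lin idR (cogen R) d (s (pre_lin idR (cogen R) d h)) = pre_lin idR (cogen R) d h) ->
  exists T : {linear 'rV[R]_b -> 'rV[R]_a}, forall x, d (T (d x)) = d x.
Proof.
set D := pre_lin idR (cogen R) d => DsD.
pose toh m n (f : {linear 'rV[R]_m -> 'rV[R]_n}) : shom idR 'rV[R]_m 'rV[R]_n := of_linear f.
(* The map T |-> d T d, with image U. The claim is that d lies in U; otherwise a functional F into
   [cogen] kills all d T d but not d. *)
have Wl : linear (fun T : shom idR 'rV[R]_b 'rV[R]_a =>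
   mkshom (fun c x y => etrans (congr1 (fun z => d (shom_fun T z)) (linearP d (idR c) x y))
     (etrans (congr1 d (shom_linP T c (d x) (d y))) (linearP d c _ _))) : shom idR 'rV[R]_a 'rV[R]_b).
  move=> c T T'; apply: shomP => x; rewrite shom_funD shom_funZ !mkshomE.
  by rewrite shom_funD shom_funZ linearD linearZ_LR.
pose U := img (mklin Wl).
have [[T /(congr1 (@shom_fun _ _ _ _ _)) TE]|nU] := pselect (U (toh _ _ d)).
  have Tl : linear (shom_fun T : 'rV[R]_b -> 'rV[R]_a).
    by move=> c x y; rewrite -[c *: x]/(idR c *: x) shom_linP.
  exists (mklin Tl) => x; symmetry; exact: (congr1 (fun f => f x) TE).
exfalso; have q0 : qpi U (toh _ _ d) != 0 by apply/eqP => /qpi0.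
have [f fn] := cogenP q0; move/eqP: fn; apply.
pose F : {linear shom idR 'rV[R]_a 'rV[R]_b -> cogen R} := f \o qpi U.
rewrite -[LHS]/(F (toh _ _ d)).
have F0 T : F (mklin Wl T) = 0.
  by rewrite /F /= -[RHS](linear0 f); congr (f _); apply/qpi0; exists T.
(* e x y is F of the rank one map z |-> (z x) y *)
have onel (i : 'I_a) (y : 'rV[R]_b) c (z w : 'rV[R]_a) :
   (idR c *: z + w) 0 i *: y = c *: (z 0 i *: y) + w 0 i *: y.
  by rewrite !mxE scalerDl scalerA.
pose one i y : shom idR 'rV[R]_a 'rV[R]_b := mkshom (onel i y).
have el i c (y z : 'rV[R]_b) : F (one i (idR c *: y + z)) = c *: F (one i y) + F (one i z).
  rewrite -linearP; congr (F _); apply: shomP => x.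
  rewrite shom_funD shom_funZ !mkshomE scalerDr !mxE scalerA mulrC.
  by rewrite -scalerA.
pose e i : shom idR 'rV[R]_b (cogen R) := mkshom (el i).
have FE (h : {linear 'rV[R]_a -> 'rV[R]_b}) : F (toh _ _ h) = \sum_i shom_fun (e i) (h (delta_mx 0 i)).
  have -> : toh _ _ h = \sum_i one i (h (delta_mx 0 i)).
    apply: shomP => x; rewrite -[LHS]/(h x) rv_lin.
    elim/big_rec2: _ => [//|i y g _ IH]; rewrite shom_funD mkshomE; congr (_ + _).
    exact: IH.
  by rewrite lin_sum; apply: eq_bigr => i _; rewrite mkshomE.
(* By linearity g j sends y to F of the map z |-> (d z)_j y. Hence D (g j) at x is F (d T d) for T y
   = y_j x, which vanishes. *)
pose g (j : 'I_b) : shom idR 'rV[R]_b (cogen R) := \sum_i (d (delta_mx 0 i)) 0 j *: e i.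
have sumE (I : finType) (h : I -> shom idR 'rV[R]_b (cogen R)) x :
   shom_fun (\sum_i h i) x = \sum_i shom_fun (h i) x.
  by elim/big_rec2: _ => [//|i y k _ <-]; rewrite shom_funD.
have Dg j : D (g j) = 0.
  apply: shomP => x; rewrite pre_linE sumE shom_fun0.
  have Tl c (y z : 'rV[R]_b) : (idR c *: y + z) 0 j *: x = c *: (y 0 j *: x) + z 0 j *: x.
    by rewrite !mxE scalerDl scalerA.
  rewrite -[RHS](F0 (mkshom Tl)).
  have -> : mklin Wl (mkshom Tl) = \sum_i one i ((d (delta_mx 0 i)) 0 j *: d x).
    apply: shomP => z; rewrite mkshomE linearZ_LR.
    have -> : d z = \sum_i z 0 i *: d (delta_mx 0 i) by rewrite rv_lin.
    rewrite summxE scaler_suml.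
    elim/big_rec2: _ => [//|i y k _ IH]; rewrite shom_funD mkshomE IH.
    by rewrite mxE scalerA.
  by rewrite lin_sum; apply: eq_bigr => i _; rewrite shom_funZ mkshomE.
rewrite FE.
(* The trace computation: F d is the sum of the values D (e i) at the i-th basis vector. Replacing D
   by D s D, expanding d in coordinates and exchanging the sums collects the e i into the g j, whose
   D is 0. *)
have -> : \sum_i shom_fun (e i) (d (delta_mx 0 i)) = \sum_j shom_fun (s (D (g j))) (delta_mx 0 j).
  transitivity (\sum_i \sum_j (d (delta_mx 0 i)) 0 j *: shom_fun (s (D (e i))) (delta_mx 0 j)).
    apply: eq_bigr => i _.
    rewrite -[LHS]/(shom_fun (D (e i)) (delta_mx 0 i)) -[in LHS]DsD.
    rewrite -[LHS]/(shom_fun (s (D (e i))) (d (delta_mx 0 i))).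
    rewrite {1}(row_delta (d _)) -[LHS]/((s (D (e i)) : {linear restr idR _ -> cogen R}) _).
    rewrite (lin_sum (s (D (e i)) : {linear restr idR 'rV[R]_b -> cogen R})).
    by apply: eq_bigr => j _; exact: shom_fun_atZ.
  rewrite exchange_big; apply: eq_bigr => j _; rewrite /g.
  rewrite [D _](lin_sum D) (lin_sum s) sumE; apply: eq_bigr => i _.
  by rewrite !linearZ_LR shom_funZ shom_fun_atZ.
by rewrite big1 // => j _; rewrite Dg linear0.
Qed.

(** From d T d = d it follows that 1 - d T vanishes on the image of d; it therefore factors through
    the cokernel N and splits p. *)
Lemma coker_retract (P Q N : lmodType R) (p : {linear Q -> N}) (d : {linear P -> Q})
  (T : {linear Q -> P}) : (forall y, exists x, p x = y) -> (forall x, p x = 0 -> exists y, x = d y) ->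
  (forall x, p (d x) = 0) -> (forall x, d (T (d x)) = d x) ->
  exists t : {linear N -> Q}, cancel t p.
Proof.
move=> /choice[s sP] pd dp dTd.
have E x y : p x = p y -> x - d (T x) = y - d (T y).
  move=> e; have [|z zP] := pd (x - y); first by rewrite linearB e subrr.
  have := dTd z; rewrite -zP !linearB => h.
  apply/eqP; rewrite -subr_eq0; apply/eqP.
  have -> : x - d (T x) - (y - d (T y)) = (x - y) - (d (T x) - d (T y)) by zm.
  by rewrite h subrr.
have tl : linear (fun y => s y - d (T (s y))).
  move=> a y z; rewrite (E _ (a *: s y + s z)); last by rewrite linearP !sP.
  by rewrite [T _]linearP [d _]linearP scalerBr; zm.
by exists (mklin tl) => y; rewrite /= linearB dp subr0 sP.
Qed.

Lemma fgproj_retract (P Q : lmodType R) (i : {linear P -> Q}) (r : {linear Q -> P}) :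
  cancel i r -> fgproj Q -> fgproj P.
Proof.
move=> ir [n [j [t jt]]]; exists n, (j \o i), (r \o t) => x.
by rewrite /= jt ir.
Qed.

Definition regular_at (Q : complex R) l := exists T : {linear Q l -> Q (l + 1)},
  forall x, cd Q (l + 1) l (T (cd Q (l + 1) l x)) = cd Q (l + 1) l x.

(** n counts the syzygies still to be taken before degree l. There the incoming differential is
    regular, so its cokernel is a retract of Q_l and the resolution can stop. *)
Lemma fpd_resolution (Q : complex R) : dg_fgproj Q ->
  forall n (j l : int) (N : lmodType R) (p : {linear Q j -> N}), l = j + n%:Z -> regular_at Q l ->
  (forall i, j < i -> hzero Q i) ->
  (forall y, exists x, p x = y) -> (forall x, p x = 0 -> is_boundary x) ->
  (forall x : Q (j + 1), p (cd Q (j + 1) j x) = 0) -> fpd n N.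
Proof.
move=> Qp; elim=> [|n IHn] j l N p e [T dTd] Q0 ps pk pd.
  rewrite addr0 in e; case: _ / (esym e) in T dTd *.
  have [|t tP] := @coker_retract _ _ _ p (cd Q (j + 1) j) T ps _ pd dTd.
    by move=> x /pk/bdP.
  by apply: fpd0; exact: fgproj_retract tP (Qp j).
have [d' [d'P d's]] := img_onto (cd Q (j + 1) j).
apply: (fpdS (Qp j) (i := sinc (img (cd Q (j + 1) j))) (g := p)) => //.
- exact: sinc_inj.
- by move=> x; have [y ->] := sincP x; exact: pd.
- by move=> y /pk/bdP h; exists (mksub (U := img (cd Q (j + 1) j)) h).
apply: (IHn (j + 1) l _ d') => //.
- by rewrite e -addn1 addnC PoszD addrA.
- by exists T.
- by move=> i lt; apply: Q0; exact: lt_trans (ltS j) lt.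
- move=> x x0; apply: Q0; first exact: ltS.
  by apply: (cy_at (esym (addrK 1 j))); rewrite -d'P x0 linear0.
- by move=> x; apply: sinc_inj; rewrite d'P cd_cd linear0.
Qed.

Lemma dual_regular_eq (A B : lmodType R) (d : {linear A -> B})
  (s : {linear shom idR A (cogen R) -> shom idR B (cogen R)}) :
  (exists a, A = 'rV[R]_a) -> (exists b, B = 'rV[R]_b) ->
  (forall h, pre_lin idR (cogen R) d (s (pre_lin idR (cogen R) d h)) = pre_lin idR (cogen R) d h) ->
  exists T : {linear B -> A}, forall x, d (T (d x)) = d x.
Proof.
move=> [a eA] [b eB]; case: _ / (esym eA) in d s *; case: _ / (esym eB) in d s *.
exact: dual_regular.
Qed.

(** The cone of f is contractible. In a degree where V vanishes the V-component of the contraction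
    contributes nothing, and its W-component contracts W there. *)
Lemma Kinj_contraction (V W : complex R) (f : chmap V W) : Kinjective V -> Kinjective W -> qiso f ->
  exists s : forall i j, {linear W i -> W j}, forall i k w, cx_zero_at V i -> k = i + 1 ->
    cd W k i (s i k w) + s (i - 1) i (cd W i (i - 1) w) = w.
Proof.
move=> KV KW qf; have [s sP] := qiso_Kinj_contr KV KW qf.
exists (fun i j => (fst : {linear cone f j -> W j}) \o s i j \o tw_in (cone_tw f) i).
move=> i k w V0 ->.
have := congr1 fst (sP i (cone_in f i w)).
have -> : cd (cone f) i (i - 1) (cone_in f i w) = cone_in f (i - 1) (cd W i (i - 1) w).
  exact: chmapP.
move=> E.
rewrite -[RHS]E /= -[(w, 0)]/(cone_in f i w); case: (s i (i + 1) (cone_in f i w)) => u v.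
rewrite /twd_fun /=; congr (_ + _).
by rewrite [tr V _ _ _]V0 linear0 addr0.
Qed.

(** * Koszul complexes *)

Section Functional.
Variables (Q : complex R) (l : int).
Local Notation E := (in_deg0 (cogen R)).
Local Notation W := (homC idR Q E).
Fact hfun_subproof (h : shom idR (Q l) (cogen R)) i j a (x y : Q i) :
  tr E 0 j (shom_fun h (tr Q i l (idR a *: x + y))) =
  a *: tr E 0 j (shom_fun h (tr Q i l x)) + tr E 0 j (shom_fun h (tr Q i l y)).
Proof. by rewrite linearP -[a *: tr _ _ _ _]/(idR a *: _) shom_linP linearP. Qed.
Fact hfun_linear : linear (fun h => mkh (- l) (fun i j => mkshom (@hfun_subproof h i j)) : W (- l)).
Proof.
move=> a h k; apply: hext => i j x e; rewrite hDa hZa !ha_mkh // !mkshomE.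
by rewrite shom_funD shom_funZ linearD linearZ_LR.
Qed.
Definition hfun : {linear shom idR (Q l) (cogen R) -> W (- l)} := mklin hfun_linear.
Fact hval_linear : linear (fun w : W (- l) => hcomp (w : homdeg idR Q E (- l)) l 0 : shom idR (Q l) (cogen R)).
Proof. by []. Qed.
Definition hval : {linear W (- l) -> shom idR (Q l) (cogen R)} := mklin hval_linear.
Lemma hvalE w x : shom_fun (hval w) x = ha w 0 x. Proof. by []. Qed.
Lemma hfunK h : hval (hfun h) = h.
Proof. by apply: shomP => x; rewrite hvalE ha_mkh ?subrr // mkshomE !trE. Qed.
Lemma hvalK w : hfun (hval w) = w.
Proof.
apply: hext => i j x e; rewrite ha_mkh // mkshomE hvalE.
have [e'|ne] := eqVneq i l; last first.
  rewrite [tr Q _ _ _]tr_ne // ha0 linear0; symmetry; apply: in_deg0_zero.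
  by rewrite e subr_eq0.
by rewrite e' in x e *; rewrite trE tr_ha // e subrr.
Qed.
End Functional.

(** Dualized into [cogen], q becomes a quasi-isomorphism of K-injective complexes. The dual of P
    vanishes in degree -(l + 1), so by [Kinj_contraction] the dual of Q is contracted there. This
    makes the dual differential regular, and [dual_regular] carries regularity back to Q. *)
Lemma dual_res_regular (P Q : complex R) (q : chmap Q P) (l : int) :
  (forall i, inj_mod (shom idR (P i) (cogen R))) -> (forall i, ~~ (0 <= i <= l) -> cx_zero_at P i) ->
  (forall i, exists k, Q i = 'rV[R]_k) -> (forall i, i < 0 -> cx_zero_at Q i) -> qiso q ->
  regular_at Q l.
Proof.
move=> Pi P0 Qr Q0 qq; set E := in_deg0 (cogen R).
have Ei : dg_inj E.
  move=> [[|k]|k]; [exact: cogen_inj | |]; by apply: inj_zero => x; exact: thinmx0.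
have KE : Kinjective E by apply: (@Kinj_bounded R E 0) => // i gt; apply: in_deg0_zero; rewrite gt_eqF.
have Kh (Y : complex R) : (forall i, inj_mod (shom idR (Y i) (cogen R))) ->
    (forall i, i < 0 -> cx_zero_at Y i) -> Kinjective (homC idR Y E).
  move=> Yi Y0; apply: (@Kinj_bounded R _ 0).
    apply: dg_inj_hom => i [[|k]|k]; first exact: Yi.
      by apply: inj_zero => h; apply: shomP => x; exact: thinmx0.
    by apply: inj_zero => h; apply: shomP => x; exact: thinmx0.
  move=> n gt; apply: hom_zero => i j e; have [j0|nj] := eqVneq j 0; last by right; exact: in_deg0_zero.
  left; apply: Y0; move: e; rewrite j0 => /eqP; rewrite eq_sym addr_eq0 => /eqP ->.
  by rewrite oppr_lt0.
have Qp i : projective (Q i) by have [k ->] := Qr i; exact: projective_rv.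
have [|||s sP] := @Kinj_contraction _ _ (hpre idR E q).
- by apply: Kh => // i lt; apply: P0; rewrite leNgt lt.
- by apply: Kh => // i; apply: inj_shom => //; exact: cogen_inj.
- exact: qiso_hpre_Kinj.
set W := homC idR Q E in s sP *.
pose D := pre_lin idR (cogen R) (cd Q (l + 1) l).
pose w h : W (- (l + 1)) := cd W (- l) (- (l + 1)) (hfun Q l h).
have e1 : - l = - (l + 1) + 1 by rewrite opprD subrK.
pose c : R := - (-1) ^+ absz (- l).
have cc : c * c = 1 by rewrite mulrNN -expr2 sqrr_sign.
have DE h : D h = c *: hval Q (l + 1) (w h).
  apply: shomP => x; rewrite /c scaleNr shom_funN shom_fun_sign hvalE.
  rewrite (homC_cd _ _ e1 (j' := 1) (i' := l)) ?addrK // [cd (in_deg0 _) _ _ _]/(0 : _) sub0r scalerN opprK signK.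
  by rewrite -[ha _ _ _]/(shom_fun (hval Q l (hfun Q l h)) (cd Q (l + 1) l x)) hfunK.
pose sg h : shom idR (Q l) (cogen R) :=
  c *: hval Q l (s (- (l + 1)) (- l) (hfun Q (l + 1) h)).
have sl : linear sg.
  move=> a h k; rewrite /sg linearP [s _ _ _]linearP [hval _ _ _]linearP scalerDr.
  by rewrite !scalerA mulrC.
have e0 : cx_zero_at (homC idR P E) (- (l + 1)).
  apply: hom_zero => i j e; have [j0|nj] := eqVneq j 0; last by right; exact: in_deg0_zero.
  left; apply: P0; move: e; rewrite j0 => /eqP; rewrite eq_sym subr_eq0 => /eqP ->.
  by rewrite negb_and -!ltNge ltS orbT.
apply: (@dual_regular_eq _ _ (cd Q (l + 1) l) (mklin sl)) => // h.
rewrite -/D -[mklin sl _]/(sg (D h)).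
have h1 : s (- (l + 1)) (- l) (hfun Q (l + 1) (D h)) = c *: s (- (l + 1)) (- l) (w h).
  by rewrite DE [hfun _ _ _]linearZ_LR hvalK [s _ _ _]linearZ_LR.
have h2 : sg (D h) = hval Q l (s (- (l + 1)) (- l) (w h)).
  by rewrite /sg h1 [hval _ _ _]linearZ_LR scalerA cc scale1r.
rewrite DE [in RHS]DE; congr (_ *: hval _ _ _).
rewrite h2 {1}/w hvalK; have := sP (- (l + 1)) (- l) (w h) e0 e1.
by rewrite {2}/w cd_cd linear0 addr0.
Qed.

(** Flat and projective modules both have injective character duals, so this one statement turns
    finite resolutions of either kind into finite ones by finitely generated projectives, of the
    same length. *)
Lemma fpd_of_res (noethR : noetherian R) (N : lmodType R) (n : nat) : fin_gen N ->
  has_res (fun P => inj_mod (shom idR P (cogen R))) N n%:Z -> fpd n N.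
Proof.
move=> Nf [P [f [Pi P0 qf]]].
have N0 i : i < 0 -> hzero (in_deg0 N) i.
  by move=> lt; apply/hzero_zero_at/in_deg0_zero; rewrite lt_eqF.
have Nfg i : hfin_gen (in_deg0 N) i.
  apply: fin_gen_hfin => //; case: i => [[|i]|i]; first exact: Nf.
    by exists [::] => x; exists (fun=> 0); rewrite big_ord0; exact: thinmx0.
  by exists [::] => x; exists (fun=> 0); rewrite big_ord0; exact: thinmx0.
have [Q [g [Qr Q0 qg]]] := proj_res_exists noethR N0 Nfg.
have Qp i : fgproj (Q i) by have [k ->] := Qr i; exact: fgproj_rv.
have KQ : Kprojective Q by apply: (@Kproj_bounded R Q 0) => // i; exact: fgproj_projective.
have [q qP] := Kproj_lift g KQ qf.
have qq : qiso q.
  by apply: (qiso_cancel_r qf); apply: qiso_hequal qg; exact: homotopic_hequal.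
have rQ : regular_at Q n%:Z by exact: dual_res_regular qq.
apply: (@fpd_resolution Q Qp n 0 n%:Z N (g 0)) => //.
- move=> i gt; apply/(qiso_hzero _ qg)/hzero_zero_at/in_deg0_zero; by rewrite gt_eqF.
- move=> y; have [|z zc [k [v e]]] := (qg 0).2 y; first by move=> j.
  by exists z; apply/eqP; rewrite eq_sym -subr_eq0 e.
- move=> x x0; apply: (qg 0).1; last by rewrite x0; exact: bd0.
  by apply/cyP; rewrite [LHS]Q0.
- by move=> x; rewrite -chmapP.
Qed.
End Flat.

(** * Koszul complexes as iterated cones, and evaluation at a cycle *)

Section Koszul.
Variable R : comPzRingType.
Implicit Types A B C V W : complex R.
Local Notation idR := (idfun : {rmorphism R -> R}).

Lemma lin_ext (M N : lmodType R) (f g : {linear M -> N}) : (forall x, f x = g x) -> f = g.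
Proof.
case: f g => f [[f1] [f2]] [g [[g1] [g2]]] fg.
have e : f = g by apply: funext => x; exact: fg.
by case: _ / e g1 g2 {fg} => g1 g2;
  rewrite (Prop_irrelevance f1 g1) (Prop_irrelevance f2 g2).
Qed.
Lemma chmap_ext V W (f g : chmap V W) : (forall i x, f i x = g i x) -> f = g.
Proof.
case: f g => f fP [g gP] /= fg.
have e : f = g by apply: functional_extensionality_dep => i; apply: lin_ext; exact: fg.
by case: _ / e gP {fg} => gP; rewrite (Prop_irrelevance fP gP).
Qed.

Definition hom_by x V : chmap V V := chmap_scale x (chmap_id V).
Lemma hom_byE x V i (v : V i) : hom_by x V i v = x *: v. Proof. by []. Qed.
Definition cone_by x V := cone (hom_by x V).
Fact cone_by_subproof x V W (f : chmap V W) i v : hom_by x W i (f i v) = f i (hom_by x V i v).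
Proof. by rewrite !hom_byE linearZ_LR. Qed.
Definition cone_by_map x V W (f : chmap V W) : chmap (cone_by x V) (cone_by x W) :=
  cone_map (cone_by_subproof x f).

(** The Koszul complex of xs tensored with V, obtained from cones of homotheties without a tensor
    product of complexes. *)
Fixpoint kos (xs : seq R) V : complex R := if xs is x :: xs' then kos xs' (cone_by x V) else V.
Fixpoint kos_map xs V W (f : chmap V W) : chmap (kos xs V) (kos xs W) :=
  match xs return chmap (kos xs V) (kos xs W) with
  | [::] => f | x :: xs' => kos_map xs' (cone_by_map x f) end.
Lemma ses_kos xs A B C (f : chmap A B) (g : chmap B C) : ses f g ->
  ses (kos_map xs f) (kos_map xs g).
Proof.
elim: xs A B C f g => [//|x xs IH] A B C f g s; apply: IH.
by apply: ses_cones.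
Qed.
Lemma qiso_kos xs V W (f : chmap V W) : qiso f -> qiso (kos_map xs f).
Proof.
elim: xs V W f => [//|x xs IH] V W f qf; apply: IH.
by apply: cone_map_qiso.
Qed.

Definition killed x V := forall i (v : V i), x *: v = 0.

Definition zerocx : complex R := in_deg0 ('rV[R]_0 : lmodType R).
Lemma zerocxP i : cx_zero_at zerocx i.
Proof. by case: i => [[|i]|i] x; exact: thinmx0. Qed.
Lemma killed_cone x V W (f : chmap V W) : killed x V -> killed x W -> killed x (cone f).
Proof. by move=> xV xW i [w v]; apply: injective_projections; [exact: xW | exact: xV]. Qed.
Lemma killed_zero x : killed x zerocx.
Proof. by move=> i v; rewrite [v]zerocxP scaler0. Qed.

(** The inclusion of xV in V gives an exact sequence of cones, from V -> xV through x : V -> V to 0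
    -> V/xV. As V -> xV is onto, its cone is quasi-isomorphic to the shifted annihilator of x in V.
    Both outer pieces are killed by x and still by everything that kills V. *)
Lemma cone_by_pieces (Q : complex R -> Prop) (ys : seq R) x V :
  (forall X Y (f : chmap X Y), qiso f -> Q X <-> Q Y) ->
  (forall A B C (f : chmap A B) (g : chmap B C), ses f g -> Q A -> Q C -> Q B) ->
  (forall W, (forall y, y \in x :: ys -> killed y W) -> Q W) ->
  (forall y, y \in ys -> killed y V) -> Q (cone_by x V).
Proof.
move=> Qq Qs Qk ysV.
pose xV i := img (hom_by x V i).
have dxV i j v : xV i v -> xV j (cd V i j v).
  by move=> [w ->]; exists (cd V i j w); rewrite chmapP.
pose K i := ker (hom_by x V i).
have dK i j v : K i v -> K j (cd V i j v).
  by move=> Kv; apply: etrans (linear0 (cd V i j)); rewrite -Kv; symmetry; exact: (chmapP (hom_by x V)).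
have /dep_choice [p pP] i : exists g : {linear V i -> subm (xV i)}, (forall v, sinc (xV i) (g v) = x *: v) /\
    forall y, exists v, g v = y.
  by have [g [h1 h2]] := img_onto (hom_by x V i); exists g.
have pc i j v : cd (subcx dxV) i j (p i v) = p j (cd V i j v).
  by apply: sinc_inj; rewrite subdE !(pP _).1 linearZ_LR.
pose pm : chmap V (subcx dxV) := Chmap pc.
have sK : ses (sub_in dK) pm.
  split=> i; [exact: sinc_inj | exact: (pP i).2 | move=> v | move=> v v0].
    apply: (@sinc_inj _ _ (xV i)); rewrite (pP i).1 linear0; exact: (sincP v).
  have Kv : K i v by rewrite /= -(pP i).1 [X in sinc _ X]v0 linear0.
  by exists (mksub Kv).
have s0 X : ses (chmap0 zerocx X) (chmap_id X).
  split=> i //; first by move=> y z _; rewrite [y]zerocxP [z]zerocxP.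
    by move=> y; exists y.
  by move=> y y0; exists 0; rewrite linear0.
have s1 X : ses (chmap_id X) (chmap0 X zerocx).
  split=> i //; first by move=> y; exists 0; rewrite [y]zerocxP linear0.
  by move=> y _; exists y.
have Qp : Q (cone pm).
  have e1 i (v : subcx dK i) : pm i (sub_in dK i v) = chmap0 zerocx _ i (chmap0 (subcx dK) zerocx i v).
    by case: sK => _ _ -> _.
  have e2 i (v : V i) : chmap_id (subcx dxV) i (pm i v) = chmap_id _ i (pm i v) by [].
  have s := ses_cones e1 e2 sK (s0 _).
  have q : qiso (cone_map e1) by apply: (ses_qiso_in s); apply/qisoP; exact: qiso_id.
  apply/(Qq _ _ _ q)/Qk => y; rewrite inE => yx; apply: killed_cone; last exact: killed_zero.
  move=> i v; apply: (@sinc_inj _ _ (K i)); rewrite linearZ_LR linear0.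
  by case/orP: yx => [/eqP->|/ysV ->//]; exact: (sincP v).
have e1 i (v : V i) : hom_by x V i (chmap_id V i v) = sub_in dxV i (pm i v).
  by rewrite [RHS](pP i).1.
have e2 i (v : V i) : chmap0 zerocx (quocx dxV) i (chmap0 V zerocx i v) = quo_out dxV i (hom_by x V i v).
  by rewrite [LHS]linear0; symmetry; apply/qpi0; exists v.
apply: (Qs _ _ _ _ _ (ses_cones e1 e2 (s1 V) (ses_subquo dxV))) Qp _.
apply: Qk => y; rewrite inE => yx; apply: killed_cone; first exact: killed_zero.
move=> i q; have [v <-] := qpi_surj q; rewrite -linearZ_LR; apply/qpi0.
by case/orP: yx => [/eqP->|/ysV yk]; [exists v | rewrite yk; exact: sub_0].
Qed.

(** On a cone of x the element x acts only null-homotopically, whereas [null_eta] requires it to act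
    as 0. So the Koszul complex is decomposed into pieces that are strictly killed; ys collects the
    elements already dealt with. *)
Lemma kos_pieces (Q : complex R -> Prop) (xs ys : seq R) V :
  (forall X Y (f : chmap X Y), qiso f -> Q X <-> Q Y) ->
  (forall A B C (f : chmap A B) (g : chmap B C), ses f g -> Q A -> Q C -> Q B) ->
  (forall W, (forall y, y \in xs ++ ys -> killed y W) -> Q W) ->
  (forall y, y \in ys -> killed y V) -> Q (kos xs V).
Proof.
move=> Qq Qs; elim: xs ys V => [|x xs IH] ys V Qk ysV; first exact: Qk.
apply: (@cone_by_pieces (fun W => Q (kos xs W)) ys) => //.
- by move=> X Y f /(qiso_kos xs)/Qq.
- by move=> A B C f g /(ses_kos xs)/Qs.
move=> W kW; apply: (IH (x :: ys)) => // W' kW'; apply: Qk => y yx; apply: kW'.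
by move: yx; rewrite !(mem_cat, inE) -?orbA => /or3P[] ->; rewrite ?orbT.
Qed.

Section Nil.
Variables (F : complex R) (u : F 0) (uc : is_cycle u) (I : complex R).
Hypotheses (Fp : dg_proj F) (KF : Kprojective F) (Ii : dg_inj I) (KI : Kinjective I).

Definition Phi V := homC idR F V.
Definition ev V : chmap (Phi V) V := hev V uc.
(** If [eta V] induces 0 on the homology of Hom(-, I), then the homology of Hom(V, I) embeds in that
    of Hom(Phi V, I), and bounds for the latter hold for the former. *)
Definition Theta V := cone (ev V).
Definition eta V : chmap V (Theta V) := cone_in (ev V).
Fact Theta_subproof V W (f : chmap V W) i h : ev W i (hpost idR F f i h) = f i (ev V i h).
Proof. by rewrite /ev !hevE hpostE. Qed.
Definition Theta_map V W (f : chmap V W) : chmap (Theta V) (Theta W) := cone_map (Theta_subproof f).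

Fixpoint Th n V : complex R := if n is m.+1 then Theta (Th m V) else V.
Fixpoint Th_map n V W (f : chmap V W) : chmap (Th n V) (Th n W) :=
  match n return chmap (Th n V) (Th n W) with 0 => f | m.+1 => Theta_map (Th_map m f) end.
Fixpoint Th_eta n a V : chmap (Th a V) (Th (n + a) V) :=
  match n return chmap (Th a V) (Th (n + a) V) with
  | 0 => chmap_id _ | m.+1 => chcomp (eta _) (Th_eta m a V) end.

Lemma Th_eta_nat n a V W (f : chmap V W) i x :
  Th_map (n + a) f i (Th_eta n a V i x) = Th_eta n a W i (Th_map a f i x).
Proof.
elim: n => [//|n IH]; rewrite [RHS]/= -IH.
by apply: injective_projections; [| exact: linear0].
Qed.
Lemma ses_Th n A B C (f : chmap A B) (g : chmap B C) : ses f g -> ses (Th_map n f) (Th_map n g).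
Proof.
by move=> s; elim: n => [//|n IH]; apply: ses_cones => //; exact: ses_hpost_proj.
Qed.
Lemma qiso_Th n V W (f : chmap V W) : qiso f -> qiso (Th_map n f).
Proof.
by move=> q; elim: n => [//|n IH]; apply: cone_map_qiso => //; exact: qiso_hpost_Kproj.
Qed.
(** The codomains at n + (m + a) and at (n + m) + a are different types; a predicate over all
    codomains avoids a transport. *)
Lemma Th_eta_add a V n m (P : forall W, chmap (Th a V) W -> Prop) :
  P _ (chcomp (Th_eta n (m + a) V) (Th_eta m a V)) -> P _ (Th_eta (n + m) a V).
Proof.
elim: n P => [|n IH] P /=.
  by have -> : chcomp (chmap_id (Th (m + a) V)) (Th_eta m a V) = Th_eta m a V by apply: chmap_ext.
move=> h; apply: (IH (fun W e => P _ (chcomp (eta W) e))).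
by rewrite (_ : chcomp _ _ = chcomp (chcomp (eta (Th (n + (m + a)) V)) (Th_eta n (m + a) V)) (Th_eta m a V)) //; apply: chmap_ext.
Qed.

Definition null V W (e : chmap V W) := forall n (h : homC idR W I n), is_cycle h ->
  is_boundary (hpre idR I e n h).
(** Nilpotence of [eta], as seen by Hom(-, I). In [Nil_ses] the map for one outer term is applied
    after some powers of [Theta] have already been taken, so the exponent n must be uniform in the
    starting point a. *)
Definition Nil V := exists n, forall a, null (Th_eta n a V).

Lemma hpre_comp V W X (f : chmap V W) (g : chmap W X) n h :
  hpre idR I (chcomp g f) n h = hpre idR I f n (hpre idR I g n h).
Proof. by apply: hext => i j x _; rewrite !hpreE. Qed.
Lemma hpre_sq V W V' W' (f : chmap V W) (g : chmap W W') (f' : chmap V V') (g' : chmap V' W') n h :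
  (forall i x, g i (f i x) = g' i (f' i x)) ->
  hpre idR I f n (hpre idR I g n h) = hpre idR I f' n (hpre idR I g' n h).
Proof. by move=> e; apply: hext => i j x _; rewrite !hpreE e. Qed.

Lemma Nil_qiso V W (f : chmap V W) : qiso f -> Nil V <-> Nil W.
Proof.
move=> qf; split=> -[n nP]; exists n => a k h hc.
  apply: ((qiso_hpre_Kinj KI (qiso_Th a qf)) k).1; first exact: chmap_cy.
  rewrite (hpre_sq _ (fun i x => esym (@Th_eta_nat n a _ _ f i x))).
  by apply: nP; exact: chmap_cy.
have [h' h'c h'P] := ((qiso_hpre_Kinj KI (qiso_Th (n + a) qf)) k).2 h hc.
rewrite -(subrK (hpre idR I (Th_map (n + a) f) k h') h) linearD; apply: bdD; first exact: chmap_bd.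
rewrite (hpre_sq _ (@Th_eta_nat n a _ _ f)); apply: chmap_bd; exact: nP.
Qed.
Lemma Nil_ses A B C (f : chmap A B) (g : chmap B C) : ses f g -> Nil A -> Nil C -> Nil B.
Proof.
move=> s [nA hA] [nC hC]; exists (nA + nC)%N => a.
apply: (@Th_eta_add a B nA nC (fun W e => null e)) => k h hc.
rewrite hpre_comp; set b := (nC + a)%N in h hc *.
have sb := ses_hpre_inj idR (ses_Th b s) Ii.
have [||h'' h''c h''P] := ses_mid sb (z := hpre idR I (Th_eta nA b B) k h).
- exact: chmap_cy.
- rewrite -(hpre_sq _ (@Th_eta_nat nA b _ _ f)); apply: hA; exact: chmap_cy.
rewrite -(subrK (hpre idR I (Th_map b g) k h'') (hpre idR I (Th_eta nA b B) k h)) linearD.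
apply: bdD; first exact: chmap_bd.
rewrite (hpre_sq _ (@Th_eta_nat nC a _ _ g)); apply: chmap_bd; exact: hC.
Qed.

Section Killed.
Variables (m : set R) (ct : {linear F 0 -> R^o}).
Hypotheses (ctu : m (ct u - 1 : R)) (ctd : forall x : F 1, m (ct (cd F 1 0 x))).
Definition killed_by V := forall x, m x -> killed x V.
Lemma killed_Phi V : killed_by V -> killed_by (Phi V).
Proof.
move=> kV x mx n h; apply: hext => i j y _; rewrite hZa -[x *: y]addr0 -[x *: y]/(idR x *: y).
by rewrite haP ha0 addr0 kV.
Qed.
Lemma killed_Th n V : killed_by V -> killed_by (Th n V).
Proof.
move=> kV; elim: n => [//|n IH] x mx; apply: killed_cone; last exact: IH.
exact: killed_Phi.
Qed.
(** The map sending v to x |-> ct(x) v is a chain map V -> Hom(F, V), since [ct] sends boundaries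
    into m and m kills V; it is a section of the evaluation, since ct(u) is 1 modulo m. Therefore
    [eta V] factors through the contractible cone of the identity of V. *)
Lemma null_eta V : killed_by V -> null (eta V).
Proof.
move=> kV.
have kl n (v : V n) i j a (x y : F i) :
   (ct (tr F i 0 (idR a *: x + y)) : R) *: tr V n j v =
   a *: ((ct (tr F i 0 x) : R) *: tr V n j v) + (ct (tr F i 0 y) : R) *: tr V n j v.
  by rewrite !linearP scalerDl scalerA.
have sl n : linear (fun v : V n => mkh n (fun i j => mkshom (kl n v i j)) : Phi V n).
  move=> a v w; apply: hext => i j x e; rewrite hDa hZa !ha_mkh // !mkshomE.
  rewrite [tr V n j _]linearP scalerDr scalerA mulrC; congr (_ *: _ + _).
  by rewrite [tr _ i 0 (_ *: _)]linearZ_LR [ct (_ *: _)]linearZ_LR.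
have sE n (v : V n) i j (x : F i) : j = i + n -> ha (mklin (sl n) v) j x =
    (ct (tr F i 0 x) : R) *: tr V n j v.
  by move=> e; rewrite ha_mkh // mkshomE.
have sP n k (v : V n) : cd (Phi V) n k (mklin (sl n) v) = mklin (sl k) (cd V n k v).
  have [e|ne] := eqVneq n (k + 1); last by rewrite !cd_shape ?linear0.
  apply: hext => i j x ij; rewrite (homC_cd _ _ e erefl erefl) !sE //; last 2 first.
  - by rewrite ij e; zm.
  - by rewrite ij e; zm.
  have [i1|ni] := eqVneq i 1.
    rewrite i1 in x ij *.
    rewrite [tr F 1 0 x]tr_ne // [ct 0]linear0 !scale0r linear0 sub0r.
    by rewrite [tr F (1 - 1) 0 _]trE (kV _ (ctd x)) scaler0 oppr0.
  rewrite [tr F (i - 1) 0 _]tr_ne ?linear0 ?scale0r ?scaler0 ?subr0; last first.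
    by rewrite subr_eq add0r.
  rewrite linearZ_LR; have [i0|ni0] := eqVneq i 0; last by rewrite tr_ne // linear0 !scale0r.
  congr (_ *: _); rewrite cd_tr ?tr_cd // ij i0 ?e; zm.
pose sg : chmap V (Phi V) := Chmap sP.
have uv i (v : V i) : ev V i (sg i v) = chmap_id V i (chmap_id V i v).
  rewrite /ev hevE [LHS]sE ?add0r // !trE -[RHS]scale1r; apply/eqP.
  by rewrite -subr_eq0 -scalerBl kV.
move=> n h hc; have -> : hpre idR I (eta V) n h =
    hpre idR I (cone_in (chmap_id V)) n (hpre idR I (cone_map uv) n h).
  apply: hext => i j x _; rewrite !hpreE; congr (ha h j _).
  by apply: injective_projections; [| symmetry; exact: linear0].
apply: chmap_bd; apply: contr_hom_pre; first exact: cone_id_contractible.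
exact: chmap_cy.
Qed.
Lemma Nil_killed V : killed_by V -> Nil V.
Proof.
move=> kV; exists 1%N => a n h hc.
rewrite -[Th_eta 1 a V]/(chcomp (eta _) (chmap_id _)) hpre_comp; apply: chmap_bd.
by apply: null_eta => //; exact: killed_Th.
Qed.
End Killed.

Lemma hbounded_ses_hom A B C (f : chmap A B) (g : chmap B C) : ses f g ->
  hbounded (homC idR A I) -> hbounded (homC idR C I) -> hbounded (homC idR B I).
Proof. by move=> s hA hC; apply: (ses_hbounded_mid (ses_hpre_inj idR s Ii)). Qed.

(** [Phi (Theta V)] is an extension of [Phi] of the suspended [Phi V] by [Phi V]. The dual of
    [Phi (Phi V)] is bounded because F is perfect, and the suspension is removed with the cone of
    the identity. *)
Lemma hbounded_Phi_Theta n V : perf n F -> hbounded (homC idR (Phi V) I) ->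
  hbounded (homC idR (Phi (Theta V)) I).
Proof.
move=> pF hV; have hPV := thick_hom_perf (hbounded_hom_thick I) hV pF.
apply: (hbounded_ses_hom (ses_hpost_proj (ses_cone (ev V)) Fp)) => //.
have s := ses_hpre_inj idR (ses_hpost_proj (ses_cone (chmap_id (Phi V))) Fp) Ii.
apply: (ses_hbounded_left s) => //; apply: acyclic_hbounded; apply: KI; apply: KF.
exact/contractible_acyclic/cone_id_contractible.
Qed.
(** The obstruction to extending a class of Hom(V, I) along [eta V] lies in the homology of the dual
    of the suspended [Phi V], which vanishes far out. There a class extends through k successive
    [eta], and by nilpotence the composite restriction is 0. *)
Lemma Nil_hbounded n V : perf n F -> Nil V -> hbounded (homC idR (Phi V) I) ->
  hbounded (homC idR V I).
Proof.
move=> pF [k kP] hV.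
have hTh a : hbounded (homC idR (Phi (Th a V)) I) by elim: a => //= a; exact: (hbounded_Phi_Theta pF).
suff : exists a b, forall l, l < a \/ b <= l -> forall h : homC idR V I l, is_cycle h ->
    exists2 h' : homC idR (Th (k + 0) V) I l, is_cycle h' & is_boundary (h - hpre idR I (Th_eta k 0 V) l h').
  move=> [a [b ab]]; apply/hboundedP; exists a, b.
  suff key l : l < a \/ b <= l -> hzero (homC idR V I) l.
    by split=> l hl; apply: key; [left | right].
  move=> hl h hc; have [h' h'c h'P] := ab l hl h hc.
  rewrite -(subrK (hpre idR I (Th_eta k 0 V) l h') h); apply: bdD => //.
  exact: (kP 0%N l h' h'c).
elim: {kP} k => [|k [a [b ab]]].
  exists 0, 0 => l _ h hc; exists h => //.
  by rewrite (_ : hpre _ _ _ _ _ = h) ?subrr; [exact: bd0 | apply: hext => i j x _; rewrite hpreE].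
have s := ses_hpre_inj idR (ses_cone (ev (Th (k + 0) V))) Ii.
have : hbounded (homC idR (sh 1 (Phi (Th (k + 0) V))) I).
  apply: (ses_hbounded_left (ses_hpre_inj idR (ses_cone (chmap_id (Phi (Th (k + 0) V)))) Ii)) => //.
  apply: acyclic_hbounded; apply: contr_hom_pre; exact: cone_id_contractible.
move=> /hboundedP[a' [b' [h1 h2]]]; exists (Num.min a a'), (Num.max b (b' + 1)) => l hl h hc.
have [|h' h'c h'P] := ab l _ h hc.
  by case: hl; rewrite ?lt_min ?ge_max => /andP[]; auto.
have z0 : hzero (homC idR (sh 1 (Phi (Th (k + 0) V))) I) (l - 1).
  case: hl; rewrite ?lt_min ?ge_max => /andP[_ hl]; last by apply: h2; rewrite lerBrDr.
  by apply: h1; apply: lt_trans hl; rewrite ltrBlDr ltS.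
have [b0 [a0 [b0P db0 a0c]]] := ses_connect s h'c.
have [a1 a1P] := bd_at (esym (subrK 1 l)) (z0 _ a0c).
exists (b0 - hpre idR I (cone_out (ev (Th (k + 0) V))) l a1).
  by apply/cyP; rewrite linearB db0 a1P -chmapP subrr.
have E : hpre idR I (eta (Th (k + 0) V)) l (b0 - hpre idR I (cone_out (ev (Th (k + 0) V))) l a1) = h'.
  by case: s => _ _ gf _; rewrite [LHS]linearB gf subr0.
by rewrite -[Th_eta k.+1 0 V]/(chcomp (eta _) (Th_eta k 0 V)) hpre_comp E.
Qed.
End Nil.
End Koszul.

(** * Localization of homology *)

Section Local.
Variable R : comPzRingType.
Implicit Types A B C V W : complex R.
Local Notation idR := (idfun : {rmorphism R -> R}).

(** The localization of H_l(V) at m vanishes. *)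
Definition locz (m : set R) V l :=
  exists2 t, ~ m t & forall z : V l, is_cycle z -> is_boundary (t *: z).

(** The rules shared by [hzero], [locz m] and [hfin_gen]. Statements about exact functors are proved
    once for any such Z and then used for each of the three. *)
Record zero_like (Z : complex R -> int -> Prop) : Prop := ZeroLike {
  zl_zero : forall V l, hzero V l -> Z V l;
  zl_qiso : forall V W (f : chmap V W) l, qiso f -> Z V l <-> Z W l;
  zl_mid : forall A B C (f : chmap A B) (g : chmap B C) l, ses f g -> Z A l -> Z C l -> Z B l;
  zl_right : forall A B C (f : chmap A B) (g : chmap B C) l, ses f g -> Z B l -> Z A (l - 1) -> Z C l;
  zl_retr : forall V W (i : chmap V W) (r : chmap W V) l, (forall k x, r k (i k x) = x) ->
    Z W l -> Z V l }.

Lemma hzero_zero_like : zero_like (@hzero R).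
Proof.
split=> //.
- by move=> V W f l qf; exact: qiso_hzero.
- by move=> A B C f g l s; exact: (ses_hzero_mid s).
- by move=> A B C f g l s; exact: (ses_hzero_right s).
- by move=> V W i r l ri; apply: (hzero_retract (i := i) (r := r)).
Qed.
Lemma locz_zero_like m : maximal_ideal m -> zero_like (locz m).
Proof.
move=> maxm; split.
- by move=> V l V0; exists 1; [exact: max1 | move=> z zc; rewrite scale1r; exact: V0].
- move=> V W f l qf; split=> -[t nt tP]; exists t => // z zc.
    have [x xc xP] := (qf l).2 z zc; rewrite -(subrK (f l x) z) scalerDr.
    by apply: bdD; [exact: bdZ | rewrite -linearZ_LR; exact/chmap_bd/tP].
  apply: (qf l).1; first exact: cycleZ.
  by rewrite linearZ_LR; apply: tP; exact: chmap_cy.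
- move=> A B C f g l s [t nt tP] [t' nt' t'P]; exists (t * t'); first exact: max_prime.
  move=> z zc; have [||a ac aP] := ses_mid s (z := t' *: z).
  + exact: cycleZ.
  + by rewrite linearZ_LR; apply: t'P; exact: chmap_cy.
  rewrite -scalerA -(subrK (f l a) (t' *: z)) scalerDr; apply: bdD; first exact: bdZ.
  by rewrite -linearZ_LR; exact/chmap_bd/tP.
- move=> A B C f g l s [t nt tP] [t' nt' t'P]; exists (t * t'); first exact: max_prime.
  move=> c cc; have [b [a [bP dbP ac]]] := ses_connect s cc.
  have [a' a'P] := bd_at (esym (subrK 1 l)) (t'P _ ac).
  rewrite -scalerA -bP -[t' *: _]linearZ_LR.
  have -> : g l (t' *: b) = g l (t' *: b - f l a').
    by case: s => _ _ gf _; rewrite linearB gf subr0.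
  rewrite -linearZ_LR; apply/chmap_bd/tP/cyP.
  by rewrite linearB linearZ_LR chmapP -a'P dbP linearZ_LR subrr.
by move=> V W i r l ri [t nt tP]; exists t => // z zc; rewrite -(ri _ z) -linearZ_LR;
  apply/chmap_bd/tP/chmap_cy.
Qed.
Lemma hzero_locz V l : (forall m, maximal_ideal m -> locz m V l) -> hzero V l.
Proof.
move=> h z zc; apply: contrapT => nb.
have Ul (a x y : R^o) : is_boundary ((x : R) *: z) -> is_boundary ((y : R) *: z) ->
    is_boundary (((a : R) *: x + y : R) *: z).
  by move=> hx hy; rewrite scalerDl -[a *: x]/(a * x) -scalerA; exact: bdL.
have U0 : is_boundary ((0 : R) *: z) by rewrite scale0r; exact: bd0.
have [|m [maxm Um]] := @ideal_in_maximal R (@Submod R (R^o : lmodType R) (fun x => is_boundary ((x : R) *: z)) U0 Ul).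
  by rewrite /= scale1r.
by have [t nt tP] := h m maxm; apply/nt/Um/tP.
Qed.

(** U stands for B_l + m Z_l: a proof of local vanishing only has to place each cycle in it, up to a
    scalar outside m. Quantifying over U spares every application a description of that
    submodule. *)
Lemma locz_nakayama m V l : maximal_ideal m -> hfin_gen V l ->
  (forall U : submod (V l), (forall z, is_boundary z -> U z) ->
     (forall x z, m x -> is_cycle z -> U (x *: z)) ->
     forall z, is_cycle z -> exists2 t, ~ m t & U (t *: z)) -> locz m V l.
Proof.
move=> maxm [s [sc sP]] h.
have U0 : exists c, (forall j, m (c j)) /\ is_boundary (0 - comb s c).
  exists (fun=> 0); split=> [j|]; first exact: max0.
  by rewrite /comb big1 ?subrr; [exact: bd0 | move=> k _; rewrite scale0r].
have Ul a x y : (exists c, (forall j, m (c j)) /\ is_boundary (x - comb s c)) ->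
   (exists c, (forall j, m (c j)) /\ is_boundary (y - comb s c)) ->
   exists c, (forall j, m (c j)) /\ is_boundary (a *: x + y - comb s c).
  move=> [c [mc cP]] [c' [mc' c'P]]; exists (fun k => a * c k + c' k); split=> [j|].
    exact: maxL.
  rewrite combL (_ : _ - _ = a *: (x - comb s c) + (y - comb s c')); last by rewrite scalerBr; zm.
  exact: bdL.
have [|t nt tP] := @nakayama R m maxm (V l) (bdm V l) s.
  move=> y ys; have [|||t nt [c [mc cP]]] := h (Submod U0 Ul) _ _ y.
  - move=> z zb; exists (fun=> 0); split=> [j|]; first exact: max0.
    by rewrite /comb big1 ?subr0 // => k _; rewrite scale0r.
  - move=> x z mx zc; have [c cP] := sP z zc; exists (fun k => x * c k); split=> [j|].
      by rewrite mulrC; exact: maxM.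
    rewrite (_ : comb s _ = x *: comb s c); first by rewrite -scalerBr; exact: bdZ.
    by rewrite /comb scaler_sumr; apply: eq_bigr => k _; rewrite scalerA.
  - exact: sc.
  by exists t => //; exists c.
exists t => // z zc; have [c cP] := sP z zc.
rewrite -(subrK (\sum_(k < size s) c k *: s`_k) z) scalerDr; apply: bdD; first exact: bdZ.
rewrite scaler_sumr; apply: (@sub_sum _ _ (bdm V l)) => k _.
by rewrite scalerA mulrC -scalerA; apply: bdZ; apply: tP; exact: mem_nth.
Qed.

(** The map b is multiplication by x on A and the identity on C, so the connecting map of the first
    sequence is x times that of the second. A class that dies in B is a value of the former, hence
    divisible by x. *)
Lemma ses_div x A B B' C (f : chmap A B) (g : chmap B C) (f' : chmap A B') (g' : chmap B' C)
  (b : chmap B' B) l (h : A l) : ses f g -> ses f' g' ->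
  (forall i a, b i (f' i a) = f i (x *: a)) -> (forall i y, g i (b i y) = g' i y) ->
  is_cycle h -> is_boundary (f l h) -> exists2 h' : A l, is_cycle h' & is_boundary (h - x *: h').
Proof.
move=> s s' bf gb; move: h; rewrite -(addrK 1 l); move: (l + 1) => {l} k h hc.
move=> /(bd_at (esym (subrK 1 k)))[e eP]; case: (s) => fi gs gf ex.
have gc : is_cycle (g _ e) by apply/cyP; rewrite chmapP -eP gf.
have [e' [h' [e'P de' h'c]]] := ses_connect s' gc.
exists h' => //; have [|w wP] := ex k (e - b k e'); first by rewrite linearB gb e'P subrr.
exists k, w; apply: (fi (k - 1)); rewrite -chmapP -wP !linearB -eP chmapP de' bf.
by [].
Qed.

Section ResidueFunctional.
Variables (F : complex R) (V : complex R).
Hypothesis Fp : dg_fgproj F.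

Section Rank.
Variables (n l0 k : int) (g : {linear F l0 -> R^o}) (v : V k).
Fact hrank_subproof i j a (x y : F i) : (g (tr F i l0 (idR a *: x + y)) : R) *: tr V k j v =
   a *: ((g (tr F i l0 x) : R) *: tr V k j v) + (g (tr F i l0 y) : R) *: tr V k j v.
Proof. by rewrite !linearP scalerDl scalerA. Qed.
Definition hrank : homC idR F V n := mkh n (fun i j => mkshom (@hrank_subproof i j)).
Lemma hrankE i j (x : F i) : j = i + n -> ha hrank j x = (g (tr F i l0 x) : R) *: tr V k j v.
Proof. by move=> e; rewrite ha_mkh. Qed.
End Rank.

Lemma tr_cd_shift i l0 (x : F i) :
  tr F (i - 1) l0 (cd F i (i - 1) x) = cd F (l0 + 1) l0 (tr F i (l0 + 1) x).
Proof.
have [e|ne] := eqVneq i (l0 + 1).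
  by rewrite e in x *; rewrite trE tr_cd // addrK.
rewrite !tr_ne ?linear0 //; by rewrite subr_eq.
Qed.
Lemma hrank_cd n m l0 k (g : {linear F l0 -> R^o}) (v : V k) : n = m + 1 -> is_cycle v ->
  cd (homC idR F V) n m (hrank n g v) = - ((-1) ^+ absz n *: hrank m (g \o cd F (l0 + 1) l0) v).
Proof.
move=> e vc; apply: hext => i j x ij; rewrite (homC_cd _ _ e erefl erefl) hNa hsign_a !hrankE //; last 2 first.
- by rewrite ij e; zm.
- by rewrite ij e; zm.
rewrite tr_cd_shift linearZ_LR; have -> : cd V (j + 1) j (tr V k (j + 1) v) = 0.
  have [e'|ne] := eqVneq k (j + 1); first by rewrite cd_tr.
  by rewrite tr_ne // linear0.
by rewrite scaler0 sub0r.
Qed.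

Variables (u : F 0) (uc : is_cycle u) (m : set R) (ct : {linear F 0 -> R^o}).
Hypotheses (maxm : maximal_ideal m) (ctu : m (ct u - 1 : R)) (ctd : forall x : F 1, m (ct (cd F 1 0 x))).

(** P = Hom(F, V) is K-projective, so its identity factors up to a homotopy s through the truncation
    above i, which is 0 in degree i. Thus phi = d s phi + s d phi for phi : x |-> ct(x) v. At u the
    left side is v modulo m, the first term is a boundary, and the second lies in m V_i because d
    phi lies in m P. *)
Lemma residue_bottom i : (forall l, l < i -> cx_zero_at V l) -> Kprojective (homC idR F V) ->
  (forall l, l <= i -> hzero (homC idR F V) l) ->
  forall U : submod (V i), (forall z, is_boundary z -> U z) -> (forall x z, m x -> U (x *: z)) ->
  forall z, U z.
Proof.
move=> V0 KP P0 U Ub Um v; set P := homC idR F V in KP P0.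
have vc : is_cycle v by apply/cyP; rewrite [LHS]V0 // gtrBl.
have qT : qiso (Tge_in P (i + 1)) by apply: Tge_qiso => l; rewrite ltzD1; exact: P0.
have [f' [s sP]] := Kproj_lift (chmap_id P) KP qT.
have sE h : h = cd P (i + 1) i (s i (i + 1) h) + s (i - 1) i (cd P i (i - 1) h).
  rewrite -sP chcompE [f' i h](@sub_zero_below _ P (i + 1) _ _ i _) ?ltS //.
  by rewrite [Tge_in _ _ _ 0]linear0 subr0.
have [n [io [r ior]]] := Fp 1.
pose xk k : R := ct (cd F 1 0 (r (delta_mx 0 k))).
have col_lin k : linear (fun x : F 1 => io x 0 k : R^o) by move=> a x y; rewrite linearP !mxE.
pose gk k : {linear F 1 -> R^o} := mklin (col_lin k).
(* That [ct] sends boundaries into m does not yet place d phi in m P. Written through the finitely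
   many coordinates of F_1, d phi becomes a combination with coefficients in m. *)
have dphi : cd P i (i - 1) (hrank i ct v) =
    \sum_k (- ((-1) ^+ absz i * xk k)) *: hrank (i - 1) (gk k) v.
  rewrite (hrank_cd _ (esym (subrK 1 i)) vc); apply: hext => a b x ab.
  rewrite hNa hsign_a hrankE //.
  have E (h : 'I_n -> P (i - 1)) : ha (\sum_k h k) b x = \sum_k ha (h k) b x.
    by elim/big_rec2: _ => [//|k y z _ <-].
  rewrite E; set y : F 1 := tr F a 1 x; set w := tr V i b v.
  transitivity (- ((-1) ^+ absz i *: ((\sum_k (io y 0 k : R) * xk k) *: w))).
    congr (- (_ *: (_ *: _))); rewrite -[LHS]/(ct (cd F 1 0 y)) -{1}(ior y) [in LHS](row_delta (io y)) !lin_sum.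
    by apply: eq_bigr => k _; rewrite [r _]linearZ_LR [cd F 1 0 _]linearZ_LR linearZ_LR.
  rewrite scaler_suml scaler_sumr -sumrN; apply: eq_bigr => k _.
  rewrite hZa hrankE // linearZ_LR [gk k _]linearZ_LR -/y -/w.
  rewrite -[_ *: gk k y]/(- ((-1) ^+ absz i * xk k) * io y 0 k) mulNr scaleNr -scalerA.
  by rewrite scalerA [in RHS]mulrAC -mulrA [X in X *: w](mulrC) mulrC; congr (- _); rewrite !scalerA; congr (_ *: _); ring.
have : ha (hrank i ct v) i u = ha (cd P (i + 1) i (s i (i + 1) (hrank i ct v))) i u +
   ha (s (i - 1) i (cd P i (i - 1) (hrank i ct v))) i u by rewrite {1}[hrank i ct v]sE.
rewrite hrankE ?add0r // !trE => vE.
rewrite -[v]scale1r -(subKr (ct u : R) 1) scalerBl; apply: subB; last exact: Um.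
rewrite vE; apply: subD.
  by rewrite -(hevE uc) -chmapP; apply: Ub; exact: bd_cd.
rewrite dphi lin_sum -(hevE uc) lin_sum; apply: sub_sum => k _.
rewrite !linearZ_LR; apply: Um; rewrite -mulNr; apply: maxM => //; exact: ctd.
Qed.

End ResidueFunctional.

End Local.

(** * Exact functors into complexes *)

Section Functors.
Variable R : comPzRingType.
Implicit Types A B C V W : complex R.
Local Notation idR := (idfun : {rmorphism R -> R}).

(** The laws take a third map h that agrees pointwise with the combination or composite, so that no
    equality of bundled linear maps arises in applications. *)
Record efun := Efun {
  ef :> lmodType R -> complex R;
  ef_map : forall M N : lmodType R, {linear M -> N} -> chmap (ef M) (ef N);
  ef_lin : forall (M N : lmodType R) (f g h : {linear M -> N}) a, (forall x, h x = a *: f x + g x) ->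
    forall i v, ef_map h i v = a *: ef_map f i v + ef_map g i v;
  ef_comp : forall (M N L : lmodType R) (f : {linear M -> N}) (g : {linear N -> L}) (h : {linear M -> L}),
    (forall x, h x = g (f x)) -> forall i v, ef_map h i v = ef_map g i (ef_map f i v);
  ef_id : forall (M : lmodType R) (f : {linear M -> M}), (forall x, f x = x) -> forall i v, ef_map f i v = v;
  ef_ses : forall (M N L : lmodType R) (f : {linear M -> N}) (g : {linear N -> L}),
    injective f -> (forall y, exists x, g x = y) -> (forall x, g (f x) = 0) ->
    (forall y, g y = 0 -> exists x, y = f x) -> ses (ef_map f) (ef_map g) }.

Section Theory.
Variable T : efun.

Lemma ef_zero (M N : lmodType R) (f : {linear M -> N}) : (forall x, f x = 0) ->
  forall i v, ef_map T f i v = 0.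
Proof.
move=> f0 i v; have H x : f x = -1 *: f x + f x by rewrite !f0 scaler0 addr0.
by apply: etrans (ef_lin H v) _; rewrite scaleN1r addNr.
Qed.
Lemma ef_zero_obj (M : lmodType R) : (forall x : M, x = 0) -> forall i, cx_zero_at (T M) i.
Proof.
move=> M0 i v; have H x : (idfun : {linear M -> M}) x = x by [].
rewrite -(ef_id (e := T) H v).
by apply: ef_zero => x; exact: M0.
Qed.

Lemma rv_ses n : exists (f : {linear 'rV[R]_n -> 'rV[R]_(1 + n)}) (g : {linear 'rV[R]_(1 + n) -> R^o}),
  [/\ injective f, forall y, exists x, g x = y, forall x, g (f x) = 0 &
    forall y, g y = 0 -> exists x, y = f x].
Proof.
have fl : linear (fun x : 'rV[R]_n => row_mx (0 : 'rV[R]_1) x).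
  by move=> a x y; rewrite scale_row_mx add_row_mx scaler0 addr0.
have gl : linear (fun x : 'rV[R]_(1 + n) => x 0 (lshift n 0) : R^o).
  by move=> a x y; rewrite !mxE.
exists (mklin fl), (mklin gl); split=> [x y /eq_row_mx[]|c|x|y y0] //.
- by exists (row_mx c%:M 0); rewrite /= row_mxEl mxE.
- by rewrite /= row_mxEl mxE.
exists (rsubmx y); rewrite /= -[LHS]hsubmxK; congr row_mx.
by apply/rowP => j; rewrite !ord1 !mxE.
Qed.

Variable Z : complex R -> int -> Prop.
Hypothesis ZZ : zero_like Z.

Lemma ef_rv l : Z (T R^o) l -> forall n, Z (T 'rV[R]_n) l.
Proof.
move=> ZR; elim=> [|n IH].
  by apply: (zl_zero ZZ); apply: hzero_zero_at; apply: ef_zero_obj => x; exact: thinmx0.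
have [f [g [fi gs gf ex]]] := rv_ses n.
exact: (zl_mid ZZ (ef_ses T fi gs gf ex)).
Qed.
Lemma ef_fgproj l P : Z (T R^o) l -> fgproj P -> Z (T P) l.
Proof.
move=> ZR [n [i [r ir]]].
apply: (zl_retr ZZ (i := ef_map T i) (r := ef_map T r)); last exact: ef_rv.
move=> k x; have E y : (idfun : {linear P -> P}) y = r (i y) by rewrite ir.
have H y : (idfun : {linear P -> P}) y = y by [].
by rewrite -(ef_comp E) (ef_id H).
Qed.
Lemma ef_fpd c n N : (forall l, l < c -> Z (T R^o) l) -> fpd n N -> forall l, l < c -> Z (T N) l.
Proof.
move=> ZR; elim=> {n N} [N Np|n K P N i g Pp fi gs gf ex _ IH] l lc.
  by apply: ef_fgproj => //; exact: ZR.
apply: (zl_right ZZ (ef_ses T fi gs gf ex)).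
  by apply: ef_fgproj => //; exact: ZR.
by apply: IH; apply: lt_trans lc; rewrite ltrBlDr ltS.
Qed.
(** A syzygy lowers the degree by one. The bound a, uniform in N, stops the recursion after finitely
    many steps although N may have infinite projective dimension. *)
Lemma ef_fin_gen (noethR : noetherian R) a c : (forall N l, l < a -> Z (T N) l) ->
  (forall l, l < c -> Z (T R^o) l) -> forall N, fin_gen N -> forall l, l < c -> Z (T N) l.
Proof.
move=> Za ZR N Nf l lc.
have [k] : exists k : nat, l < a + k%:Z.
  by exists (`|l - a|.+1)%N; rewrite -ltrBlDl -addn1 PoszD ltzD1 abszE ler_norm.
elim: k N Nf l lc => [|k IH] N Nf l lc; first by rewrite addr0; exact: Za.
move=> lk; have [n [g gs]] := fin_gen_surj Nf.
have s := ef_ses T (@sinc_inj _ _ (ker g)) gs (fun x => sincP x)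
  (fun y y0 => ex_intro _ (mksub (U := ker g) y0) erefl).
apply: (zl_right ZZ s); first by apply: ef_rv; exact: ZR.
apply: IH.
- by apply: fin_gen_sub => //; exact: fin_gen_rv.
- by apply: lt_trans lc; rewrite ltrBlDr ltS.
by rewrite ltrBlDr -addrA -PoszD addn1.
Qed.
End Theory.

Section HomFun.
Variable F : complex R.
Hypothesis Fp : dg_proj F.
Definition homfun : efun.
Proof.
refine (@Efun (fun N => homC idR F (in_deg0 N)) (fun M N f => hpost idR F (deg0_map f)) _ _ _ _).
- abstract (move=> M N f g h a e i v; apply: hext => j k x _; rewrite hDa hZa !hpostE;
    rewrite -[a *: x]addr0 -[a *: x]/(idR a *: x) haP ha0 addr0;
    by move: (ha v k x) => {x} y; case: k y => [[|k]|k] y; rewrite /= ?e ?linearZ_LR // [LHS]thinmx0 [RHS]thinmx0).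
- abstract (move=> M N L f g h e i v; apply: hext => j k x _; rewrite !hpostE;
    by move: (ha v k x) => {x} y; case: k y => [[|k]|k] y; rewrite /= ?e).
- abstract (move=> M f e i v; apply: hext => j k x _; rewrite !hpostE;
    by move: (ha v k x) => {x} y; case: k y => [[|k]|k] y; rewrite /= ?e // [LHS]thinmx0 [RHS]thinmx0).
abstract (move=> M N L f g fi gs gf ex; apply: ses_hpost_proj => //; exact: ses_deg0).
Defined.
End HomFun.

Section Dual.
Local Notation E := (in_deg0 (cogen R)).
Lemma cogen_dg_inj : dg_inj E.
Proof. by move=> [[|k]|k]; [exact: cogen_inj | |]; apply: inj_zero => x; exact: thinmx0. Qed.
Lemma cogen_Kinj : Kinjective E.
Proof.
apply: (@Kinj_bounded R E 0); first exact: cogen_dg_inj.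
by move=> i gt; apply: in_deg0_zero; rewrite gt_eqF.
Qed.
Lemma dual_hzero V l : hzero V l -> hzero (homC idR V E) (- l).
Proof.
move=> V0 h hc.
have [|g gP] := @inj_ext_ker R (cogen R) _ _ (cd V l (l - 1)) (hlin h l 0) (@cogen_inj R).
  move=> x x0; have /bdP[y ->] := V0 x ((cyP x).2 x0).
  apply: (@sign_inj _ _ (absz (- l))); rewrite scaler0 /=.
  rewrite -((homC_cyP h).1 hc _ _ 1 0 y _ erefl (esym (addrK 1 l))) //.
  by rewrite addrC addKr.
have kl i j a (x y : V i) : tr E 0 j (g (tr V i (l - 1) (idR a *: x + y))) =
   a *: tr E 0 j (g (tr V i (l - 1) x)) + tr E 0 j (g (tr V i (l - 1) y)).
  by rewrite !linearP.
exists (- l + 1), (- ((-1) ^+ absz (- l + 1) *: mkh (- l + 1) (fun i j => mkshom (kl i j)))).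
apply: hext => i j x e; rewrite (homC_cd _ _ erefl erefl erefl) hNa hsign_a.
rewrite [cd E _ _ _]/(0 : _) sub0r hNa hsign_a scalerN opprK signK ha_mkh ?mkshomE; last first.
  by rewrite e; zm.
have [e'|ne] := eqVneq i l; last first.
  have j0 : j != 0 by rewrite e subr_eq0.
  by rewrite [LHS](in_deg0_zero j0) [RHS](in_deg0_zero j0).
rewrite e' in x e *; have j0 : j = 0 by rewrite e subrr.
by rewrite j0 !trE gP.
Qed.
Lemma dual_hzeroK V l : hzero (homC idR V E) (- l) -> hzero V l.
Proof.
move=> D0 z zc; apply: contrapT => nb.
have q0 : qpi (bdm V l) z != 0 by apply/eqP => /qpi0.
have [f fn] := cogenP q0; move/eqP: fn; apply.
pose g : {linear V l -> cogen R} := f \o qpi (bdm V l).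
have kl i j a (x y : V i) : tr E 0 j (g (tr V i l (idR a *: x + y))) =
   a *: tr E 0 j (g (tr V i l x)) + tr E 0 j (g (tr V i l y)).
  by rewrite !linearP.
have hc : is_cycle (mkh (- l) (fun i j => mkshom (kl i j)) : homC idR V E (- l)).
  apply/homC_cyP => i i' j' j x e1 e2 e3; rewrite [LHS]/(0 : _).
  have e : j = i' - l by apply: (addIr 1); rewrite -e2 e1 e3; zm.
  rewrite ha_mkh // mkshomE.
  have [e'|ne] := eqVneq i' l; last by rewrite [tr V _ _ _]tr_ne // !linear0 ?scaler0.
  rewrite tr_cd // (_ : g _ = 0) ?linear0 ?scaler0 //.
  by rewrite /g /= -[RHS](linear0 f); congr (f _); apply/qpi0; exact: bd_cd.
have /bdP[k kP] := D0 _ hc.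
have := congr1 (fun w => ha w 0 z) kP; rewrite ha_mkh ?subrr // mkshomE !trE => E1.
rewrite -[LHS]/(g z) E1 (homC_cd _ _ erefl erefl erefl) zc ha0 scaler0 subr0 //.
Qed.
Lemma dual_hbounded V : hbounded V <-> hbounded (homC idR V E).
Proof.
(* Negation turns the half-open range from a to b into one that is open on the other side; the
   summand 1 makes it half-open in the usual sense again. *)
rewrite !hboundedP; split=> -[a [b [h1 h2]]]; exists (- b + 1), (- a + 1); split=> i hi.
- rewrite -(opprK i); apply: dual_hzero; apply: h2.
  by rewrite lerNr -ltzD1.
- rewrite -(opprK i); apply: dual_hzero; apply: h1.
  by rewrite ltrNl -lezD1.
- apply: dual_hzeroK; apply: h2; by rewrite lerNr -ltzD1.
apply: dual_hzeroK; apply: h1; by rewrite ltrNl -lezD1.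
Qed.
End Dual.
End Functors.

(** * Tensor products with complexes of finitely generated projectives *)

Section TensorFunctor.
Variable R : comPzRingType.
Implicit Types (M N P K : lmodType R).
Local Notation idR := (idfun : {rmorphism R -> R}).
Local Notation "x *t y" := (pure idR x y) (at level 40).

Lemma tens2_exists P M N (f : {linear M -> N}) : exists h : {linear tens idR P M -> tens idR P N},
  forall x y, h (x *t y) = x *t f y.
Proof.
apply: tens_lift => [x x' y|x a y z|a x y]; first exact: pureDl.
  by rewrite linearP pureDr pureZr.
by rewrite pureZl -linearZ_LR.
Qed.
Definition tens2 P M N (f : {linear M -> N}) := proj1_sig (cid (tens2_exists P f)).
Lemma tens2_pure P M N (f : {linear M -> N}) x y : tens2 P f (x *t y) = x *t f y.
Proof. exact: (proj2_sig (cid (tens2_exists P f))). Qed.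
Lemma tens2_map P P' (p : {linear P -> P'}) M N (f : {linear M -> N}) u :
  tens_map idR p N (tens2 P f u) = tens2 P' f (tens_map idR p M u).
Proof.
apply: (tens_eq (f := tens_map idR p N \o tens2 P f) (g := tens2 P' f \o tens_map idR p M)).
move=> x y; rewrite -[LHS]/(tens_map idR p N (tens2 P f (x *t y))).
rewrite -[RHS]/(tens2 P' f (tens_map idR p M (x *t y))).
by rewrite tens2_pure !tens_map_pure tens2_pure.
Qed.

Section Coordinates.
Variables (n : nat) (P : lmodType R) (i : {linear P -> 'rV[R]_n}) (r : {linear 'rV[R]_n -> P}).
Hypothesis ir : cancel i r.
Lemma tcoord_exists N (k : 'I_n) : exists h : {linear tens idR P N -> N},
  forall x y, h (x *t y) = i x 0 k *: y.
Proof.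
apply: tens_lift => [x x' y|x a y z|a x y].
- by rewrite linearD mxE scalerDl.
- by rewrite scalerDr !scalerA mulrC.
- by rewrite linearZ_LR mxE scalerA mulrC.
Qed.
Definition tcoord N k := proj1_sig (cid (tcoord_exists N k)).
Lemma tcoord_pure N k x y : tcoord N k (x *t y) = i x 0 k *: y.
Proof. exact: (proj2_sig (cid (tcoord_exists N k))). Qed.
(** Dual basis expansion. An element of a tensor product with P is determined by its coordinates in
    N, which are natural in N; exactness of the tensor product is then checked coordinatewise. *)
Lemma tens_recover N (u : tens idR P N) : u = \sum_k r (delta_mx 0 k) *t tcoord N k u.
Proof.
have l : linear (fun u : tens idR P N => \sum_k r (delta_mx 0 k) *t tcoord N k u).
  move=> a v w; rewrite scaler_sumr -big_split; apply: eq_bigr => k _ /=.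
  by rewrite linearP pureDr pureZr.
apply: (tens_eq (f := idfun) (g := mklin l)) => x y.
rewrite -[RHS]/(\sum_k r (delta_mx 0 k) *t tcoord N k (x *t y)) -[LHS]/(x *t y).
have -> : \sum_k r (delta_mx 0 k) *t tcoord N k (x *t y) = \sum_k (i x 0 k *: r (delta_mx 0 k)) *t y.
  by apply: eq_bigr => k _; rewrite tcoord_pure pureZl.
have lp : linear (fun p : P => p *t y).
  by move=> a p q; rewrite pureDl pureZl pureZr.
rewrite -[RHS](lin_sum (mklin lp)) /=; congr (_ *t _).
by rewrite -[LHS]ir rv_lin.
Qed.
Lemma tcoord_tens2 M N (f : {linear M -> N}) k u : tcoord N k (tens2 P f u) = f (tcoord M k u).
Proof.
apply: (tens_eq (f := tcoord N k \o tens2 P f) (g := f \o tcoord M k)) => x y.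
rewrite -[LHS]/(tcoord N k (tens2 P f (x *t y))) -[RHS]/(f (tcoord M k (x *t y))).
by rewrite tens2_pure !tcoord_pure linearZ_LR.
Qed.
Lemma tens2_ses M N K (f : {linear M -> N}) (g : {linear N -> K}) :
  injective f -> (forall y, exists x, g x = y) -> (forall x, g (f x) = 0) ->
  (forall y, g y = 0 -> exists x, y = f x) ->
  [/\ injective (tens2 P f), forall y, exists x, tens2 P g x = y,
    forall x, tens2 P g (tens2 P f x) = 0 & forall y, tens2 P g y = 0 -> exists x, y = tens2 P f x].
Proof.
move=> fi gs gf ex.
have z0 (y : P) N' : y *t (0 : N') = 0 by rewrite -(scale0r (0 : N')) pureZr scale0r.
split.
- move=> u v e; apply/eqP; rewrite -subr_eq0; apply/eqP.
  have E k : tcoord M k (u - v) = 0.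
    by apply: fi; rewrite -tcoord_tens2 linear0 linearB e subrr linear0.
  by rewrite [LHS]tens_recover big1 // => k _; rewrite E z0.
- move=> v; have /choice[s sP] : forall k : 'I_n, exists x, g x = tcoord K k v by move=> k.
  exists (\sum_k r (delta_mx 0 k) *t s k); rewrite lin_sum [RHS]tens_recover.
  by apply: eq_bigr => k _; rewrite tens2_pure sP.
- move=> u; rewrite [LHS]tens_recover big1 // => k _.
  by rewrite !tcoord_tens2 gf z0.
move=> u u0; have /choice[s sP] : forall k : 'I_n, exists x, tcoord N k u = f x.
  by move=> k; apply: ex; rewrite -tcoord_tens2 u0 linear0.
exists (\sum_k r (delta_mx 0 k) *t s k); rewrite lin_sum [LHS]tens_recover.
by apply: eq_bigr => k _; rewrite tens2_pure -sP.
Qed.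
End Coordinates.

Section TensFun.
Variable L : complex R.
Hypothesis Lp : dg_fgproj L.
Definition tens2C M N (f : {linear M -> N}) : chmap (tensC idR L M) (tensC idR L N).
Proof.
exists (fun i => tens2 (L i) f) => i j u; exact: tens2_map.
Defined.
Lemma tens2_lin P M N (f g h : {linear M -> N}) a : (forall x, h x = a *: f x + g x) ->
  forall u, tens2 P h u = a *: tens2 P f u + tens2 P g u.
Proof.
move=> e u; apply: (tens_eq (f := tens2 P h) (g := (a \*: tens2 P f) \+ tens2 P g)) => x y.
rewrite -[RHS]/(a *: tens2 P f (x *t y) + tens2 P g (x *t y)).
by rewrite !tens2_pure e pureDr pureZr.
Qed.
Lemma tens2_comp P M N K (f : {linear M -> N}) (g : {linear N -> K}) (h : {linear M -> K}) :
  (forall x, h x = g (f x)) -> forall u, tens2 P h u = tens2 P g (tens2 P f u).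
Proof.
move=> e u; apply: (tens_eq (f := tens2 P h) (g := tens2 P g \o tens2 P f)) => x y.
rewrite -[RHS]/(tens2 P g (tens2 P f (x *t y))).
by rewrite !tens2_pure e.
Qed.
Lemma tens2_id P M (f : {linear M -> M}) : (forall x, f x = x) -> forall u, tens2 P f u = u.
Proof.
move=> e u; apply: (tens_eq (f := tens2 P f) (g := idfun)) => x y.
by rewrite tens2_pure e.
Qed.
Definition tensfun : efun R.
Proof.
refine (@Efun R (fun N => tensC idR L N) tens2C _ _ _ _).
- by move=> M N f g h a e i v; exact: tens2_lin.
- by move=> M N K f g h e i v; exact: tens2_comp.
- by move=> M f e i v; exact: tens2_id.
abstract (move=> M N K f g fi gs gf ex; split=> i;
  have [n [io [r ir]]] := Lp i; have [h1 h2 h3 h4] := tens2_ses ir fi gs gf ex; eauto).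
Defined.

Fact tens_unit_linear i : linear (fun x : L i => x *t (1 : R^o) : tensC idR L R^o i).
Proof. by move=> a x y; rewrite pureDl pureZl pureZr. Qed.
Definition tens_unit : chmap L (tensC idR L R^o).
Proof.
exists (fun i => mklin (@tens_unit_linear i)) => i j x.
abstract (rewrite -[LHS]/(tens_map idR (cd L i j) R^o (x *t (1 : R^o))); exact: tens_map_pure).
Defined.
Lemma tens_unit_qiso : qiso tens_unit.
Proof.
have ex i : exists h : {linear tens idR (L i) R^o -> L i}, forall x y, h (x *t y) = (y : R) *: x.
  apply: tens_lift => [x x' y|x a y z|a x y]; first exact: scalerDr.
    by rewrite scalerDl -scalerA.
  by rewrite scalerA -[in RHS]/(_ * _) mulrC.
apply: qiso_bij => i.
  have [h hP] := ex i; move=> x y e.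
  by rewrite -[x]scale1r -(hP x (1 : R^o)) -[y]scale1r -(hP y (1 : R^o)); congr (h _).
have [h hP] := ex i; move=> u; exists (h u).
apply: (tens_eq (f := mklin (@tens_unit_linear i) \o h) (g := idfun)) => x y.
rewrite -[LHS]/(h (x *t y) *t (1 : R^o)) hP pureZl -[RHS]/(x *t y); congr (_ *t _).
exact: mulr1.
Qed.

(** No signs occur since N sits in degree 0. *)
Section Adjunction.
Variables (N : lmodType R) (I : complex R).
Local Notation LN := (tensC idR L N).
Local Notation Y := (homC idR L I).
Local Notation N0 := (in_deg0 N).
Fact adj_sub1 n (h : homC idR LN I n) (y : N) i j a (x x' : L i) :
  ha h j ((idR a *: x + x') *t y : LN i) = a *: ha h j (x *t y : LN i) + ha h j (x' *t y : LN i).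
Proof. by rewrite pureDl pureZl pureZr haP. Qed.
Definition adj_in n (h : homC idR LN I n) m (y : N) : Y m :=
  mkh m (fun i j => mkshom (@adj_sub1 n h y i j)).
Lemma adj_inE n (h : homC idR LN I n) m y i j (x : L i) : j = i + m ->
  ha (adj_in h m y) j x = ha h j (x *t y : LN i).
Proof. by move=> e; rewrite ha_mkh. Qed.
Fact adj_sub2 n (h : homC idR LN I n) k m a (y y' : N0 k) :
  adj_in h m (tr N0 k 0 (idR a *: y + y')) = a *: adj_in h m (tr N0 k 0 y) + adj_in h m (tr N0 k 0 y').
Proof.
apply: hext => i j x e; rewrite hDa hZa !adj_inE // linearP pureDr pureZr haD.
by rewrite -pureZr pureZl.
Qed.
Fact adj_linear n : linear (fun h : homC idR LN I n =>
  mkh n (fun k m => mkshom (@adj_sub2 n h k m)) : homC idR N0 Y n).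
Proof.
move=> a h h'; apply: hext => k m y e; rewrite hDa hZa !ha_mkh // !mkshomE.
apply: hext => i j x e'; rewrite hDa !adj_inE // hDa hZa; congr (ha h j _ + _).
by rewrite [tr _ _ _ (_ *: _)]linearZ_LR pureZr.
Qed.
Lemma adjE n (h : homC idR LN I n) k m (y : N0 k) i j (x : L i) : m = k + n -> j = i + m ->
  ha (ha (mklin (@adj_linear n) h) m y) j x = ha h j (x *t (tr N0 k 0 y : N) : LN i).
Proof. by move=> e e'; rewrite ha_mkh // mkshomE adj_inE. Qed.
Fact adj_chmap n m (h : homC idR LN I n) :
  cd (homC idR N0 Y) n m (mklin (@adj_linear n) h) = mklin (@adj_linear m) (cd (homC idR LN I) n m h).
Proof.
have [e|ne] := eqVneq n (m + 1); last by rewrite !cd_shape ?linear0.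
apply: hext => k l y kl; have [k0|nk] := eqVneq k 0; last first.
  by rewrite [y](in_deg0_zero nk) !ha0.
rewrite (homC_cd _ _ e erefl erefl) [cd N0 _ _ _]/(0 : _) ha0 scaler0 subr0.
apply: hext => i j x ij; rewrite (homC_cd _ _ erefl erefl erefl).
have ln : l + 1 = n by rewrite kl k0 e; zm.
rewrite !adjE //; last 3 first.
- by rewrite ij; zm.
- by rewrite kl e; zm.
- by rewrite ij; zm.
have -> : (-1) ^+ absz (l + 1) = (-1) ^+ absz n :> R by rewrite ln.
by rewrite (homC_cd _ _ e erefl erefl) -[cd LN _ _ _]/(tens_map idR _ _ _) tens_map_pure.
by first [rewrite kl e; zm | rewrite ij; zm].
Qed.
Definition adj : chmap (homC idR LN I) (homC idR N0 Y) := Chmap adj_chmap.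
Lemma adj_qiso : qiso adj.
Proof.
apply: qiso_bij => n.
  move=> h h' e; apply: hext => i j u ij.
  have hl (g : homC idR LN I n) : linear (fun u : tens idR (L i) N => ha g j (u : LN i)).
    by move=> a x y; rewrite -[a *: x]/(idR a *: x) haP.
  apply: (tens_eq (f := mklin (hl h)) (g := mklin (hl h'))) => x y.
  have E (g : homC idR LN I n) : ha g j (x *t y : LN i) =
      ha (ha (adj n g) n (y : N0 0)) j x by rewrite adjE ?add0r // trE.
  by rewrite -[LHS]/(ha h j _) -[RHS]/(ha h' j _) !E e.
move=> H.
have ex i j : exists k : shom idR (LN i) (I j), forall x y, shom_fun k (x *t y) = ha (ha H n (y : N0 0)) j x.
  have [|||k kP] := @tens_lift R R idR (L i) N (I j) (fun x y => ha (ha H n (y : N0 0)) j x).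
  - by move=> x x' y; rewrite haD.
  - by move=> x a y z; rewrite -[a *: y]/(idR a *: y) haP hDa hZa -[a *: x]addr0 -[a *: x]/(idR a *: x) haP ha0 addr0.
  - by move=> a x y; rewrite -[idR a *: y]addr0 haP ha0 addr0 hZa.
  by exists (of_linear k).
have [k kP] := fam_choice ex.
exists (mkh n k); apply: hext => a m y e.
have [a0|na] := eqVneq a 0; last by rewrite [y](in_deg0_zero na) !ha0.
rewrite a0 add0r in e y *; rewrite e; apply: hext => i j x ij.
by rewrite adjE ?add0r // trE ha_mkh // kP.
Qed.
End Adjunction.
End TensFun.
End TensorFunctor.

(** * Exact functors of complexes and the biduality cone *)

Section ComplexFunctors.
Variable R : comPzRingType.
Implicit Types A B C V W X : complex R.
Local Notation idR := (idfun : {rmorphism R -> R}).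

Record cfun := Cfun {
  cf :> complex R -> complex R;
  cf_map : forall V W : complex R, chmap V W -> chmap (cf V) (cf W);
  cf_lin : forall (V W : complex R) (f g h : chmap V W) a, (forall i x, h i x = a *: f i x + g i x) ->
    forall i v, cf_map h i v = a *: cf_map f i v + cf_map g i v;
  cf_comp : forall (V W X : complex R) (f : chmap V W) (g : chmap W X) (h : chmap V X),
    (forall i x, h i x = g i (f i x)) -> forall i v, cf_map h i v = cf_map g i (cf_map f i v);
  cf_id : forall (V : complex R) (f : chmap V V), (forall i x, f i x = x) -> forall i v, cf_map f i v = v;
  cf_ses : forall (A B C : complex R) (f : chmap A B) (g : chmap B C), ses f g ->
    ses (cf_map f) (cf_map g) }.

Definition ef_cf (T : efun R) (G : cfun) : efun R.
Proof.
refine (@Efun R (fun N => G (T N)) (fun M N f => cf_map G (ef_map T f)) _ _ _ _).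
- by move=> M N f g h a e i v; apply: cf_lin => j x; exact: ef_lin.
- by move=> M N K f g h e i v; apply: cf_comp => j x; exact: ef_comp.
- by move=> M f e i v; apply: cf_id => j x; exact: ef_id.
by move=> M N K f g fi gs gf ex; apply: cf_ses; exact: ef_ses.
Defined.
Definition cf_cf (H G : cfun) : cfun.
Proof.
refine (@Cfun (fun V => G (H V)) (fun V W f => cf_map G (cf_map H f)) _ _ _ _).
- by move=> M N f g h a e i v; apply: cf_lin => j x; exact: cf_lin.
- by move=> M N K f g h e i v; apply: cf_comp => j x; exact: cf_comp.
- by move=> M f e i v; apply: cf_id => j x; exact: cf_id.
by move=> A B C f g s; do 2 apply: cf_ses.
Defined.

Definition kosF (xs : seq R) : cfun.
Proof.
refine (@Cfun (kos xs) (@kos_map R xs) _ _ _ _).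
- abstract (elim: xs => [|x xs IH] V W f g h a e i v; [exact: e | apply: IH] => j [y z];
    by apply: injective_projections; exact: e).
- abstract (elim: xs => [|x xs IH] V W X f g h e i v; [exact: e | apply: IH] => j [y z];
    by apply: injective_projections; exact: e).
- abstract (elim: xs => [|x xs IH] V f e i v; [exact: e | apply: IH] => j [y z];
    by apply: injective_projections; exact: e).
by move=> A B C f g; exact: ses_kos.
Defined.

Section Biduality.
Variable I : complex R.
Hypotheses (Ii : dg_inj I) (KI : Kinjective I).
Definition DD V := homC idR (homC idR V I) I.
Definition DD_map V W (f : chmap V W) : chmap (DD V) (DD W) := hpre idR I (hpre idR I f).
Lemma bidE V p (x : V p) n j (k : homC idR V I n) :
  ha (biduality_map V I p x) j k = (-1) ^+ (absz n * absz p) *: ha k j x.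
Proof. by []. Qed.
Lemma bid_nat V W (f : chmap V W) i x :
  biduality_map W I i (f i x) = DD_map f i (biduality_map V I i x).
Proof. by apply: hext => n j k e; rewrite hpreE !bidE hpreE. Qed.
Definition bid V := cone (biduality_map V I).
Definition bid_map V W (f : chmap V W) : chmap (bid V) (bid W) := cone_map (bid_nat f).
Lemma ses_DD A B C (f : chmap A B) (g : chmap B C) : ses f g -> ses (DD_map f) (DD_map g).
Proof. by move=> s; do 2 apply: ses_hpre_inj => //. Qed.
Lemma DD_lin V W (f g h : chmap V W) a : (forall i x, h i x = a *: f i x + g i x) ->
  forall i v, DD_map h i v = a *: DD_map f i v + DD_map g i v.
Proof.
move=> e i v; apply: hext => n j k _; rewrite hDa hZa !hpreE.
rewrite -[RHS](haD v) ; congr (ha v j _).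
by apply: hext => b c y _; rewrite hDa !hpreE e haD.
Qed.
Definition bidF : cfun.
Proof.
refine (@Cfun bid bid_map _ _ _ _).
- abstract (move=> V W f g h a e i [y z]; apply: injective_projections; [exact: DD_lin | exact: e]).
- abstract (move=> V W X f g h e i [y z]; apply: injective_projections; [|exact: e];
    apply: hext => n j k _; rewrite !hpreE; congr (ha y j _);
    by apply: hext => b c w _; rewrite !hpreE e).
- abstract (move=> V f e i [y z]; apply: injective_projections; [|exact: e];
    apply: hext => n j k _; rewrite !hpreE; congr (ha y j _);
    by apply: hext => b c w _; rewrite !hpreE e).
abstract (by move=> A B C f g s; apply: ses_cones => //; exact: ses_DD).
Defined.
Lemma qiso_DD V W (f : chmap V W) : qiso f -> qiso (DD_map f).
Proof. by move=> qf; do 2 apply: qiso_hpre_Kinj => //. Qed.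
Lemma bid_qiso V W (f : chmap V W) : qiso f -> qiso (bid_map f).
Proof. by move=> qf; apply: cone_map_qiso => //; exact: qiso_DD. Qed.
Lemma bid_acyclic V : acyclic V -> acyclic (bid V).
Proof.
move=> Va; apply/qisoP; apply: qiso_acyclic => //.
have Ha : acyclic (homC idR V I) by exact: KI.
exact: KI.
Qed.
End Biduality.

Lemma kos_closed (Q : complex R -> Prop) xs V : (forall x V, Q V -> Q (cone_by x V)) -> Q V ->
  Q (kos xs V).
Proof. by move=> Qc; elim: xs V => [//|x xs IH] V QV; apply/IH/Qc. Qed.

Lemma hbounded_sh k V : hbounded V -> hbounded (sh k V).
Proof.
move=> /hboundedP[a [b [h1 h2]]]; apply/hboundedP; exists (a + k), (b + k).
by split=> i hi; apply/sh_hzero; [apply: h1; rewrite ltrBlDr | apply: h2; rewrite lerBrDr].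
Qed.
Lemma hfinite_cone (noethR : noetherian R) V W (f : chmap V W) : hfinite V -> hfinite W ->
  hfinite (cone f).
Proof.
move=> [Vb Vf] [Wb Wf]; split.
  by apply: (ses_hbounded_mid (ses_cone f)) => //; exact: hbounded_sh.
move=> i; apply: (ses_hfin_mid (ses_cone f) noethR) => //.
by apply/sh_hfin.
Qed.
Lemma hfinite_kos (noethR : noetherian R) xs V : hfinite V -> hfinite (kos xs V).
Proof. by apply: kos_closed => x W hW; exact: hfinite_cone. Qed.

Lemma cf_cone_div (T : cfun) x V l (h : T V l) : is_cycle h ->
  is_boundary (cf_map T (cone_in (hom_by x V)) l h) ->
  exists2 h' : T V l, is_cycle h' & is_boundary (h - x *: h').
Proof.
have uv i (v : V i) : hom_by x V i (chmap_id V i v) = hom_by x V i (chmap_id V i v) by [].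
apply: (@ses_div R x _ _ _ _ _ (cf_map T (cone_out (hom_by x V))) (cf_map T (cone_in (chmap_id V)))
   (cf_map T (cone_out (chmap_id V))) (cf_map T (cone_map uv))).
- by apply: cf_ses; exact: ses_cone.
- by apply: cf_ses; exact: ses_cone.
- move=> i a.
  have E j y : chcomp (cone_in (hom_by x V)) (hom_by x V) j y =
     cone_map uv j (cone_in (chmap_id V) j y).
    by apply: injective_projections => //=; rewrite linear0.
  rewrite -(cf_comp (f := cone_in (chmap_id V)) E).
  have E2 j y : chcomp (cone_in (hom_by x V)) (hom_by x V) j y =
     x *: cone_in (hom_by x V) j y + chmap0 _ _ j y by rewrite addr0 -linearZ_LR.
  rewrite (cf_lin E2) [RHS]linearZ_LR.
  have E3 j (y : V j) : chmap0 V (cone (hom_by x V)) j y =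
     -1 *: chmap0 V (cone (hom_by x V)) j y + chmap0 V (cone (hom_by x V)) j y by rewrite scaler0 addr0.
  by rewrite [X in _ + X](cf_lin E3) scaleN1r addNr addr0.
- move=> i y; have E j z : cone_out (chmap_id V) j z = cone_out (hom_by x V) j (cone_map uv j z) by [].
  by rewrite -(cf_comp E).
Qed.

(** If T of the cone of x is locally acyclic in degree l, then multiplication by x is locally onto
    on H_l(T V), by [cf_cone_div]; as x lies in m, Nakayama applies. *)
Lemma locz_cone (m : set R) (T : cfun) x V l : maximal_ideal m -> m x -> hfin_gen (T V) l ->
  locz m (T (cone_by x V)) l -> locz m (T V) l.
Proof.
move=> maxm mx Tf [t nt tP]; apply: locz_nakayama => // U Ub Um z zc.
exists t => //; have [||h' h'c h'P] := @cf_cone_div T x V l (t *: z).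
- exact: cycleZ.
- by rewrite linearZ_LR; apply: tP; exact: chmap_cy.
rewrite -(subrK (x *: h') (t *: z)); apply: subD; [exact: Ub | exact: Um].
Qed.
End ComplexFunctors.

(** * Descent along a perfect complex *)

Section RLevel.
Variable R : comPzRingType.
Hypothesis noethR : noetherian R.
Implicit Types A B V W X L : complex R.
Local Notation idR := (idfun : {rmorphism R -> R}).

(** A functional N -> R/m sending e to 1, given by representatives. *)
Definition residual (N : lmodType R) (e : N) := forall m, maximal_ideal m ->
  exists c : N -> R, (forall a x y, m (c (a *: x + y) - (a * c x + c y))) /\ m (c e - 1).

Lemma lift_mod m (N P : lmodType R) (c : N -> R) (g : {linear P -> N}) : maximal_ideal m ->
  (forall a x y, m (c (a *: x + y) - (a * c x + c y))) -> projective P ->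
  exists k : {linear P -> R^o}, forall x, m ((k x : R) - c (g x)).
Proof.
move=> maxm cl Pp; have [M MP] := max_submod maxm.
have l : linear (fun x => qpi M (c (g x) : R^o)).
  move=> a x y; rewrite -linearP; apply/qpiP; apply/MP.
  by rewrite linearP -[a *: (c _ : R^o)]/(a * c (g x)); exact: cl.
have [k kP] := Pp _ _ (qpi M) (mklin l) (@qpi_surj _ _ M).
by exists k => x; apply/MP; apply/qpiP; exact: kP.
Qed.

Lemma residual_cycle (N : lmodType R) (F : complex R) (f : chmap F (in_deg0 N)) (u : F 0) m :
  residual (f 0 u : N) -> projective (F 0) -> maximal_ideal m ->
  exists ct : {linear F 0 -> R^o}, m (ct u - 1 : R) /\ forall x : F 1, m (ct (cd F 1 0 x)).
Proof.
move=> rs Pp maxm; have [c [cl ce]] := rs m maxm.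
have [k kP] := lift_mod (f 0 : {linear F 0 -> N}) maxm cl Pp.
exists k; split.
  by rewrite -(subrK (c (f 0 u)) (k u : R)) -addrA; apply: (maxD maxm).
move=> x; have h := kP (cd F 1 0 x); rewrite -(subrK (c (f 0 (cd F 1 0 x))) (k _ : R)).
apply: (maxD maxm) => //; rewrite -chmapP [cd (in_deg0 N) _ _ _]/(0 : _).
have := cl 1 0 0; rewrite scaler0 addr0 mul1r opprD addrA subrr sub0r => /(maxN maxm).
by rewrite opprK.
Qed.

Section WithF.
Variables (p : nat) (F : complex R) (u : F 0).
Hypotheses (pF : perf p F) (uc : is_cycle u)
  (ctF : forall m, maximal_ideal m -> exists ct : {linear F 0 -> R^o}, m (ct u - 1 : R) /\
     forall x : F 1, m (ct (cd F 1 0 x))).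

Let Fp : dg_fgproj F := (perf_fgproj pF).1.
Let Fpr : dg_proj F := fun i => fgproj_projective (Fp i).
Let KF : Kprojective F := perf_Kproj pF.

Lemma Phi_lower W b : (forall i, i < b -> hzero W i) ->
  forall i, i < b - p%:Z -> hzero (homC idR F W) i.
Proof.
move=> W0 i ib; apply/(qiso_hzero _ (qiso_hpost_Kproj KF (Tge_qiso W0))).
apply: hzero_zero_at; apply: hom_zero => k j e.
have [kp|nk] := boolP (0 <= k <= p%:Z); last by left; apply: (perf_fgproj pF).2.
right; apply: sub_zero_below; rewrite e; case/andP: kp => _ kp.
by rewrite -(subrK p%:Z b) addrC; apply: ltr_leD.
Qed.

(** Induction on l upwards from a, which is why a lower bound for W is among the assumptions. When W
    has no homology below l it has a free resolution V starting in degree l; Hom(F, V) is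
    K-projective since F is perfect, and [residue_bottom] gives H_l(V) = m H_l(V) for every m. *)
Lemma inf_ge W a j : (forall i, i < a -> hzero W i) -> (forall i, hfin_gen W i) ->
  (forall l, l < j -> hzero (homC idR F W) l) -> forall l, l < j -> hzero W l.
Proof.
move=> Wa Wf W0 l lj.
have [n] : exists n : nat, l < a + n%:Z.
  by exists (`|l - a|.+1)%N; rewrite -ltrBlDl -addn1 PoszD ltzD1 abszE ler_norm.
elim: n l lj => [|n IH] l lj; first by rewrite addr0; exact: Wa.
rewrite -addn1 PoszD addrA ltzD1 le_eqVlt => /orP[/eqP e|]; last exact: IH.
have Wl i : i < l -> hzero W i by move=> il; apply: IH; [exact: lt_trans lj | rewrite -e].
have [V [f [Vr V0 qf]]] := proj_res_exists noethR Wl Wf.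
have Vp i : projective (V i) by have [k ->] := Vr i; exact: projective_rv.
have KV : Kprojective V by exact: Kproj_bounded Vp V0.
apply/(qiso_hzero _ qf); apply: hzero_locz => m maxm.
have [ct [ctu ctd]] := ctF maxm.
apply: locz_nakayama => //; first by apply/(qiso_hfin _ qf).
move=> U Ub Um z zc; exists 1; first exact: max1.
rewrite scale1r; apply: (residue_bottom Fp uc maxm ctu ctd V0) => //.
- exact: (thick_hom_perf (@Kproj_thick R) KV pF).
- move=> k kl; apply/(qiso_hzero _ (qiso_hpost_Kproj KF qf)); apply: W0.
  exact: le_lt_trans kl lj.
by move=> x y mx; apply: Um => //; apply/cyP; rewrite [LHS]V0 // gtrBl.
Qed.

Section WithI.
Variables (C I : complex R) (iota : chmap C I).
Hypotheses (Cf : hfinite C) (Ii : dg_inj I) (KI : Kinjective I) (qi : qiso iota).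

Lemma hom_hfin W : hfinite W -> forall n, hfin_gen (homC idR W I) n.
Proof.
move=> [/hboundedP[a [b [Wa _]]] Wf] n.
have [V [f [Vr V0 qf]]] := proj_res_exists noethR Wa Wf.
have Vp : dg_fgproj V by move=> i; have [k ->] := Vr i; exact: fgproj_rv.
have KV : Kprojective V.
  by apply: Kproj_bounded V0 => i; exact: fgproj_projective.
apply/(qiso_hfin n (qiso_hpre_Kinj KI qf))/(qiso_hfin n (qiso_hpost_Kproj KV qi)).
exact: hom_fin_gen.
Qed.

Definition PhiD W := homC idR F (homC idR W I).
Lemma ses_PhiD A B D (f : chmap A B) (g : chmap B D) : ses f g ->
  ses (hpost idR F (hpre idR I g)) (hpost idR F (hpre idR I f)).
Proof. by move=> s; apply: ses_hpost_proj => //; exact: ses_hpre_inj. Qed.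
Lemma PhiD_acyclic W : acyclic W -> acyclic (PhiD W).
Proof. by move=> Wa; apply: KF; exact: KI. Qed.
Lemma cone_id_acyclic W : acyclic (cone (chmap_id W)).
Proof. by apply/contractible_acyclic/cone_id_contractible. Qed.

Lemma PhiD_cone_lower x W j : (forall l, l < j -> hzero (PhiD W) l) ->
  forall l, l < j - 1 -> hzero (PhiD (cone_by x W)) l.
Proof.
move=> W0 l lj; have lj' : l < j by apply: lt_trans lj _; rewrite ltrBlDr ltS.
apply: (ses_hzero_mid (ses_PhiD (ses_cone (hom_by x W)))); last exact: W0.
apply: (ses_hzero_left (ses_PhiD (ses_cone (chmap_id W)))).
  by apply: W0; rewrite -ltrBrDr.
exact/PhiD_acyclic/cone_id_acyclic.
Qed.
Lemma PhiD_kos_lower xs W j : (forall l, l < j -> hzero (PhiD W) l) ->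
  forall l, l < j - (size xs)%:Z -> hzero (PhiD (kos xs W)) l.
Proof.
elim: xs W j => [|x xs IH] W j W0 l; first by rewrite subr0; exact: W0.
rewrite /= -add1n PoszD opprD addrA; apply: IH; exact: PhiD_cone_lower.
Qed.

Section WithJ.
Variable J : complex R.
Hypotheses (Ji : dg_inj J) (KJ : Kinjective J).
Lemma PhiD_kos_hbounded2 xs W : hbounded (homC idR (PhiD W) J) ->
  hbounded (homC idR (PhiD (kos xs W)) J).
Proof.
have s2 A B D (f : chmap A B) (g : chmap B D) (s : ses f g) := ses_hpre_inj idR (ses_PhiD s) Ji.
apply: (@kos_closed R (fun V => hbounded (homC idR (PhiD V) J))) => x V hV.
apply: (ses_hbounded_mid (s2 _ _ _ _ _ (ses_cone (hom_by x V)))) => //.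
apply: (ses_hbounded_right (s2 _ _ _ _ _ (ses_cone (chmap_id V)))) => //.
exact/acyclic_hbounded/KJ/PhiD_acyclic/cone_id_acyclic.
Qed.
Lemma Nil_kos m xs W : maximal_ideal m -> (forall x, x \in xs -> m x) ->
  (forall x, m x -> exists c : nat -> R, x = \sum_(k < size xs) c k * xs`_k) ->
  Nil uc J (homC idR (kos xs W) I).
Proof.
move=> maxm xm mx; have [ct [ctu ctd]] := ctF maxm.
(* Nilpotence is proved for Hom(-, I) of each piece. A piece is killed by all of xs, hence by m, and
   so is its dual. *)
apply: (@kos_pieces R (fun V => Nil uc J (homC idR V I)) xs [::]) => //.
- move=> V V' f qf; apply: iff_sym; apply: Nil_qiso => //.
  exact: qiso_hpre_Kinj.
- move=> A B D f g s hA hD; apply: (Nil_ses Fpr Ji (ses_hpre_inj idR s Ii)) => //.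
move=> V kV; apply: (Nil_killed uc J ctu ctd) => x /mx[c ->] n h.
apply: hext => i j v _; rewrite hZa scaler_suml.
rewrite big1 ?ha0 // => k _; have k0 : xs`_k *: v = 0 by apply: kV; rewrite cats0 mem_nth.
by rewrite -scalerA k0 scaler0.
Qed.
(** J is independent of I because two cases occur: the character module bounds Hom(kos xs W, I)
    itself, through [dual_hbounded], and J = I bounds the bidual of [kos xs W]. *)
Lemma kos_dual_hbounded m xs W : maximal_ideal m -> (forall x, x \in xs -> m x) ->
  (forall x, m x -> exists c : nat -> R, x = \sum_(k < size xs) c k * xs`_k) ->
  hbounded (homC idR (PhiD W) J) -> hbounded (homC idR (homC idR (kos xs W) I) J).
Proof.
move=> maxm xm mx hW; apply: (Nil_hbounded Fpr KF Ji KJ pF (Nil_kos W maxm xm mx)).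
exact: PhiD_kos_hbounded2.
Qed.
End WithJ.

Lemma kos_hom_hbounded m xs W : maximal_ideal m -> (forall x, x \in xs -> m x) ->
  (forall x, m x -> exists c : nat -> R, x = \sum_(k < size xs) c k * xs`_k) ->
  hbounded (PhiD W) -> hbounded (homC idR (kos xs W) I).
Proof.
move=> maxm xm mx hW; apply: (dual_hbounded (homC idR (kos xs W) I)).2.
apply: (kos_dual_hbounded (@cogen_dg_inj R) (@cogen_Kinj R) maxm xm mx).
exact: (dual_hbounded (PhiD W)).1.
Qed.

(** The contravariant counterpart of [locz_cone]. Hom(-, I) turns the suspension in the cone into a
    shift down by one, whence the degree l - 1 and, in [locz_hom_kos], a loss equal to the number of
    generators. *)
Lemma locz_hom_cone m x W l : maximal_ideal m -> m x -> hfinite W ->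
  locz m (homC idR (cone_by x W) I) (l - 1) -> locz m (homC idR W I) l.
Proof.
move=> maxm mx Wf [t nt tP].
have s := ses_hpre_inj idR (ses_cone (hom_by x W)) Ii.
have s' := ses_hpre_inj idR (ses_cone (chmap_id W)) Ii.
have uv i (v : W i) : chmap_id W i (hom_by x W i v) = chmap_id W i (hom_by x W i v) by [].
apply: (zl_right (locz_zero_like maxm) s').
  by apply: (zl_zero (locz_zero_like maxm)); exact/KI/cone_id_acyclic.
have fin : hfin_gen (homC idR (sh 1 W) I) (l - 1).
  apply: hom_hfin; case: Wf => Wb Wf; split; first exact: hbounded_sh.
  by move=> i; apply/sh_hfin.
apply: locz_nakayama => // U Ub Um z zc; exists t => //.
have [||||h' h'c h'P] := ses_div (x := x) (b := hpre idR I (cone_map uv)) (h := t *: z) s s'.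
- move=> i a; apply: hext => j k [y v] _; rewrite !hpreE.
  rewrite -[cone_out (hom_by x W) j (y, v)]/(v : sh 1 W j) hZa; congr (ha a k _).
- move=> i a; apply: hext => j k v _; rewrite !hpreE; congr (ha a k _).
  by apply: injective_projections => //=; rewrite ?linear0 ?scaler0.
- exact: cycleZ.
- by rewrite linearZ_LR; apply: tP; exact: chmap_cy.
rewrite -(subrK (x *: h') (t *: z)); apply: subD; [exact: Ub | exact: Um].
Qed.
Lemma locz_hom_kos m xs W j : maximal_ideal m -> (forall x, x \in xs -> m x) -> hfinite W ->
  (forall l, l < j - (size xs)%:Z -> locz m (homC idR (kos xs W) I) l) ->
  forall l, l < j -> locz m (homC idR W I) l.
Proof.
move=> maxm; elim: xs W j => [|x xs IH] W j xm Wf h l lj; first by apply: h; rewrite subr0.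
apply: (locz_hom_cone (x := x)) => //; first by apply: xm; rewrite mem_head.
apply: (IH _ (j - 1)); last by rewrite ltrD2r.
- by move=> y yx; apply: xm; rewrite inE yx orbT.
- exact: hfinite_cone.
by move=> k hk; apply: h; rewrite /= -add1n PoszD opprD addrA.
Qed.

Lemma max_gens m : maximal_ideal m -> exists xs : seq R, (forall x, x \in xs -> m x) /\
  forall x, m x -> exists c : nat -> R, x = \sum_(k < size xs) c k * xs`_k.
Proof. by case=> im _ _; exact: noethR. Qed.

(** [inf_ge] cannot be applied to Hom(W, I), which is not known to be bounded below. It applies to
    Hom(kos xs W, I) for generators xs of m, with j lowered by their number; [locz_hom_kos] then
    restores exactly that loss. *)
Theorem hom_inf_ge W j : hfinite W -> hbounded (PhiD W) ->
  (forall l, l < j -> hzero (PhiD W) l) -> forall l, l < j -> hzero (homC idR W I) l.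
Proof.
move=> Wf Pb P0 l lj; apply: hzero_locz => m maxm.
have [xs [xm mx]] := max_gens maxm.
apply: (locz_hom_kos maxm xm Wf) lj => k hk; apply: (zl_zero (locz_zero_like maxm)).
have /hboundedP[a [b [Za _]]] := kos_hom_hbounded maxm xm mx Pb.
apply: (inf_ge Za) hk; first by move=> i; apply: hom_hfin; exact: hfinite_kos.
by move=> i; exact: PhiD_kos_lower.
Qed.
End WithI.
End WithF.
End RLevel.

(** * Descent of reflexivity *)

Section BidualDescent.
Variable R : comPzRingType.
Hypothesis noethR : noetherian R.
Implicit Types A B V W X L : complex R.
Local Notation idR := (idfun : {rmorphism R -> R}).

(** A functional on a finitely generated projective with values in m is a combination of coordinate
    functionals with coefficients in m, and T is additive; so T w sends cycles into m times
    cycles. *)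
Lemma ef_residue (T : efun R) (m : set R) (Q : lmodType R) (w : {linear Q -> R^o}) l (y : T Q l)
  (U : submod (T R^o l)) : fgproj Q -> (forall x, m (w x : R)) -> is_cycle y ->
  (forall x z, m x -> is_cycle z -> U (x *: z)) -> U (ef_map T w l y).
Proof.
move=> [n [io [r ior]]] mw yc Um.
have gl (k : 'I_n) : linear (fun q : Q => io q 0 k : R^o) by move=> a x z; rewrite linearP !mxE.
pose g k : {linear Q -> R^o} := mklin (gl k).
pose xk k : R := w (r (delta_mx 0 k)).
have key (s : seq 'I_n) (v : {linear Q -> R^o}) : (forall q, v q = \sum_(k <- s) xk k *: g k q) ->
    U (ef_map T v l y).
  elim: s v => [|k s IH] v vE.
    by rewrite ef_zero; [exact: sub_0 | move=> q; rewrite vE big_nil].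
  have sl : linear (fun q => \sum_(k <- s) xk k *: g k q).
    move=> a x z; rewrite scaler_sumr -big_split; apply: eq_bigr => j _.
    have -> : g j (a *: x + z) = a *: g j x + g j z by exact: gl.
    by rewrite scalerDr !scalerA mulrC.
  have E q : v q = xk k *: g k q + mklin sl q by rewrite vE big_cons.
  rewrite (ef_lin E); apply: subD; last exact: IH.
  by apply: Um; [exact: mw | exact: chmap_cy].
apply: (key (index_enum _)) => q; rewrite -[in LHS](ior q) (row_delta (io q)) !lin_sum.
by apply: eq_bigr => k _; rewrite [r _]linearZ_LR [w _]linearZ_LR -[LHS]/(_ * _) mulrC.
Qed.

Lemma thick_hbounded : thick (@hbounded R).
Proof.
split=> [A B C f g [s _]|A B C f g [s _]|A cA|V W i r ri].
- exact: (ses_hbounded_mid s).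
- exact: (ses_hbounded_left s).
- by apply: acyclic_hbounded; exact: contractible_acyclic.
move=> /hboundedP[a [b [h1 h2]]]; apply/hboundedP; exists a, b.
by split=> j l; apply: (hzero_retract (i := i) (r := r)) => //; auto.
Qed.

Lemma ef_hbounded (T : efun R) n N : hbounded (T R^o) -> fpd n N -> hbounded (T N).
Proof.
move=> hR; elim=> {n N} [N Np|n K P N i g Pp fi gs gf ex _ IH].
  move/hboundedP: hR => [a [b [h1 h2]]]; apply/hboundedP; exists a, b.
  by split=> l hl; apply: (ef_fgproj (hzero_zero_like R)) => //; auto.
apply: (ses_hbounded_right (ef_ses T fi gs gf ex)) => //.
move/hboundedP: hR => [a [b [h1 h2]]]; apply/hboundedP; exists a, b.
by split=> l hl; apply: (ef_fgproj (hzero_zero_like R)) => //; auto.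
Qed.

Section Descent.
Variables (T : efun R) (m : set R) (maxm : maximal_ideal m).

(** A cycle of T P maps to a boundary in T N, hence comes from the syzygy K. Lifting it further to a
    projective cover Q of K meets an obstruction in degree l - 1 of T of the second syzygy, which
    vanishes locally. The existential form also covers N or K projective, where Q is N with d = 0,
    or K itself. *)
Lemma fpd_cycle_lift n N l : fpd n N -> hzero (T N) l ->
  (forall n' K, fpd n' K -> locz m (T K) (l - 1)) ->
  exists (P Q : lmodType R) (g : {linear P -> N}) (d : {linear Q -> P}),
   [/\ fgproj P, fgproj Q, forall y, exists x, g x = y, forall q, g (d q) = 0 &
    forall z : T P l, is_cycle z -> exists2 t, ~ m t & exists2 y : T Q l, is_cycle y &
      is_boundary (t *: z - ef_map T d l y)].
Proof.
move=> [{n}{}N Np|{n} n K P {}N i g Pp fi gs gf ex fK] N0 lK.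
  exists N, N, idfun, \0; split=> // [y|z zc]; first by exists y.
  exists 1; first exact: max1.
  exists 0; first exact: cy0.
  by rewrite [ef_map _ _ _ 0]linear0 subr0 scale1r; exact: N0.
have lift1 (z : T P l) : is_cycle z -> exists2 a : T K l, is_cycle a & is_boundary (z - ef_map T i l a).
  move=> zc; apply: (ses_mid (ef_ses T fi gs gf ex)) => //.
  by apply: N0; exact: chmap_cy.
case: {n} fK i fi gf ex lift1 => [{}K Kp|n K' Q {}K i' g' Qp fi' gs' gf' ex' fK'] i fi gf ex lift1.
  exists P, K, g, i; split=> // z zc; exists 1; first exact: max1.
  by rewrite scale1r; exact: lift1.
exists P, Q, g, (i \o g'); split=> // [q|z zc]; first exact: gf.
have [a ac zb] := lift1 z zc.
have [b [a' [bP dbP ac']]] := ses_connect (ef_ses T fi' gs' gf' ex') ac.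
have [t nt tP] := lK _ _ fK'; exists t => //.
have [a'' a''P] := bd_at (esym (subrK 1 l)) (tP a' ac').
exists (t *: b - ef_map T i' l a'').
  by apply/cyP; rewrite linearB linearZ_LR chmapP -a''P dbP linearZ_LR subrr.
have E q : (i \o g') q = i (g' q) by [].
rewrite (ef_comp E) [ef_map T g' l _]linearB.
have [_ _ h _] := ef_ses T fi' gs' gf' ex'.
rewrite h subr0 [ef_map T g' l _]linearZ_LR bP [ef_map T i l _]linearZ_LR -scalerBr.
exact: bdZ.
Qed.

(** Let [up] send 1 to a lift p0 of e in P, and let k : P -> R lift c. The composite of [up] and k
    is multiplication by k p0, a scalar outside m, while k d takes values in m because g d = 0. A
    cycle z of T R, pushed to T P, is locally T d of a cycle up to a boundary; applying T k shows
    that a multiple of z by a scalar outside m lies in m Z + B. *)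
Lemma residual_locz n (N : lmodType R) (e : N) l (c : N -> R) : fpd n N -> hzero (T N) l ->
  (forall a x y, m (c (a *: x + y) - (a * c x + c y))) -> m (c e - 1) ->
  hfin_gen (T R^o) l -> (forall l', l' < l -> locz m (T R^o) l') -> locz m (T R^o) l.
Proof.
move=> fN N0 cl ce Tf IH.
have lK n' K : fpd n' K -> locz m (T K) (l - 1).
  by move=> fK; apply: (ef_fpd (locz_zero_like maxm) IH fK); rewrite ltrBlDr ltS.
have [P [Q [g [d [Pp Qp gs gd zP]]]]] := fpd_cycle_lift fN N0 lK.
have [p0 p0P] := gs e.
have ul : linear (fun a : R^o => (a : R) *: p0) by move=> a x y; rewrite scalerDl scalerA.
pose up : {linear R^o -> P} := mklin ul.
have [k kP] := lift_mod g maxm cl (fgproj_projective Pp).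
apply: locz_nakayama => // U Ub Um z zc.
have [t nt [y yc tyP]] := zP (ef_map T up l z) (chmap_cy _ zc).
have Ek (x : R^o) : (k \o up) x = (k p0 : R) *: (idfun : {linear R^o -> R^o}) x + (\0 : {linear R^o -> R^o}) x.
  by rewrite addr0 /= /up [k _]linearZ_LR -[LHS]/(_ * _) mulrC.
have Ei x : (idfun : {linear R^o -> R^o}) x = x by [].
have E1 : ef_map T k l (ef_map T up l z) = (k p0 : R) *: z.
  have E q : (k \o up) q = k (up q) by [].
  by rewrite -(ef_comp E) (ef_lin Ek) (ef_id Ei) ef_zero // addr0.
have kp : ~ m (k p0 : R).
  move=> mk; case: (max1 maxm); have h := kP p0; rewrite p0P in h.
  have -> : 1 = (k p0 : R) - ((k p0 : R) - c e) - (c e - 1) by zm.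
  by apply: (maxB maxm) => //; apply: (maxB maxm).
exists (t * (k p0 : R)); first exact: max_prime.
rewrite -scalerA -E1 -[t *: _](linearZ_LR (ef_map T k l)).
rewrite -(subrK (ef_map T d l y) (t *: _)) linearD; apply: subD.
  by apply: Ub; exact: chmap_bd.
have E q : (k \o d) q = k (d q) by [].
rewrite -(ef_comp E); apply: (ef_residue (m := m) Qp) => // q.
have h := kP (d q); rewrite gd in h.
have h0 := cl 1 0 0; rewrite scaler0 addr0 mul1r opprD addrA subrr sub0r in h0.
have h1 := maxN maxm h0; rewrite opprK in h1.
have := maxD maxm h h1; rewrite subrK; exact.
Qed.
End Descent.

Lemma residual_locz_all (T : efun R) m n (N : lmodType R) (e : N) : maximal_ideal m -> fpd n N -> acyclic (T N) ->
  residual e -> (forall l, hfin_gen (T R^o) l) -> hbounded (T R^o) -> forall l, locz m (T R^o) l.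
Proof.
move=> maxm fN N0 re Tf /hboundedP[a [_ [Ta _]]] l.
have [c [cl ce]] := re m maxm.
have [k] : exists k : nat, l < a + k%:Z.
  by exists (`|l - a|.+1)%N; rewrite -ltrBlDl -addn1 PoszD ltzD1 abszE ler_norm.
elim: k l => [|k IH] l.
  by rewrite addr0 => la; apply: (zl_zero (locz_zero_like maxm)); exact: Ta.
rewrite -addn1 PoszD addrA ltzD1 le_eqVlt => /orP[/eqP lk|]; last exact: IH.
by apply: (residual_locz maxm fN _ cl ce) => // l' l'l; apply: IH; rewrite -lk.
Qed.

Section WithI.
Variables (C I : complex R) (iota : chmap C I).
Hypotheses (Cf : hfinite C) (Ii : dg_inj I) (KI : Kinjective I) (qi : qiso iota).

Definition dualizable V := hfinite V /\ hbounded (homC idR V I).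
Lemma hbounded_hom_cone x V : hbounded (homC idR V I) -> hbounded (homC idR (cone_by x V) I).
Proof.
move=> Vb; apply: (ses_hbounded_mid (ses_hpre_inj idR (ses_cone (hom_by x V)) Ii)) => //.
apply: (ses_hbounded_left (ses_hpre_inj idR (ses_cone (chmap_id V)) Ii)) => //.
by apply: acyclic_hbounded; apply: KI; exact/contractible_acyclic/cone_id_contractible.
Qed.
Lemma dualizable_cone x V : dualizable V -> dualizable (cone_by x V).
Proof. by move=> [Vf Vb]; split; [exact: hfinite_cone | exact: hbounded_hom_cone]. Qed.
Lemma DD_hfin V : dualizable V -> forall l, hfin_gen (DD I V) l.
Proof.
move=> [Vf Vb] l; apply: (hom_hfin noethR Cf KI qi); split=> //; exact: (hom_hfin noethR Cf KI qi).
Qed.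
Lemma bid_hfin V : dualizable V -> forall l, hfin_gen (bid I V) l.
Proof.
move=> Vd l; apply: (ses_hfin_mid (ses_cone (biduality_map V I)) noethR); first exact: DD_hfin.
by apply/sh_hfin; case: Vd => -[].
Qed.
Lemma locz_kos_bid m xs V : maximal_ideal m -> (forall x, x \in xs -> m x) -> dualizable V ->
  (forall l, locz m (bid I (kos xs V)) l) -> forall l, locz m (bid I V) l.
Proof.
move=> maxm; elim: xs V => [//|x xs IH] V xm Vd h l.
have mx : m x by apply: xm; rewrite mem_head.
apply: (locz_cone (T := bidF Ii) maxm mx); first exact: bid_hfin.
apply: IH => //; last exact: dualizable_cone.
by move=> y yx; apply: xm; rewrite inE yx orbT.
Qed.

Lemma bid_kos_acyclic xs V : acyclic (bid I V) -> acyclic (bid I (kos xs V)).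
Proof.
apply: (@kos_closed R (fun V => acyclic (bid I V))) => x W Wa.
have s1 := cf_ses (bidF Ii) (ses_cone (hom_by x W)).
have s2 := cf_ses (bidF Ii) (ses_cone (chmap_id W)).
apply: (ses_acyclic_mid s1) => //; apply: (ses_acyclic_right s2) => //.
by apply: bid_acyclic => //; exact/contractible_acyclic/cone_id_contractible.
Qed.

(** The descent is applied to the functor M |-> biduality cone of the Koszul complex over the tensor
    product of L and M. Its value at R must be bounded for the upward induction to start, and that
    is what the assumption on [DD I (kos xs L)] provides. *)
Theorem bid_descent L (Lp : dg_fgproj L) n (N : lmodType R) (e : N) : dualizable L -> fpd n N -> residual e ->
  (forall m xs, maximal_ideal m -> (forall x, x \in xs -> m x) ->
     (forall x, m x -> exists c : nat -> R, x = \sum_(k < size xs) c k * xs`_k) ->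
     hbounded (DD I (kos xs L))) ->
  acyclic (bid I (tensC idR L N)) -> acyclic (bid I L).
Proof.
move=> Ld fN re hb Na l; apply: hzero_locz => m maxm.
have [xs [xm mx]] := max_gens noethR maxm.
apply: (locz_kos_bid maxm xm Ld) => {}l.
have Kd : dualizable (kos xs L) by apply: (@kos_closed R dualizable) => // x V; exact: dualizable_cone.
have qu : qiso (bid_map I (kos_map xs (tens_unit L))).
  by apply: bid_qiso => //; apply: qiso_kos; exact: tens_unit_qiso.
apply/(zl_qiso (locz_zero_like maxm) l qu).
apply: (@residual_locz_all (ef_cf (tensfun Lp) (cf_cf (kosF xs) (bidF Ii))) m n N e) => //.
- exact: bid_kos_acyclic.
- by move=> k; apply/(qiso_hfin k qu); exact: bid_hfin.
apply/(qiso_hbounded qu); apply: (ses_hbounded_mid (ses_cone (biduality_map (kos xs L) I))).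
  exact: (hb m).
by apply: hbounded_sh; case: Kd => -[].
Qed.
End WithI.
End BidualDescent.

(** * Reflexivity and the infimum of Hom(F, W) *)

Section Equivalence.
Variable R : comPzRingType.
Hypothesis noethR : noetherian R.
Implicit Types A B V W X L : complex R.
Local Notation idR := (idfun : {rmorphism R -> R}).

Lemma hfin_zero_like : zero_like (@hfin_gen R).
Proof.
split.
- by move=> V l; exact: hzero_hfin.
- by move=> V W f l qf; exact: qiso_hfin.
- by move=> A B C f g l s hA hC; exact: (ses_hfin_mid s noethR).
- by move=> A B C f g l s hB hA; exact: (ses_hfin_right s noethR).
move=> V W i r l ri [s [sc sP]]; exists (map (r l) s); split=> [z /mapP[y ys ->]|z zc].
  by apply: chmap_cy; exact: sc.
have [|c cP] := sP (i l z); first exact: chmap_cy.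
exists c; rewrite size_map -(ri l z).
under eq_bigr do rewrite (nth_map 0) // -linearZ_LR.
by rewrite -lin_sum -linearB; exact: chmap_bd.
Qed.

Section WithF.
Variables (p : nat) (F : complex R) (u : F 0) (n : nat) (N : lmodType R) (f : chmap F (in_deg0 N)).
Hypotheses (pF : perf p F) (uc : is_cycle u) (qf : qiso f) (fN : fpd n N) (re : residual (f 0 u : N)).

Lemma residual_ct m : maximal_ideal m -> exists ct : {linear F 0 -> R^o}, m (ct u - 1 : R) /\
     forall x : F 1, m (ct (cd F 1 0 x)).
Proof.
move=> maxm; apply: (residual_cycle (f := f)) => //.
exact: (fgproj_projective ((perf_fgproj pF).1 0)).
Qed.

Section WithI.
Variables (C I : complex R) (iota : chmap C I) (b : int).
Hypotheses (Cf : hfinite C) (Ii : dg_inj I) (I0 : forall i, b < i -> cx_zero_at I i) (qi : qiso iota).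
Let KI : Kinjective I := Kinj_bounded Ii I0.
Variables (L : complex R) (a : int).
Hypotheses (Lp : dg_fgproj L) (L0 : forall i, i < a -> cx_zero_at L i) (Lf : hfinite L).
Local Notation LN := (tensC idR L N).

Lemma dual_zero_above i : b - a < i -> cx_zero_at (homC idR L I) i.
Proof.
move=> lt; apply: hom_zero => j k e; have [/L0|le] := ltP j a; first by left.
right; apply: I0; rewrite e -(subrK a b) addrC; exact: ler_ltD.
Qed.
Lemma dual_Kinj : Kinjective (homC idR L I).
Proof.
apply: (Kinj_bounded (b := b - a)); last exact: dual_zero_above.
by apply: dg_inj_hom => i j; apply: inj_shom; [exact: fgproj_projective | exact: Ii].
Qed.
Definition dual_tens : chmap (homC idR LN I) (PhiD F I L) :=
  chcomp (hpre idR (homC idR L I) f) (adj L N I).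
Lemma dual_tens_qiso : qiso dual_tens.
Proof.
apply: qiso_comp; first exact: adj_qiso.
by apply: qiso_hpre_Kinj => //; exact: dual_Kinj.
Qed.

Lemma tens_hbounded : hbounded LN.
Proof.
apply: (ef_hbounded (T := tensfun Lp)) fN.
by apply/(qiso_hbounded (tens_unit_qiso L)); case: Lf.
Qed.
Lemma tens_hfin l : hfin_gen LN l.
Proof.
apply: (ef_fpd (T := tensfun Lp) hfin_zero_like (c := l + 1)) fN _ (ltS l) => k _.
by apply/(qiso_hfin k (tens_unit_qiso L)); case: Lf.
Qed.

Theorem reflexive_equiv : hbounded (homC idR L I) /\ acyclic (bid I L) <->
  hbounded (homC idR LN I) /\ acyclic (bid I LN).
Proof.
split=> -[hb La]; split.
- apply/(qiso_hbounded dual_tens_qiso).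
  exact: (thick_hom_perf (@thick_hbounded R) hb pF).
- move=> l; apply: (ef_fpd (T := ef_cf (tensfun Lp) (bidF Ii)) (hzero_zero_like R) (c := l + 1)) fN _ (ltS l).
  move=> k _; apply/(qiso_hzero k (bid_qiso KI (tens_unit_qiso L))); exact: La.
(* Hom(L, I) vanishes above b - a by construction. Its lower bound is a lower bound c of
   [PhiD F I L], transferred by [hom_inf_ge]. *)
- have Pb : hbounded (PhiD F I L) by apply/(qiso_hbounded dual_tens_qiso).
  have /hboundedP[c [_ [P0 _]]] := Pb.
  apply/hboundedP; exists c, (b - a + 1); split=> i.
    exact: (hom_inf_ge noethR pF uc residual_ct Cf Ii KI qi Lf Pb P0).
  by move=> le; apply: hzero_zero_at; apply: dual_zero_above; rewrite -lezD1.
have Pb : hbounded (PhiD F I L) by apply/(qiso_hbounded dual_tens_qiso).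
have /hboundedP[c [_ [P0 _]]] := Pb.
have Yb : hbounded (homC idR L I).
  apply/hboundedP; exists c, (b - a + 1); split=> i.
    exact: (hom_inf_ge noethR pF uc residual_ct Cf Ii KI qi Lf Pb P0).
  by move=> le; apply: hzero_zero_at; apply: dual_zero_above; rewrite -lezD1.
apply: (bid_descent noethR Cf Ii KI qi Lp _ fN re _ La) => // m xs maxm xm mx.
apply: (kos_dual_hbounded pF uc residual_ct Ii KI Ii KI maxm xm mx).
(* [dual_tens] identifies Hom(PhiD F I L, I) with the bidual of the tensor product of L and N; by
   its assumed reflexivity this is the tensor product itself, which is bounded. *)
apply/(qiso_hbounded (qiso_hpre_Kinj KI dual_tens_qiso)).
apply/(qiso_hbounded (f := biduality_map LN I)); last exact: tens_hbounded.
exact/qisoP.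
Qed.
End WithI.

(** The augmentation f itself is a cycle of degree 0. If t f were a boundary, evaluation at u would
    give t f(u) = 0, and the functional c would put t in m. *)
Lemma hom_residual_nontriv (m : set R) : maximal_ideal m ->
  ~ locz m (homC idR F (in_deg0 N)) 0.
Proof.
move=> maxm [t nt tP]; have [c [cl ce]] := re maxm; apply: nt.
have fc : is_cycle (of_chmap f : homC idR F (in_deg0 N) 0) by exact: of_chmap_cycle.
have /bdP[h hP] := tP _ fc.
have := congr1 (fun k => ha k 0 u) hP.
rewrite -[in RHS](hevE uc) -chmapP [RHS]/(0 : _).
rewrite hZa -[t *: u]addr0 -[t *: u]/(idR t *: u) haP ha0 addr0 of_chmapE => tu.
have c0 : m (c 0).
  have h0 := cl 1 0 0; rewrite scaler0 addr0 mul1r opprD addrA subrr sub0r in h0.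
  by have := maxN maxm h0; rewrite opprK.
have tc : m (t * c (f 0 u) + c 0).
  have h1 := cl t (f 0 u : N) 0; rewrite addr0 -[t *: _]/(t *: f 0 u) tu in h1.
  have -> : t * c (f 0 u) + c 0 = c 0 - (c 0 - (t * c (f 0 u) + c 0)) by rewrite subKr.
  exact: (maxB maxm).
have -> : t = (t * c (f 0 u) + c 0) - c 0 - (c (f 0 u) - 1) * t.
  by rewrite addrK mulrBl mul1r mulrC opprB addrCA subrr addr0.
by apply: (maxB maxm); [exact: (maxB maxm) | rewrite mulrC; apply: maxM].
Qed.
End WithF.
End Equivalence.

(** * The exact shift of the infimum *)

Section Sharp.
Variable R : comPzRingType.
Hypothesis noethR : noetherian R.
Implicit Types A B V W X L : complex R.
Local Notation idR := (idfun : {rmorphism R -> R}).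

Lemma fin_gen_regular : fin_gen (R^o : lmodType R).
Proof.
by exists [:: 1 : R^o] => x; exists (fun=> x); rewrite big_ord1 /= -[RHS]/(_ * _) mulr1.
Qed.

(** For m containing the annihilator of v, no scalar outside m kills N, so N differs from m N by
    Nakayama. A functional modulo m N with value 1 somewhere is onto R/m. *)
Lemma residue_quotient (N : lmodType R) (v : N) : fin_gen N -> v <> 0 ->
  exists m (M : submod (R^o : lmodType R)) (q : {linear N -> quom M}),
   [/\ maximal_ideal m, forall x : R^o, M x <-> m x & forall y, exists x, q x = y].
Proof.
move=> [s sP] v0.
have A0 : (0 : R) *: v = 0 by rewrite scale0r.
have Al (a x y : R^o) : (x : R) *: v = 0 -> (y : R) *: v = 0 -> (a *: x + y : R) *: v = 0.
  by move=> hx hy; rewrite scalerDl -[a *: x]/(a * x) -scalerA hx hy scaler0 addr0.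
have [|m [maxm Am]] := @ideal_in_maximal R (@Submod R (R^o : lmodType R) (fun x => (x : R) *: v = 0) A0 Al).
  by rewrite /= scale1r.
have U0 : exists c, (forall j, m (c j)) /\ 0 = comb s c.
  exists (fun=> 0); split=> [j|]; first exact: max0.
  by rewrite /comb big1 // => k _; rewrite scale0r.
have Ul a x y : (exists c, (forall j, m (c j)) /\ x = comb s c) ->
   (exists c, (forall j, m (c j)) /\ y = comb s c) ->
   exists c, (forall j, m (c j)) /\ a *: x + y = comb s c.
  move=> [c [mc ->]] [c' [mc' ->]]; exists (fun k => a * c k + c' k); split=> [j|].
    exact: maxL.
  by rewrite combL.
pose U := Submod U0 Ul.
have mU a x : m a -> U (a *: x).
  move=> ma; have [c ->] := sP x; exists (fun k => a * c k); split=> [j|].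
    by rewrite mulrC; apply: maxM.
  by rewrite /comb scaler_sumr; apply: eq_bigr => k _; rewrite scalerA.
have [y nUy] : exists y, ~ U y.
  apply: contrapT => nU.
  have Z0 : (0 : N) = 0 by [].
  have Zl a (x y : N) : x = 0 -> y = 0 -> a *: x + y = 0 by move=> -> ->; rewrite scaler0 addr0.
  have [|t nt tP] := @nakayama R m maxm N (@Submod R N (fun x => x = 0) Z0 Zl) s.
    move=> y ys; exists 1; first exact: max1.
    have [c [mc cP]] : U y by apply: contrapT => nUy; apply: nU; exists y.
    by exists c => //=; rewrite scale1r -cP subrr.
  apply/nt/Am; rewrite /=; have [c {1}->] := sP v; rewrite scaler_sumr big1 // => k _.
  by rewrite scalerA mulrC -scalerA tP ?scaler0 // mem_nth.
have [c [cl cU cy]] := functional_mod maxm mU nUy.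
have [M MP] := max_submod maxm.
have ql : linear (fun x => qpi M (c x : R^o)).
  move=> a x z; rewrite -linearP; apply/qpiP; apply/MP.
  by rewrite -[a *: (c _ : R^o)]/(a * c x); exact: cl.
exists m, M, (mklin ql); split=> // w; have [x <-] := qpi_surj w.
exists ((x : R) *: y); apply: (@etrans _ _ (qpi M ((x : R) *: (c y : R^o)))).
  by rewrite linearZ_LR [RHS]linearZ_LR.
apply/qpiP; apply/MP.
rewrite -[_ *: (c y : R^o)]/((x : R) * c y) -[X in _ - X]mulr1 -mulrBr.
exact: (maxM maxm).
Qed.

Section Functor.
Variable T : efun R.
Hypotheses (Tb : hbounded (T R^o)) (Tf : forall l, hfin_gen (T R^o) l).
Variable a0 : int.
Hypothesis T0 : forall M l, l < a0 -> hzero (T M) l.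

(** As H_l(T(R/m)) vanishes, a cycle of T R comes from T m. Cover m by R^n; the obstruction to
    lifting to T(R^n) sits in degree l - 1 and is locally zero. The composite R^n -> m -> R has
    values in m, so [ef_residue] and Nakayama conclude. *)
Lemma residue_step (m : set R) (M : submod (R^o : lmodType R)) (l : int) : maximal_ideal m -> (forall x : R^o, M x <-> m x) ->
  (forall N, fin_gen N -> forall l', l' < l -> locz m (T N) l') -> hzero (T (quom M)) l ->
  locz m (T R^o) l.
Proof.
move=> maxm MP lo k0; apply: locz_nakayama => // U Ub Um z zc.
have s1 := ef_ses T (@sinc_inj _ _ M) (@qpi_surj _ _ M) (fun x => (qpi0 M _).2 (sincP x))
  (fun y y0 => ex_intro _ (mksub (U := M) ((qpi0 M y).1 y0)) erefl).
have [|a ac ab] := ses_mid s1 zc; first by apply: k0; exact: chmap_cy.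
have [n [g gs]] := fin_gen_surj (fin_gen_sub M noethR fin_gen_regular).
have s2 := ef_ses T (@sinc_inj _ _ (ker g)) gs (fun x => sincP x)
  (fun y y0 => ex_intro _ (mksub (U := ker g) y0) erefl).
have [y [a' [yP dyP ac']]] := ses_connect s2 ac.
have [||t nt tP] := lo (subm (ker g)) _ (l - 1).
- by apply: fin_gen_sub => //; exact: fin_gen_rv.
- by rewrite ltrBlDr ltS.
exists t => //.
have [a'' a''P] := bd_at (esym (subrK 1 l)) (tP a' ac').
pose w := t *: y - ef_map T (sinc (ker g)) l a''.
have wc : is_cycle w.
  by apply/cyP; rewrite linearB linearZ_LR chmapP -a''P dyP linearZ_LR subrr.
have gw : ef_map T g l w = t *: a.
  case: (s2) => _ _ h _; by rewrite [LHS]linearB h subr0 linearZ_LR yP.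
have E x : (sinc M \o g) x = sinc M (g x) by [].
rewrite -(subrK (ef_map T (sinc M) l a) z) scalerDr; apply: subD.
  by apply: Ub; exact: bdZ.
rewrite -[t *: _](linearZ_LR (ef_map T (sinc M) l)) -gw -(ef_comp E).
apply: (ef_residue (m := m) (fgproj_rv R n)) => // x; apply/MP; exact: sincP.
Qed.

(** For T = Hom(F, -) this says that the infimum moves by exactly l0, for every module here and for
    every homologically finite complex in [sharp_bottom]. *)
Definition sharp (l0 : int) := (forall N, fin_gen N -> forall l, l < l0 -> hzero (T N) l) /\
  forall (N : lmodType R) (v : N), fin_gen N -> v <> 0 -> ~ hzero (T N) l0.

(** Below l0 everything vanishes, so in degree l0 a surjection N -> R/m stays surjective on
    homology; hence residue fields suffice as tests. *)
Lemma sharpI (l0 : int) : (forall l, l < l0 -> hzero (T R^o) l) ->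
  (forall (m : set R) (M : submod (R^o : lmodType R)), maximal_ideal m -> (forall x : R^o, M x <-> m x) ->
     ~ hzero (T (quom M)) l0) -> sharp l0.
Proof.
move=> TR nk; have lo N : fin_gen N -> forall l, l < l0 -> hzero (T N) l.
  move=> Nf l; apply: (ef_fin_gen (hzero_zero_like R) noethR (a := a0) (c := l0)) => //.
split=> // N v Nf v0 N0; have [m [M [q [maxm MP qs]]]] := residue_quotient Nf v0.
apply: (nk m M maxm MP); have s := ef_ses T (@sinc_inj _ _ (ker q)) qs (fun x => sincP x)
  (fun y y0 => ex_intro _ (mksub (U := ker q) y0) erefl).
apply: (ses_hzero_right s N0); apply: lo; last by rewrite ltrBlDr ltS.
exact: fin_gen_sub.
Qed.

Lemma sharp_amp (l0 : int) : (forall l, l != l0 -> hzero (T R^o) l) ->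
  (forall m : set R, maximal_ideal m -> exists l, ~ locz m (T R^o) l) -> sharp l0.
Proof.
move=> TR nt; apply: sharpI => [l lt|m M maxm MP k0]; first by apply: TR; rewrite lt_eqF.
have [l nl] := nt m maxm; apply: nl.
have [->|ne] := eqVneq l l0; last by apply: (zl_zero (locz_zero_like maxm)); exact: TR.
apply: (residue_step maxm MP) => // N Nf l' lt; apply: (zl_zero (locz_zero_like maxm)).
apply: (ef_fin_gen (hzero_zero_like R) noethR (a := a0) (c := l0)) => // k kl.
by apply: TR; rewrite lt_eqF.
Qed.

Lemma sharp_local : local_ring R -> (forall m : set R, maximal_ideal m -> exists l, ~ locz m (T R^o) l) ->
  exists l0, sharp l0.
Proof.
move=> [m [maxm mu]] nt; have [M MP] := max_submod maxm.
have [l nl] := nt m maxm.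
have step l' : (forall l'', l'' < l' -> hzero (T (quom M)) l'') ->
   forall l'', l'' < l' -> locz m (T R^o) l''.
  move=> k0 l''.
  have [j] : exists j : nat, l'' < a0 + j%:Z.
    by exists (`|l'' - a0|.+1)%N; rewrite -ltrBlDl -addn1 PoszD ltzD1 abszE ler_norm.
  elim: j l'' => [|j IH] l''.
    by rewrite addr0 => la _; apply: (zl_zero (locz_zero_like maxm)); exact: T0.
  rewrite -addn1 PoszD addrA ltzD1 le_eqVlt => /orP[/eqP lk lt|]; last exact: IH.
  apply: (residue_step maxm MP); last exact: k0.
  move=> N Nf l3 l3l; apply: (ef_fin_gen (locz_zero_like maxm) noethR (a := a0) (c := l'')) => //.
    by move=> K k ka; apply: (zl_zero (locz_zero_like maxm)); exact: T0.
  by move=> k kl; apply: IH; [rewrite -lk | exact: lt_trans lt].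
(* l0 is the least degree in which T of the residue field has homology. If there were none, [step]
   would make T R locally acyclic, against [nl]. *)
have [l0 [kz kn]] : exists l0, (forall l', l' < l0 -> hzero (T (quom M)) l') /\ ~ hzero (T (quom M)) l0.
  apply: contrapT => no.
  have all j l' : l' < a0 + j%:Z -> hzero (T (quom M)) l'.
    elim: j l' => [|j IH] l'; first by rewrite addr0; exact: T0.
    rewrite -addn1 PoszD addrA ltzD1 le_eqVlt => /orP[/eqP ->|]; last exact: IH.
    by apply: contrapT => nz; apply: no; exists (a0 + j%:Z).
  apply/nl/(step (l + 1)); last exact: ltS.
  move=> l' _; apply: (all `|l' - a0|.+1).
  by rewrite -ltrBlDl -addn1 PoszD ltzD1 abszE ler_norm.
exists l0; apply: sharpI.
  move=> l' lt; apply: hzero_locz => m' /mu ->; exact: (step l0).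
(* The quotient depends on the submodule record and not only on m; another presentation of the same
   ideal gives an isomorphic residue field. *)
move=> m' M' maxm' MP' k0; apply: kn.
have e x : M x <-> M' x by rewrite MP MP' (mu _ maxm').
have ql : factors M (qpi M') by move=> x Mx; apply/qpi0; apply/e.
have ql' : factors M' (qpi M) by move=> x Mx; apply/qpi0; apply/e.
apply: (hzero_retract (i := ef_map T (qlift ql)) (r := ef_map T (qlift ql'))) k0 => x.
have E y : (idfun : {linear quom M -> quom M}) y = qlift ql' (qlift ql y).
  by have [w <-] := qpi_surj y; rewrite !qliftE.
have H y : (idfun : {linear quom M -> quom M}) y = y by [].
by rewrite -(ef_comp E) (ef_id H).
Qed.
End Functor.

Section HomInf.
Variables (F : complex R) (l0 : int).
Hypotheses (Fp : dg_fgproj F) (KF : Kprojective F).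
Let Fpr : dg_proj F := fun i => fgproj_projective (Fp i).
Hypothesis sh0 : sharp (homfun Fpr) l0.

Lemma deg0_sh_qiso V l : (forall i, i != l -> cx_zero_at V i) ->
  exists g : chmap (in_deg0 (V l)) (sh (- l) V), qiso g.
Proof.
move=> V0; have e : l = 0 - - l by rewrite opprK add0r.
have gc (x : V l) : is_cycle (tr V l (0 - - l) x : sh (- l) V 0).
  have h : 0 - 1 - - l != l by rewrite opprK sub0r -subr_eq0 addrK.
  by apply/cyP; exact: (V0 _ h).
pose g := @from_deg0 R (V l) (sh (- l) V) (tr V l (0 - - l)) gc.
exists g; apply: qiso_bij.
  case=> [[|k]|k] x y.
  - by have [h _] := @tr_bij R V _ _ e; exact: h.
  - by move=> _; rewrite [x]thinmx0 [y]thinmx0.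
  by move=> _; rewrite [x]thinmx0 [y]thinmx0.
case=> [[|k]|k] y.
- by have [_ h] := @tr_bij R V _ _ e; exact: h.
- have h : Posz k.+1 - - l != l by rewrite opprK -subr_eq0 addrK.
  by exists 0; rewrite linear0; symmetry; exact: (V0 _ h).
have h : Negz k - - l != l by rewrite opprK -subr_eq0 addrK.
by exists 0; rewrite linear0; symmetry; exact: (V0 _ h).
Qed.
Lemma hom_concentrated V l j : (forall i, i != l -> cx_zero_at V i) ->
  hzero (homfun Fpr (V l)) j <-> hzero (homC idR F V) (j + l).
Proof.
move=> V0; have [g qg] := deg0_sh_qiso V0.
apply: iff_trans (qiso_hzero j (qiso_hpost_Kproj KF qg)) _.
have := (hom_sh_post idR F V (- l) j).1; rewrite opprK => h; exact: iff_sym h.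
Qed.

Lemma sharp_lower W i : hbounded W -> (forall j, hfin_gen W j) -> (forall j, j < i -> hzero W j) ->
  forall j, j < i + l0 -> hzero (homC idR F W) j.
Proof.
move=> /hboundedP[_ [b [_ Wb]]] Wf W0.
apply: (@devissage R (fun W => forall j, j < i + l0 -> hzero (homC idR F W) j) i b) W0 Wb Wf.
- move=> X Y f qf; have q := qiso_hpost_Kproj KF qf.
  by split=> h j lj; apply/(qiso_hzero j q); exact: h.
- move=> A B C f g s hA hC j lj; apply: (ses_hzero_mid (ses_hpost_proj s Fpr)); auto.
- by move=> X Xa j _; exact: KF.
move=> V l /andP[il _] V0 Vf j lj; rewrite -(subrK l j); apply/hom_concentrated => //.
apply: sh0.1 => //; rewrite ltrBlDr; apply: lt_le_trans lj _; rewrite addrC lerD2l; exact: il.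
Qed.
(** Truncation isolates the module H_i(W). The rest of W starts in degree i + 1, so its Hom(F, -)
    starts no lower than i + 1 + l0 and cannot cancel the homology of Hom(F, H_i(W)) in degree i +
    l0. *)
Lemma sharp_bottom W i : hbounded W -> (forall j, hfin_gen W j) -> (forall j, j < i -> hzero W j) ->
  ~ hzero W i -> ~ hzero (homC idR F W) (i + l0).
Proof.
move=> Wb Wf W0 nW nz; apply: nW.
have qT := Tge_qiso W0; set T := Tge W i in qT; apply/(qiso_hzero i qT).
have Tb : hbounded T by apply/(qiso_hbounded qT).
have Tf j : hfin_gen T j by apply/(qiso_hfin _ qT).
have T0 j : j < i -> cx_zero_at T j by move=> lt; exact: sub_zero_below.
have s := ses_subquo (@tru_bd R T i).
have B0 j : j != i -> cx_zero_at (Tle T i) j.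
  case: ltgtP => // [lt _|gt _]; last exact: Tle_zero.
  by move=> x; have [y <-] := qpi_surj x; rewrite [y]T0 // linear0.
have Ab : hbounded (Tgt T i).
  move/hboundedP: Tb => [c [d [h1 h2]]]; apply/hboundedP; exists (i + 1), (Num.max (i + 1) d).
  split=> j; first by rewrite ltzD1; exact: Tgt_hzero.
  by rewrite ge_max => /andP[le1 le2]; apply: Tgt_hzero_gt; [rewrite -lezD1 | exact: h2].
have A0 : forall j, j < i + 1 + l0 -> hzero (homC idR F (Tgt T i)) j.
  apply: sharp_lower => // [j|j]; first exact: Tgt_hfin.
  by rewrite ltzD1; exact: Tgt_hzero.
have Bz : hzero (homC idR F (Tle T i)) (i + l0).
  apply: (ses_hzero_right (ses_hpost_proj s Fpr)).
    by apply/(qiso_hzero _ (qiso_hpost_Kproj KF qT)).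
  by apply: A0; rewrite -[i + 1 + l0]addrA [1 + l0]addrC addrA; apply: lt_trans (ltS _); rewrite ltrBlDr; exact: ltS.
have Bf : fin_gen (Tle T i i).
  have [r [rc rP]] := Tf i; exists (map (qpi _) r) => y; have [x <-] := qpi_surj y.
  have [|c cP] := rP x; first by apply/cyP; rewrite [LHS]T0 // ltrBlDr ltS.
  exists c; rewrite size_map.
  under eq_bigr do rewrite (nth_map 0) // -linearZ_LR.
  rewrite -lin_sum; apply/qpiP; split=> // lt.
  by move: lt; rewrite ltxx.
move=> z zc; apply: contrapT => nb.
have v0 : (qpi (tru i (bdm T) i) z : Tle T i i) <> 0.
  by move=> /qpi0 -[_ h]; apply: nb; exact: h.
apply: (sh0.2 _ _ Bf v0); apply/(hom_concentrated _ B0); by rewrite addrC.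
Qed.
End HomInf.
End Sharp.

(** * Change of rings *)

Section Invariance.
Variable R : comPzRingType.
Implicit Types A B E X Y J P L : complex R.
Local Notation idR := (idfun : {rmorphism R -> R}).

Lemma qiso_hpost_Kinj X J J' (g : chmap J J') : Kinjective J -> Kinjective J' -> qiso g ->
  qiso (hpost idR X g).
Proof. by move=> KJ KJ' qg; apply/qiso_hpost/contr_hom_post; exact: qiso_Kinj_contr. Qed.

Lemma qiso_square A B B' E (f : chmap A B) (f' : chmap A B') (g : chmap B E) (g' : chmap B' E) :
  (forall i x, g i (f i x) = g' i (f' i x)) -> qiso g -> qiso g' -> qiso f <-> qiso f'.
Proof.
move=> e qg qg'; have E1 : chcomp g f = chcomp g' f' by exact: chmap_ext.
split=> q; [apply: (qiso_cancel_r (g := g')) => // | apply: (qiso_cancel_r (g := g)) => //].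
  by rewrite -E1; exact: qiso_comp.
by rewrite E1; exact: qiso_comp.
Qed.

(** The biduals with respect to J and J' are related by no direct map, as the inner and outer Hom
    vary oppositely; both map to Hom(Hom(X, J), J'). *)
Lemma biduality_Kinj X J J' (g : chmap J J') : Kinjective J -> Kinjective J' -> qiso g ->
  qiso (biduality_map X J) <-> qiso (biduality_map X J').
Proof.
move=> KJ KJ' qg.
apply: (qiso_square (g := hpost idR (homC idR X J) g) (g' := hpre idR J' (hpost idR X g))).
- move=> i x; apply: hext => n j k e; rewrite hpostE hpreE !bidE hpostE.
  by rewrite linearZ_LR.
- exact: qiso_hpost_Kinj.
by apply: qiso_hpre_Kinj => //; exact: qiso_hpost_Kinj.
Qed.
Lemma biduality_qiso X X' J (f : chmap X X') : Kinjective J -> qiso f ->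
  qiso (biduality_map X J) <-> qiso (biduality_map X' J).
Proof.
move=> KJ qf; apply: iff_trans (qisoP _) _; apply: iff_trans _ (iff_sym (qisoP _)).
by split=> h i; apply/(qiso_hzero i (bid_qiso KJ qf)); exact: h.
Qed.
Lemma hom_hzero_inv X X' J J' (f : chmap X X') (g : chmap J J') n : Kinjective J -> Kinjective J' ->
  qiso f -> qiso g -> hzero (homC idR X J) n <-> hzero (homC idR X' J') n.
Proof.
move=> KJ KJ' qf qg; apply: iff_trans (iff_sym (qiso_hzero n (qiso_hpre_Kinj KJ qf))) _.
exact/qiso_hzero/qiso_hpost_Kinj.
Qed.
Lemma hzero_hbounded (R' : comPzRingType) (X : complex R) (X' : complex R') :
  (forall n, hzero X n <-> hzero X' n) -> hbounded X <-> hbounded X'.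
Proof.
move=> h; split=> /hboundedP[a [b [h1 h2]]]; apply/hboundedP; exists a, b.
  by split=> i hi; apply/h; auto.
by split=> i hi; apply/(h i); auto.
Qed.
Lemma inj_res_unique Y J J' (f : chmap Y J) (f' : chmap Y J') : Kinjective J -> Kinjective J' ->
  qiso f -> qiso f' -> exists g : chmap J J', qiso g.
Proof.
move=> KJ KJ' qf qf'; have [g gh] := Kinj_ext f' KJ' qf; exists g.
apply: (qiso_cancel_l (f := f)) => //.
by apply: qiso_hequal qf'; exact: homotopic_hequal.
Qed.
Lemma proj_res_unique X L P (f : chmap L X) (f' : chmap P X) : Kprojective L ->
  qiso f -> qiso f' -> exists g : chmap L P, qiso g.
Proof.
move=> KL qf qf'; have [g gh] := Kproj_lift f KL qf'; exists g.
apply: (qiso_cancel_r (g := f')) => //.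
by apply: qiso_hequal qf; exact: homotopic_hequal.
Qed.

Section TensMap.
Variable N : lmodType R.
Definition tensC_map L P (g : chmap L P) : chmap (tensC idR L N) (tensC idR P N).
Proof.
exists (fun i => tens_map idR (g i) N : {linear tens idR (L i) N -> tens idR (P i) N}) => i j u.
abstract (apply: (tens_eq (f := tens_map idR (cd P i j) N \o tens_map idR (g i) N)
   (g := tens_map idR (g j) N \o tens_map idR (cd L i j) N)) => x y;
   rewrite -[LHS]/(tens_map idR (cd P i j) N (tens_map idR (g i) N (pure idR x y)));
   rewrite -[RHS]/(tens_map idR (g j) N (tens_map idR (cd L i j) N (pure idR x y)));
   by rewrite !tens_map_pure chmapP).
Defined.
Lemma tensC_hequal L P (g g' : chmap L P) : homotopic g g' -> hequal (tensC_map g) (tensC_map g').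
Proof.
move=> [s sP] i z zc.
have E (u : tensC idR L N i) : tens_map idR (g i) N u - tens_map idR (g' i) N u =
   tens_map idR (cd P (i + 1) i) N (tens_map idR (s i (i + 1)) N u) +
   tens_map idR (s (i - 1) i) N (tens_map idR (cd L i (i - 1)) N u).
  have a1 : linear (fun u : tens idR (L i) N => tens_map idR (g i) N u - tens_map idR (g' i) N u).
    by move=> a x y; rewrite [tens_map idR (g i) N _]linearP [tens_map idR (g' i) N _]linearP opprD scalerBr addrACA.
  have a2 : linear (fun u : tens idR (L i) N =>
      tens_map idR (cd P (i + 1) i) N (tens_map idR (s i (i + 1)) N u) +
      tens_map idR (s (i - 1) i) N (tens_map idR (cd L i (i - 1)) N u)).
    move=> a x y; rewrite [tens_map idR (s i (i + 1)) N _]linearP [tens_map idR (cd L i (i - 1)) N _]linearP.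
    rewrite [tens_map idR (cd P (i + 1) i) N _]linearP [tens_map idR (s (i - 1) i) N _]linearP.
    by rewrite scalerDr addrACA.
  apply: (tens_eq (f := mklin a1) (g := mklin a2)) => x y.
  rewrite -[LHS]/(tens_map idR (g i) N (pure idR x y) - tens_map idR (g' i) N (pure idR x y)).
  rewrite -[RHS]/(tens_map idR (cd P (i + 1) i) N (tens_map idR (s i (i + 1)) N (pure idR x y)) +
      tens_map idR (s (i - 1) i) N (tens_map idR (cd L i (i - 1)) N (pure idR x y))).
  rewrite !tens_map_pure -pureDl -sP pureDl; congr (_ + _).
  by rewrite -[LHS]scaleN1r -pureZr -[-1 *: y]/(idR (-1) *: y) -pureZl scaleN1r.
rewrite -[_ - _]/(tens_map idR (g i) N z - tens_map idR (g' i) N z) E.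
by rewrite [tens_map idR (cd L _ _) N z]zc linear0 addr0; exact: (@bd_cd R (tensC idR P N)).
Qed.
(** Between K-projective complexes g has an inverse up to homotopy, and homotopies survive tensoring
    with N; flatness plays no part in the argument. *)
Lemma tensC_map_qiso L P (g : chmap L P) : Kprojective L -> Kprojective P -> qiso g ->
  qiso (tensC_map g).
Proof.
move=> KL KP qg; have [h hh] := Kproj_lift (chmap_id P) KP qg.
have hh2 : homotopic (chmap_id L) (chcomp h g).
  apply: (Kproj_homotopic KL qg); case: hh => s sP.
  exists (fun i j => s i j \o g i) => i x.
  by have := sP i (g i x); rewrite /= chmapP.
have tE A B D (a : chmap A B) (b : chmap B D) i u :
    tensC_map (chcomp b a) i u = tensC_map b i (tensC_map a i u).
  apply: (tens_eq (f := tens_map idR (chcomp b a i) N) (g := tens_map idR (b i) N \o tens_map idR (a i) N)) => x y.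
  transitivity (pure idR (b i (a i x)) y); first exact: tens_map_pure.
  by rewrite /= !tens_map_pure.
have tI A i u : tensC_map (chmap_id A) i u = u.
  apply: (tens_eq (f := tens_map idR (chmap_id A i) N) (g := idfun)) => x y.
  exact: tens_map_pure.
move=> i; split=> [z zc zb|w wc].
  rewrite -(subrK (tensC_map (chcomp h g) i z) z); apply: bdD.
    by have := tensC_hequal hh2 zc; rewrite tI.
  rewrite tE; exact: chmap_bd.
exists (tensC_map h i w); first exact: chmap_cy.
by rewrite -tE; have := tensC_hequal hh wc; rewrite tI.
Qed.
End TensMap.
End Invariance.

Section Restriction.
Variables (R S : comPzRingType) (phi : {rmorphism R -> S}).
Local Notation idR := (idfun : {rmorphism R -> R}).
Local Notation idS := (idfun : {rmorphism S -> S}).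
Implicit Types (Z W : complex S) (I : complex R).

Definition restrC Z : complex R.
Proof.
refine (@Complex R (fun i => restr phi (Z i)) (fun i j => restr_map phi (cd Z i j) : {linear restr phi (Z i) -> restr phi (Z j)}) _ _).
- by move=> i j x; exact: (@cd_shape S Z i j x).
by move=> i j k x; exact: (@cd_cd S Z i j k x).
Defined.
Definition restrF Z W (f : chmap Z W) : chmap (restrC Z) (restrC W).
Proof.
exists (fun i => restr_map phi (f i) : {linear restr phi (Z i) -> restr phi (W i)}) => i j x.
exact: (chmapP f).
Defined.
Lemma restrC_hzero Z i : hzero (restrC Z) i <-> hzero Z i.
Proof. by []. Qed.
Lemma restrF_qiso Z W (f : chmap Z W) : qiso (restrF f) <-> qiso f.
Proof. by []. Qed.
Lemma restrC_hfin Z i : hfin_gen (restrC Z) i -> hfin_gen Z i.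
Proof.
move=> [s [sc sP]]; exists s; split=> // z /sP[c cP]; exists (fun k => phi (c k)).
exact: cP.
Qed.

Local Notation S0 := (in_deg0 (S^o : lmodType S)).

Section Coinduced.
Variable I : complex R.
Local Notation D := (homC phi S0 I).
(** Evaluation at 1, the counit of the adjunction between restriction of scalars and Hom_R(S, -). By
    [eps_inj] the values at the multiples s w determine w. *)
Definition eps j (w : D j) : I j := ha w j (1 : S0 0).
Lemma epsL j a (w w' : D j) : eps (phi a *: w + w') = a *: eps w + eps w'.
Proof. by rewrite /eps hDa hZa -[phi a *: _]addr0 haP ha0 addr0. Qed.
Lemma eps_cd j k (w : D j) : eps (cd D j k w) = cd I j k (eps w).
Proof.
have [e|ne] := eqVneq j (k + 1); last by rewrite !cd_shape.
by rewrite /eps (homC_cd _ _ e e erefl) [cd S0 _ _ _]/(0 : _) ha0 scaler0 subr0.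
Qed.
Lemma epsZ j (w : D j) (s : S0 0) : ha w j s = eps ((s : S) *: w).
Proof. by rewrite /eps hZa -[_ *: _]/((s : S) * 1) mulr1. Qed.
Lemma eps_sign j k (w : D j) : eps ((-1) ^+ k *: w) = (-1) ^+ k *: eps w.
Proof. by rewrite /eps hsign_a. Qed.
Lemma eps_inj j (w w' : D j) : (forall s : S, eps (s *: w) = eps (s *: w')) -> w = w'.
Proof.
move=> e; apply: hext => a b s ab.
have [a0|na] := eqVneq a 0; last by rewrite [s](in_deg0_zero na) !ha0.
by rewrite a0 add0r in s ab *; rewrite ab !epsZ e.
Qed.

Section Theta.
Variable Z : complex S.
Fact coind_subproof n (h : homC idS Z D n) i j a (x y : restrC Z i) :
  eps (ha h j (idR a *: x + y : restrC Z i)) = a *: eps (ha h j x) + eps (ha h j y).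
Proof. by rewrite -epsL; congr eps; exact: haP. Qed.
Fact coind_linear n : linear (fun h : restrC (homC idS Z D) n =>
  mkh n (fun i j => mkshom (@coind_subproof n h i j)) : homC idR (restrC Z) I n).
Proof.
move=> a h k; apply: hext => i j x e; rewrite hDa hZa !ha_mkh // !mkshomE.
Qed.
Lemma coindE n h i j (x : Z i) : ha (mklin (@coind_linear n) h) j (x : restrC Z i) = eps (ha (h : homC idS Z D n) j x).
Proof.
have [e|ne] := eqVneq j (i + n); first by rewrite ha_mkh.
by rewrite ha_ne // ha_ne.
Qed.
Fact coind_cd n m h : cd (homC idR (restrC Z) I) n m (mklin (@coind_linear n) h) =
  mklin (@coind_linear m) (cd (restrC (homC idS Z D)) n m h).
Proof.
have [e|ne] := eqVneq n (m + 1); last by rewrite !cd_shape ?linear0.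
apply: hext => i j x ij; rewrite (homC_cd _ _ e erefl erefl) !coindE.
rewrite -[ha (cd _ _ _ _) _ _]/(ha (cd (homC idS Z D) n m h) j (x : Z i)) (homC_cd _ _ e erefl erefl).
rewrite -eps_cd -eps_sign -[eps _ - _]addrC -scaleN1r -epsL rmorphN1 scaleN1r addrC.
by [].
Qed.
Definition coind : chmap (restrC (homC idS Z D)) (homC idR (restrC Z) I) := Chmap coind_cd.
Lemma coind_qiso : qiso coind.
Proof.
apply: qiso_bij => n.
  move=> h h' e; apply: (@hext _ _ idS) => i j x ij; apply: eps_inj => s.
  have lin (g : homC idS Z D n) : s *: ha g j x = ha g j (s *: x).
    by rewrite -[s *: x]addr0 -[s in RHS]/(idS s) haP ha0 addr0.
  by rewrite !lin; have := congr1 (fun k => ha k j ((s *: x : Z i) : restrC Z i)) e; rewrite !coindE.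
move=> k.
have l1 i (z : Z i) a b c (s s' : S0 a) :
    ha k b ((tr S0 a 0 (phi c *: s + s') : S) *: z : restrC Z i) =
    c *: ha k b ((tr S0 a 0 s : S) *: z : restrC Z i) + ha k b ((tr S0 a 0 s' : S) *: z : restrC Z i).
  rewrite linearP scalerDl -[_ *: _ in LHS]scalerA.
  by rewrite -[phi c *: _]/(idR c *: ((tr S0 a 0 s : S) *: z : restrC Z i)) haP.
(* The inverse of the adjunction sends k to z |-> (s |-> k(s z)). *)
pose K i j (z : Z i) : D j := mkh j (fun a b => mkshom (@l1 i z a b)).
have Kl i j t (z z' : Z i) : K i j (idS t *: z + z') = t *: K i j z + K i j z'.
  apply: hext => a b s ab; rewrite hDa hZa !ha_mkh // !mkshomE.
  by rewrite scalerDr haD [tr _ _ _ (_ *: _)]linearZ_LR !scalerA mulrC.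
exists (mkh n (fun i j => mkshom (@Kl i j))); apply: hext => i j x ij.
rewrite coindE ha_mkh // mkshomE /eps ha_mkh ?add0r // mkshomE trE.
by rewrite -[X in ha k j X]/((1 : S) *: (x : Z i)) scale1r.
Qed.
End Theta.

Lemma coind_Kinj : Kinjective I -> Kinjective D.
Proof.
move=> KI A Aa n; apply/restrC_hzero/(qiso_hzero n (coind_qiso A)).
by apply: KI => i; apply/restrC_hzero.
Qed.
Lemma coind_hom_hzero Z n : hzero (homC idS Z D) n <-> hzero (homC idR (restrC Z) I) n.
Proof. exact: iff_trans (iff_sym (restrC_hzero _ n)) (qiso_hzero n (coind_qiso Z)). Qed.
Lemma coind_biduality Z : Kinjective I ->
  qiso (biduality_map Z D) <-> qiso (biduality_map (restrC Z) I).
Proof.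
move=> KI; apply: iff_trans (iff_sym (restrF_qiso (biduality_map Z D))) _.
apply: (qiso_square (g := coind (homC idS Z D)) (g' := hpre idR I (coind Z))).
- move=> p x; apply: hext => n j h e; rewrite coindE hpreE bidE coindE.
  rewrite -[LHS]/(eps (ha (biduality_map Z D p x) j (h : homC idS Z D n))) bidE.
  exact: eps_sign.
- exact: coind_qiso.
by apply: qiso_hpre_Kinj => //; exact: coind_qiso.
Qed.

Local Notation N0 := (in_deg0 (restr phi S^o : lmodType R)).
Fact dom_subproof n (w : D n) i j a (x y : N0 i) :
  ha w j (tr N0 i 0 (idR a *: x + y) : S0 0) =
  a *: ha w j (tr N0 i 0 x : S0 0) + ha w j (tr N0 i 0 y : S0 0).
Proof. by rewrite linearP; exact: haP. Qed.
Fact dom_linear n : linear (fun w : restrC D n =>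
  mkh n (fun i j => mkshom (@dom_subproof n w i j)) : homC idR N0 I n).
Proof.
move=> a h k; apply: hext => i j x e; rewrite hDa hZa !ha_mkh // !mkshomE.
by rewrite [tr N0 _ _ (_ *: _)]linearZ_LR.
Qed.
Lemma domE n (w : D n) i j (x : N0 i) : j = i + n ->
  ha (mklin (@dom_linear n) w) j x = ha w j (tr N0 i 0 x : S0 0).
Proof. by move=> e; rewrite ha_mkh. Qed.
Fact dom_cd n m h : cd (homC idR N0 I) n m (mklin (@dom_linear n) h) =
  mklin (@dom_linear m) (cd (restrC D) n m h).
Proof.
have [e|ne] := eqVneq n (m + 1); last by rewrite !cd_shape ?linear0.
apply: hext => i j x ij; have [i0|ni] := eqVneq i 0; last first.
  by rewrite [x](in_deg0_zero ni) !ha0.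
rewrite (homC_cd _ _ e erefl erefl) [cd N0 _ _ _]/(0 : _) ha0 scaler0 subr0 !domE //; last by rewrite ij e; zm.
rewrite -[ha (cd (restrC D) _ _ _) _ _]/(ha (cd D n m h) j (tr N0 i 0 x : S0 0)) (homC_cd _ _ e erefl erefl).
by rewrite [cd S0 _ _ _]/(0 : _) ha0 scaler0 subr0.
Qed.
Definition dom : chmap (restrC D) (homC idR N0 I) := Chmap dom_cd.
Lemma dom_qiso : qiso dom.
Proof.
apply: qiso_bij => n.
  move=> h h' e; apply: (@hext _ _ phi) => i j x ij.
  have [i0|ni] := eqVneq i 0; last by rewrite [x](in_deg0_zero ni) !ha0.
  rewrite i0 in x ij *; have := congr1 (fun k => ha k j (x : N0 0)) e.
  by rewrite !domE // trE.
move=> k.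
have l1 i j a (x y : S0 i) : ha k j (tr S0 i 0 (phi a *: x + y) : N0 0) =
   a *: ha k j (tr S0 i 0 x : N0 0) + ha k j (tr S0 i 0 y : N0 0).
  by rewrite linearP; exact: haP.
exists (mkh n (fun i j => mkshom (@l1 i j))); apply: hext => i j x ij.
have [i0|ni] := eqVneq i 0; last by rewrite [x](in_deg0_zero ni) !ha0.
rewrite i0 in x ij *; rewrite domE // ha_mkh // mkshomE !trE.
by [].
Qed.
Lemma coind_hzero (F : complex R) (f : chmap F N0) n : Kinjective I -> qiso f ->
  hzero D n <-> hzero (homC idR F I) n.
Proof.
move=> KI qf; apply: iff_trans (iff_sym (restrC_hzero D n)) _.
apply: iff_trans (qiso_hzero n dom_qiso) _.
exact/qiso_hzero/qiso_hpre_Kinj.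
Qed.
End Coinduced.

Local Notation N := (restr phi S^o : lmodType R).
Lemma tens_restr_exists (M : lmodType R) : exists h : {linear tens idR M N -> restr phi (tens phi M S^o)},
  forall x (y : N), h (pure idR x y) = pure phi x (y : S^o).
Proof.
apply: tens_lift => [x x' y|x a y z|a x y]; first exact: pureDl.
  by rewrite pureDr; congr (_ + _); exact: pureZr.
exact: pureZl.
Qed.
Definition tens_restr M := proj1_sig (cid (tens_restr_exists M)).
Lemma tens_restr_pure M x (y : N) : tens_restr M (pure idR x y) = pure phi x (y : S^o).
Proof. exact: (proj2_sig (cid (tens_restr_exists M))). Qed.
Lemma tens_restr_class (M : lmodType R) (s : seq (M * N)) :
  tens_restr M (tens_class idR s) = tens_class phi (s : seq (M * S^o)).
Proof.
rewrite !tens_classE lin_sum; apply: eq_bigr => q _; exact: tens_restr_pure.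
Qed.
Lemma tens_rel_restr (M : lmodType R) (s t : seq (M * S^o)) : tens_rel phi s t ->
  tens_rel idR (s : seq (M * N)) (t : seq (M * N)).
Proof.
elim=> {s t}.
- by move=> s; exact: TensRefl.
- by move=> s t _; exact: TensSym.
- by move=> s t v _ h1 _ h2; exact: TensTrans h1 h2.
- by move=> s s' t t' _ h1 _ h2; exact: TensCat.
- by move=> s t; exact: TensComm.
- by move=> y; exact: TensZero.
- by move=> x x' y; exact: TensAddl.
- by move=> x y y'; exact: (@TensAddr _ _ idR M N).
by move=> a x y; exact: (@TensScale _ _ idR M N).
Qed.
Definition tensC_restr (P : complex R) : chmap (tensC idR P N) (restrC (tensC phi P S^o)).
Proof.
exists (fun i => tens_restr (P i)) => i j.
abstract (elim/tens_ind => s; rewrite tens_restr_class -[cd (tensC idR P N) i j _]/(tens_map idR _ _ _) tens_mapE tens_restr_class; exact: tens_mapE).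
Defined.
Lemma tensC_restr_qiso P : qiso (tensC_restr P).
Proof.
apply: qiso_bij => i.
  elim/tens_ind => s; elim/tens_ind => t; rewrite -![tensC_restr P i _]/(tens_restr _ _) !tens_restr_class.
  by move=> /tens_classP/tens_rel_restr h; exact/tens_classP.
by elim/tens_ind => s; exists (tens_class idR (s : seq (P i * N))); exact: tens_restr_class.
Qed.

(** A prime q of S over m contains m S but not 1, so [functional_mod] with U = q gives a functional
    S -> R/m with value 1 at 1. *)
Lemma residual_one : (forall m : set R, maximal_ideal m ->
    exists q : set S, prime_ideal q /\ forall x, q (phi x) <-> m x) -> residual (1 : N).
Proof.
move=> mS m maxm; have [q [[[q0 qL] q1 _] qm]] := mS m maxm.
have Ul (a : R) (x y : N) : q x -> q y -> q (a *: x + y : N).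
  by move=> qx qy; exact: qL.
have [||c [cl _ c1]] := @functional_mod R N m (@Submod R N (fun x => q x) q0 Ul) 1 maxm.
- move=> a x /qm ma; rewrite -[_ *: _]/(phi a * (x : S)) mulrC -[_ * _]addr0.
  exact: qL.
- exact: q1.
by exists c.
Qed.
End Restriction.

(** * Dimensions *)

Section Bounds.

Lemma infimum_min (P : set int) (i : int) : P i -> (forall j, P j -> i <= j) ->
  infimum +oo%E [set k%:E | k in P]%classic = i%:E.
Proof.
move=> Pi le; rewrite /infimum; case: ifPn => [/eqP e|_].
  have : ([set k%:E | k in P]%classic) i%:E by exists i.
  by rewrite e.
apply: xget_subset1; last exact: is_subset1_infimums.
split=> [x [j Pj <-]|y yl]; first by rewrite lee_fin; exact: le.
by apply: yl; exists i.
Qed.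
Lemma supremum_max (P : set int) (i : int) : P i -> (forall j, P j -> j <= i) ->
  supremum -oo%E [set k%:E | k in P]%classic = i%:E.
Proof.
move=> Pi le; rewrite /supremum; case: ifPn => [/eqP e|_].
  have : ([set k%:E | k in P]%classic) i%:E by exists i.
  by rewrite e.
apply: xget_subset1; last exact: is_subset1_supremums.
split=> [x [j Pj <-]|y yl]; first by rewrite lee_fin; exact: le.
by apply: yl; exists i.
Qed.
Lemma infimum_empty (P : set int) : (forall j, ~ P j) ->
  infimum +oo%E [set k%:E | k in P]%classic = +oo%E.
Proof.
move=> nP; rewrite /infimum ifT //; apply/eqP/seteqP; split=> // x [j /nP].
by [].
Qed.

Lemma int_least (P : int -> Prop) a k : (forall j, j < a -> ~ P j) -> P k ->
  exists2 i, P i & forall j, j < i -> ~ P j.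
Proof.
move=> Pa Pk; apply: contrapT => no.
have all n : forall j, j < a + n%:Z -> ~ P j.
  elim: n => [|n IH] j; first by rewrite addr0; exact: Pa.
  rewrite -addn1 PoszD addrA ltzD1 le_eqVlt => /orP[/eqP ->|]; last exact: IH.
  by move=> Pn; apply: no; exists (a + n%:Z).
apply: (all (`|k - a|.+1)%N k) => //.
by rewrite -ltrBlDl -addn1 PoszD ltzD1 abszE ler_norm.
Qed.

Section Homology.
Variable R : comPzRingType.
Implicit Types X : complex R.
Lemma hinf_min X i : ~ hzero X i -> (forall j, j < i -> hzero X j) -> hinf X = i%:E.
Proof. by move=> ni lo; apply: infimum_min => // j nj; rewrite leNgt; apply/negP => /lo. Qed.
Lemma hsup_max X i : ~ hzero X i -> (forall j, i < j -> hzero X j) -> hsup X = i%:E.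
Proof. by move=> ni lo; apply: supremum_max => // j nj; rewrite leNgt; apply/negP => /lo. Qed.
Lemma hinf_acyclic X : acyclic X -> hinf X = +oo%E.
Proof. by move=> Xa; apply: infimum_empty => j; apply; exact: Xa. Qed.
Lemma hbounded_least X : hbounded X -> ~ acyclic X ->
  exists2 i, ~ hzero X i & forall j, j < i -> hzero X j.
Proof.
move=> /hboundedP[a [_ [Xa _]]] /existsNP[k nk].
have [|i ni lo] := @int_least (fun i => ~ hzero X i) a k _ nk; first by move=> j /Xa h; apply.
by exists i => // j /lo h; apply: contrapT.
Qed.
Lemma hbounded_greatest X : hbounded X -> ~ acyclic X ->
  exists2 i, ~ hzero X i & forall j, i < j -> hzero X j.
Proof.
move=> /hboundedP[_ [b [_ Xb]]] /existsNP[k nk].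
have [||i ni lo] := @int_least (fun i => ~ hzero X (- i)) (- b + 1) (- k).
- by move=> j lt; apply; apply: Xb; rewrite lerNr -ltzD1.
- by rewrite opprK.
exists (- i) => // j lt; apply: contrapT; rewrite -(opprK j); apply: lo.
by rewrite ltrNl.
Qed.
End Homology.

Lemma hinf_congr (R R' : comPzRingType) (X : complex R) (X' : complex R') :
  (forall n, hzero X n <-> hzero X' n) -> hinf X = hinf X'.
Proof.
move=> h; rewrite /hinf (_ : [set i | ~ hzero X i]%classic = [set i | ~ hzero X' i]%classic) //.
by apply/seteqP; split=> i ni /h.
Qed.
End Bounds.

Section PerfectHom.
Variable R : comPzRingType.
Hypothesis noethR : noetherian R.
Local Notation idR := (idfun : {rmorphism R -> R}).
Variables (p : nat) (F : complex R) (u : F 0) (N : lmodType R) (f : chmap F (in_deg0 N)).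
Hypotheses (pF : perf p F) (uc : is_cycle u) (qf : qiso f) (fN : fpd p N) (re : residual (f 0 u : N)).
Let Fp : dg_fgproj F := (perf_fgproj pF).1.
Let KF : Kprojective F := perf_Kproj pF.
Definition rhom_fun : efun R := homfun (fun i => fgproj_projective (Fp i)).

(** The acyclic case is split off because both infima are then +oo and cannot be written as
    integers. *)
Lemma hom_perf_hinf W : hfinite W ->
  (hinf W = +oo%E /\ hinf (homC idR F W) = +oo%E) \/
  exists i j : int, [/\ hinf W = i%:E, hinf (homC idR F W) = j%:E, i - p%:Z <= j <= i &
    forall l0, sharp rhom_fun l0 -> j = i + l0].
Proof.
move=> [Wb Wf]; have ct := residual_ct pF re.
have [Wa|nWa] := pselect (acyclic W).
  by left; split; apply: hinf_acyclic => //; exact: KF.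
have [i ni lo] := hbounded_least Wb nWa; right.
have Pb : hbounded (homC idR F W) by exact: (thick_hom_perf (@thick_hbounded R) Wb pF).
(* Hom(F, -) detects acyclicity: were Hom(F, W) acyclic, [inf_ge] with j = i + 1 would kill
   H_i(W). *)
have nPa : ~ acyclic (homC idR F W).
  move=> Pa; apply: ni; apply: (inf_ge noethR pF uc ct (a := i) (j := i + 1) lo Wf) (ltS i).
  by move=> l _; exact: Pa.
have [j nj lo'] := hbounded_least Pb nPa.
have hW := hinf_min ni lo; have hP := hinf_min nj lo'.
exists i, j; split=> // [|l0 sh0].
  apply/andP; split; rewrite leNgt; apply/negP => lt.
    by apply: nj; exact: (Phi_lower pF lo).
  by apply: ni; exact: (inf_ge noethR pF uc ct lo Wf lo').
have nj' := sharp_bottom KF sh0 Wb Wf lo ni.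
have lo2 := sharp_lower KF sh0 Wb Wf lo.
apply/eqP; rewrite eq_le !leNgt; apply/andP; split; apply/negP => lt.
  by apply: nj'; exact: lo'.
by apply: nj; exact: lo2.
Qed.

Lemma rhom_nontriv m : maximal_ideal m -> exists l, ~ locz m (rhom_fun R^o) l.
Proof.
move=> maxm; apply: contrapT => no; apply: (hom_residual_nontriv uc re maxm).
apply: (ef_fpd (T := rhom_fun) (locz_zero_like maxm) (c := 1)) fN _ _ => // l _.
by apply: contrapT => nl; apply: no; exists l.
Qed.
Lemma rhom_below M l : l < 0 - p%:Z -> hzero (rhom_fun M) l.
Proof.
move=> lt; apply: (Phi_lower pF (b := 0)) lt => i lt.
by apply: hzero_zero_at; apply: in_deg0_zero; rewrite lt_eqF.
Qed.
Lemma deg0_hbounded (M : lmodType R) : hbounded (in_deg0 M).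
Proof.
apply/hboundedP; exists 0, 1; split=> i lt; apply: hzero_zero_at; apply: in_deg0_zero.
  by rewrite lt_eqF.
by rewrite gt_eqF // (lt_le_trans _ lt).
Qed.
Lemma rhom_hfin l : hfin_gen (rhom_fun R^o) l.
Proof.
apply: (hom_fin_gen noethR Fp KF); split; first exact: deg0_hbounded.
move=> i; have [->|ni] := eqVneq i 0; first by apply: fin_gen_hfin => //; exact: fin_gen_regular.
by apply: hzero_hfin; apply: hzero_zero_at; exact: in_deg0_zero.
Qed.
Lemma rhom_sharp_local : local_ring R -> exists l0, sharp rhom_fun l0.
Proof.
move=> lR; apply: (sharp_local noethR rhom_hfin rhom_below lR).
exact: rhom_nontriv.
Qed.
(** Amplitude depends only on the degrees that carry homology, so Y may live over another ring; it
    will be RHom_R(S, R). Amplitude 0 places the homology of Hom(F, R) in one degree, which becomes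
    l0. *)
Lemma rhom_sharp_amp (S : comPzRingType) (Y : complex S) : (exists m : set R, maximal_ideal m) ->
  (forall n, hzero Y n <-> hzero (rhom_fun R^o) n) -> amp Y = 0%E -> exists l0, sharp rhom_fun l0.
Proof.
move=> [m maxm] YT aY.
have Tb : hbounded (rhom_fun R^o).
  exact: (thick_hom_perf (@thick_hbounded R) (deg0_hbounded _) pF).
have Yb : hbounded Y by apply/(hzero_hbounded YT).
have nYa : ~ acyclic Y.
  move=> Ya; have [l] := rhom_nontriv maxm; apply.
  by apply: (zl_zero (locz_zero_like maxm)); apply/YT; exact: Ya.
have [i ni lo] := hbounded_least Yb nYa; have [j nj hi] := hbounded_greatest Yb nYa.
have e : j = i.
  move: aY; rewrite /amp (hinf_min ni lo) (hsup_max nj hi) -EFinB => -[/eqP].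
  by rewrite subr_eq0 => /eqP.
exists i; apply: (sharp_amp noethR rhom_hfin rhom_below); last exact: rhom_nontriv.
move=> l; case: ltgtP => // [lt _|gt _]; apply/YT; first exact: lo.
by apply: hi; rewrite e.
Qed.
End PerfectHom.

Section Resolutions.
Variable R : comPzRingType.
Implicit Types X Y : complex R.

Lemma proj_resP X : (exists p, is_proj_res (X := X) p) -> is_proj_res (proj_res X).
Proof. by move=> h; rewrite /proj_res; case: pselect => // h'; exact: (projT2 (cid h')). Qed.
Lemma inj_resP X : (exists p, is_inj_res (Y := X) p) -> is_inj_res (inj_res X).
Proof. by move=> h; rewrite /inj_res; case: pselect => // h'; exact: (projT2 (cid h')). Qed.

Lemma fpd_res n (N : lmodType R) : fpd n N -> has_res (@projective R) N n.
Proof.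
move=> /fpd_perf[F [f [pF qf]]]; have [Fp F0] := perf_fgproj pF; exists F, f.
by split=> // i; exact: fgproj_projective.
Qed.
Lemma res_fpd n (N : lmodType R) : noetherian R -> fin_gen N -> has_res (@projective R) N n%:Z -> fpd n N.
Proof.
move=> noethR Nf [F [f [Fp F0 qf]]]; apply: fpd_of_res => //; exists F, f; split=> // i.
by apply: inj_shom; [exact: Fp | exact: cogen_inj].
Qed.
Lemma res_flat_fpd n (N : lmodType R) : noetherian R -> fin_gen N -> has_res (@flat R) N n%:Z -> fpd n N.
Proof.
move=> noethR Nf [F [f [Ff F0 qf]]]; apply: fpd_of_res => //; exists F, f; split=> // i.
exact: flat_dual_inj.
Qed.
Lemma has_res_ge0 (Q : lmodType R -> Prop) (N : lmodType R) (e : N) n : e <> 0 -> has_res Q N n -> 0 <= n.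
Proof.
move=> e0 [F [f [_ F0 qf]]]; rewrite leNgt; apply/negP => n0; apply: e0.
have ec : is_cycle (e : in_deg0 N 0) by [].
have [z zc /bdP[w wP]] := (qf 0).2 _ ec.
have z0 : z = 0 by apply: F0; rewrite lexx /= -ltNge.
by move: wP; rewrite z0 linear0 subr0.
Qed.
(** A nonzero module has no resolution of negative length, so the set of lengths of projective
    resolutions has a least element; it is nonempty since a flat resolution yields a projective one
    of the same length. *)
Lemma pd_attained (N : lmodType R) (e : N) : noetherian R -> fin_gen N -> e <> 0 ->
  (fd N < +oo)%E -> exists2 p : nat, fpd p N & pd N = p%:Z%:E.
Proof.
move=> noethR Nf e0 fN.
have [n nP] : exists n, has_res (@flat R) N n.
  apply: contrapT => no; move: fN; rewrite /fd infimum_empty ?ltxx // => j h.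
  by apply: no; exists j.
have n0 := has_res_ge0 e0 nP.
have pn : has_res (@projective R) N n.
  by rewrite -(gez0_abs n0) in nP *; apply: fpd_res; exact: res_flat_fpd.
have [|i iP lo] := @int_least (fun i => has_res (@projective R) N i) 0 n _ pn.
  by move=> j j0 /(has_res_ge0 e0); rewrite leNgt j0.
have i0 := has_res_ge0 e0 iP.
exists `|i|%N; first by apply: res_fpd => //; rewrite gez0_abs.
rewrite /pd gez0_abs //; apply: infimum_min => // j jP; rewrite leNgt.
by apply/negP => /lo; exact.
Qed.
End Resolutions.

Lemma trivial_acyclic (R : comPzRingType) (X : complex R) : (1 : R) = 0 -> acyclic X.
Proof.
move=> t i; apply: hzero_zero_at => x.
by rewrite -(scale1r x) t scale0r.
Qed.
Lemma maximal_exists (R : comPzRingType) : (1 : R) <> 0 -> exists m : set R, maximal_ideal m.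
Proof.
move=> n0; have Z0 : (0 : R^o) = 0 by [].
have Zl (a x y : R^o) : x = 0 -> y = 0 -> (a : R) *: x + y = 0 by move=> -> ->; rewrite scaler0 addr0.
by have [|m [maxm _]] := @ideal_in_maximal R (@Submod R (R^o : lmodType R) (fun x => x = 0) Z0 Zl); [|exists m].
Qed.

(** * Reduction of the statements over S to statements over R *)

Section Comparison.
Variables (R S : comPzRingType) (phi : {rmorphism R -> S}).
Hypothesis noethR : noetherian R.
Local Notation idR := (idfun : {rmorphism R -> R}).
Local Notation idS := (idfun : {rmorphism S -> S}).
Local Notation N := (restr phi S^o : lmodType R).
Local Notation S0 := (in_deg0 (S^o : lmodType S)).
Variables (p : nat) (F : complex R) (u : F 0) (f : chmap F (in_deg0 N)).
Hypotheses (pF : perf p F) (uc : is_cycle u) (qf : qiso f) (fN : fpd p N) (re : residual (f 0 u : N)).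
Variables (C X : complex R).
Hypotheses (Cf : hfinite C) (Xf : hfinite X).
Let D := RHom phi S0 C.
Let XS := Ltens phi X.

(** This hides all chosen resolutions: what remains are the infima of I, Y, Hom(F, I) and Hom(F, Y).
    The equivalences are degreewise, which is all that [hinf] and boundedness can see. *)
Theorem comparison : exists Y I : complex R,
  [/\ hfinite I, forall n, hzero C n <-> hzero I n,
      forall n, hzero (RHom idR X C) n <-> hzero Y n,
      forall n, hzero D n <-> hzero (homC idR F I) n &
      forall n, hzero (RHom idS XS D) n <-> hzero (homC idR F Y) n] /\
  (reflexive_cplx C X -> hfinite Y) /\ (reflexive_cplx D XS <-> reflexive_cplx C X).
Proof.
have [Cb Cfg] := Cf; have [Xb Xfg] := Xf.
have /hboundedP[a [_ [Xa _]]] := Xb; have /hboundedP[_ [b [_ Cb0]]] := Cb.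
have [L [ell [Lr L0 ql]]] := proj_res_exists noethR Xa Xfg.
have Lp : dg_fgproj L by move=> i; have [k ->] := Lr i; exact: fgproj_rv.
have KL : Kprojective L by apply: Kproj_bounded L0 => i; exact: fgproj_projective.
have Lf : hfinite L by apply/(qiso_hfinite ql).
have [I [iota [Ii I0 qi]]] := inj_res_exists (fun i lt => Cb0 i (ltW lt)).
have KI : Kinjective I := Kinj_bounded Ii I0.
have [KP qP] : is_proj_res (proj_res X) by apply: proj_resP; exists (existT _ L ell).
have [KJ qJ] : is_inj_res (inj_res C) by apply: inj_resP; exists (existT _ I iota).
set P := projT1 (proj_res X) in KP qP; set J := projT1 (inj_res C) in KJ qJ.
have [g qg] := inj_res_unique KI KJ qi qJ.
(* D is already K-injective over S, so it is its own injective resolution and can be compared with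
   the chosen one. *)
have KD : Kinjective D by exact: coind_Kinj.
have [KJS qJS] : is_inj_res (inj_res D).
  by apply: inj_resP; exists (existT _ D (chmap_id D)); split=> //; exact: qiso_id.
set JS := projT1 (inj_res D) in KJS qJS.
have [h qh] := proj_res_unique KL ql qP.
set LN := tensC idR L N.
(* Over R, the derived tensor product formed from the chosen resolution P is the tensor product of N
   with the finite free resolution L. *)
have qk : qiso (chcomp (tensC_restr phi P) (tensC_map N h)).
  by apply: qiso_comp; [exact: tensC_map_qiso | exact: tensC_restr_qiso].
have hX n : hzero (RHom idR X C) n <-> hzero (homC idR L I) n.
  exact: iff_sym (hom_hzero_inv n KI KJ ql qg).
have hXS n : hzero (RHom idS XS D) n <-> hzero (homC idR LN I) n.
  apply: iff_trans (iff_sym (hom_hzero_inv n KD KJS (qiso_id XS) qJS)) _.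
  apply: iff_trans (coind_hom_hzero phi J XS n) _.
  exact: iff_sym (hom_hzero_inv n KI KJ qk qg).
have bX : qiso (biduality C X) <-> acyclic (bid I L).
  apply: iff_trans (iff_sym (biduality_Kinj X KI KJ qg)) _.
  apply: iff_trans (iff_sym (biduality_qiso KI ql)) _; exact: qisoP.
have bXS : qiso (biduality D XS) <-> acyclic (bid I LN).
  apply: iff_trans (iff_sym (biduality_Kinj XS KD KJS qJS)) _.
  apply: iff_trans (coind_biduality phi XS KJ) _.
  apply: iff_trans (iff_sym (biduality_Kinj _ KI KJ qg)) _.
  apply: iff_trans (iff_sym (biduality_qiso KI qk)) _; exact: qisoP.
have XSf : hfinite XS.
  split=> [|l].
    apply/(hzero_hbounded (restrC_hzero phi XS)).
    by apply/(qiso_hbounded qk); exact: (tens_hbounded fN Lp Lf).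
  apply: (@restrC_hfin R S phi); apply/(qiso_hfin l qk).
  exact: (tens_hfin noethR fN Lp Lf).
exists (homC idR L I), I; split; [split=> // [|n|n|n] | split].
- by apply/(qiso_hfinite qi).
- exact: qiso_hzero.
- apply: iff_trans (coind_hzero n KJ qf) _; apply: iff_sym.
  exact/qiso_hzero/(qiso_hpost_Kproj (perf_Kproj pF) qg).
- apply: iff_trans (hXS n) _; exact/qiso_hzero/(dual_tens_qiso qf Ii I0 Lp L0).
- move=> [_ Yb _]; split; first by apply/(hzero_hbounded hX).
  exact: (hom_hfin noethR Cf KI qi Lf).
have eq := reflexive_equiv noethR pF uc qf fN re Cf Ii I0 qi Lp L0 Lf.
split=> -[_ Hb Hq].
  have [Yb La] : hbounded (homC idR L I) /\ acyclic (bid I L).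
    by apply/eq; split; [apply/(hzero_hbounded hXS) | apply/bXS].
  by split=> //; [apply/(hzero_hbounded hX) | apply/bX].
have [Yb La] : hbounded (homC idR LN I) /\ acyclic (bid I LN).
  by apply/eq; split; [apply/(hzero_hbounded hX) | apply/bX].
by split=> //; [apply/(hzero_hbounded hXS) | apply/bXS].
Qed.
End Comparison.

Local Open Scope ereal_scope.
Local Open Scope classical_set_scope.

Theorem mainTheorem3 (R S : comPzRingType) (phi : {rmorphism R -> S})
    (noethR : noetherian R) (noethS : noetherian S)
    (C X : complex R) (finC : hfinite C) (finX : hfinite X)
    (semiC : semidualizing C)
    (finS : fin_gen (restr phi S^o))
    (fdS : fd (restr phi S^o) < +oo)
    (mSpec : forall m : set R, maximal_ideal m ->
       exists q : set S, prime_ideal q /\ phi @^-1` q = m) :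
  let D := RHom phi (in_deg0 S^o) C in
  let XS := Ltens phi X in
  [/\ Gdim C X - pd (restr phi S^o) <= Gdim D XS,
      Gdim D XS <= Gdim C X + pd (restr phi S^o),
      reflexive_cplx D XS <-> reflexive_cplx C X &
      local_ring R \/
        (amp C = 0 /\ amp (RHom phi (in_deg0 S^o) (in_deg0 R^o)) = 0) ->
      Gdim D XS = Gdim C X].
Proof.
move=> D XS.
(* If S = 0 then R = 0, for a maximal ideal of R would be the preimage of a prime of the zero ring.
   All complexes are then acyclic. *)
have [S1|S1] := pselect ((1 : S)%R = 0%R).
  have R1 : (1 : R)%R = 0%R.
    apply: contrapT => R1; have [m /mSpec[q [[[q0 _] q1 _] _]]] := maximal_exists R1.
    by apply: q1; rewrite S1.
  have aR (Y : complex R) : acyclic Y := @trivial_acyclic R Y R1.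
  have aS (Y : complex S) : acyclic Y := @trivial_acyclic S Y S1.
  have fin (T : comPzRingType) (Y : complex T) : acyclic Y -> hfinite Y.
    by move=> Ya; split=> [|l]; [exact: acyclic_hbounded | exact: hzero_hfin].
  have rR : reflexive_cplx C X.
    by split; [exact: fin | exact: acyclic_hbounded | apply: qiso_acyclic].
  have rS : reflexive_cplx D XS.
    by split; [exact: fin | exact: acyclic_hbounded | apply: qiso_acyclic].
  have gR : Gdim C X = -oo by rewrite /Gdim asboolT // !hinf_acyclic.
  have gS : Gdim D XS = -oo by rewrite /Gdim asboolT // !hinf_acyclic.
  by rewrite gR gS; split.
have R1 : (1 : R)%R <> 0%R by move=> e; apply: S1; rewrite -(rmorph1 phi) e rmorph0.
have [p fN pdE] := pd_attained noethR finS S1 fdS.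
have [F [f [pF qf]]] := fpd_perf fN.
have oc : is_cycle ((1 : S)%R : in_deg0 (restr phi S^o : lmodType R) 0%R) by [].
(* The cycle u over 1 is the point at which Hom(F, V) is evaluated; f u equals 1 exactly, as a
   module in degree 0 has no boundaries. *)
have [u uc /bdP[w wP]] := (qf 0%R).2 _ oc.
have u1 : f 0%R u = (1 : S)%R by apply/eqP; rewrite eq_sym -subr_eq0; apply/eqP; exact: wP.
have re : residual (f 0%R u : (restr phi S^o : lmodType R)).
  rewrite u1; apply: residual_one => m /mSpec[q [qp <-]]; by exists q.
have [Y [I [[If hC hX hD hXS] [Yf rE]]]] := comparison noethR pF uc qf fN re finC finX.
have [rR|nR] := pselect (reflexive_cplx C X); last first.
  have gR : Gdim C X = +oo by rewrite /Gdim asboolF.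
  have gS : Gdim D XS = +oo by rewrite /Gdim asboolF // => /rE.
  by rewrite gR gS pdE; split.
have gR : Gdim C X = hinf I - hinf Y.
  by rewrite /Gdim asboolT // (hinf_congr hC) (hinf_congr hX).
have gS : Gdim D XS = hinf (homC idfun F I) - hinf (homC idfun F Y).
  by rewrite /Gdim asboolT ?(hinf_congr hD) ?(hinf_congr hXS) //; exact/rE.
rewrite gR gS pdE.
have hI := hom_perf_hinf noethR pF uc re If.
have hY := hom_perf_hinf noethR pF uc re (Yf rR).
(* When I or Y is acyclic the two dimensions are the same infinite value. Otherwise i' and j' lie
   between 0 and p below i and j, so i' - j' differs from i - j by at most p in either direction. *)
case: hI => [[-> ->]|[i [i' [-> -> /andP[i1 i2] iS]]]]; case: hY => [[-> ->]|[j [j' [-> -> /andP[j1 j2] jS]]]].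
- by split.
- by split.
- by split.
rewrite -!EFinB -EFinD !lee_fin; split.
- lia.
- lia.
- exact: rE.
(* The same l0 moves the infima of I and of Y, so it cancels in the difference. *)
move=> hyp; have [l0 sh0] : exists l0, sharp (rhom_fun pF) l0.
  case: hyp => [lR|[_ aS]]; first exact: (rhom_sharp_local noethR pF uc fN re lR).
  have mR := maximal_exists R1.
  apply: (rhom_sharp_amp noethR uc fN re mR (Y := RHom phi (in_deg0 (S^o : lmodType S)) (in_deg0 (R^o : lmodType R)))); last exact: aS.
  move=> n.
  have [J [iota [Ji J0 qJ]]] : exists (J : complex R) (g : chmap (in_deg0 (R^o : lmodType R)) J),
     [/\ dg_inj J, forall k, (0 < k)%R -> cx_zero_at J k & qiso g].
    apply: inj_res_exists => k k0; apply: hzero_zero_at; apply: in_deg0_zero.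
    by rewrite gt_eqF.
  have [KJ' qJ'] : is_inj_res (inj_res (in_deg0 (R^o : lmodType R))).
    by apply: inj_resP; exists (existT _ J iota); split=> //; exact: (Kinj_bounded Ji J0).
  apply: iff_trans (coind_hzero n KJ' qf) _; apply: iff_sym.
  exact/qiso_hzero/(qiso_hpost_Kproj (perf_Kproj pF) qJ').
rewrite (iS l0 sh0) (jS l0 sh0); congr EFin; lia.
Qed.
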